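(* Let $H,V$ satisfy the assumptions (S1)--(S2), and let the operators $A$, $F$, $G$ satisfy the assumptions (A1)--(A5), (F1)--(F3), (G1)--(G3), all spelled out in the context. Let $$u_0^1,\,u_0^2\in L^2(\Omega,\mathscr F_0;H),\qquad h_1,\,h_2\in L^2_{\mathcal P}(\Omega;L^1(0,T;H)),$$ and let $$u_1,\,u_2\in L^2(\Omega;C^0([0,T];H))\cap L^p_{\mathcal P}(\Omega;L^p(0,T;V))$$ be the unique solutions to the Cauchy problem $$\mathrm d u + A(u)\,\mathrm d t = h\,\mathrm d t + F(u)\,\mathrm d t + G(u)\,\mathrm d W \ \text{ in } V^*, \text{ a.e. in } \Omega\times(0,T),\qquad u(0)=u_0,$$ with data $(u_0,h)=(u_0^1,h_1)$ and $(u_0,h)=(u_0^2,h_2)$, respectively. That is, for $i=1,2$, $\mathbb P$-almost surely, for every $t\in[0,T]$, $$u_i(t)+\int_0^tA(s,u_i(s))\,\mathrm ds=u_0^i+\int_0^th_i(s)\,\mathrm ds+\int_0^tF(s,u_i(s))\,\mathrm ds+\int_0^tG(s,u_i(s))\,\mathrm dW(s)\quad\text{in }V^*.$$ If $$u_0^1\le u_0^2\ \text{ a.e. in }\Omega\times\mathcal O,\qquad h_1\le h_2\ \text{ a.e. in }\Omega\times(0,T)\times\mathcal O,$$ then $$u_1(t)\le u_2(t)\quad\text{a.e. in }\Omega\times\mathcal O,\quad\forall\,t\in[0,T].$$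
   Context: Probabilistic setting. $T>0$ is fixed, $(\Omega,\mathscr F,(\mathscr F_t)_{t\in[0,T]},\mathbb P)$ is a complete filtered probability space, $W$ is a cylindrical Wiener process on a separable Hilbert space $U$, and $(e_k)_{k\in\mathbb N}$ is a fixed complete orthonormal system of $U$. $\mathcal P$ is the progressive $\sigma$-algebra on $\Omega\times[0,T]$. For a Banach space $E$ and $r,s\in[1,\infty)$, $L^r_{\mathcal P}(\Omega;L^s(0,T;E))$ is the space of progressively measurable processes $\varphi:\Omega\times[0,T]\to E$ with $\mathbb E\big(\int_0^T\|\varphi(t)\|_E^s\,\mathrm dt\big)^{r/s}<\infty$. $\mathscr L^2(E_1,E_2)$ denotes the Hilbert--Schmidt operators between separable Hilbert spaces, and $\mathscr B(E)$ the Borel $\sigma$-algebra of $E$. The variable $\omega$ (and sometimes $t$) is often omitted, e.g. $A(s,u(s))=A(\omega,s,u(\omega,s))$. Spaces. $\mathcal O\subset\mathbb R^d$ is a nonempty, open, bounded set with Lipschitz boundary. (S1) $H:=L^2(\mathcal O)$, with its usual scalar product $(\cdot,\cdot)_H$ and norm $\|\cdot\|_H$. (S2) $V$ is a separable reflexive Banach space, continuously and densely embedded in $H$; $V$ and $V^*$ are uniformly convex; and $V\hookrightarrow L^4(\mathcal O)$ continuously. $H$ is identified with $H^*$ via the Riesz isomorphism, so that $V\hookrightarrow H\hookrightarrow V^*$ continuously and densely; $\langle\cdot,\cdot\rangle_V$ is the duality between $V^*$ and $V$. Operator $A:\Omega\times[0,T]\times V\to V^*$ (the model case being $\langle A(\omega,t,u),v\rangle_V=\int_{\mathcal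 O}a(\omega,t,\nabla u)\cdot\nabla v\,\mathrm dx$ with $a$ Carath\'eodory, monotone and of $p$-growth in the last variable; the assumptions are made directly on the operator): (A1) $A$ is $\mathcal P\otimes\mathscr B(V)$--$\mathscr B(V^* )$ measurable. (A2) For every $(\omega,t)\in\Omega\times[0,T]$ and $\varphi,\psi,\zeta\in V$ the map $r\mapsto\langle A(\omega,t,\varphi+r\psi),\zeta\rangle_V$, $r\in\mathbb R$, is continuous. (A3) There exist constants $c_A>0$ and $p\ge2$ such that $\langle A(\omega,t,\varphi),\varphi\rangle_V\ge c_A\|\varphi\|_V^p$ for every $(\omega,t)\in\Omega\times[0,T]$ and $\varphi\in V$. (A4) There exist a constant $C_A>0$ and a progressively measurable process $h_A\in L^1(\Omega\times(0,T))$ such that, with $q:=p/(p-1)$, $\|A(\omega,t,\varphi)\|_{V^*}^q\le C_A\|\varphi\|_V^p+h_A(\omega,t)$ for every $(\omega,t)\in\Omega\times[0,T]$ and $\varphi\in V$. (A5) For every increasing Lipschitz-continuous function $\sigma\in C^2(\mathbb R)$ with $\sigma(0)=0$: $\sigma(\varphi)\in V$ for all $\varphi\in V$; the map $\sigma_{|V}:V\to V$, $\varphi\mapsto\sigma(\varphi)$ (pointwise composition), is locally bounded; and $\langle A(\omega,t,\varphi)-A(\omega,t,\psi),\sigma(\varphi-\psi)\rangle_V\ge0$ for all $(\omega,t)\in\Omega\times[0,T]$ and $\varphi,\psi\in V$. Operator $F:\Omega\times[0,T]\times H\to H$, given by $F(\omega,t,u)(x)=f(\omega,t,u(x))$ for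 a.e. $(\omega,t,x)\in\Omega\times[0,T]\times\mathcal O$, where $f:\Omega\times[0,T]\times\mathbb R\to\mathbb R$ is a Carath\'eodory function, Lipschitz continuous in the last variable, and such that: (F1) $F$ is $\mathcal P\otimes\mathscr B(H)$--$\mathscr B(H)$ measurable. (F2) There is a constant $C_F>0$ such that, for all $u_1,u_2\in H$, $\|F(\cdot,u_1)-F(\cdot,u_2)\|_H\le C_F\|u_1-u_2\|_H$ a.e. in $\Omega\times(0,T)$. (F3) There exists $\varphi_F\in H$ such that $F(\cdot,\cdot,\varphi_F)\in L^2_{\mathcal P}(\Omega;L^2(0,T;H))$. Operator $G:\Omega\times[0,T]\times H\to\mathscr L^2(U,H)$: (G1) $G$ is $\mathcal P\otimes\mathscr B(H)$--$\mathscr B(\mathscr L^2(U,H))$ measurable. (G2) There is a constant $C_G>0$ such that, for every measurable subset $\bar{\mathcal O}\subset\mathcal O$, $\sum_{k=0}^\infty\int_{\bar{\mathcal O}}|G(\omega,t,\varphi)e_k-G(\omega,t,\psi)e_k|^2\le C_G^2\int_{\bar{\mathcal O}}|\varphi-\psi|^2$ for every $(\omega,t)\in\Omega\times[0,T]$ and $\varphi,\psi\in H$. (G3) There exists $\varphi_G\in H$ such that $G(\cdot,\cdot,\varphi_G)\in L^2_{\mathcal P}(\Omega;L^2(0,T;\mathscr L^2(U,H)))$. Known fact (classical well-posedness): under these assumptions, for every $u_0\in L^2(\Omega,\mathscr F_0;H)$ and $h\in L^2_{\mathcal P}(\Omega;L^1(0,T;H))$ the Cauchy problem in the claim has a unique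 solution in $L^2(\Omega;C^0([0,T];H))\cap L^p_{\mathcal P}(\Omega;L^p(0,T;V))$, in the integrated sense written in the claim. *)

(* Defs.v *)
From HB Require Import structures.
From mathcomp Require Import all_boot all_order all_algebra.
From mathcomp Require Import all_classical all_reals all_analysis.
From mathcomp Require Import measurable_realfun ess_sup_inf.
From mathcomp Require Import ring.
Import Order.TTheory GRing.Theory Num.Theory.
Import numFieldNormedType.Exports.
Set Implicit Arguments.
Unset Strict Implicit.
Unset Printing Implicit Defensive.
Local Open Scope classical_set_scope.
Local Open Scope ring_scope.

Section bounded_operators.
Context (R : realType) (V W : normedModType R).

Definition blin_pred : {pred V -> W} := fun f => `[< linear f /\ continuous f >].

Lemma blin_submod_closed : submod_closed blin_pred.
Proof.
split.
  apply/asboolP; split; first by move=> a x y; rewrite /= scaler0 addr0.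
  exact: cst_continuous.
move=> a f g /asboolP[lf cf] /asboolP[lg cg]; apply/asboolP; split.
  have E z : (a *: f + g) z = a *: f z + g z by [].
  by move=> b x y; rewrite !E lf lg !scalerDr !scalerA (mulrC b) addrACA.
move=> x; apply: (@continuousD R W V (a \*: f) g); last exact: cg.
by apply: cvgZr; exact: cf.
Qed.

HB.instance Definition _ := GRing.isSubmodClosed.Build R (V -> W) blin_pred
  blin_submod_closed.

Record blin := Blin { blin_val :> V -> W ; _ : blin_val \in blin_pred }.

HB.instance Definition _ := [isSub for blin_val].
HB.instance Definition _ := gen_eqMixin blin.
HB.instance Definition _ := [Choice of blin by <:].
HB.instance Definition _ := [SubChoice_isSubLmodule of blin by <:].

Lemma blin_linear (f : blin) : linear f.
Proof. by have /asboolP[] := valP f. Qed.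

Lemma blin_continuous (f : blin) : continuous f.
Proof. by have /asboolP[] := valP f. Qed.

HB.instance Definition _ (f : blin) :=
  GRing.isLinear.Build R V W *:%R f (blin_linear f).

Definition opnorm (f : blin) : R := sup [set `|f x| | x in [set x | `|x| <= 1]].

Lemma opnorm_has_sup (f : blin) : has_sup [set `|f x| | x in [set x | `|x| <= 1]].
Proof.
split; first by exists `|f 0|; exists 0 => //=; rewrite normr0.
have /linear_boundedP/pinfty_ex_gt0[M M0 fM] :=
  continuous_linear_bounded 0 (@blin_continuous f 0).
exists M => _ [x /= x1 <-]; rewrite (le_trans (fM x))//.
by rewrite -[leRHS]mulr1 ler_pM2l.
Qed.

Lemma opnorm_le (f : blin) M : (forall x, `|x| <= 1 -> `|f x| <= M) -> opnorm f <= M.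
Proof.
by move=> fM; apply: ge_sup => [|_ [x x1 <-]]; [case: (opnorm_has_sup f)|exact: fM].
Qed.

Lemma le_opnorm1 (f : blin) x : `|x| <= 1 -> `|f x| <= opnorm f.
Proof.
by move=> x1; apply: ub_le_sup; [case: (opnorm_has_sup f)|exists x].
Qed.

Lemma opnorm_ge0 f : 0 <= opnorm f.
Proof. by apply: le_trans (le_opnorm1 f (x := 0) _); rewrite ?normr0. Qed.

Lemma le_opnorm (f : blin) x : `|f x| <= opnorm f * `|x|.
Proof.
have [->|x0] := eqVneq x 0; first by rewrite linear0 !normr0 mulr0.
have nx0 : 0 < `|x| by rewrite normr_gt0.
have := @le_opnorm1 f (`|x|^-1 *: x); rewrite linearZ !normrZ normfV normr_id.
by rewrite mulVf ?gt_eqF// => /(_ (lexx _)); rewrite ler_pdivrMl// mulrC.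
Qed.

Lemma ler_opnormD (f g : blin) : opnorm (f + g) <= opnorm f + opnorm g.
Proof.
apply: opnorm_le => x x1; rewrite (le_trans (ler_normD _ _))//.
by rewrite lerD// le_opnorm1.
Qed.

Lemma opnormZ_le (a : R) (f : blin) : opnorm (a *: f) <= `|a| * opnorm f.
Proof.
by apply: opnorm_le => x x1; rewrite normrZ ler_wpM2l// le_opnorm1.
Qed.

Lemma opnormZ (a : R) (f : blin) : opnorm (a *: f) = `|a| * opnorm f.
Proof.
apply/eqP; rewrite eq_le opnormZ_le/=.
have [->|a0] := eqVneq a 0; first by rewrite normr0 mul0r opnorm_ge0.
rewrite -ler_pdivlMl ?normr_gt0//.
by rewrite -{1}[f](scalerK a0) -normfV opnormZ_le.
Qed.

Lemma opnorm_eq0 (f : blin) : opnorm f = 0 -> f = 0.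
Proof.
move=> f0; apply/val_inj/funext => x /=; apply/eqP.
by rewrite -normr_le0 (le_trans (le_opnorm f x))// f0 mul0r.
Qed.

HB.instance Definition _ :=
  Lmodule_isNormed.Build R blin ler_opnormD opnormZ opnorm_eq0.

End bounded_operators.

Definition dual (R : realType) (V : normedModType R) := blin V R^o.

Section Lebesgue_quotient.
Context d (T : measurableType d) (R : realType).
Variables (mu : {measure set T -> \bar R}) (p : \bar R) (p1 : (1 <= p)%E).

Definition ae_null : {pred LfunType mu p1} :=
  fun f => `[< {ae mu, forall x, f x = 0} >].

Lemma ae_null_zmod_closed : zmod_closed ae_null.
Proof.
split; first by apply/asboolP; apply: nearW.
move=> f g /asboolP f0 /asboolP g0; apply/asboolP.
apply: filterS2 f0 g0 => x fx gx.
by rewrite (_ : (f - g) x = f x - g x)// fx gx subr0.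
Qed.

HB.instance Definition _ :=
  GRing.isZmodClosed.Build (LfunType mu p1) ae_null ae_null_zmod_closed.

(* The type [LspaceType] of hoelder.v carries neither a module structure nor a norm. *)
Definition Lp : Type := Quotient.quot ae_null.

HB.instance Definition _ := Choice.on Lp.
HB.instance Definition _ := GRing.Zmodule.on Lp.

Definition Lp_class (f : LfunType mu p1) : Lp := \pi_(Quotient.quot ae_null)%qT f.

Definition Lp_repr (u : Lp) : LfunType mu p1 := repr (u : Quotient.quot ae_null).

Definition Lp_fun (u : Lp) : T -> R := Lp_repr u.

Lemma Lp_classP (f g : LfunType mu p1) :
  Lp_class f = Lp_class g <-> {ae mu, forall x, f x = g x}.
Proof.
rewrite /Lp_class; split.
  move=> /eqP; rewrite -Quotient.idealrBE => /asboolP.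
  apply: filterS => x; rewrite (_ : (f - g) x = f x - g x)//.
  by move=> /eqP; rewrite subr_eq0 => /eqP.
move=> fg; apply/eqP; rewrite -Quotient.idealrBE; apply/asboolP.
apply: filterS fg => x fg.
by rewrite (_ : (f - g) x = f x - g x)// fg subrr.
Qed.

Lemma Lp_reprK (u : Lp) : Lp_class (Lp_repr u) = u.
Proof. exact: reprK. Qed.

Lemma Lp_class_fun (f : LfunType mu p1) : {ae mu, forall x, Lp_fun (Lp_class f) x = f x}.
Proof. by apply/Lp_classP; rewrite Lp_reprK. Qed.

Lemma Lp_classD (f g : LfunType mu p1) : Lp_class (f + g) = Lp_class f + Lp_class g.
Proof. exact: (raddfD (\pi_(Quotient.quot ae_null)%qT)). Qed.

Lemma Lp_ind (K : Lp -> Prop) : (forall f, K (Lp_class f)) -> forall u, K u.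
Proof. by move=> Kc u; rewrite -[u]Lp_reprK. Qed.

Definition Lp_scale (a : R) (u : Lp) : Lp := Lp_class (a *: Lp_repr u).

Lemma Lp_scaleE a (f : LfunType mu p1) : Lp_scale a (Lp_class f) = Lp_class (a *: f).
Proof.
apply/Lp_classP; apply: filterS (Lp_class_fun f) => x fx.
have E (g : LfunType mu p1) : (a *: g) x = a * g x by [].
by rewrite !E -fx.
Qed.

Lemma Lp_scalerA a b u : Lp_scale a (Lp_scale b u) = Lp_scale (a * b) u.
Proof. by elim/Lp_ind: u => f; rewrite !Lp_scaleE scalerA. Qed.

Lemma Lp_scale1r : left_id 1 Lp_scale.
Proof. by elim/Lp_ind => f; rewrite !Lp_scaleE scale1r. Qed.

Lemma Lp_scalerDr : right_distributive Lp_scale +%R.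
Proof.
by move=> a; elim/Lp_ind => f; elim/Lp_ind => g;
  rewrite -Lp_classD !Lp_scaleE scalerDr Lp_classD.
Qed.

Lemma Lp_scalerDl u : {morph Lp_scale^~ u : a b / a + b}.
Proof.
by move=> a b; elim/Lp_ind: u => f; rewrite !Lp_scaleE scalerDl Lp_classD.
Qed.

HB.instance Definition _ := GRing.Zmodule_isLmodule.Build R Lp
  Lp_scalerA Lp_scale1r Lp_scalerDr Lp_scalerDl.

Definition Lp_norm (u : Lp) : R := fine ('N[mu]_p[EFin \o Lp_fun u]).

Lemma Lp_normE (f : LfunType mu p1) :
  Lp_norm (Lp_class f) = fine ('N[mu]_p[EFin \o f]).
Proof.
rewrite /Lp_norm; congr fine; have fx := Lp_class_fun f; rewrite unlock.
have mg : measurable_fun setT (Lp_fun (Lp_class f)) by [].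
have mf : measurable_fun setT (f : T -> R) by [].
move: (Lp_fun _) mg fx => g mg fx; move: (f : T -> R) mf fx => {}f mf fx.
case: (p) => [r||].
- congr (_ `^ _)%E; apply: ge0_ae_eq_integral => //.
  + apply/measurable_EFinP/(measurableT_comp (measurable_powR _)).
    exact: measurableT_comp.
  + apply/measurable_EFinP/(measurableT_comp (measurable_powR _)).
    exact: measurableT_comp.
  + by move=> x _; exact: poweR_ge0.
  + by move=> x _; exact: poweR_ge0.
  + by apply: filterS fx => x /= ->.
- case: ifP => // _; apply: eq_ess_sup.
  by apply: filterS fx => x /= ->.
- case: ifP => // _; apply: eq_ess_inf.
  by apply: filterS fx => x /= ->.
Qed.

Lemma ler_Lp_normD u v : Lp_norm (u + v) <= Lp_norm u + Lp_norm v.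
Proof.
by elim/Lp_ind: u => f; elim/Lp_ind: v => g;
  rewrite -Lp_classD !Lp_normE ler_LnormD.
Qed.

Lemma Lp_normZ a u : Lp_norm (a *: u) = `|a| * Lp_norm u.
Proof.
elim/Lp_ind: u => f; rewrite [_ *: _]Lp_scaleE !Lp_normE.
rewrite (_ : EFin \o _ = EFin \o (a \*: f))// LnormZ.
by rewrite -finite_norm_fine.
Qed.

Lemma Lp_norm_eq0 u : Lp_norm u = 0 -> u = 0.
Proof.
elim/Lp_ind: u => f; rewrite Lp_normE => /fine_Lnormr_eq0 f0.
rewrite -[RHS](raddf0 (\pi_(Quotient.quot ae_null)%qT)).
apply/Lp_classP; apply: filterS f0 => x; exact.
Qed.

HB.instance Definition _ :=
  Lmodule_isNormed.Build R Lp ler_Lp_normD Lp_normZ Lp_norm_eq0.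

End Lebesgue_quotient.

Section lebesgue_Rn.
Context (R : realType).
Local Notation RT := (measurableTypeR R).

Definition tuple_cons n (x : RT * n.-tuple RT) : n.+1.-tuple RT :=
  [tuple of x.1 :: x.2].

Lemma measurable_tuple_cons n : measurable_fun setT (@tuple_cons n).
Proof. exact: measurable_cons. Qed.

HB.instance Definition _ n := isMeasurableFun.Build _ _ _ _ (@tuple_cons n)
  (@measurable_tuple_cons n).

Section lebesgue_step.
Context n (m : {sigma_finite_measure set (n.-tuple RT) -> \bar R}).

Definition lebesgue_step : set (n.+1.-tuple RT) -> \bar R :=
  pushforward ((@lebesgue_measure R) \x m)%E (@tuple_cons n).

Let step0 : lebesgue_step set0 = 0%E.
Proof. exact: measure0. Qed.

Let step_ge0 A : (0 <= lebesgue_step A)%E.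
Proof. exact: measure_ge0. Qed.

Let step_sigma_additive : semi_sigma_additive lebesgue_step.
Proof. exact: measure_semi_sigma_additive. Qed.

HB.instance Definition _ := isMeasure.Build _ _ _ lebesgue_step
  step0 step_ge0 step_sigma_additive.

Let step_sigma_finite : sigma_finite setT lebesgue_step.
Proof.
have /sigma_finiteP[F [TF ndF Foo]] := sigma_finiteT (@lebesgue_measure R).
have /sigma_finiteP[G [TG ndG Goo]] := sigma_finiteT m.
pose tsplit (t : n.+1.-tuple RT) : RT * n.-tuple RT := (thead t, [tuple of behead t]).
have mtsplit : measurable_fun setT tsplit.
  by apply/measurable_fun_pair; [exact: measurable_tnth|exact: measurable_behead].
have tsplitK : tsplit \o @tuple_cons n = id.
  by apply/funext => -[x t]; congr pair; exact/val_inj.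
exists (fun k => tsplit @^-1` (F k `*` G k)).
  apply/esym; rewrite -subTset => t _.
  have [i _ Fi] : (\bigcup_k F k) (tsplit t).1 by rewrite -TF.
  have [j _ Gj] : (\bigcup_k G k) (tsplit t).2 by rewrite -TG.
  exists (maxn i j) => //; split.
  - by apply: (subsetPset _ _ (ndF _ _ (leq_maxl i j))).
  - by apply: (subsetPset _ _ (ndG _ _ (leq_maxr i j))).
move=> k; have [mF Fk] := Foo k; have [mG Gk] := Goo k; split.
  by rewrite -[X in measurable X]setTI; apply: mtsplit => //; exact: measurableX.
rewrite /lebesgue_step /pushforward -comp_preimage tsplitK preimage_id.
by rewrite product_measure1E// lte_mul_pinfty// ge0_fin_numE.
Qed.

HB.instance Definition _ := Measure_isSigmaFinite.Build _ _ _ lebesgue_step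
  step_sigma_finite.

End lebesgue_step.

Fixpoint lebesgue_tuple n : {sigma_finite_measure set (n.-tuple RT) -> \bar R} :=
  if n is n'.+1 then lebesgue_step (lebesgue_tuple n') else dirac [tuple].

Definition borel_rV n : Type := g_sigma_algebraType (@open 'rV[R]_n).

HB.instance Definition _ n := Measurable.on (borel_rV n).

Definition row_of_tuple n (t : n.-tuple RT) : borel_rV n := \row_i tnth t i.

Lemma measurable_row_of_tuple n : measurable_fun setT (@row_of_tuple n).
Proof.
apply: (@measurability _ _ _ _ setT (@row_of_tuple n) (@open 'rV[R]_n)) => //.
move=> _ [D oD <-]; rewrite setTI.
pose e (k : nat) : R := k.+1%:R^-1.
have e0 k : 0 < e k by rewrite invr_gt0.
pose box (q : {ffun 'I_n -> rat} * nat) :=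
  \bigcap_(i in [set: 'I_n]) [set t : n.-tuple RT | `|ratr (q.1 i) - tnth t i| < e q.2].
pose center (q : {ffun 'I_n -> rat} * nat) : 'rV[R]_n := \row_i ratr (q.1 i).
have mbox q : measurable (box q).
  apply: fin_bigcap_measurable => // i _.
  rewrite [X in measurable X](_ : _ =
      (fun t : n.-tuple RT => tnth t i) @^-1` (ball (ratr (q.1 i) : R) (e q.2))) //.
  rewrite -[X in measurable X]setTI; apply: measurable_tnth => //.
  exact: measurable_ball.
have boxE q t : box q t <-> ball (center q) (e q.2) (row_of_tuple t : 'rV[R]_n).
  split=> [qt|[_ qt] i _].
    by split=> // i j; rewrite !mxE; exact: (qt j).
  by have := qt ord0 i; rewrite !mxE.
rewrite (_ : _ @^-1` D = \bigcup_k (if unpickle k is Some q then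
    if `[< ball (center q) (e q.2) `<=` D >] then box q else set0 else set0)).
  apply: bigcupT_measurable => k; case: unpickle => // q.
  by case: ifP.
apply/seteqP; split => t /=; last first.
  move=> [k _]; case: unpickle => // q; case: ifPn => // /asboolP qD /boxE.
  exact: qD.
move: oD; rewrite openE => /[apply] /nbhs_ballP[r /= r0 rD].
have [k kr] : exists k, e k + e k < r.
  have r2 : 0 < r / 2 by rewrite divr_gt0.
  have [k _ kr] := near_infty_natSinv_lt (PosNum r2).
  by exists k; rewrite (splitr r) ltrD//; exact: (kr k (leqnn k)).
have /choice[q qt] (i : 'I_n) : exists q : rat, `|ratr q - tnth t i| < e k.
  have [|q] := @rat_in_itvoo R (tnth t i - e k) (tnth t i + e k).
    by rewrite ltrBlDr -addrA ltrDl addr_gt0.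
  by rewrite in_itv/= => qe; exists q; rewrite ltr_distl.
exists (pickle (finfun q, k)) => //; rewrite pickleK.
have bqt : box (finfun q, k) t by move=> i _ /=; rewrite ffunE.
rewrite asboolT// => y qy; apply: rD; apply: le_ball (ltW kr) _ _.
by apply: ball_triangle qy; apply: ball_sym; exact/boxE.
Qed.

HB.instance Definition _ n := isMeasurableFun.Build _ _ _ _ (@row_of_tuple n)
  (@measurable_row_of_tuple n).

Definition lebesgue_rV n : set (borel_rV n) -> \bar R :=
  pushforward (lebesgue_tuple n) (@row_of_tuple n).

Section lebesgue_rV.
Context (n : nat).

Let lebesgue_rV0 : @lebesgue_rV n set0 = 0%E.
Proof. exact: measure0. Qed.

Let lebesgue_rV_ge0 A : (0 <= @lebesgue_rV n A)%E.
Proof. exact: measure_ge0. Qed.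

Let lebesgue_rV_sigma_additive : semi_sigma_additive (@lebesgue_rV n).
Proof. exact: measure_semi_sigma_additive. Qed.

HB.instance Definition _ := isMeasure.Build _ _ _ (@lebesgue_rV n)
  lebesgue_rV0 lebesgue_rV_ge0 lebesgue_rV_sigma_additive.

End lebesgue_rV.

Lemma open_borel n (A : set 'rV[R]_n) : open A -> measurable (A : set (borel_rV n)).
Proof. by move=> oA; exact: sub_sigma_algebra. Qed.

Definition lebesgue_on n (A : set 'rV[R]_n) (oA : open A) :
    {measure set (borel_rV n) -> \bar R} :=
  mrestr (@lebesgue_rV n) (open_borel oA).

End lebesgue_Rn.

HB.mixin Record NormedModule_isHilbert (R : realType) U & CompleteNormedModule R U := {
  hdot : U -> U -> R ;
  hdotC : forall x y, hdot x y = hdot y x ;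
  hdotDl : forall x y z, hdot (x + y) z = hdot x z + hdot y z ;
  hdotZl : forall a x y, hdot (a *: x) y = a * hdot x y ;
  hdotxx : forall x, hdot x x = `|x| ^+ 2
}.

#[short(type="hilbertType")]
HB.structure Definition Hilbert (R : realType) :=
  {U of NormedModule_isHilbert R U & CompleteNormedModule R U}.

Record onbasis (R : realType) (U : hilbertType R) := Onbasis {
  onvec :> nat -> U ;
  onvec_orthonormal : forall j k, hdot (onvec j) (onvec k) = (j == k)%:R ;
  onvec_total : closure [set x | exists n (c : nat -> R), x = \sum_(k < n) c k *: onvec k]
                = [set: U]
}.

Section Hilbert_Schmidt.
Context (R : realType) (U : hilbertType R) (e : onbasis U) (W : normedModType R).

Definition hs_sum (f : U -> W) : \bar R := (\sum_(0 <= k <oo) (`|f (e k)| ^+ 2)%:E)%E.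

Definition hs_pred : {pred blin U W} := fun f => (hs_sum f < +oo)%E.

Lemma hs_sum_ge0 f : (0 <= hs_sum f)%E.
Proof. by apply: nneseries_ge0 => k _ _; rewrite lee_fin sqr_ge0. Qed.

Lemma hs_sumZ a f : hs_sum (a \*: f) = ((a ^+ 2)%:E * hs_sum f)%E.
Proof.
rewrite /hs_sum -nneseriesZl; last by move=> k _; rewrite lee_fin sqr_ge0.
by apply: eq_eseriesr => k _; rewrite -EFinM normrZ exprMn real_normK ?num_real.
Qed.

Lemma hs_sumD_le (c : R) (f g : U -> W) : 0 < c ->
  (hs_sum (f \+ g)%R <= (1 + c)%:E * hs_sum f + (1 + c^-1)%:E * hs_sum g)%E.
Proof.
move=> c0; have ci0 : 0 < c^-1 by rewrite invr_gt0.
have c10 : 0 <= 1 + c by rewrite addr_ge0// ltW.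
have ci10 : 0 <= 1 + c^-1 by rewrite addr_ge0// ltW.
rewrite /hs_sum -!nneseriesZl; try by move=> k _; rewrite lee_fin sqr_ge0.
rewrite -nneseriesD; try by move=> k _; rewrite mule_ge0// lee_fin ?sqr_ge0.
apply: lee_nneseries => k _; first by rewrite lee_fin sqr_ge0.
rewrite -!EFinM -EFinD lee_fin /=.
set x := `|f _|; set y := `|g _|.
have : `|f (e k) + g (e k)| ^+ 2 <= (x + y) ^+ 2.
  by rewrite ler_sqr ?nnegrE ?addr_ge0 ?normr_ge0//; exact: ler_normD.
move=> /le_trans; apply; rewrite -subr_ge0.
have -> : (1 + c) * x ^+ 2 + (1 + c^-1) * y ^+ 2 - (x + y) ^+ 2 =
    c * (x - c^-1 * y) ^+ 2 by field; rewrite gt_eqF.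
by rewrite mulr_ge0 ?sqr_ge0// ltW.
Qed.

Lemma hs_submod_closed : submod_closed hs_pred.
Proof.
split.
  rewrite /hs_pred unfold_in /hs_sum eseries0// => k _ _ /=.
  by rewrite normr0 expr0n.
move=> a f g; rewrite !unfold_in => fs gs.
apply: le_lt_trans (hs_sumD_le (c := 1) (a \*: f) g _) _ => //.
by rewrite hs_sumZ lte_add_pinfty// ?lte_mul_pinfty ?lee_fin// ?ltry// ?sqr_ge0 ?hs_sum_ge0 // mule_ge0.
Qed.

HB.instance Definition _ := GRing.isSubmodClosed.Build R (blin U W) hs_pred
  hs_submod_closed.

Record hilbert_schmidt := HilbertSchmidt {
  hs_val :> blin U W ; _ : hs_val \in hs_pred }.

HB.instance Definition _ := [isSub for hs_val].
HB.instance Definition _ := gen_eqMixin hilbert_schmidt.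
HB.instance Definition _ := [Choice of hilbert_schmidt by <:].
HB.instance Definition _ := [SubChoice_isSubLmodule of hilbert_schmidt by <:].

Definition hs_norm (f : hilbert_schmidt) : R := Num.sqrt (fine (hs_sum f)).

Lemma hs_norm_ge0 f : 0 <= hs_norm f.
Proof. exact: sqrtr_ge0. Qed.

Lemma hs_normE (f : hilbert_schmidt) : hs_sum f = (hs_norm f ^+ 2)%:E.
Proof.
rewrite sqr_sqrtr; last exact/fine_ge0/hs_sum_ge0.
by rewrite fineK// ge0_fin_numE ?hs_sum_ge0//; exact: (valP f).
Qed.

Lemma hs_norm_eq0 f : hs_norm f = 0 -> f = 0.
Proof.
move=> f0; apply/val_inj/val_inj/funext => x /=.
have fe k : f (onvec e k) = 0.
  apply/eqP; rewrite -normr_eq0 -sqrf_eq0 -eqe; apply/eqP.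
  have := hs_normE f; rewrite f0 expr0n/= => fs0.
  have s_ge0 j : (0 <= (`|f (e j)| ^+ 2)%:E)%E by rewrite lee_fin sqr_ge0.
  apply/le_anti; rewrite s_ge0 andbT -fs0.
  apply: le_trans (nneseries_lim_ge (m := 0%N) k.+1 (fun j _ _ => s_ge0 j)).
  by rewrite big_nat_recr//= leeDr// sume_ge0.
have : closure [set y | f y = 0] x.
  have : [set: U] x by [].
  rewrite -(onvec_total e); apply: closureS => _ [n [c ->]] /=.
  by rewrite linear_sum big1// => k _; rewrite linearZ/= fe scaler0.
suff /closure_id <- : closed [set y | f y = 0] by [].
apply: (@preimage_closed _ _ f [set 0]); first by move=> y _; exact: blin_continuous.
exact/accessible_closed_set1/hausdorff_accessible/norm_hausdorff.
Qed.

Lemma ler_hs_normD f g : hs_norm (f + g) <= hs_norm f + hs_norm g.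
Proof.
have [/hs_norm_eq0->|f0] := eqVneq (hs_norm f) 0; first by rewrite add0r lerDr hs_norm_ge0.
have [/hs_norm_eq0->|g0] := eqVneq (hs_norm g) 0; first by rewrite addr0 lerDl hs_norm_ge0.
have fp : 0 < hs_norm f by rewrite lt_neqAle eq_sym f0 hs_norm_ge0.
have gp : 0 < hs_norm g by rewrite lt_neqAle eq_sym g0 hs_norm_ge0.
rewrite -ler_sqr ?nnegrE ?addr_ge0 ?hs_norm_ge0// -lee_fin -hs_normE.
have := hs_sumD_le f g (divr_gt0 gp fp); rewrite !hs_normE => /le_trans; apply.
rewrite -!EFinM -EFinD lee_fin le_eqVlt; apply/orP; left; apply/eqP.
by field; rewrite f0 g0.
Qed.

Lemma hs_normZ a f : hs_norm (a *: f) = `|a| * hs_norm f.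
Proof.
by rewrite /hs_norm [hs_sum _]hs_sumZ hs_normE -EFinM/= sqrtrM ?sqr_ge0// !sqrtr_sqr
  (ger0_norm (hs_norm_ge0 f)).
Qed.

HB.instance Definition _ :=
  Lmodule_isNormed.Build R hilbert_schmidt ler_hs_normD hs_normZ hs_norm_eq0.

End Hilbert_Schmidt.

Section Banach_spaces.
Context (R : realType).

Definition separable (E : topologicalType) := exists2 D : set E, countable D & dense D.

Definition reflexive_space (E : normedModType R) :=
  forall L : dual (dual E), exists x : E, forall phi : dual E, L phi = phi x.

Definition uniformly_convex (E : normedModType R) :=
  forall eps : R, 0 < eps -> exists2 delta : R, 0 < delta &
    forall x y : E, `|x| = 1 -> `|y| = 1 -> eps <= `|x - y| ->
      `|2^-1 *: (x + y)| <= 1 - delta.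

Definition borel (E : topologicalType) : set (set E) := <<s @open E >>.

(* [f] restricted to [D] is measurable from the sigma-algebra [S] of subsets of
   [D] to the Borel sigma-algebra of [E]. *)
Definition borel_measurable (X : Type) (E : topologicalType) (S : set (set X))
    (D : set X) (f : X -> E) :=
  forall B, borel B -> S (D `&` f @^-1` B).

End Banach_spaces.

Section Bochner_integral.
Context d (X : measurableType d) (R : realType) (E : normedModType R).

Record simple_function := SimpleFunction {
  sf_size : nat ;
  sf_set : nat -> set X ;
  sf_val : nat -> E ;
  sf_measurable : forall k, measurable (sf_set k)
}.

Definition sf_fun (s : simple_function) (x : X) : E :=
  \sum_(k < sf_size s) (\1_(sf_set s k) x : R) *: sf_val s k.

Variables (mu : {measure set X -> \bar R}) (D : set X).

Definition sf_integral (s : simple_function) : E :=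
  \sum_(k < sf_size s) fine (mu (sf_set s k `&` D)) *: sf_val s k.

Definition is_Bochner_integral (f : X -> E) (I : E) :=
  exists s : nat -> simple_function,
  [/\ forall n k, (mu (sf_set (s n) k `&` D) < +oo)%E,
      {ae mu, forall x, D x -> sf_fun (s n) x @[n --> \oo] --> f x},
      (\int[mu]_(x in D) (`|sf_fun (s n) x - f x|)%:E)%E @[n --> \oo] --> 0%E
    & sf_integral (s n) @[n --> \oo] --> I].

End Bochner_integral.

Section Lipschitz_boundary.
Context (R : realType) (n : nat).

(* Near each boundary point, and in suitable orthonormal coordinates, the set is
   the strict epigraph (first coordinate above the others) of a Lipschitz map. *)
Definition Lipschitz_boundary (A : set 'rV[R]_n.+1) :=
  forall x0, closure A x0 -> ~ interior A x0 ->
  exists (Q : 'M[R]_n.+1) (gamma : 'rV[R]_n -> R) (L r : R),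
  [/\ Q *m Q^T = 1%:M, L.-lipschitz gamma, 0 < r &
      forall x, ball x0 r x ->
        (A x <-> gamma (col' ord0 (x *m Q)) < (x *m Q) ord0 ord0)].

End Lipschitz_boundary.

Section L2_spaces.
Context d (X : measurableType d) (R : realType) (mu : {measure set X -> \bar R}).

Definition L2 := Lp mu (lee1n 2).

HB.instance Definition _ := NormedModule.on L2.

Definition L2_dot (f g : L2) : R := \int[mu]_x (Lp_fun f x * Lp_fun g x).

Definition le_ae (f g : L2) := {ae mu, forall x, Lp_fun f x <= Lp_fun g x}.

End L2_spaces.

Section processes.
Context d (Omega : measurableType d) (R : realType) (P : probability Omega R).
Context (T : R) (F : R -> set (set Omega)).

Definition complete_filtration :=
  [/\ measure_is_complete P,
      forall t : R, 0 <= t <= T -> sigma_algebra setT (F t) /\ F t `<=` measurable,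
      forall s t : R, 0 <= s -> s <= t -> t <= T -> F s `<=` F t
    & P.-negligible `<=` F 0].

Definition time_domain (t : R) : set (Omega * R) := setT `*` `[0, t].

Definition progressive_sets : set (set (Omega * R)) :=
  [set A | A `<=` time_domain T /\ forall t : R, 0 <= t <= T ->
    <<s [set B `*` C | B in F t & C in @measurable _ (measurableTypeR R)] >>
      (A `&` time_domain t)].

Definition progressive (E : topologicalType) (phi : Omega -> R -> E) :=
  borel_measurable progressive_sets (time_domain T) (fun z => phi z.1 z.2).

Definition progressive_operator (E E' : topologicalType) (B : Omega -> R -> E -> E') :=
  borel_measurable
    <<s time_domain T `*` setT, [set A `*` C | A in progressive_sets & C in @borel E] >>
    (time_domain T `*` setT) (fun z => B z.1.1 z.1.2 z.2).

Definition LrLs (r s : R) (E : normedModType R) (phi : Omega -> R -> E) :=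
  progressive phi /\
  (\int[P]_w ((\int[lebesgue_measure]_(t in `[0%R, T]) (`|phi w t| `^ s)%:E)
    `^ (r / s)) < +oo)%E.

Definition L2_initial (E : normedModType R) (u0 : Omega -> E) :=
  borel_measurable (F 0) setT u0 /\ (\int[P]_w (`|u0 w| ^+ 2)%:E < +oo)%E.

Definition L2C0 (E : normedModType R) (u : Omega -> R -> E) :=
  [/\ forall w, {within `[0, T], continuous (u w)},
      borel_measurable measurable setT (u : Omega -> {uniform` `[0, T] -> E})
    & (\int[P]_w ereal_sup [set (`|u w t| ^+ 2)%:E | t in `[0%R, T]] < +oo)%E].

Section Wiener.
Context (U : hilbertType R).

Definition increment (W : R -> U -> Omega -> R) (s t : R) (g : U) (w : Omega) : R :=
  W t g w - W s g w.

Record cylindrical_Wiener (W : R -> U -> Omega -> R) : Prop := {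
  Wiener0 : forall g, {ae P, forall w, W 0 g w = 0} ;
  Wiener_linear : forall (t a : R) g h, 0 <= t <= T ->
    {ae P, forall w, W t (a *: g + h) w = a * W t g w + W t h w} ;
  Wiener_adapted : forall (t : R) g B, 0 <= t <= T -> @measurable _ (measurableTypeR R) B ->
    F t (W t g @^-1` B) ;
  Wiener_continuous : forall g,
    {ae P, forall w, {within `[0, T], continuous (fun t : R => W t g w)}} ;
  Wiener_independent : forall (s t : R) g A B, 0 <= s -> s < t -> t <= T ->
    F s A -> @measurable _ (measurableTypeR R) B ->
    P (A `&` increment W s t g @^-1` B) = (P A * P (increment W s t g @^-1` B))%E ;
  Wiener_normal : forall (s t : R) g B, 0 <= s -> s < t -> t <= T -> g != 0 ->
    @measurable _ (measurableTypeR R) B ->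
    P (increment W s t g @^-1` B) = normal_prob 0 (Num.sqrt (t - s) * `|g|) B
}.

Context (e : onbasis U) (W : R -> U -> Omega -> R) (E : normedModType R).

(* Finite sums of 1_A 1_]s, t] <e_k, .> x with A in F_s: these are dense among the
   square-integrable progressive integrands. *)
Record elementary := Elementary {
  el_size : nat ;
  el_event : nat -> set Omega ;
  el_start : nat -> R ;
  el_end : nat -> R ;
  el_index : nat -> nat ;
  el_val : nat -> E ;
  el_time : forall j, 0 <= el_start j /\ el_start j <= el_end j /\ el_end j <= T ;
  el_adapted : forall j, F (el_start j) (el_event j)
}.

Definition el_fun (s : elementary) (w : Omega) (t : R) (g : U) : E :=
  \sum_(j < el_size s)
    (\1_(el_event s j) w * \1_(`]el_start s j, el_end s j]) t
      * hdot (e (el_index s j)) g) *: el_val s j.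

Definition el_integral (s : elementary) (w : Omega) (t : R) : E :=
  \sum_(j < el_size s)
    (\1_(el_event s j) w *
      (W (Num.min t (el_end s j)) (e (el_index s j)) w
       - W (Num.min t (el_start s j)) (e (el_index s j)) w)) *: el_val s j.

Definition is_stochastic_integral (Phi : Omega -> R -> hilbert_schmidt e E)
    (I : Omega -> R -> E) :=
  [/\ LrLs 2 2 Phi,
      forall t : R, 0 <= t <= T -> borel_measurable (F t) setT (I ^~ t),
      {ae P, forall w, {within `[0, T], continuous (I w)}} &
      exists (s : nat -> elementary) (Phin : nat -> Omega -> R -> hilbert_schmidt e E),
      [/\ forall n w t g, Phin n w t g = el_fun (s n) w t g,
          (\int[P]_w \int[lebesgue_measure]_(t in `[0%R, T])
             (`|Phin n w t - Phi w t| ^+ 2)%:E)%E @[n --> \oo] --> 0%E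
        & forall t : R, 0 <= t <= T ->
          (\int[P]_w (`|el_integral (s n) w t - I w t| ^+ 2)%:E)%E @[n --> \oo] --> 0%E]].

End Wiener.
End processes.

Section assumptions.
Context d (Omega : measurableType d) (R : realType) (P : probability Omega R).
Context (T : R) (Ft : R -> set (set Omega)).
Context (U : hilbertType R) (e : onbasis U) (W : R -> U -> Omega -> R).
Context d' (X : measurableType d') (mu : {measure set X -> \bar R}).
Local Notation H := (L2 mu).
Context (V : completeNormedModType R) (iota : blin V H).

(* [iota] is the embedding of V into H. *)
Definition assumption_V :=
  [/\ separable V /\ reflexive_space V,
      injective iota /\ dense (range iota),
      uniformly_convex V /\ uniformly_convex (dual V)
    & exists C : R, forall v : V,
        ('N[mu]_4%:E[EFin \o Lp_fun (iota v)] <= (C * `|v|)%:E)%E].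

Context (p : R).

Section operator_A.
Context (A : Omega -> R -> V -> dual V).

Definition assumption_A1 := progressive_operator T Ft A.

Definition assumption_A2 := forall w (t : R) (phi psi zeta : V), 0 <= t <= T ->
  continuous (fun r : R => A w t (phi + r *: psi) zeta : R).

Definition assumption_A3 := exists2 cA : R, 0 < cA &
  forall w (t : R) (phi : V), 0 <= t <= T -> cA * `|phi| `^ p <= A w t phi phi.

Definition assumption_A4 := exists (CA : R) (hA : Omega -> R -> R^o),
  [/\ 0 < CA, LrLs P T Ft 1 1 hA &
      forall w (t : R) (phi : V), 0 <= t <= T ->
        `|A w t phi| `^ (p / (p - 1)) <= CA * `|phi| `^ p + hA w t].

Definition C2 (sigma : R -> R) :=
  [/\ forall x, derivable sigma x 1, forall x, derivable (derive1 sigma) x 1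
    & continuous (derive1 (derive1 sigma))].

Definition assumption_A5 := forall sigma : R -> R,
  {homo sigma : x y / x <= y} -> lipschitz (sigma : R^o -> R^o) -> C2 sigma ->
  sigma 0 = 0 ->
  exists sigmaV : V -> V,
  [/\ forall phi : V, {ae mu, forall x,
        Lp_fun (iota (sigmaV phi)) x = sigma (Lp_fun (iota phi) x)},
      forall phi : V, exists M : R, \forall psi \near phi, `|sigmaV psi| <= M
    & forall w (t : R) (phi psi : V), 0 <= t <= T ->
        0 <= (A w t phi - A w t psi) (sigmaV (phi - psi))].

End operator_A.

Section operator_F.
Context (f : Omega -> R -> R -> R) (F : Omega -> R -> H -> H).

Definition Caratheodory :=
  (forall y, measurable_fun (time_domain T) (fun z : Omega * R => f z.1 z.2 y)) /\
  (forall w (t : R), 0 <= t <= T -> continuous (f w t)).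

(* The exceptional set of (w, t) does not depend on the argument of the operator,
   so that F may be evaluated along a process. *)
Definition superposition :=
  {ae (P \x lebesgue_measure)%E, forall z : Omega * R, 0 <= z.2 <= T -> forall u : H,
    {ae mu, forall x, Lp_fun (F z.1 z.2 u) x = f z.1 z.2 (Lp_fun u x)}}.

Definition assumption_F0 :=
  [/\ Caratheodory,
      forall w (t : R), 0 <= t <= T -> lipschitz (f w t : R^o -> R^o)
    & superposition].

Definition assumption_F1 := progressive_operator T Ft F.

Definition assumption_F2 := exists2 CF : R, 0 < CF & forall u1 u2 : H,
  {ae (P \x lebesgue_measure)%E, forall z : Omega * R, 0 <= z.2 <= T ->
    `|F z.1 z.2 u1 - F z.1 z.2 u2| <= CF * `|u1 - u2|}.

Definition assumption_F3 := exists phiF : H,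
  LrLs P T Ft 2 2 (fun w t => F w t phiF).

End operator_F.

Section operator_G.
Context (G : Omega -> R -> H -> hilbert_schmidt e H).

Definition assumption_G1 := progressive_operator T Ft G.

Definition assumption_G2 := exists2 CG : R, 0 < CG &
  forall B, measurable B -> forall w (t : R) (phi psi : H), 0 <= t <= T ->
  (\sum_(0 <= k <oo) \int[mu]_(x in B)
     ((Lp_fun (G w t phi (e k)) x - Lp_fun (G w t psi (e k)) x) ^+ 2)%:E
   <= (CG ^+ 2)%:E * \int[mu]_(x in B) ((Lp_fun phi x - Lp_fun psi x) ^+ 2)%:E)%E.

Definition assumption_G3 := exists phiG : H,
  LrLs P T Ft 2 2 (fun w t => G w t phiG).

End operator_G.

Context (A : Omega -> R -> V -> dual V) (F : Omega -> R -> H -> H)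
  (G : Omega -> R -> H -> hilbert_schmidt e H).

(* [v] is the V-valued representative of [u], which exists for almost every (w, t);
   the identity in V* is tested against z in V, H being embedded in V* by the scalar
   product of H. *)
Definition is_solution (u0 : Omega -> H) (h u : Omega -> R -> H) :=
  L2C0 P T u /\
  exists (v : Omega -> R -> V) (IG : Omega -> R -> H),
  [/\ LrLs P T Ft p p v,
      {ae (P \x lebesgue_measure)%E, forall z : Omega * R, 0 <= z.2 <= T ->
        iota (v z.1 z.2) = u z.1 z.2},
      is_stochastic_integral P T Ft W (fun w t => G w t (u w t)) IG &
      {ae P, forall w, forall t : R, 0 <= t <= T ->
        exists (IA : dual V) (Ih IF : H),
        [/\ is_Bochner_integral lebesgue_measure `[0, t] (fun s => A w s (v w s)) IA,
            is_Bochner_integral lebesgue_measure `[0, t] (h w) Ih,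
            is_Bochner_integral lebesgue_measure `[0, t] (fun s => F w s (u w s)) IF
          & forall z : V, L2_dot (u w t) (iota z) + IA z
              = L2_dot (u0 w + Ih + IF + IG w t) (iota z)]}].

End assumptions.

(* Main.v *)
(* The difference w = u_1 - u_2 is tested with phi(r) = r^4 / (1 + r)^2 for r > 0 and
   phi(r) = 0 for r <= 0, a convex C^2 function with bounded phi'' that vanishes exactly on
   (-oo, 0]; the energy is the mean y(t) of the integral of phi(w(t)). Instead of an Ito
   formula, y is expanded over steps of length h. Write w = Z + M with M the difference of the
   stochastic integrals. Convexity gives
     phi(w(s)) - phi(w(s - h) + M(s) - M(s - h)) <= phi'(w(s)) (Z(s) - Z(s - h)),
   and, Z being a Bochner integral, the right-hand side is h times an average over [s - h, s]
   of the pairing of the drift with phi'(w(s)): the data contribute a nonpositive term, F at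
   most a multiple of the energy because r phi'(r) <= 4 phi(r), and the A-term converges, for
   almost every s, to a nonpositive limit by (A5). For reverse Fatou this pairing must be
   dominated: (A3) and (A5) applied to a resolvent of sigma yield
   |sigma(v)|_V^p <= C |A(v)|_{V*}^q, and Young's inequality concludes.
   The stochastic increment is handled by a second-order Taylor expansion of phi around
   w(s - h): the linear term has mean zero, and phi'' is at most a multiple of the weight
   (r / (1 + r))^2, for which (G2), extended from sets to weights, bounds the quadratic term by
   the energy again. The quartic part of the Taylor remainder is controlled after approximating M
   by elementary integrals with values in V, contained in L^4; this costs O(h^2) for each such
   approximation. Dividing by h, integrating over s and letting h tend to 0 gives
   y(t) <= y(0) + C int_0^t y, whence y = 0. *)
Require Import Defs.
From mathcomp Require Import all_boot all_order all_algebra.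
From mathcomp Require Import all_classical all_reals all_analysis.
From mathcomp Require Import measurable_realfun ring lra.
Import Order.TTheory GRing.Theory Num.Theory.
Import numFieldNormedType.Exports.
Set Implicit Arguments.
Unset Strict Implicit.
Unset Printing Implicit Defensive.
Local Open Scope classical_set_scope.
Local Open Scope ring_scope.

(** * Square-integrable functions and superposition operators *)

(** Three obstacles shape the argument. The drift takes values in the dual of V, so the energy
    increment can be linearized only at a vector of V. The path lies in V at almost every time, not
    at a prescribed one; hence the linearization at the right endpoint w(s), for almost every s, and
    the averaging in s. The noise must instead be linearized at w(s - h), known before the
    increment. Convexity of phi decouples the two. Next, (A5) gives no growth bound for sigma on V,
    while reverse Fatou needs domination; a second use of (A5), with another function, supplies it.
    Last, stochastic integrals are known only as L^2 limits, so their increments come without fourth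
    moments. The Taylor remainder is therefore shared between an elementary process, chosen before
    h, and its distance to the integral, which enters only quadratically. The choice of phi: its
    square root r k(r), with k(r) = r / (1 + r) for r > 0, is 1-Lipschitz, so the energy is the
    squared norm of a Lipschitz superposition operator; and phi'' is controlled by k^2, so weighting
    the noise by k and comparing with w itself returns the energy. *)

Section lipschitz_continuity.
Context (R : realType).

Lemma lip_continuous (E E' : normedModType R) (f : E -> E') L :
  (forall x y, `|f x - f y| <= L * `|x - y|) -> continuous f.
Proof.
move=> fL a; apply/cvgrPdist_le => e e0.
have L1 : 0 < `|L| + 1 by rewrite ltr_wpDl.
near=> b; apply: le_trans (fL a b) _.
apply: le_trans (_ : (`|L| + 1) * `|a - b| <= e).
  by rewrite ler_wpM2r// (le_trans (ler_norm _))// lerDl.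
rewrite -ler_pdivlMl//; near: b.
by apply: cvgr_dist_le; rewrite ?mulr_gt0 ?invr_gt0//.
Unshelve. all: by end_near. Qed.

(** Stated for the uncurried map, because joint continuity is what makes the pairing of two Borel
    maps measurable. *)
Lemma bilip_continuous (E1 E2 E' : normedModType R) (B : E1 -> E2 -> E') :
  (forall a b a' b', `|B a b - B a' b'| <= `|a - a'| * `|b| + `|a'| * `|b - b'|) ->
  continuous (fun z : E1 * E2 => B z.1 z.2).
Proof.
move=> Bl [a b]; apply/cvgrPdist_le => e e0 /=.
pose C := `|a| + `|b| + 2.
have C0 : 0 < C by rewrite /C ltr_wpDl.
pose r := Num.min 1 (e / C).
have r0 : 0 < r by rewrite lt_min ltr01 divr_gt0.
exists (ball a r, ball b r); first by split; exact: nbhsx_ballx.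
move=> [a' b'] /= []; rewrite -!ball_normE /= => ar br.
apply: le_trans (Bl _ _ _ _) _.
have a'C : `|a'| <= `|a| + 1.
  rewrite -lerBlDl (le_trans (lerB_dist _ _))// distrC (le_trans (ltW ar))//.
  by rewrite ge_min lexx.
have rC : r * C <= e by rewrite -ler_pdivlMr// ge_min lexx orbT.
apply: le_trans rC; rewrite /C.
have -> : r * (`|a| + `|b| + 2) = r * (`|b|) + (`|a| + 1) * r + r by ring.
apply: ler_wpDr; first exact: ltW.
by apply: lerD; [rewrite ler_wpM2r// ltW|rewrite ler_pM// ltW].
Qed.

End lipschitz_continuity.

Section L2_calculus.
Context d (X : measurableType d) (R : realType) (mu : {measure set X -> \bar R}).
Local Notation H := (L2 mu).
Local Notation L2p := (lee1n 2).

Lemma Lp_fun_measurable (a : H) : measurable_fun setT (Lp_fun a).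
Proof. exact: (@measurable_funPT _ _ _ _ (Lp_repr a)). Qed.

Lemma Lp_fun_Lfun (a : H) : Lp_fun a \in Lfun mu 2%:E.
Proof. exact: LfunP. Qed.

Lemma integrable_dot (a b : H) :
  mu.-integrable setT (EFin \o (fun x => Lp_fun a x * Lp_fun b x)).
Proof. by apply/Lfun1_integrable/Lfun2_mul_Lfun1; exact: Lp_fun_Lfun. Qed.

Lemma Lp_funD (a b : H) : {ae mu, forall x, Lp_fun (a + b) x = Lp_fun a x + Lp_fun b x}.
Proof.
have := Lp_class_fun (Lp_repr a + Lp_repr b).
by rewrite Lp_classD !Lp_reprK.
Qed.

Lemma Lp_funZ c (a : H) : {ae mu, forall x, Lp_fun (c *: a) x = c * Lp_fun a x}.
Proof. exact: Lp_class_fun. Qed.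

Lemma Lp_funN (a : H) : {ae mu, forall x, Lp_fun (- a) x = - Lp_fun a x}.
Proof.
by rewrite -scaleN1r; apply: filterS (Lp_funZ (-1) a) => x ->; rewrite mulN1r.
Qed.

Lemma Lp_funB (a b : H) : {ae mu, forall x, Lp_fun (a - b) x = Lp_fun a x - Lp_fun b x}.
Proof. by apply: filterS2 (Lp_funD a (- b)) (Lp_funN b) => x -> ->. Qed.

Lemma Lp_fun0 : {ae mu, forall x, Lp_fun (0 : H) x = 0}.
Proof.
by rewrite -(scale0r (0 : H)); apply: filterS (Lp_funZ 0 0) => x ->; rewrite mul0r.
Qed.

Lemma Lp_eqP (a b : H) : {ae mu, forall x, Lp_fun a x = Lp_fun b x} -> a = b.
Proof. by move=> /Lp_classP; rewrite !Lp_reprK. Qed.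

(** The value 0 outside L^2 only makes the construction total; [ofunE] is the usable
    characterization. *)
Definition ofun (f : X -> R) : H :=
  if pselect (f \in Lfun mu 2%:E) is left fL then Lp_class (Lfun_Sub L2p fL) else 0.

Lemma ofunE (f : X -> R) : f \in Lfun mu 2%:E ->
  {ae mu, forall x, Lp_fun (ofun f) x = f x}.
Proof.
move=> fL; rewrite /ofun; case: pselect => // fL'.
exact: (Lp_class_fun (Lfun_Sub L2p fL')).
Qed.

Lemma Lfun2P (f : X -> R) : measurable_fun setT f ->
  (\int[mu]_x (f x ^+ 2)%:E < +oo)%E -> f \in Lfun mu 2%:E.
Proof.
move=> mf fi; rewrite inE; apply/andP; split; rewrite inE//=.
rewrite /finite_norm unlock; apply: poweR_lty.
apply: le_lt_trans fi; under eq_integral do rewrite /= powR_mulrn// real_normK ?num_real//.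
by [].
Qed.

Lemma Lfun2_le (f : X -> R) C (a : H) : measurable_fun setT f ->
  {ae mu, forall x, `|f x| <= C * `|Lp_fun a x|} -> f \in Lfun mu 2%:E.
Proof.
move=> mf fa; apply: Lfun2P => //.
have /Lfun2_integrable_sqr ia := Lp_fun_Lfun a.
have ma := Lp_fun_measurable a.
apply: (@le_lt_trans _ _ (\int[mu]_x ((C ^+ 2)%:E * (Lp_fun a x ^+ 2)%:E)))%E.
  apply: ae_ge0_le_integral => //.
  - by move=> x _; rewrite lee_fin sqr_ge0.
  - by apply/measurable_EFinP; exact: measurable_funX.
  - by move=> x _; rewrite -EFinM lee_fin mulr_ge0// sqr_ge0.
  - by apply/measurable_EFinP/measurable_funM => //; exact: measurable_funX.
  - apply: filterS fa => x fx _; rewrite -EFinM lee_fin.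
    rewrite -[f x ^+ 2]real_normK ?num_real// -[Lp_fun a x ^+ 2]real_normK ?num_real//.
    by rewrite -exprMn lerXn2r// nnegrE (le_trans _ fx).
have -> : (\int[mu]_x ((C ^+ 2)%:E * (Lp_fun a x ^+ 2)%:E) =
   (C ^+ 2)%:E * \int[mu]_x ((Lp_fun a x ^+ 2)%:E))%E by rewrite integralZl.
rewrite lte_mul_pinfty// ?lee_fin ?sqr_ge0//.
move/integrableP : ia => [_]; under eq_integral do rewrite /= ger0_norm ?sqr_ge0//.
by [].
Qed.

Lemma L2_dotC (a b : H) : L2_dot a b = L2_dot b a.
Proof. by apply: eq_Rintegral => x _; rewrite mulrC. Qed.

Lemma eq_ae_Rintegral (f g : X -> R) : measurable_fun setT f -> measurable_fun setT g ->
  {ae mu, forall x, f x = g x} -> \int[mu]_x f x = \int[mu]_x g x.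
Proof.
move=> mf mg fg; congr fine; apply: ae_eq_integral => //.
- exact/measurable_EFinP.
- exact/measurable_EFinP.
- by apply: filterS fg => x ->.
Qed.

Lemma L2_dotDl (a b c : H) : L2_dot (a + b) c = L2_dot a c + L2_dot b c.
Proof.
rewrite /L2_dot -RintegralD//; try exact: integrable_dot.
apply: eq_ae_Rintegral.
- by apply: measurable_funM; exact: Lp_fun_measurable.
- by apply: measurable_funD; apply: measurable_funM; exact: Lp_fun_measurable.
- by apply: filterS (Lp_funD a b) => x ->; rewrite mulrDl.
Qed.

Lemma L2_dotZl r (a c : H) : L2_dot (r *: a) c = r * L2_dot a c.
Proof.
rewrite /L2_dot -RintegralZl//; try exact: integrable_dot.
apply: eq_ae_Rintegral.
- by apply: measurable_funM; exact: Lp_fun_measurable.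
- by apply: measurable_funM => //; apply: measurable_funM; exact: Lp_fun_measurable.
- by apply: filterS (Lp_funZ r a) => x ->; rewrite mulrA.
Qed.

Lemma L2_dotNl (a c : H) : L2_dot (- a) c = - L2_dot a c.
Proof. by rewrite -scaleN1r L2_dotZl mulN1r. Qed.

Lemma L2_dotBl (a b c : H) : L2_dot (a - b) c = L2_dot a c - L2_dot b c.
Proof. by rewrite L2_dotDl L2_dotNl. Qed.

Lemma L2_dotDr (a b c : H) : L2_dot c (a + b) = L2_dot c a + L2_dot c b.
Proof. by rewrite !(L2_dotC c) L2_dotDl. Qed.

Lemma L2_dotZr r (a c : H) : L2_dot c (r *: a) = r * L2_dot c a.
Proof. by rewrite !(L2_dotC c) L2_dotZl. Qed.

Lemma L2_dotBr (a b c : H) : L2_dot c (a - b) = L2_dot c a - L2_dot c b.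
Proof. by rewrite !(L2_dotC c) L2_dotBl. Qed.

Lemma L2_dot_sumr I (r : seq I) (F : I -> H) a :
  L2_dot a (\sum_(i <- r) F i) = \sum_(i <- r) L2_dot a (F i).
Proof.
elim: r => [|i r IH]; last by rewrite !big_cons L2_dotDr IH.
by rewrite !big_nil -(scale0r 0) L2_dotZr mul0r.
Qed.

Lemma L2_normE (a : H) : `|a| ^+ 2 = L2_dot a a.
Proof.
have E : (\int[mu]_x (Lp_fun a x * Lp_fun a x)%:E
    = \int[mu]_x (`|Lp_fun a x| `^ 2)%:E)%E.
  apply: eq_integral => x _.
  by rewrite powR_mulrn// real_normK ?num_real// expr2.
rewrite [L2_dot a a]/Rintegral E.
have -> : `|a| = fine ('N[mu]_2%:E[EFin \o Lp_fun a])%E by [].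
have -> : (\int[mu]_x (`|Lp_fun a x| `^ 2)%:E =
   'N[mu]_2%:E[EFin \o Lp_fun a] `^ 2)%E.
  by rewrite powR_Lnorm//.
have := finite_norm_fine (Lp_repr a); rewrite /Lp_fun => <-.
by rewrite poweR_EFin /= powR_mulrn// fine_ge0 // Lnorm_ge0.
Qed.

Lemma L2_normE_int (a : H) : ((`|a| ^+ 2)%:E = \int[mu]_x (Lp_fun a x ^+ 2)%:E)%E.
Proof.
rewrite L2_normE /L2_dot /Rintegral fineK; last exact/integrable_fin_num/integrable_dot.
by apply: eq_integral => x _; rewrite expr2.
Qed.

Lemma L2_dot_ge0 (a b : H) :
  {ae mu, forall x, 0 <= Lp_fun a x * Lp_fun b x} -> 0 <= L2_dot a b.
Proof.
move=> ab; have mab : measurable_fun setT (fun x => Lp_fun a x * Lp_fun b x).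
  by apply: measurable_funM; exact: Lp_fun_measurable.
rewrite /L2_dot (@eq_ae_Rintegral _ (fun x => `|Lp_fun a x * Lp_fun b x|))//.
- exact: Rintegral_ge0.
- exact: measurableT_comp.
- by apply: filterS ab => x /ger0_norm.
Qed.

(* Cauchy-Schwarz, from the nonnegativity of |s a - t b|^2. *)
Lemma L2_dot_le (a b : H) : `|L2_dot a b| <= `|a| * `|b|.
Proof.
have key (x y : H) : L2_dot x y <= `|x| * `|y|.
  have [x0|x0] := eqVneq `|x| 0.
    by move/normr0_eq0 : x0 => ->; rewrite normr0 mul0r -(scale0r 0) L2_dotZl mul0r.
  have [y0|y0] := eqVneq `|y| 0.
    by move/normr0_eq0 : y0 => ->; rewrite normr0 mulr0 -(scale0r 0) L2_dotZr mul0r.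
  have := sqr_ge0 `| `|y| *: x - `|x| *: y|.
  rewrite L2_normE L2_dotBl !L2_dotBr !L2_dotZl !L2_dotZr -!L2_normE (L2_dotC y x).
  have x1 : 0 < `|x| by rewrite lt_neqAle eq_sym x0 normr_ge0.
  have y1 : 0 < `|y| by rewrite lt_neqAle eq_sym y0 normr_ge0.
  move=> h; have : 0 <= 2 * (`|x| * `|y|) * (`|x| * `|y| - L2_dot x y).
    by apply: le_trans h _; rewrite le_eqVlt; apply/orP; left; apply/eqP; ring.
  by rewrite pmulr_rge0 ?subr_ge0// !mulr_gt0.
rewrite ler_norml key andbT lerNl -L2_dotNl.
by rewrite (le_trans (key _ _))// normrN.
Qed.

Lemma L2_norm_le (a b : H) C : 0 <= C ->
  {ae mu, forall x, `|Lp_fun a x| <= C * `|Lp_fun b x|} -> `|a| <= C * `|b|.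
Proof.
move=> C0 ab; rewrite -ler_sqr ?nnegrE ?mulr_ge0// exprMn -lee_fin.
rewrite L2_normE_int EFinM L2_normE_int -ge0_integralZl_EFin//; last 3 first.
- by move=> x _; rewrite lee_fin sqr_ge0.
- by apply/measurable_EFinP; apply: measurable_funX; exact: Lp_fun_measurable.
- exact: sqr_ge0.
apply: ae_ge0_le_integral => //.
- by move=> x _; rewrite lee_fin sqr_ge0.
- by apply/measurable_EFinP; apply: measurable_funX; exact: Lp_fun_measurable.
- by move=> x _; rewrite -EFinM lee_fin mulr_ge0// sqr_ge0.
- apply/measurable_EFinP/measurable_funM => //.
  by apply: measurable_funX; exact: Lp_fun_measurable.
- apply: filterS ab => x abx _; rewrite -EFinM lee_fin.
  rewrite -[leLHS]real_normK ?num_real// -[Lp_fun b x ^+ 2]real_normK ?num_real//.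
  by rewrite -exprMn lerXn2r// nnegrE (le_trans _ abx).
Qed.

Definition nemytskii (g : R -> R) (a : H) : H := ofun (g \o Lp_fun a).

Section nemytskii.
Variables (g : R -> R) (L : R).
Hypotheses (g0 : g 0 = 0) (L0 : 0 <= L) (gL : forall x y, `|g x - g y| <= L * `|x - y|).

Lemma lip_measurable : measurable_fun setT g.
Proof. by apply: continuous_measurable_fun; exact: (@lip_continuous _ R^o R^o _ L). Qed.

Lemma nemytskiiE a : {ae mu, forall x, Lp_fun (nemytskii g a) x = g (Lp_fun a x)}.
Proof.
apply: ofunE; apply: (@Lfun2_le _ L a).
  by apply: measurableT_comp; [exact: lip_measurable|exact: Lp_fun_measurable].
by apply: nearW => x /=; have := gL (Lp_fun a x) 0; rewrite g0 !subr0.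
Qed.

Lemma nemytskii_lip a b : `|nemytskii g a - nemytskii g b| <= L * `|a - b|.
Proof.
apply: L2_norm_le => //.
apply: filterS2 (filterI (nemytskiiE a) (nemytskiiE b))
  (filterI (Lp_funB (nemytskii g a) (nemytskii g b)) (Lp_funB a b)) => x.
by move=> [ga gb] [-> ->]; rewrite ga gb.
Qed.

Lemma nemytskii_norm a : `|nemytskii g a| <= L * `|a|.
Proof.
apply: L2_norm_le => //; apply: filterS (nemytskiiE a) => x ->.
by have := gL (Lp_fun a x) 0; rewrite g0 !subr0.
Qed.

Lemma nemytskii_continuous : continuous (nemytskii g).
Proof. exact: lip_continuous nemytskii_lip. Qed.

End nemytskii.

Lemma L2_dot_continuous : continuous (fun z : H * H => L2_dot z.1 z.2).
Proof.
apply: bilip_continuous => a b a' b'.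
have -> : L2_dot a b - L2_dot a' b' = L2_dot (a - a') b + L2_dot a' (b - b').
  by rewrite L2_dotBl L2_dotBr; ring.
apply: le_trans (ler_normD _ _) _.
exact: lerD (L2_dot_le _ _) (L2_dot_le _ _).
Qed.

End L2_calculus.

(** * Test functions *)

Section glueing.
Context (R : realType).

Definition pos_part_fun (F : R -> R) (x : R) : R := if 0 < x then F x else 0.

(** The quadratic bound forces a zero derivative at 0. The derivative has the same glued form, so
    the lemma iterates through phi, phi' and phi''. *)
Lemma pos_part_fun_derive (F F' : R -> R) C :
  (forall x : R, 0 < x -> is_derive x 1 F (F' x)) ->
  (forall x : R, 0 < x -> `|F x| <= C * x ^+ 2) ->
  forall x : R, is_derive x 1 (pos_part_fun F) (pos_part_fun F' x).
Proof.
move=> dF qF x; rewrite /pos_part_fun; case: ltgtP => [x0|x0|<-].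
- apply: near_eq_is_derive (dF x x0); near=> y; rewrite ifT//.
  by near: y; exact: lt_nbhsr.
- apply: (near_eq_is_derive (f := cst 0)).
  near=> y; rewrite ifF//; apply/negbTE; rewrite -leNgt ltW//.
  by near: y; exact: lt_nbhsl.
- apply/is_derive1_caratheodory.
  (* The difference quotient at 0, of size at most |C z|. *)
  exists (fun z => if 0 < z then F z / z else 0); split; last by rewrite ltxx.
  + move=> z; rewrite ltxx !subr0; case: ifPn => z0; last by rewrite mul0r.
    by rewrite divfK// gt_eqF.
  + apply/cvgrPdist_le => e e0; rewrite ltxx.
    have C1 : 0 < `|C| + 1 by rewrite ltr_wpDl.
    near=> z; rewrite sub0r normrN; case: ifPn => [z0|]; last by rewrite normr0 ltW.
    rewrite normrM normfV (gtr0_norm z0) ler_pdivrMr//.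
    rewrite (le_trans (qF _ z0))// expr2 mulrA ler_wpM2r ?(ltW z0)//.
    apply: (@le_trans _ _ ((`|C| + 1) * `|z - 0|)).
      rewrite subr0 (gtr0_norm z0) ler_wpM2r ?(ltW z0)//.
      by rewrite (le_trans (ler_norm _))// lerDl.
    rewrite -ler_pdivlMl// distrC; near: z.
    by apply: cvgr_dist_le; rewrite ?mulr_gt0 ?invr_gt0//.
Unshelve. all: by end_near. Qed.

Lemma pos_part_fun_continuous (F : R -> R) C :
  (forall x : R, 0 < x -> {for x, continuous F}) ->
  (forall x : R, 0 < x -> `|F x| <= C * x) -> continuous (pos_part_fun F).
Proof.
move=> cF qF x; rewrite /pos_part_fun; have [x0|x0|<-] := ltgtP 0 x.
- have : F y @[y --> x] --> F x by exact: cF.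
  rewrite /prop_for /continuous_at x0; apply: cvg_trans; apply: near_eq_cvg.
  by near=> y; rewrite ifT//; near: y; exact: lt_nbhsr.
- have : (cst 0 : R -> R) y @[y --> x] --> (0 : R) by exact: cvg_cst.
  rewrite /prop_for /continuous_at (lt_gtF x0); apply: cvg_trans; apply: near_eq_cvg.
  near=> y; rewrite ifF//; apply/negbTE; rewrite -leNgt ltW//.
  by near: y; exact: lt_nbhsl.
- apply/cvgrPdist_le => e e0; rewrite ltxx.
  have C1 : 0 < `|C| + 1 by rewrite ltr_wpDl.
  near=> z; rewrite sub0r normrN; case: ifPn => [z0|]; last by rewrite normr0 ltW.
  rewrite (le_trans (qF _ z0))//.
  apply: (@le_trans _ _ ((`|C| + 1) * `|z - 0|)).
    rewrite subr0 (gtr0_norm z0) ler_wpM2r ?(ltW z0)//.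
    by rewrite (le_trans (ler_norm _))// lerDl.
  rewrite -ler_pdivlMl// distrC; near: z.
  by apply: cvgr_dist_le; rewrite ?mulr_gt0 ?invr_gt0//.
Unshelve. all: by end_near. Qed.

Lemma is_derive_continuous (f f' : R -> R) :
  (forall x : R, is_derive x 1 f (f' x)) -> continuous f.
Proof.
move=> df x; have [fx _] := df x.
exact/differentiable_continuous/derivable1_diffP.
Qed.

(** The intermediate point is located by inequalities that do not depend on the order of a and b;
    the sign of the product tells on which side of a it lies. *)
Lemma mvt_abs (f f' : R -> R) : (forall x : R, is_derive x 1 f (f' x)) ->
  forall a b, exists c, (`|c - a| <= `|b - a| /\ 0 <= (c - a) * (b - a)) /\ f b - f a = f' c * (b - a).
Proof.
move=> df a b; have cf := is_derive_continuous df.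
have [ab|ba|->] := ltgtP a b; last by exists b; rewrite !subrr !mulr0.
- have [c] := MVT ab (fun x _ => df x) (continuous_subspaceT cf).
  rewrite in_itv/= => /andP[ac cb] E; exists c; split => //.
  by split; [rewrite !ger0_norm; lra|rewrite mulr_ge0//; lra].
- have [c] := MVT ba (fun x _ => df x) (continuous_subspaceT cf).
  rewrite in_itv/= => /andP[ac cb] E; exists c; split.
    by split; [rewrite !ler0_norm; lra|rewrite mulr_le0//; lra].
  by rewrite -opprB E -mulrN opprB.
Qed.

End glueing.

Section test_functions.
Context (R : realType).
Implicit Types x y r : R.

(** [tf_phi] is the square of [tf_g], and [tf_sigma], [tf_sigma1], [tf_sigma2] are its first three
    derivatives. The exponent 4 makes all of them vanish at 0, as (A5) asks for a test function
    [tf_sigma] of class C^2; the division by (1 + r)^2 keeps the growth quadratic, hence [tf_sigma]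
    Lipschitz. *)
Definition tf_k : R -> R := pos_part_fun (fun r => r / (1 + r)).
Definition tf_g (r : R) : R := r * tf_k r.
Definition tf_phi : R -> R := pos_part_fun (fun r => r ^+ 4 * (1 + r)^-1 ^+ 2).
Definition tf_sigma : R -> R :=
  pos_part_fun (fun r => 2 * (r ^+ 3 * (r + 2)) * (1 + r)^-1 ^+ 3).
Definition tf_sigma1 : R -> R :=
  pos_part_fun (fun r => 2 * (r ^+ 2 * (r ^+ 2 + 4 * r + 6)) * (1 + r)^-1 ^+ 4).
Definition tf_sigma2 : R -> R := pos_part_fun (fun r => 24 * r * (1 + r)^-1 ^+ 5).

Let is_derive_u r : 0 < r ->
  is_derive r 1 (fun r => (1 + r)^-1 : R) (- (1 + r)^-1 ^+ 2).
Proof.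
move=> r0; have r1 : 1 + r != 0 by rewrite gt_eqF// addr_gt0.
have d1 : is_derive r 1 (fun y : R => 1 + y) 1.
  have /= := @is_deriveD _ _ _ (cst (1 : R)) id r 1 0 1 _ _.
  by rewrite add0r; apply.
have := @is_deriveV _ (fun y : R => 1 + y) r 1 1 r1 d1.
by rewrite exprVn /GRing.scale/= mulr1.
Qed.

Let uE r : 0 < r -> r * (1 + r)^-1 = 1 - (1 + r)^-1.
Proof. by move=> r0; field; rewrite gt_eqF// addr_gt0. Qed.

Let u01 r : 0 < r -> 0 < (1 + r)^-1 /\ (1 + r)^-1 < 1.
Proof.
by move=> r0; rewrite invr_gt0 invf_lt1 ?addr_gt0// ltrDl.
Qed.


(** With u = 1 / (1 + r) in (0, 1) and r u = 1 - u, the rational inequalities on r > 0 become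
    polynomial ones, within reach of [nra]. *)
Let uP r : 0 < r -> exists u, [/\ u = (1 + r)^-1, 0 < u, u < 1 & r * u = 1 - u].
Proof. by move=> r0; exists (1 + r)^-1; have [] := u01 r0; split => //; exact: uE. Qed.


Let tf_phiE r : 0 < r -> tf_phi r = r ^+ 2 * (1 - (1 + r)^-1) ^+ 2.
Proof. by move=> r0; rewrite /tf_phi /pos_part_fun r0 -uE//; ring. Qed.

Let tf_sigmaE r : 0 < r ->
  tf_sigma r = 2 * r * (1 - (1 + r)^-1) ^+ 2 * (1 + (1 + r)^-1).
Proof.
move=> r0; rewrite /tf_sigma /pos_part_fun r0 -uE//.
by field; rewrite gt_eqF// addr_gt0.
Qed.

Let tf_sigma1E r : 0 < r -> tf_sigma1 r =
  2 * (1 - (1 + r)^-1) ^+ 2 * (1 + 2 * (1 + r)^-1 + 3 * (1 + r)^-1 ^+ 2).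
Proof.
move=> r0; rewrite /tf_sigma1 /pos_part_fun r0 -uE//.
by field; rewrite gt_eqF// addr_gt0.
Qed.

Let tf_kE r : 0 < r -> tf_k r = 1 - (1 + r)^-1.
Proof. by move=> r0; rewrite /tf_k /pos_part_fun r0 uE. Qed.

Lemma tf_k_le0 r : r <= 0 -> tf_k r = 0.
Proof. by move=> r0; rewrite /tf_k /pos_part_fun ltNge r0. Qed.

Lemma tf_phi_le0 r : r <= 0 -> tf_phi r = 0.
Proof. by move=> r0; rewrite /tf_phi /pos_part_fun ltNge r0. Qed.

Lemma tf_sigma_le0 r : r <= 0 -> tf_sigma r = 0.
Proof. by move=> r0; rewrite /tf_sigma /pos_part_fun ltNge r0. Qed.

Lemma tf_sigma1_le0 r : r <= 0 -> tf_sigma1 r = 0.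
Proof. by move=> r0; rewrite /tf_sigma1 /pos_part_fun ltNge r0. Qed.

Lemma tf_k_bounds x : 0 <= tf_k x <= 1.
Proof.
have [x0|x0] := leP x 0; first by rewrite tf_k_le0// lexx ler01.
by rewrite tf_kE//; have [u [<- u0 u1 xu]] := uP x0; lra.
Qed.

(** On r > 0, phi'' = 2 k^2 (1 + 2 u + 3 u^2) with u < 1, whence 12 = 2 (1 + 2 + 3). *)
Lemma tf_sigma1_bounds x : 0 <= tf_sigma1 x <= 12 * tf_k x ^+ 2.
Proof.
have [x0|x0] := leP x 0; first by rewrite tf_sigma1_le0// tf_k_le0// expr0n/= mulr0 lexx.
rewrite tf_sigma1E// tf_kE//; have [u [<- u0 u1 xu]] := uP x0.
have u2 : 0 <= u ^+ 2 <= 1 by rewrite exprn_ge0 ?(ltW u0)// exprn_ile1 ?(ltW u0) ?(ltW u1).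
apply/andP; split; first by rewrite !mulr_ge0// ?sqr_ge0//; lra.
have : 0 <= (1 - u) ^+ 2 by rewrite sqr_ge0.
by move: (_ ^+ 2) => w w0; nra.
Qed.

Lemma tf_sigma1_le12 x : `|tf_sigma1 x| <= 12.
Proof.
have /andP[k0 k1] := tf_k_bounds x; have /andP[s0 s1] := tf_sigma1_bounds x.
by rewrite ger0_norm// (le_trans s1)// ler_piMr// exprn_ile1.
Qed.

Lemma tf_phi_derive x : is_derive x 1 tf_phi (tf_sigma x).
Proof.
apply: (@pos_part_fun_derive _ _ _ 1) => {}x x0.
  have du := is_derive_u x0.
  apply: is_derive_eq; rewrite /GRing.scale/=.
  have r1 : 1 + x != 0 by rewrite gt_eqF// addr_gt0.
  by rewrite /=; field; exact: r1.
have := tf_phiE x0; rewrite /tf_phi /pos_part_fun x0 => ->.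
have [u [<- u0 u1 xu]] := uP x0.
rewrite ger0_norm; last by rewrite mulr_ge0 ?sqr_ge0.
rewrite mulrC ler_wpM2r ?sqr_ge0//.
by rewrite exprn_ile1//; lra.
Qed.

Lemma tf_sigma_derive x : is_derive x 1 tf_sigma (tf_sigma1 x).
Proof.
apply: (@pos_part_fun_derive _ _ _ 4) => {}x x0.
  have du := is_derive_u x0.
  apply: is_derive_eq; rewrite /GRing.scale/=.
  have r1 : 1 + x != 0 by rewrite gt_eqF// addr_gt0.
  by rewrite /=; field; exact: r1.
have := tf_sigmaE x0; rewrite /tf_sigma /pos_part_fun x0 => ->.
have [u [<- u0 u1 xu]] := uP x0.
rewrite ger0_norm; last by rewrite !mulr_ge0// ?sqr_ge0//; lra.
have -> : 2 * x * (1 - u) ^+ 2 * (1 + u) = x * (x * u) * (2 * (1 - u ^+ 2)).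
  by rewrite xu; ring.
have -> : x * (x * u) * (2 * (1 - u ^+ 2)) = x ^+ 2 * (2 * u * (1 - u ^+ 2)) by ring.
rewrite mulrC ler_wpM2r ?sqr_ge0//.
have u2 : 0 <= u ^+ 2 <= 1 by rewrite exprn_ge0 ?(ltW u0)// exprn_ile1 ?(ltW u0) ?(ltW u1).
by move: (u ^+ 2) u2 => w /andP[w0 w1]; nra.
Qed.

Lemma tf_sigma1_derive x : is_derive x 1 tf_sigma1 (tf_sigma2 x).
Proof.
apply: (@pos_part_fun_derive _ _ _ 12) => {}x x0.
  have du := is_derive_u x0.
  apply: is_derive_eq; rewrite /GRing.scale/=.
  have r1 : 1 + x != 0 by rewrite gt_eqF// addr_gt0.
  by rewrite /=; field; exact: r1.
have := tf_sigma1_bounds x; have := tf_kE x0.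
rewrite /tf_sigma1 /pos_part_fun x0 => -> /andP[s0 s1].
rewrite ger0_norm// (le_trans s1)// ler_wpM2l//.
have [u [<- u0 u1 xu]] := uP x0; rewrite -xu exprMn ler_piMr ?sqr_ge0//.
by rewrite exprn_ile1// ltW.
Qed.

Lemma tf_sigma2_continuous : continuous tf_sigma2.
Proof.
apply: (@pos_part_fun_continuous _ _ 24) => x x0.
  have r1 : 1 + x != 0 by rewrite gt_eqF// addr_gt0.
  have du := is_derive_u x0.
  have [dx _] : is_derive x 1 (fun r : R => 24 * r * (1 + r)^-1 ^+ 5)
      (24 * (1 + x)^-1 ^+ 5 - 120 * x * (1 + x)^-1 ^+ 6).
    by apply: is_derive_eq; rewrite /GRing.scale/=; field.
  exact/differentiable_continuous/derivable1_diffP.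
have [u [<- u0 u1 xu]] := uP x0.
rewrite ger0_norm ?mulr_ge0 ?exprn_ge0 ?(ltW x0) ?(ltW u0)//.
by rewrite ler_piMr ?mulr_ge0 ?(ltW x0)// exprn_ile1// ltW.
Qed.

Lemma tf_sigma_ge0 x : 0 <= tf_sigma x.
Proof.
have [x0|x0] := leP x 0; first by rewrite tf_sigma_le0.
rewrite tf_sigmaE//; have [u [<- u0 u1 xu]] := uP x0.
by rewrite !mulr_ge0 ?sqr_ge0//; lra.
Qed.

Lemma tf_phi_gE x : tf_phi x = tf_g x ^+ 2.
Proof.
rewrite /tf_g; have [x0|x0] := leP x 0.
  by rewrite tf_phi_le0// tf_k_le0// mulr0 expr0n.
by rewrite tf_phiE// tf_kE// exprMn.
Qed.

Lemma tf_phi_eq0 x : tf_phi x = 0 -> x <= 0.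
Proof.
have [//|x0] := leP x 0; rewrite tf_phiE//; have [u [<- u0 u1 xu]] := uP x0.
move/eqP; rewrite mulf_eq0 !sqrf_eq0 gt_eqF//= => /eqP; lra.
Qed.

Lemma tf_sigma_phi x : `|x * tf_sigma x| <= 4 * tf_phi x.
Proof.
have [x0|x0] := leP x 0; first by rewrite tf_sigma_le0// tf_phi_le0// !mulr0 normr0.
rewrite tf_phiE// tf_sigmaE//; have [u [<- u0 u1 xu]] := uP x0.
rewrite ger0_norm; last by rewrite !mulr_ge0 ?sqr_ge0//; lra.
have -> : x * (2 * x * (1 - u) ^+ 2 * (1 + u)) = 2 * (1 + u) * (x ^+ 2 * (1 - u) ^+ 2).
  by ring.
by rewrite ler_wpM2r ?mulr_ge0 ?sqr_ge0//; lra.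
Qed.

Lemma tf_k_lip x y : `|tf_k x - tf_k y| <= `|x - y|.
Proof.
wlog xy : x y / x <= y.
  move=> W; have /orP[xy|yx] := le_total x y; first exact: W.
  by rewrite distrC (distrC x); exact: W.
rewrite (distrC (tf_k x)) (distrC x) (@ger0_norm _ (y - x)) ?subr_ge0//.
have [y0|y0] := leP y 0; first by rewrite !tf_k_le0 ?(le_trans xy)// subrr normr0 subr_ge0.
rewrite tf_kE//; have [u [<- u0 u1 yu]] := uP y0.
have [x0|x0] := leP x 0; first by rewrite tf_k_le0// subr0 ger0_norm; nra.
rewrite tf_kE//; have [v [<- v0 v1 xv]] := uP x0.
have uv : u <= v.
  have : (1 + y) * u = 1 by rewrite mulrDl mul1r yu; ring.
  have : (1 + x) * v = 1 by rewrite mulrDl mul1r xv; ring.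
  nra.
rewrite ger0_norm; last by lra.
have : (v - u) = (y - x) * (u * v).
  have E1 : y * u * v = (1 - u) * v by rewrite yu.
  have E2 : x * v * u = (1 - v) * u by rewrite xv.
  by rewrite mulrBl !mulrA E1 -(mulrA x u v) (mulrC u v) mulrA E2; ring.
nra.
Qed.

(** For r > 0, r k(r) = r - (1 - u) with u = 1 / (1 + r), a function of slope 1 - u^2. *)
Lemma tf_g_lip x y : `|tf_g x - tf_g y| <= 1 * `|x - y|.
Proof.
rewrite mul1r; wlog xy : x y / x <= y.
  move=> W; have /orP[xy|yx] := le_total x y; first exact: W.
  by rewrite distrC (distrC x); exact: W.
rewrite (distrC (tf_g x)) (distrC x) (@ger0_norm _ (y - x)) ?subr_ge0// /tf_g.
have [y0|y0] := leP y 0.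
  by rewrite !tf_k_le0 ?(le_trans xy)// !mulr0 subrr normr0 subr_ge0.
rewrite tf_kE//; have [u [<- u0 u1 yu]] := uP y0.
have [x0|x0] := leP x 0; first by rewrite tf_k_le0// mulr0 subr0 ger0_norm; nra.
rewrite tf_kE//; have [v [<- v0 v1 xv]] := uP x0.
have uv : u <= v.
  have : (1 + y) * u = 1 by rewrite mulrDl mul1r yu; ring.
  have : (1 + x) * v = 1 by rewrite mulrDl mul1r xv; ring.
  nra.
have -> : y * (1 - u) - x * (1 - v) = (y - x) - (v - u).
  by rewrite !mulrBr yu xv !mulr1; ring.
rewrite ger0_norm; first by lra.
have : (v - u) = (y - x) * (u * v).
  have E1 : y * u * v = (1 - u) * v by rewrite yu.
  have E2 : x * v * u = (1 - v) * u by rewrite xv.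
  by rewrite mulrBl !mulrA E1 -(mulrA x u v) (mulrC u v) mulrA E2; ring.
nra.
Qed.

Lemma tf_sigma_lip x y : `|tf_sigma x - tf_sigma y| <= 12 * `|x - y|.
Proof.
have [c [_ E]] := mvt_abs tf_sigma_derive y x.
by rewrite E normrM ler_wpM2r// tf_sigma1_le12.
Qed.

Lemma tf_sigma_homo : {homo tf_sigma : x y / x <= y}.
Proof.
move=> x y xy; have [c [_ E]] := mvt_abs tf_sigma_derive x y.
rewrite -subr_ge0 E mulr_ge0 ?subr_ge0//.
by have /andP[] := tf_sigma1_bounds c.
Qed.

(** By the mean value theorem phi' is evaluated between b - D and b, so below phi'(b) if D > 0 and
    above it if D < 0. *)
Lemma tf_phi_convex b D : tf_phi b - tf_phi (b - D) <= tf_sigma b * D.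
Proof.
have [c [[_ cb] E]] := mvt_abs tf_phi_derive b (b - D).
have -> : tf_phi b - tf_phi (b - D) = tf_sigma c * D by rewrite -opprB E; ring.
rewrite (_ : b - D - b = - D) in cb; last by ring.
have [D0|D0|->] := ltgtP D 0; last by rewrite !mulr0.
- rewrite ler_wnM2r ?(ltW D0)//; apply: tf_sigma_homo.
  by move: cb; rewrite pmulr_lge0 ?oppr_gt0// subr_ge0.
- rewrite ler_wpM2r ?(ltW D0)//; apply: tf_sigma_homo.
  by move: cb; rewrite nmulr_lge0 ?oppr_lt0// subr_le0.
Qed.

(* Taylor at order two; for a < 0 the remainder is only controlled through k(a + m) <= |m|,
   whence the quartic term. *)
Lemma tf_phi_taylor a m m' :
  `|tf_phi (a + m) - tf_phi a - tf_sigma a * m| <=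
  400 * (tf_k a ^+ 2 * m' ^+ 2 + m' ^+ 4 + (m - m') ^+ 2).
Proof.
have [x [[xa _] E1]] := mvt_abs tf_phi_derive a (a + m).
have [y [[ya _] E2]] := mvt_abs tf_sigma_derive a x.
rewrite (_ : a + m - a = m) in xa E1; last by ring.
have -> : tf_phi (a + m) - tf_phi a - tf_sigma a * m = tf_sigma1 y * (x - a) * m.
  by rewrite E1 -mulrBl E2.
have /andP[s0 s1] := tf_sigma1_bounds y.
have h1 : `|tf_sigma1 y * (x - a) * m| <= tf_sigma1 y * m ^+ 2.
  rewrite !normrM (ger0_norm s0) -(real_normK (num_real m)) expr2 mulrA.
  by rewrite ler_wpM2r// ler_wpM2l.
apply: le_trans h1 _.
have kya : tf_k y <= tf_k a + `|m|.
  rewrite -lerBlDl (le_trans (ler_norm _))// (le_trans (tf_k_lip _ _))//.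
  exact: le_trans ya xa.
have /andP[k0 k1] := tf_k_bounds y; have /andP[l0 l1] := tf_k_bounds a.
have mE : `|m| ^+ 2 = m ^+ 2 by rewrite real_normK ?num_real.
have k2 : tf_k y ^+ 2 <= 2 * tf_k a ^+ 2 + 2 * m ^+ 2.
  rewrite -mE; apply: (@le_trans _ _ ((tf_k a + `|m|) ^+ 2)).
    by rewrite lerXn2r// nnegrE ?addr_ge0.
  by rewrite -subr_ge0; have := sqr_ge0 (tf_k a - `|m|); congr (_ <= _); ring.
have ky1 : tf_k y ^+ 2 <= 1 by rewrite exprn_ile1.
have ka1 : tf_k a ^+ 2 <= 1 by rewrite exprn_ile1.
have ka0 := sqr_ge0 (tf_k a); have ky0 := sqr_ge0 (tf_k y).
have m2 : m ^+ 2 <= 2 * m' ^+ 2 + 2 * (m - m') ^+ 2.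
  by rewrite -subr_ge0; have := sqr_ge0 (m - 2 * m'); congr (_ <= _); ring.
have h2 : tf_sigma1 y * m ^+ 2 <= 12 * (tf_k y ^+ 2 * m ^+ 2).
  by rewrite mulrA ler_wpM2r ?sqr_ge0.
apply: le_trans h2 _; rewrite (exprM m' 2 2).
have := sqr_ge0 m; have := sqr_ge0 m'; have := sqr_ge0 (m - m').
move: (tf_k y ^+ 2) (tf_k a ^+ 2) (m ^+ 2) (m' ^+ 2) ((m - m') ^+ 2) ky0 ky1 k2 ka0 ka1 m2.
move=> K A M N E K0 K1 KA A0 A1 MN E0 N0 M0.
(* If m^2 <= 4 (m - m')^2, the bound phi'' <= 12 is enough. Otherwise m^2 <= 4 m'^2, and k(y)^2 <= 2
   k(a)^2 + 2 m^2 gives 96 k(a)^2 m'^2 + 384 m'^4; the constant 400 exceeds 384. *)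
have [ME|ME] := leP M (4 * E).
  have : K * M <= M by rewrite ler_piMl.
  have := mulr_ge0 A0 N0; have := sqr_ge0 N; nra.
have M4 : M <= 4 * N by lra.
have : K * M <= (2 * A + 2 * M) * M by rewrite ler_wpM2r.
have : A * M <= A * (4 * N) by rewrite ler_wpM2l.
have : M * M <= (4 * N) * (4 * N) by rewrite ler_pM.
rewrite (expr2 N); have : 0 <= A * N by rewrite mulr_ge0.
nra.
Qed.

End test_functions.

(** * The resolvent of the test function *)

Section contraction.
Context (R : realType).

(** As phi'' <= 12, the factor 1/24 bounds the slope by 1/2: then [rho], the identity minus
    [tf_sig], is an increasing bijection with slope in [1/2, 1]. *)
Definition tf_sig (r : R) : R := 24^-1 * tf_sigma r.
Let rho (r : R) := r - tf_sig r.

Let sig_derive (x : R) : is_derive x 1 tf_sig (24^-1 * tf_sigma1 x).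
Proof.
have d := tf_sigma_derive x.
have := @is_deriveZ _ _ _ (@tf_sigma R) (24^-1) x 1 (tf_sigma1 x) d.
by rewrite /GRing.scale.
Qed.

Let sig1_derive (x : R) : is_derive x 1 (fun r => 24^-1 * tf_sigma1 r : R) (24^-1 * tf_sigma2 x).
Proof.
have d := tf_sigma1_derive x.
have := @is_deriveZ _ _ _ (@tf_sigma1 R) (24^-1) x 1 (tf_sigma2 x) d.
by rewrite /GRing.scale.
Qed.

Let h (x : R) : R := 24^-1 * tf_sigma1 x.

Let h01 (x : R) : 0 <= h x <= 2^-1.
Proof.
have := tf_sigma1_le12 x; have /andP[s0 _] := tf_sigma1_bounds x.
by rewrite ger0_norm// /h => s12; apply/andP; split; lra.
Qed.

Let rho_derive (x : R) : is_derive x 1 rho (1 - h x).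
Proof. exact: (@is_deriveB _ _ _ id tf_sig x 1 1 (h x) (is_derive_id _ _) (sig_derive x)). Qed.

Let rho_expand (x y : R) : x <= y -> 2^-1 * (y - x) <= rho y - rho x <= y - x.
Proof.
move=> xy; have [c [_ ->]] := mvt_abs rho_derive x y.
by have /andP[h0 h1] := h01 c; apply/andP; split; nra.
Qed.

Let rho_cont : continuous rho.
Proof. exact: is_derive_continuous rho_derive. Qed.

Let rho0 : rho 0 = 0.
Proof. by rewrite /rho /tf_sig tf_sigma_le0// mulr0 subr0. Qed.

Let rho_surj (y : R) : exists x, rho x = y.
Proof.
(* [rho] vanishes at 0 and has slope at least 1/2, so its values at -2 |y| and 2 |y| enclose y. *)
pose N := 2 * `|y|.
have N0 : - N <= N by rewrite ge0_cp// mulr_ge0.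
have [|x _ <-] := @IVT _ rho (- N) N y N0 (continuous_subspaceT rho_cont); last by exists x.
have N1 : 0 <= N by rewrite mulr_ge0.
have /andP[e1 _] := rho_expand N1; have NN : - N <= 0 by rewrite oppr_le0.
have /andP[e2 _] := rho_expand NN; rewrite rho0 in e1 e2.
have := ler_norm y; have := ler_norm (- y); rewrite normrN => y1 y2.
by rewrite ge_min le_max; apply/andP; split; apply/orP; [left|right]; move: e1 e2; rewrite /N; lra.
Qed.

Let rinv (y : R) := sval (cid (rho_surj y)).

Let rinvK : cancel rinv rho.
Proof. by move=> y; rewrite /rinv; case: cid. Qed.

Let rho_lt (x y : R) : x < y -> rho x < rho y.
Proof. by move=> xy; have /andP[e _] := rho_expand (ltW xy); lra. Qed.

Let rhoK : cancel rho rinv.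
Proof.
move=> x; have := rinvK (rho x).
by have [/rho_lt xx|/rho_lt xx|//] := ltgtP (rinv (rho x)) x => E; move: xx; rewrite E ltxx.
Qed.

Let rinv_derive (y : R) : is_derive y 1 rinv (1 - h (rinv y))^-1.
Proof.
rewrite -{1}[y]rinvK; apply: is_derive_inverse.
- by near=> z; exact: rhoK.
- by near=> z; exact: rho_cont.
- exact: rho_derive.
- by have /andP[h0 h1] := h01 (rinv y); rewrite gt_eqF//; lra.
Unshelve. all: by end_near. Qed.

Let q (x : R) : R := h x / (1 - h x).
Let q' x : R := 24^-1 * tf_sigma2 x / (1 - h x) ^+ 2.

Let nz (x : R) : 1 - h x != 0.
Proof. by have /andP[h0 h1] := h01 x; rewrite gt_eqF//; lra. Qed.

Let q_derive (x : R) : is_derive x 1 q (q' x).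
Proof.
have dh : is_derive x 1 h (24^-1 * tf_sigma2 x) := sig1_derive x.
have d1 : is_derive x 1 (fun y => 1 - h y) (- (24^-1 * tf_sigma2 x)).
  have := @is_deriveB _ _ _ (cst (1 : R)) h x 1 0 _ (is_derive_cst _ _ _) dh.
  by rewrite sub0r.
have d2 := @is_deriveV _ (fun y => 1 - h y) x _ 1 (nz x) d1.
have := @is_deriveM _ _ h (fun y => (1 - h y)^-1) x 1 _ _ dh d2.
have <- : h x *: (- (1 - h x) ^- 2 *: - (24^-1 * tf_sigma2 x)) +
     (1 - h x)^-1 *: (24^-1 * tf_sigma2 x) = q' x.
  by rewrite /GRing.scale/= /q'; field; exact: nz.
by [].
Qed.

Let rinv_cont : continuous rinv.
Proof. exact: is_derive_continuous rinv_derive. Qed.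

(** Take tau = [tf_sig] o [rinv]. Its slope is h / (1 - h) at the preimage, at most 1 because h <=
    1/2; its regularity comes from the derivative of the inverse function. *)
Lemma resolvent_function : exists tau : R -> R,
  [/\ {homo tau : x y / x <= y},
      forall x y : R, `|tau x - tau y| <= `|x - y|, C2 tau, tau 0 = 0 &
      forall r, tau (r - tf_sig r) = tf_sig r].
Proof.
pose tau := tf_sig \o rinv.
have tau_derive (y : R) : is_derive y 1 tau (q (rinv y)).
  have := @is_derive1_comp _ tf_sig rinv y _ _ (sig_derive _) (rinv_derive y).
  by rewrite /q /h /GRing.scale.
have tau1_derive (y : R) : is_derive y 1 (q \o rinv) (q' (rinv y) / (1 - h (rinv y))).
  exact: (@is_derive1_comp _ q rinv y _ _ (q_derive _) (rinv_derive y)).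
have q01 (x : R) : 0 <= q x <= 1.
  have /andP[h0 h1] := h01 x; rewrite /q divr_ge0//=; last by lra.
  by rewrite ler_pdivrMr ?mul1r; lra.
have D1 : derive1 tau = q \o rinv.
  by apply/funext => y; rewrite derive1E; have [_ ->] := tau_derive y.
have D2 : derive1 (q \o rinv) = fun y => q' (rinv y) / (1 - h (rinv y)).
  by apply/funext => y; rewrite derive1E; have [_ ->] := tau1_derive y.
exists tau; split.
- move=> x y xy; rewrite -subr_ge0; have [c [_ ->]] := mvt_abs tau_derive x y.
  by rewrite mulr_ge0 ?subr_ge0//; have /andP[] := q01 (rinv c).
- move=> x y; have [c [_ ->]] := mvt_abs tau_derive y x.
  rewrite normrM ler_piMl//; have /andP[q0 q1] := q01 (rinv c).
  by rewrite ger0_norm.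
- split.
  + by move=> y; have [] := tau_derive y.
  + by rewrite D1 => y; have [] := tau1_derive y.
  + rewrite D1 D2 => y.
    have ch : continuous h := is_derive_continuous sig1_derive.
    have c1 : {for y, continuous (fun y => 1 - h (rinv y))}.
      apply: cvgB; first exact: cvg_cst.
      by apply: continuous_comp; [exact: rinv_cont|exact: ch].
    apply: cvgM; last by apply: cvgV => //; exact: nz.
    apply: cvgM; last first.
      apply: cvgV; first by rewrite sqrf_eq0 nz.
      by rewrite expr2; apply: cvgM; exact: c1.
    apply: cvgM; first exact: cvg_cst.
    by apply: continuous_comp; [exact: rinv_cont|exact: tf_sigma2_continuous].
- by rewrite /tau/= -{1}rho0 rhoK /tf_sig tf_sigma_le0// mulr0.
- by move=> r; rewrite /tau/= -/(rho r) rhoK.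
Qed.

Lemma tf_sig_C2 : C2 tf_sig.
Proof.
have D1 : derive1 tf_sig = h.
  by apply/funext => y; rewrite derive1E; have [_ ->] := sig_derive y.
have D2 : derive1 h = fun y => 24^-1 * tf_sigma2 y.
  by apply/funext => y; rewrite derive1E; have [_ ->] := sig1_derive y.
split.
- by move=> y; have [] := sig_derive y.
- by rewrite D1 => y; have [] := sig1_derive y.
- rewrite D1 D2 => y; apply: cvgM; first exact: cvg_cst.
  exact: tf_sigma2_continuous.
Qed.

Lemma tf_sig_homo : {homo tf_sig : x y / x <= y}.
Proof. by move=> x y xy; rewrite /tf_sig ler_wpM2l// tf_sigma_homo. Qed.

Lemma tf_sig_lip (x y : R) : `|tf_sig x - tf_sig y| <= `|x - y|.
Proof.
rewrite /tf_sig -mulrBr normrM ger0_norm//.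
by rewrite (le_trans (ler_wpM2l _ (tf_sigma_lip _ _)))//; have := normr_ge0 (x - y); lra.
Qed.

Lemma tf_sig0 : tf_sig 0 = 0.
Proof. by rewrite /tf_sig tf_sigma_le0// mulr0. Qed.

End contraction.

(** * Growth of the test element in V *)

Section growth.
Context d (Omega : measurableType d) (R : realType) (T : R).
Context d' (X : measurableType d') (mu : {measure set X -> \bar R}).
Local Notation H := (L2 mu).
Context (V : completeNormedModType R) (iota : blin V H).
Hypothesis iota_inj : injective iota.
Context (p : R) (p_ge2 : 2 <= p) (A : Omega -> R -> V -> dual V).

Lemma blinE_B (E E' : normedModType R) (f g : blin E E') z : (f - g) z = f z - g z.
Proof. by []. Qed.

(** Divide by x and raise to the power q = p / (p - 1), for which (p - 1) q = p. *)
Lemma powR_conj (c a x : R) : 0 < c -> 0 <= a -> 0 <= x ->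
  c * x `^ p <= a * x -> x `^ p <= (c^-1) `^ (p / (p - 1)) * a `^ (p / (p - 1)).
Proof.
move=> c0 a0; have p0 : p != 0 by rewrite gt_eqF// (lt_le_trans _ p_ge2).
have p1 : p - 1 != 0 by rewrite gt_eqF//; move: p_ge2; lra.
rewrite le_eqVlt => /predU1P[<- _|x0 cx].
  by rewrite powR0// mulr_ge0// powR_ge0.
have xE : x `^ p = x * x `^ (p - 1).
  by rewrite -{2}(powRr1 (ltW x0)) -powRD ?(gt_eqF x0) ?implybT//; congr (_ `^ _); ring.
have : x `^ (p - 1) <= c^-1 * a.
  rewrite -(ler_pM2l c0) mulrA divff ?gt_eqF// mul1r -(ler_pM2r x0).
  by rewrite (le_trans _ cx)// xE -mulrA (mulrC x).
have q0 : 0 <= p / (p - 1) by move: p_ge2 => ?; rewrite divr_ge0//; lra.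
move=> /(ge0_ler_powR q0); rewrite !nnegrE powR_ge0 => /(_ isT).
rewrite mulr_ge0 ?invr_ge0 ?(ltW c0)// => /(_ isT).
by rewrite -powRrM mulrCA divff// mulr1 powRM// invr_ge0 ltW.
Qed.

Lemma klip_lipschitz (g : R -> R) : (forall x y, `|g x - g y| <= `|x - y|) ->
  lipschitz (g : R^o -> R^o).
Proof.
move=> gl; exists 1; split => // M M1 [x y] /= _.
by rewrite (le_trans (gl x y))// ler_peMl// ltW.
Qed.

(* (A5) is applied between phi and sigma phi to the function tau with
   tau (r - sigma r) = sigma r. *)
Lemma sigma_growth : assumption_A3 T p A -> assumption_A5 T iota A ->
  exists (sigV : V -> V) (C : R), [/\ 0 <= C,
    forall phi, {ae mu, forall x, Lp_fun (iota (sigV phi)) x = tf_sig (Lp_fun (iota phi) x)},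
    forall w (t : R) phi psi, 0 <= t <= T ->
      0 <= (A w t phi - A w t psi) (sigV (phi - psi)) &
    forall w (t : R) phi, 0 <= t <= T ->
      `|sigV phi| `^ p <= C * `|A w t phi| `^ (p / (p - 1))].
Proof.
move=> [cA cA0 A3] A5.
have [tau [tau_homo tau_lip tauC2 tau0 tauE]] := resolvent_function R.
have [sigV [sigVE _ sigVA]] := A5 _ (@tf_sig_homo R) (klip_lipschitz (@tf_sig_lip R))
  (@tf_sig_C2 R) (@tf_sig0 R).
have [tauV [tauVE _ tauVA]] := A5 _ tau_homo (klip_lipschitz tau_lip) tauC2 tau0.
exists sigV, ((cA^-1) `^ (p / (p - 1))); split => //; first exact: powR_ge0.
move=> w t phi t0T; apply: powR_conj => //.
(* Injectivity of [iota] lifts the pointwise identity tau (r - sig r) = sig r to V. *)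
have tauVsig : tauV (phi - sigV phi) = sigV phi.
  apply: iota_inj; apply: Lp_eqP.
  apply: filterS2 (filterI (tauVE (phi - sigV phi)) (sigVE phi))
    (Lp_funB (iota phi) (iota (sigV phi))) => x [-> E] B.
  by rewrite linearB/= B E tauE.
(* Monotonicity tested with tau reads <A(sig phi), sig phi> <= <A(phi), sig phi>; by coercivity the
   left side is at least cA |sig phi|^p. *)
have := tauVA w t phi (sigV phi) t0T; rewrite tauVsig blinE_B subr_ge0 => h.
rewrite (le_trans (A3 w t _ t0T))// (le_trans h)//.
by rewrite (le_trans (ler_norm _))// le_opnorm.
Qed.

End growth.

(** * Bochner integrals and reverse Fatou *)

Lemma cvge0_lt (R : realType) (u : nat -> \bar R) (e : R) :
  (u n @[n --> \oo] --> 0)%E -> 0 < e ->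
  exists N, forall n, (N <= n)%N -> (u n < e%:E)%E.
Proof.
move=> u0 e0; have : nbhs (0%E : \bar R) [set y | (y < e%:E)%E].
  by apply: open_nbhs_nbhs; split; [exact: open_ereal_lt_ereal|rewrite /= lte_fin].
by move=> /u0 [N _ HN]; exists N => n Nn; exact: HN.
Qed.

Section Bochner_functional.
Context d (X : measurableType d) (R : realType) (E : normedModType R).
Variables (mu : {measure set X -> \bar R}) (D : set X) (mD : measurable D).
Variable (f : X -> E).
Hypothesis mf : forall c, measurable_fun D (fun x => `|f x - c|).

Lemma measurable_fun_mem (S : set X) : measurable S ->
  measurable_fun D (fun x => x \in S).
Proof.
move=> mS; apply: (measurable_fun_bool true) => //.
rewrite (_ : _ @^-1` _ = S); first exact: measurableI.
by apply/seteqP; split => x /=; [exact: set_mem|exact: mem_set].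
Qed.

(** Whether x lies in the first set only changes the constant [c0], so measurability of the
    distances of f to constants carries over by induction. In this form the argument covers values
    in [dual V]. *)
Lemma measurable_dist_sum I (r : seq I) (b : I -> X -> bool) (c : I -> E) :
  (forall i, measurable_fun D (b i)) -> forall c0,
  measurable_fun D (fun x => `|f x - (c0 + \sum_(i <- r) (b i x)%:R *: c i)|).
Proof.
move=> mb; elim: r => [|i r IH] c0.
  by under eq_fun do rewrite big_nil addr0; exact: mf.
apply: (@eq_measurable_fun _ _ _ _ D (fun x => if b i x then
    `|f x - ((c0 + c i) + \sum_(i <- r) (b i x)%:R *: c i)| else
    `|f x - (c0 + \sum_(i <- r) (b i x)%:R *: c i)|)).
  move=> x _; rewrite big_cons; case: (b i x) => /=.
    by rewrite scale1r addrA.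
  by rewrite scale0r add0r.
by apply: measurable_fun_if => //; exact: measurable_funS (IH _).
Qed.

Lemma measurable_dist_sf (s : simple_function X E) :
  measurable_fun D (fun x => `|sf_fun s x - f x|).
Proof.
have := @measurable_dist_sum _ (index_enum 'I_(sf_size s)) (fun k x => x \in sf_set s k)
  (fun k => sf_val s k) _ 0.
move=> /(_ (fun k => measurable_fun_mem (@sf_measurable _ _ _ _ s k))).
apply: eq_measurable_fun => x _; rewrite add0r distrC.
by congr `| _ - _ |; apply: eq_bigr => k _; rewrite indicE.
Qed.

Variables (I : E) (l : E -> R) (C : R).
Hypotheses (l_lin : forall a x y, l (a *: x + y) = a * l x + l y)
  (l_le : forall x, `|l x| <= C * `|x|) (C0 : 0 <= C).
Hypothesis ml : measurable_fun D (l \o f).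

Let l0 : l 0 = 0.
Proof. by have := l_lin (-1) 0 0; rewrite scaler0 addr0 mulN1r addNr. Qed.

Let lD x y : l (x + y) = l x + l y.
Proof. by have := l_lin 1 x y; rewrite scale1r mul1r. Qed.

Let lZ a x : l (a *: x) = a * l x.
Proof. by have := l_lin a x 0; rewrite !addr0 l0 addr0. Qed.

Let lB x y : l (x - y) = l x - l y.
Proof. by rewrite lD -scaleN1r lZ mulN1r. Qed.

Let l_sum J (r : seq J) (F : J -> E) : l (\sum_(i <- r) F i) = \sum_(i <- r) l (F i).
Proof. by elim: r => [|i r IH]; rewrite ?big_nil ?l0// !big_cons lD IH. Qed.

Let l_continuous : continuous (l : E -> R^o).
Proof. by apply: (@lip_continuous _ _ _ _ C) => x y; rewrite -lB. Qed.

Let term (s : simple_function X E) k (a : R) (x : X) : R := (\1_(sf_set s k) x : R) * a.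

Let sf_norm (s : simple_function X E) x :=
  \sum_(k < sf_size s) (\1_(sf_set s k) x : R) * `|sf_val s k|.

Let sf_norm_ge s x : `|sf_fun s x| <= sf_norm s x.
Proof.
rewrite (le_trans (ler_norm_sum _ _ _))//; apply: ler_sum => k _.
by rewrite normrZ ger0_norm.
Qed.

Let fin_indic (s : simple_function X E) k a : (mu (sf_set s k `&` D) < +oo)%E ->
  mu.-integrable D (EFin \o term s k a).
Proof.
move=> fs; have := @integrableZr _ _ _ mu D mD a (EFin \o \1_(sf_set s k)).
apply; apply/integrableP; split.
  apply/measurable_EFinP; apply: measurable_indic; exact: sf_measurable.
under eq_integral do rewrite /= ger0_norm//.
by rewrite integral_indic//; exact: sf_measurable.
Qed.

Let sf_norm_int (s : simple_function X E) : (forall k, (mu (sf_set s k `&` D) < +oo)%E) ->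
  mu.-integrable D (EFin \o sf_norm s).
Proof.
move=> fs; rewrite (_ : EFin \o _ = (fun x => \sum_(k < sf_size s)
   (EFin \o term s k `|sf_val s k|%R) x)%E).
  by apply: integrable_sum => // k _; exact: fin_indic.
by apply/funext => x; rewrite /= sumEFin.
Qed.

Let l_sfE (s : simple_function X E) x : l (sf_fun s x) = \sum_(k < sf_size s) (\1_(sf_set s k) x : R) * l (sf_val s k).
Proof. by rewrite l_sum; apply: eq_bigr => k _; rewrite lZ. Qed.

Let l_sf_int (s : simple_function X E) : (forall k, (mu (sf_set s k `&` D) < +oo)%E) ->
  mu.-integrable D (EFin \o (l \o sf_fun s)) /\
  \int[mu]_(x in D) l (sf_fun s x) = l (sf_integral mu D s).
Proof.
move=> fs.
have E' : EFin \o (l \o sf_fun s) = (fun x => \sum_(k < sf_size s)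
   (EFin \o term s k (l (sf_val s k))) x)%E.
  by apply/funext => x; rewrite /= l_sfE sumEFin.
split; first by rewrite E'; apply: integrable_sum => // k _; exact: fin_indic.
rewrite /Rintegral (_ : (fun x => _) = EFin \o (l \o sf_fun s))// E' integral_sum//; last first.
  by move=> k; exact: fin_indic.
rewrite l_sum -sum_fine; last by move=> k _; apply: integrable_fin_num => //; exact: fin_indic.
apply: eq_bigr => k _; rewrite lZ -/(Rintegral _ _ _).
rewrite [LHS]RintegralZr//; last first.
  by have := @fin_indic s k 1 (fs k); apply: eq_integrable => // x _ /=; rewrite /term mulr1.
congr (_ * _); rewrite /Rintegral integral_indic//; exact: sf_measurable.
Qed.

(** A Bochner integral is given only as a limit of simple integrals; later it is used solely through
    bounded functionals, which commute with it. Integrability of |f| comes from one simple function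
    on sets of finite measure and its integrable distance to f. *)
Lemma is_Bochner_integral_functional : is_Bochner_integral mu D f I ->
  [/\ mu.-integrable D (fun x => (`|f x|)%:E), mu.-integrable D (EFin \o (l \o f)) &
      l I = \int[mu]_(x in D) l (f x)].
Proof.
move=> [s [sfin _ s_cvg sI]].
have nfs n : measurable_fun D (fun x => `|sf_fun (s n) x - f x|) by exact: measurable_dist_sf.
have [N HN] := cvge0_lt s_cvg ltr01.
have idist n : (N <= n)%N -> mu.-integrable D (fun x => (`|sf_fun (s n) x - f x|)%:E).
  move=> Nn; apply/integrableP; split; first exact/measurable_EFinP.
  by under eq_integral do rewrite /= normr_id; apply: lt_trans (HN _ Nn) _; exact: ltry.
have mnf : measurable_fun D (fun x => `|f x|).
  by have := mf 0; under eq_fun do rewrite subr0.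
have inf : mu.-integrable D (fun x => (`|f x|)%:E).
  apply: (@le_integrable _ _ _ mu D mD _
    (fun x => (sf_norm (s N) x)%:E + (`|sf_fun (s N) x - f x|)%:E)%E).
  - exact/measurable_EFinP.
  - move=> x _; rewrite /= normr_id lee_fin ger0_norm; last first.
      by rewrite addr_ge0//; exact: le_trans (sf_norm_ge _ _).
    rewrite (le_trans _ (lerD (sf_norm_ge _ _) (lexx _)))//.
    by rewrite -{1}[f x](subKr (sf_fun (s N) x)) (le_trans (ler_normB _ _)).
  - by apply: integrableD => //; [exact: sf_norm_int|exact: idist].
have ilf : mu.-integrable D (EFin \o (l \o f)).
  apply: (@le_integrable _ _ _ mu D mD _ (fun x => C%:E * (`|f x|)%:E)%E).
  - exact/measurable_EFinP.
  - by move=> x _; rewrite /= lee_fin (le_trans (l_le _))// ler_norm.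
  - exact: integrableZl.
split => //.
have lsI : l (sf_integral mu D (s n)) @[n --> \oo] --> (l I : R^o).
  exact: (cvg_comp _ _ sI (l_continuous (x := I))).
suff : l (sf_integral mu D (s n)) @[n --> \oo] --> (\int[mu]_(x in D) l (f x) : R^o).
  by move=> h; apply: (cvg_unique _ lsI h).
apply/cvgrPdist_le => e e0.
have e1 : 0 < e / (C + 1) by rewrite divr_gt0// ltr_wpDl.
have [M HM] := cvge0_lt s_cvg e1; exists (maxn N M) => // n /=.
rewrite geq_max => /andP[Nn Mn].
have [il <-] := l_sf_int (sfin n).
rewrite distrC -RintegralB//.
have id2 : mu.-integrable D (EFin \o (fun x => l (sf_fun (s n) x) - l (f x))).
  by have := integrableB mD il ilf; apply: eq_integrable.
rewrite (le_trans (le_normr_Rintegral mD id2))//.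
have := HM n Mn => /=.
rewrite -[X in (X < _)%E]fineK; last by apply: integrable_fin_num => //; exact: idist.
rewrite lte_fin => h.
apply: (@le_trans _ _ (C * \int[mu]_(x in D) `|sf_fun (s n) x - f x|)).
  rewrite -RintegralZl//; last exact: idist.
  apply: le_Rintegral => //.
  - exact: integrable_norm id2.
  - by have := @integrableZl _ _ _ mu D mD C _ (idist n Nn); apply: eq_integrable.
  - by move=> x _; rewrite -lB l_le.
rewrite (le_trans (ler_wpM2l C0 (ltW h)))// mulrA ler_pdivrMr ?ltr_wpDl//.
by rewrite mulrC ler_wpM2l ?(ltW e0)// lerDl.
Qed.

End Bochner_functional.

(** Replacing g by the maximum of f and g changes it on a null set only and makes the inequality
    pointwise. *)
Lemma ae_le_Rintegral d (X : measurableType d) (R : realType)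
    (mu : {measure set X -> \bar R}) (D : set X) (mD : measurable D) (f g : X -> R) :
  mu.-integrable D (EFin \o f) -> mu.-integrable D (EFin \o g) ->
  {ae mu, forall x, D x -> f x <= g x} ->
  \int[mu]_(x in D) f x <= \int[mu]_(x in D) g x.
Proof.
move=> intf intg fg.
have mf : measurable_fun D f by move/integrableP : intf => [/measurable_EFinP].
have mg : measurable_fun D g by move/integrableP : intg => [/measurable_EFinP].
have mm : measurable_fun D (fun x => Num.max (f x) (g x)) by exact: measurable_maxr.
have E : {ae mu, forall x, D x -> (g x)%:E = (Num.max (f x) (g x))%:E}.
  by apply: filterS fg => x fgx Dx; congr (_%:E); rewrite max_r// fgx.
have intm : mu.-integrable D (EFin \o (fun x => Num.max (f x) (g x))).
  apply: (le_integrable mD _ _ (integrableD mD (integrable_norm intf) (integrable_norm intg))).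
    exact/measurable_EFinP.
  move=> x Dx; rewrite /= lee_fin (ger0_norm (addr_ge0 _ _))//.
  by have [_|_] := leP (f x) (g x); rewrite ?lerDl ?lerDr.
have -> : \int[mu]_(x in D) g x = \int[mu]_(x in D) Num.max (f x) (g x).
  by congr fine; apply: ae_eq_integral => //; exact/measurable_EFinP.
by apply: le_Rintegral => // x Dx; rewrite le_max lexx.
Qed.

Section reverse_Fatou.
Context d (X : measurableType d) (R : realType).
Variables (mu : {measure set X -> \bar R}) (D : set X) (mD : measurable D).
Variables (g k : nat -> X -> R) (k0 : X -> R).
Hypotheses (ig : forall n, mu.-integrable D (EFin \o g n))
  (ik : forall n, mu.-integrable D (EFin \o k n))
  (ik0 : mu.-integrable D (EFin \o k0))
  (k_ge0 : forall n x, D x -> 0 <= k n x) (k0_ge0 : forall x, D x -> 0 <= k0 x)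
  (gk : forall n, {ae mu, forall x, D x -> g n x <= k n x})
  (k_cvg : {ae mu, forall x, D x -> k n x @[n --> \oo] --> k0 x})
  (int_k : forall n, \int[mu]_(x in D) k n x <= \int[mu]_(x in D) k0 x)
  (g_limsup : {ae mu, forall x, D x -> forall e, 0 < e -> \forall n \near \oo, g n x <= e}).

(** The majorants k n vary with n. Almost everywhere g n <= u n + (k n - k0), where u n = min(g n^+,
    k0) + (k0 - k n)^+ is at most 2 k0 and tends to 0, so that dominated convergence applies to it;
    the integral of k n - k0 is nonpositive by hypothesis. *)
Lemma reverse_Fatou e : 0 < e -> exists N, forall n, (N <= n)%N ->
  \int[mu]_(x in D) g n x <= e.
Proof.
move=> e0.
have mE h : mu.-integrable D (EFin \o h) -> measurable_fun D h.
  by move=> /integrableP[/measurable_EFinP].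
have mg n := mE _ (ig n); have mk n := mE _ (ik n); have mk0 := mE _ ik0.
pose u n x := Num.min (Num.max (g n x) 0) (k0 x) + Num.max (k0 x - k n x) 0.
have mu_ n : measurable_fun D (u n).
  apply: measurable_funD; first by apply: measurable_minr => //; exact: measurable_maxr.
  by apply: measurable_maxr => //; exact: measurable_funB.
have u_ge0 n x : D x -> 0 <= u n x.
  by move=> Dx; rewrite addr_ge0// ?le_min ?le_max ?lexx ?orbT//= k0_ge0.
have u_le n x : D x -> u n x <= 2 * k0 x.
  move=> Dx; rewrite mulr_natl mulr2n lerD//; first by rewrite ge_min lexx orbT.
  by rewrite ge_max k0_ge0// andbT gerBl k_ge0.
have ik2 : mu.-integrable D (fun x => (2 * k0 x)%:E).
  by have := integrableZl mD 2 ik0; apply: eq_integrable.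
have iu n : mu.-integrable D (EFin \o u n).
  apply: (le_integrable mD _ _ ik2); first exact/measurable_EFinP.
  move=> x Dx /=; rewrite lee_fin ger0_norm ?u_ge0// (le_trans (u_le _ _ Dx))//.
  exact: ler_norm.
have [] := @dominated_convergence _ _ _ mu D mD (fun n => EFin \o u n) (cst 0%E)
  (fun x => (2 * k0 x)%:E).
- by move=> n; exact/measurable_EFinP.
- exact: measurable_cst.
- apply: filterS2 k_cvg g_limsup => x kx gx Dx.
  have {}kx := kx Dx; have {}gx := gx Dx.
  apply/fine_cvgP; split; first exact: nearW.
  apply/cvgrPdist_le => r r0.
  have r2 : 0 < r / 2 by rewrite divr_gt0.
  near=> n; rewrite /= sub0r normrN ger0_norm ?u_ge0// (splitr r) lerD//.
    by rewrite ge_min ge_max (ltW r2) andbT; apply/orP; left; near: n; exact: gx.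
  rewrite ge_max (ltW r2) andbT (le_trans (ler_norm _))//; near: n.
  by move/cvgrPdist_le : kx; apply.
- exact: ik2.
- apply: nearW => x n Dx.
  by rewrite /= lee_fin ger0_norm ?u_ge0// u_le.
move=> _ _; rewrite integral0.
move=> /(@cvge0_lt _ _ e) /(_ e0) [N HN]; exists N => n Nn.
have := HN n Nn; rewrite /= -[X in (X < _)%E]fineK; last by apply: integrable_fin_num => //; exact: iu.
rewrite lte_fin => ue.
apply: le_trans (ltW ue).
have iB : mu.-integrable D (EFin \o (fun x => k n x - k0 x)).
  by have := integrableB mD (ik n) ik0; apply: eq_integrable.
have iS : mu.-integrable D (EFin \o (fun x => u n x + (k n x - k0 x))).
  by have := integrableD mD (iu n) iB; apply: eq_integrable.
apply: (@le_trans _ _ (\int[mu]_(x in D) (u n x + (k n x - k0 x)))).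
  apply: ae_le_Rintegral => //; apply: filterS (gk n) => x gkx Dx.
  have := gkx Dx; rewrite /u; have := k_ge0 n Dx; have := k0_ge0 Dx.
  move: (g n x) (k n x) (k0 x) => a b c c0 b0 ab.
  have m1 : c - b <= Num.max (c - b) 0 by rewrite le_max lexx.
  have m2 : 0 <= Num.max (c - b) 0 by rewrite le_max lexx orbT.
  have [ac|ca] := leP a c.
    have : a <= Num.min (Num.max a 0) c by rewrite le_min le_max lexx ac.
    by move: m1; lra.
  have : c <= Num.min (Num.max a 0) c by rewrite le_min le_max lexx (ltW ca).
  by move: m2; lra.
rewrite RintegralD// RintegralB// -[leRHS]addr0 lerD// subr_le0.
exact: int_k.
Unshelve. all: by end_near. Qed.

End reverse_Fatou.

(** * Left averages *)

Global Instance ae_lebesgue_filter (R : realType) :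
  Filter (nbhs (almost_everywhere (@lebesgue_measure R))).
Proof. exact: (ae_filter_ringOfSetsType (@lebesgue_measure R)). Qed.

Lemma ge0_integral_scale d (X : measurableType d) (R : realType)
    (mu : {measure set X -> \bar R}) (c : R) (f : X -> R) : 0 <= c ->
  measurable_fun setT f -> (forall x, 0 <= f x) ->
  (\int[mu]_x (c * f x)%:E = c%:E * \int[mu]_x (f x)%:E)%E.
Proof.
move=> c0 mf f0; under eq_integral do rewrite EFinM.
apply: ge0_integralZl_EFin => //; first by move=> x _; rewrite lee_fin.
exact/measurable_EFinP.
Qed.

Section real_integrable.
Context d (X : measurableType d) (R : realType) (mu : {measure set X -> \bar R}).
Variables (D : set X) (mD : measurable D).

Lemma rintegrableD (f g : X -> R) : mu.-integrable D (EFin \o f) ->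
  mu.-integrable D (EFin \o g) -> mu.-integrable D (EFin \o (fun x => f x + g x)).
Proof. by move=> intf intg; have := integrableD mD intf intg; apply: eq_integrable. Qed.

Lemma rintegrableB (f g : X -> R) : mu.-integrable D (EFin \o f) ->
  mu.-integrable D (EFin \o g) -> mu.-integrable D (EFin \o (fun x => f x - g x)).
Proof. by move=> intf intg; have := integrableB mD intf intg; apply: eq_integrable. Qed.

Lemma rintegrableZ (c : R) (f : X -> R) : mu.-integrable D (EFin \o f) ->
  mu.-integrable D (EFin \o (fun x => c * f x)).
Proof. by move=> intf; have := integrableZl mD c intf; apply: eq_integrable. Qed.

Lemma rintegrable_cst (c : R) : (mu D < +oo)%E -> mu.-integrable D (EFin \o cst c).
Proof.
move=> Doo; apply/integrableP; split; first exact/measurable_EFinP.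
rewrite (_ : (fun x => _) = cst (`|c|)%:E)//.
by rewrite integral_cst// lte_mul_pinfty// ?lee_fin.
Qed.

Lemma rintegrable_measurable (f : X -> R) : mu.-integrable D (EFin \o f) ->
  measurable_fun D f.
Proof. by move=> /integrableP[/measurable_EFinP]. Qed.

Lemma rintegrable_le (f g : X -> R) : measurable_fun D f -> mu.-integrable D (EFin \o g) ->
  (forall x, D x -> `|f x| <= g x) -> mu.-integrable D (EFin \o f).
Proof.
move=> mf ig fg; apply: (le_integrable mD _ _ ig); first exact/measurable_EFinP.
by move=> x Dx; rewrite /= lee_fin (le_trans (fg x Dx))// ler_norm.
Qed.

End real_integrable.

Section left_averages.
Context (R : realType).
Local Notation leb := (@lebesgue_measure R).
Local Notation RT := (measurableTypeR R).
Local Notation h n := (n.+1%:R^-1).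

(** Averages are taken to the left because the energy is linearized at the right end of each
    step. *)
Definition lavg (f : R -> R) (n : nat) (s : R) : R :=
  n.+1%:R * \int[leb]_(r in `]s - h n, s]) f r.

Let h0 n : 0 < h n :> R. Proof. by rewrite invr_gt0. Qed.

Let lenE s n : leb `]s - h n, s] = (h n)%:E.
Proof.
rewrite lebesgue_measure_itv /= lte_fin ltrBlDr ltrDl h0.
by rewrite -EFinB; congr (_%:E); ring.
Qed.

Lemma integrable_left (f : R -> R) s n : leb.-integrable setT (EFin \o f) ->
  leb.-integrable `]s - h n, s] (EFin \o f).
Proof. by apply: integrableS. Qed.

Lemma lavg_cvg (f : R -> R) : leb.-integrable setT (EFin \o f) ->
  {ae leb, forall s, lavg f n s @[n --> \oo] --> f s}.
Proof.
move=> intf; have lf : locally_integrable setT f.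
  by apply: open_integrable_locally => //; exact: openT.
pose E (x : R) n : set R := `]x - h n, x]%classic.
have niceE x : nicely_shrinking x (E x).
  split; first by move=> n; exact: measurable_itv.
  (* The interval is half of the ball of radius h around x, whence the factor 2. *)
  exists (2, fun n => PosNum (h0 n)) => /=; split => //.
  - exact: cvg_harmonic.
  - move=> n y; rewrite /E /= in_itv/= -ball_normE /= => /andP[y1 y2].
    by rewrite ger0_norm ?subr_ge0// ltrBlDr -ltrBlDl.
  - move=> n; rewrite lebesgue_measure_ball ?(ltW (h0 n))// lenE -EFinM lee_fin.
    by rewrite mulr_natl.
have := lebesgue_differentiation lf; apply: filterS => s ps.
have := nice_lebesgue_differentiation niceE lf ps.
move/fine_cvgP => [_]; apply: cvg_trans; apply: near_eq_cvg; apply: nearW => n /=.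
rewrite /E lenE /lavg /Rintegral inver gt_eqF//= invrK.
have : (\int[leb]_(x in `](s - h n)%R, s]) (f x)%:E)%E \is a fin_num.
  by apply: integrable_fin_num => //; exact: integrable_left.
by move: (\int[_]_(_ in _) _)%E => [r| |].
Qed.

Lemma lavgB (f g : R -> R) n s :
  leb.-integrable setT (EFin \o f) -> leb.-integrable setT (EFin \o g) ->
  lavg (fun r => f r - g r) n s = lavg f n s - lavg g n s.
Proof.
by move=> intf intg; rewrite /lavg RintegralB -?mulrBr//; exact: integrable_left.
Qed.

Lemma lavg_cst (c : R) n s : lavg (cst c) n s = c.
Proof.
by rewrite /lavg Rintegral_cst// [X in fine X]lenE/= mulrCA divff ?mulr1.
Qed.

Lemma lavgZr (f : R -> R) c n s : leb.-integrable setT (EFin \o f) ->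
  lavg (fun r => f r * c) n s = lavg f n s * c.
Proof.
by move=> intf; rewrite /lavg RintegralZr ?mulrA//; exact: integrable_left.
Qed.

Lemma lavg_ge (f g : R -> R) c n s : leb.-integrable setT (EFin \o f) ->
  leb.-integrable setT (EFin \o g) -> (forall r, - (g r + c) <= f r) ->
  - (lavg g n s + c) <= lavg f n s.
Proof.
move=> intf intg fg.
have il := integrable_left s n intf; have ig := integrable_left s n intg.
have ic : leb.-integrable `]s - h n, s] (EFin \o cst c).
  by apply: rintegrable_cst => //; rewrite [X in (X < _)%E]lenE ltry.
rewrite lerNl -subr_ge0 opprK -{1}(lavg_cst c n s) /lavg -!mulrDr mulr_ge0//.
rewrite -RintegralD// -RintegralD//; last by apply: rintegrableD.
by apply: Rintegral_ge0 => r _; have := fg r; rewrite /cst; lra.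
Qed.

Lemma lavg_norm_le (f g : R -> R) n s : leb.-integrable setT (EFin \o f) ->
  leb.-integrable setT (EFin \o g) -> (forall r, `|f r| <= g r) ->
  `|lavg f n s| <= lavg g n s.
Proof.
move=> intf intg fg; rewrite normrM ger0_norm// ler_wpM2l//.
have il := integrable_left s n intf; have ig := integrable_left s n intg.
rewrite (le_trans (le_normr_Rintegral _ il))// le_Rintegral//.
exact: integrable_norm.
Qed.

(** Tonelli: the time r contributes to the averages at the points s of [r, r + h[. Conservation of
    the integral is what lets averaged functions serve as majorants in reverse Fatou. *)
Lemma lavg_integral (k : R -> R) n : leb.-integrable setT (EFin \o k) -> (forall r, 0 <= k r) ->
  leb.-integrable setT (EFin \o lavg k n) /\ \int[leb]_s lavg k n s = \int[leb]_s k s.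
Proof.
move=> intk k0.
have mk : measurable_fun setT k by move/integrableP : intk => [/measurable_EFinP].
pose F (z : RT * RT) : \bar R := (if (z.1 - h n < z.2) && (z.2 <= z.1) then k z.2 else 0)%:E.
have mF : measurable_fun setT F.
  apply/measurable_EFinP; apply: measurable_fun_ifT => //.
  - apply: measurable_and.
      apply: measurable_fun_ltr; last exact: measurable_snd.
      by apply: measurable_funB => //; exact: measurable_fst.
    by apply: measurable_fun_ler; [exact: measurable_snd|exact: measurable_fst].
  - by apply: (measurableT_comp mk); exact: measurable_snd.
have F0 z : (0 <= F z)%E by rewrite /F lee_fin; case: ifP.
have E1 (s : R) : (\int[leb]_r F (s, r) = (h n * lavg k n s)%:E)%E.
  rewrite /lavg mulrA mulVf// mul1r /Rintegral fineK; last first.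
    by apply: integrable_fin_num => //; exact: integrable_left.
  rewrite [RHS]integral_mkcond; apply: eq_integral => r _; rewrite /F /= patchE.
  by rewrite mem_setE in_itv/=; case: ifP.
have E2 (r : R) : (\int[leb]_s F (s, r) = (k r * h n)%:E)%E.
  transitivity (\int[leb]_(s in `[r, (r + h n)%R[) (k r)%:E)%E.
    rewrite [RHS]integral_mkcond; apply: eq_integral => s _; rewrite /F /= patchE.
    by rewrite mem_setE in_itv/= ltrBlDr andbC; case: ifP.
  rewrite integral_cst// [X in (_ * X)%E]lebesgue_measure_itv/= lte_fin ltrDl h0 -EFinB -EFinM.
  by congr (_%:E); ring.
have FE : fubini_F leb F = (fun s => (h n * lavg k n s)%:E).
  by apply/funext => s; exact: E1.
have GE : fubini_G leb F = (fun r => (k r * h n)%:E).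
  by apply/funext => r; exact: E2.
have mlavg : measurable_fun setT (lavg k n).
  have := measurable_fun_fubini_tonelli_F (m2 := leb) F mF F0; rewrite FE.
  move=> /measurable_EFinP mhl.
  rewrite (_ : lavg k n = fun s => n.+1%:R * (h n * lavg k n s)); first exact: measurable_funM.
  by apply/funext => s; rewrite mulrA divff// mul1r.
have lavg0 s : 0 <= lavg k n s by rewrite mulr_ge0// Rintegral_ge0.
have E : (\int[leb]_s (lavg k n s)%:E = \int[leb]_s (k s)%:E)%E.
  have E3 : (\int[leb]_s \int[leb]_r F (s, r) = \int[leb]_r \int[leb]_s F (s, r))%E.
    exact: (fubini_tonelli (m1 := leb) (m2 := leb) F mF F0).
  have : (\int[leb]_s (h n * lavg k n s)%:E = \int[leb]_r (k r * h n)%:E)%E.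
    transitivity (\int[leb]_s \int[leb]_r F (s, r))%E.
      by apply: eq_integral => s _; rewrite E1.
    by rewrite E3; apply: eq_integral => r _; rewrite E2.
  under [in RHS]eq_integral do rewrite mulrC.
  have hn0 : 0 <= h n :> R by rewrite ltW.
  rewrite (@ge0_integral_scale _ _ _ leb _ _ hn0 mlavg lavg0).
  rewrite (@ge0_integral_scale _ _ _ leb _ _ hn0 mk k0).
  move=> /(congr1 (fun x => (n.+1%:R)%:E * x)%E).
  by rewrite !muleA -!EFinM divff// !mul1e.
split; last by rewrite /Rintegral E.
apply/integrableP; split; first exact/measurable_EFinP.
under eq_integral do rewrite /= ger0_norm//.
by rewrite E; move/integrableP : intk => [_]; under eq_integral do rewrite /= ger0_norm//.
Qed.

End left_averages.

Lemma separable_seq (R : realType) (V : normedModType R) : separable V ->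
  exists u : nat -> V, forall (x : V) (e : R), 0 < e -> exists n, `|x - u n| < e.
Proof.
move=> [D /countable_injP [f finj] dD].
(* Indices that the injection of D misses get the default 0, harmless for density. *)
exists (fun n => xget 0 [set x | D x /\ f x = n]) => x e e0.
have [y [xy Dy]] : ball x e `&` D !=set0.
  by apply: dD; [exists x; exact: ballxx|exact: ball_open].
exists (f y); case: xgetP => [y' _ [Dy' ff]|/(_ y)]; last by case.
by rewrite (finj y' y) ?inE//; move: xy; rewrite -ball_normE.
Qed.

(** * Averages of functionals tested on a moving vector *)

Section left_average_pairing.
Context (R : realType) (V : normedModType R).
Local Notation leb := (@lebesgue_measure R).
Local Notation h n := (n.+1%:R^-1).
Hypothesis V_separable : separable V.
Variables (a : R -> dual V) (z : R -> V) (Na k J : R -> R) (t : R).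
Hypotheses (ma : forall v, measurable_fun setT (fun r => a r v))
  (iNa : leb.-integrable setT (EFin \o Na)) (aNa : forall r, `|a r| <= Na r)
  (ik : leb.-integrable setT (EFin \o k)) (k0 : forall r, 0 <= k r)
  (k_out : forall r, ~~ (0 <= r <= t) -> k r = 0)
  (iJ : leb.-integrable `[0, t] (EFin \o J)) (J0 : forall r, 0 <= J r)
  (a_lower : forall r s, - (k r + J s) <= a r (z s))
  (a_sign : {ae leb, forall s, 0 <= s <= t -> 0 <= a s (z s)}).

Let ia v : leb.-integrable setT (EFin \o (fun r => a r v)).
Proof.
apply: (le_integrable _ _ _ (@integrableZl _ _ _ leb setT _ `|v| _ iNa)) => //.
  by apply/measurable_EFinP; exact: ma.
move=> r _ /=; rewrite lee_fin normrM normr_id mulrC.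
rewrite (le_trans (le_opnorm _ _))// ler_wpM2r//.
by rewrite (le_trans (aNa r))// ler_norm.
Qed.

(* At a common Lebesgue point of |a| and of the scalar functions a v, v in a countable dense
   set, the averages of a converge weakly, uniformly enough to plug in the moving vector z s. *)
Lemma lavg_pairing_cvg :
  {ae leb, forall s, lavg (fun r => a r (z s)) n s @[n --> \oo] --> a s (z s)}.
Proof.
have [u u_dense] := separable_seq V_separable.
have h1 : {ae leb, forall s, forall j, lavg (fun r => a r (u j)) n s @[n --> \oo] --> a s (u j)}.
  by apply: ae_foralln => j; exact: lavg_cvg.
apply: filterS2 h1 (lavg_cvg iNa) => s us Ns.
apply/cvgrPdist_le => e e0.
(* At a Lebesgue point of [Na] this bounds the left averages of [Na] for all large n. *)
pose B := Na s + 1.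
have B0 : 0 < B by rewrite /B ltr_wpDl// (le_trans _ (aNa s)).
have [j zj] := u_dense (z s) (e / (3 * B)) (divr_gt0 e0 (mulr_gt0 (ltr0n _ 3) B0)).
have e3 : 0 < e / 3 by rewrite divr_gt0.
near=> n.
have -> : a s (z s) - lavg (fun r => a r (z s)) n s =
    a s (z s - u j) + (a s (u j) - lavg (fun r => a r (u j)) n s)
    + (lavg (fun r => a r (u j)) n s - lavg (fun r => a r (z s)) n s).
  by rewrite linearB/=; ring.
rewrite (le_trans (ler_normD _ _))// (_ : e = e / 3 + e / 3 + e / 3); last by field.
rewrite lerD//; first rewrite (le_trans (ler_normD _ _))// lerD//.
- rewrite (le_trans (le_opnorm _ _))//.
  apply: le_trans (ler_pM (opnorm_ge0 _) (normr_ge0 _) (aNa s) (ltW zj)) _.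
  rewrite (_ : Na s * (e / (3 * B)) = (Na s / B) * (e / 3)); last by field; rewrite gt_eqF.
  by rewrite ler_piMl ?(ltW e3)// ler_pdivrMr// mul1r lerDl.
- near: n; move/cvgrPdist_le : (us j); exact.
- have -> : lavg (fun r => a r (u j)) n s - lavg (fun r => a r (z s)) n s =
      lavg (fun r => a r (u j - z s)) n s.
    have -> : (fun r => a r (u j - z s)) = (fun r => a r (u j) - a r (z s)).
      by apply/funext => r; rewrite linearB.
    by rewrite lavgB//; exact: ia.
  have iN1 : leb.-integrable setT (EFin \o (fun r => Na r * `|u j - z s|)).
    by have := @integrableZr _ _ _ leb setT _ `|u j - z s| _ iNa; apply.
  apply: (@le_trans _ _ (lavg (fun r => Na r * `|u j - z s|) n s)).
    apply: lavg_norm_le => //.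
    by move=> r; rewrite (le_trans (le_opnorm _ _))// ler_wpM2r//; exact: aNa.
  rewrite lavgZr// distrC.
  apply: (@le_trans _ _ (B * `|z s - u j|)).
    rewrite ler_wpM2r//; near: n.
    by apply: (cvgr_le _ Ns); rewrite /B ltrDl.
  apply: le_trans (ler_wpM2l (ltW B0) (ltW zj)) _.
  by rewrite le_eqVlt; apply/orP; left; apply/eqP; field; rewrite gt_eqF.
Unshelve. all: by end_near. Qed.

(** The window on which the averaging interval ]s - h, s] stays inside [0, t]. *)
Let w n (s : R) : R := if h n <= s then 1 else 0.

(* Young's inequality bounds the averages from below, and Fatou's lemma needs nothing more. *)
Lemma lavg_pairing_limsup (Pn : nat -> R -> R) :
  (forall n, leb.-integrable `[0, t] (EFin \o (fun s => w n s * Pn n s))) ->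
  (forall n, {ae leb, forall s, h n <= s -> s <= t ->
    Pn n s <= - lavg (fun r => a r (z s)) n s}) ->
  (forall n, \int[leb]_(s in `[0, t]) (w n s * Pn n s) <=
     \int[leb]_r k r + \int[leb]_(s in `[0, t]) J s) /\
  forall e, 0 < e -> exists N, forall n, (N <= n)%N ->
    \int[leb]_(s in `[0, t]) (w n s * Pn n s) <= e.
Proof.
move=> iP PnE.
(* Averaging acts on the variable of a alone, so in Young's bound k is averaged and J is not; K n
   tends to K0 and its integral over [0, t] does not exceed that of K0. *)
pose K n s := lavg k n s + J s; pose K0 s := k s + J s.
have ik0t : leb.-integrable `[0, t] (EFin \o k) by apply: integrableS ik.
have ilk n : leb.-integrable `[0, t] (EFin \o lavg k n).
  by apply: integrableS (lavg_integral n ik k0).1.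
have iK n : leb.-integrable `[0, t] (EFin \o K n) by exact: rintegrableD.
have iK0 : leb.-integrable `[0, t] (EFin \o K0) by exact: rintegrableD.
have lk0 n s : 0 <= lavg k n s by rewrite mulr_ge0// Rintegral_ge0.
have PK n : {ae leb, forall s, `[0, t]%classic s -> w n s * Pn n s <= K n s}.
  apply: filterS (PnE n) => s Ps /=; rewrite in_itv/= => /andP[s0 st].
  rewrite /w; case: ifPn => hs; last by rewrite mul0r addr_ge0.
  by rewrite mul1r (le_trans (Ps hs st))// lerNl lavg_ge.
have k0tE : \int[leb]_(s in `[0, t]) k s = \int[leb]_s k s.
  rewrite Rintegral_mkcond; apply: eq_Rintegral => s _; rewrite patchE mem_setE in_itv/=.
  by case: ifPn => // /k_out.
have K0_ge0 s : `[0, t]%classic s -> 0 <= K0 s by move=> _; rewrite addr_ge0.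
have K_cvg : {ae leb, forall s, `[0, t]%classic s -> K n s @[n --> \oo] --> K0 s}.
  by apply: filterS (lavg_cvg ik) => s ks _; apply: cvgD => //; exact: cvg_cst.
have int_K n : \int[leb]_(s in `[0, t]) K n s <= \int[leb]_(s in `[0, t]) K0 s.
  rewrite /K /K0 !RintegralD// lerD2r.
  rewrite k0tE -(lavg_integral n ik k0).2 Rintegral_mkcond.
  have [ilT _] := lavg_integral n ik k0.
  apply: le_Rintegral => //.
    by rewrite -restrict_EFin -integrable_mkcond.
  by move=> s _; rewrite patchE; case: ifP.
have lim : {ae leb, forall s, `[0, t]%classic s -> forall e, 0 < e ->
    \forall n \near \oo, w n s * Pn n s <= e}.
  have PE := ae_foralln PnE.
  apply: filterS2 (filterI PE a_sign) lavg_pairing_cvg => s [Ps as0] cs /=.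
  rewrite in_itv/= => /andP[s0 st] e e0.
  have {}as0 : 0 <= a s (z s) by apply: as0; rewrite s0.
  near=> n; rewrite /w; case: ifPn => hs; last by rewrite mul0r ltW.
  rewrite mul1r (le_trans (Ps n hs st))// lerNl.
  have : a s (z s) - e <= lavg (fun r => a r (z s)) n s.
    by near: n; apply: (cvgr_ge _ cs); rewrite ltrBlDr ltrDl.
  by apply: le_trans; lra.
split.
- move=> n; apply: (@le_trans _ _ (\int[leb]_(s in `[0, t]) K n s)).
    exact: ae_le_Rintegral.
  by rewrite (le_trans (int_K n))// /K0 RintegralD// k0tE.
- move=> e e0; have := @reverse_Fatou _ _ _ leb `[0, t]%classic _ (fun n s => w n s * Pn n s)
    K K0 iP iK iK0 _ K0_ge0 PK K_cvg int_K lim e e0.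
  apply => //; by move=> n s _; rewrite /K addr_ge0.
Unshelve. all: by end_near. Qed.

End left_average_pairing.

(** * Borel and progressive measurability *)

Section Borel_maps.
Context d (Omega : measurableType d) (R : realType).

(** No measurable structure is put on the target; preimages of open sets suffice. *)
Definition Borel_map (E : topologicalType) (f : Omega -> E) :=
  forall B, open B -> measurable (f @^-1` B).

Lemma Borel_map_comp (E E' : topologicalType) (f : Omega -> E) (g : E -> E') :
  continuous g -> Borel_map f -> Borel_map (g \o f).
Proof.
move=> cg bf B oB; rewrite comp_preimage; apply: bf.
by move/continuousP : cg; apply.
Qed.

Lemma Borel_map_measurable (f : Omega -> R) : Borel_map f -> measurable_fun setT f.
Proof.
move=> bf mD; apply: (measurability _ (RGenOInfty.measurableE R)) => //.
move=> _ [_ [x ->] <-].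
by rewrite setTI; apply: bf; exact: interval_open.
Qed.

Lemma measurable_Borel_map (f : Omega -> R) : measurable_fun setT f -> Borel_map f.
Proof.
by move=> mf B oB; rewrite -[X in measurable X]setTI; apply: mf => //; exact: open_measurable.
Qed.

Lemma Borel_map_dist (E : normedModType R) (f : Omega -> E) :
  Borel_map f -> forall c, measurable_fun setT (fun w => `|f w - c|).
Proof.
move=> bf c; apply: Borel_map_measurable.
apply: (@Borel_map_comp _ _ f (fun x => `|x - c|)) => // x.
by apply: cvg_norm; apply: cvgB => //; exact: cvg_cst.
Qed.

Lemma Borel_map_norm (E : normedModType R) (f : Omega -> E) :
  Borel_map f -> measurable_fun setT (fun w => `|f w|).
Proof. by move=> bf; have := Borel_map_dist bf 0; under eq_fun do rewrite subr0. Qed.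

(** In a separable space an open set is a countable union of balls with centres in a dense sequence
    and radii 1 / (m + 1); the preimage of such a ball is a sublevel set of a distance. *)
Lemma dist_Borel_map (E : normedModType R) (f : Omega -> E) : separable E ->
  (forall c, measurable_fun setT (fun w => `|f w - c|)) -> Borel_map f.
Proof.
move=> sE mf B oB; have [u ud] := separable_seq sE.
rewrite (_ : f @^-1` B = \bigcup_n \bigcup_m
    (if `[< ball (u n) (m.+1%:R^-1) `<=` B >] then
      [set w | `|f w - u n| < m.+1%:R^-1] else set0)).
  apply: bigcupT_measurable => n; apply: bigcupT_measurable => m.
  case: ifPn => // _.
  have := mf (u n); move=> /(_ measurableT _ (measurable_itv `]-oo, (m.+1%:R^-1 : R)[)).
  by rewrite setTI; congr measurable; apply/seteqP; split => w /=; rewrite in_itv.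
apply/seteqP; split => [w /= Bw|w /= [n _ [m _]]]; last first.
  case: ifPn => // /asboolP uB /= fw; apply: uB.
  by rewrite -ball_normE /= distrC.
move: oB; rewrite openE => /(_ _ Bw) /nbhs_ballP[r /= r0 rB].
have r2 : 0 < r / 2 by rewrite divr_gt0.
have [m _ mr] := near_infty_natSinv_lt (PosNum r2).
have {}mr := mr m (leqnn m); rewrite /= in mr.
have m0 : 0 < m.+1%:R^-1 :> R by rewrite invr_gt0.
have [n fn] := ud (f w) _ m0.
exists n => //; exists m => //; rewrite asboolT// => y uy; apply: rB.
move: uy; rewrite -!ball_normE /= => uy.
rewrite -(subrK (u n) (f w)) -addrA (le_lt_trans (ler_normD _ _))//.
by rewrite (splitr r) ltrD// (lt_trans _ mr).
Qed.

Lemma separable_prod (E1 E2 : normedModType R) : separable E1 -> separable E2 ->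
  separable (E1 * E2)%type.
Proof.
move=> [D1 cD1 dD1] [D2 cD2 dD2]; exists (D1 `*` D2); first exact: countableX.
move=> B [[x y] Bxy] oB.
move: oB; rewrite openE => /(_ _ Bxy) [[P Q] /= [Px Qy] PQ].
move: Px Qy; rewrite !nbhsE => -[P' [oP' P'x] P'P] [Q' [oQ' Q'y] Q'Q].
have [x' [Px' Dx']] := dD1 P' (ex_intro _ x P'x) oP'.
have [y' [Qy' Dy']] := dD2 Q' (ex_intro _ y Q'y) oQ'.
by exists (x', y'); split => //; apply: PQ; split; [exact: P'P|exact: Q'Q].
Qed.

(** Separability reduces the claim to distances to points, and the distance in the product is the
    maximum of two measurable ones. *)
Lemma Borel_map_pair (E1 E2 : normedModType R) (f : Omega -> E1) (g : Omega -> E2) :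
  separable E1 -> separable E2 -> Borel_map f -> Borel_map g ->
  Borel_map (fun w => (f w, g w)).
Proof.
move=> s1 s2 bf bg; apply: dist_Borel_map; first exact: separable_prod.
move=> [c1 c2]; rewrite (_ : (fun w => _) = fun w => Num.max `|f w - c1| `|g w - c2|)//.
by apply: measurable_maxr; exact: Borel_map_dist.
Qed.

Lemma Borel_map_comp2 (E1 E2 : normedModType R) (E' : topologicalType)
    (f : Omega -> E1) (g : Omega -> E2) (h : E1 * E2 -> E') :
  separable E1 -> separable E2 -> Borel_map f -> Borel_map g -> continuous h ->
  Borel_map (fun w => h (f w, g w)).
Proof.
move=> s1 s2 bf bg ch; exact: (@Borel_map_comp _ _ _ h ch (Borel_map_pair s1 s2 bf bg)).
Qed.

Lemma Borel_map_cst (E : topologicalType) (c : E) : Borel_map (cst c).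
Proof. by move=> B oB; rewrite preimage_cst; case: ifPn. Qed.

Lemma Borel_mapD (E : normedModType R) (f g : Omega -> E) : separable E ->
  Borel_map f -> Borel_map g -> Borel_map (fun w => f w + g w).
Proof.
move=> sE bf bg; apply: (Borel_map_comp2 (h := fun z => z.1 + z.2) sE sE bf bg).
by move=> z; exact: add_continuous.
Qed.

Lemma Borel_mapN (E : normedModType R) (f : Omega -> E) :
  Borel_map f -> Borel_map (fun w => - f w).
Proof. by move=> bf; apply: (@Borel_map_comp _ _ f -%R) => // x; exact: opp_continuous. Qed.

Lemma Borel_mapB (E : normedModType R) (f g : Omega -> E) : separable E ->
  Borel_map f -> Borel_map g -> Borel_map (fun w => f w - g w).
Proof. by move=> sE bf bg; apply: Borel_mapD => //; exact: Borel_mapN. Qed.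

Lemma Borel_map_if (E : topologicalType) (S : set Omega) (f g : Omega -> E) : measurable S ->
  Borel_map f -> Borel_map g -> Borel_map (fun w => if w \in S then f w else g w).
Proof.
move=> mS bf bg B oB.
rewrite (_ : _ @^-1` B = (S `&` f @^-1` B) `|` (~` S `&` g @^-1` B)).
  by apply: measurableU; apply: measurableI; [|exact: bf|exact: measurableC|exact: bg].
apply/seteqP; split => w /=.
  by case: (boolP (w \in S)) => [/set_mem Sw|/negP wS] ?; [left|right; split => // /mem_set].
by move=> [[Sw]|[Sw]]; [rewrite mem_set|rewrite memNset].
Qed.

Lemma separable_dense_image (E E' : normedModType R) (f : E -> E') : separable E ->
  continuous f -> dense (range f) -> separable E'.
Proof.
move=> [D cD dD] cf df; exists (f @` D); first exact: (card_le_trans (card_image_le _ _)).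
move=> B B0 oB; have [y0 [By0 [x _ fx]]] := df B B0 oB.
have of1 : open (f @^-1` B) by move/continuousP : cf; apply.
have Bx : B (f x) by rewrite fx.
have [y [fy Dy]] := dD (f @^-1` B) (ex_intro _ x Bx) of1.
by exists (f y); split => //; exists y.
Qed.

Local Notation RT := (measurableTypeR R).

Lemma Caratheodory_process (X : Omega -> R -> R) :
  (forall w, continuous (X w)) -> (forall s, measurable_fun setT (X ^~ s)) ->
  measurable_fun setT (fun z : Omega * RT => X z.1 z.2).
Proof.
move=> cX mX.
(* Time rounded down to the grid of mesh 1 / (n + 1); the rounded process is constant in time on
   each of countably many cells, and continuity gives its limit. *)
pose a n (s : R) : R := (Num.floor (n.+1%:R * s))%:~R / n.+1%:R.
have a_cvg s : a n s @[n --> \oo] --> s.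
  apply/cvgrPdist_le => e e0; have [m _ mr] := near_infty_natSinv_lt (PosNum e0).
  exists m => // n /mr /= /ltW; apply: le_trans; rewrite /a.
  have n0 : 0 < n.+1%:R :> R by [].
  have := floor_itv (n.+1%:R * s); move: (Num.floor _) => k /andP[k1 k2].
  rewrite intrD in k2.
  have y1 : k%:~R / n.+1%:R <= s by rewrite ler_pdivrMr// mulrC.
  have y2 : s < k%:~R / n.+1%:R + n.+1%:R^-1.
    by rewrite -{2}[n.+1%:R^-1]mul1r -mulrDl ltr_pdivlMr// mulrC.
  rewrite ger0_norm; last by rewrite subr_ge0.
  by rewrite lerBlDl ltW.
apply: (@measurable_fun_cvg _ _ _ _ (fun n z => X z.1 (a n z.2))) => [n|[w s] _]; last first.
  exact: (cvg_comp _ _ (a_cvg s) (cX w s)).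
move=> _ B mB; rewrite setTI.
rewrite (_ : _ @^-1` B = \bigcup_j (if unpickle j is Some k then
    ((X ^~ (k%:~R / n.+1%:R)) @^-1` B) `*`
      `[(k%:~R / n.+1%:R), ((k + 1)%:~R / n.+1%:R)[%classic else set0)).
  apply: bigcupT_measurable => j; case: unpickle => // k.
  apply: measurableX => //.
  by rewrite -[X in measurable X]setTI; apply: mX.
have n0 : 0 < n.+1%:R :> R by [].
apply/seteqP; split => [[w s] /= Bw|[w s] /= [j _]]; last first.
  case: unpickle => // k [/= Bk]; rewrite in_itv/= ler_pdivrMr// ltr_pdivlMr// => ks.
  by rewrite /a (_ : Num.floor _ = k)//; apply/eqP; rewrite floor_eq mulrC.
exists (pickle (Num.floor (n.+1%:R * s))); first exact: I.
rewrite pickleK; split; first exact: Bw.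
rewrite /= in_itv/= ler_pdivrMr// ltr_pdivlMr// mulrC.
exact: floor_itv.
Qed.

Lemma Borel_process (E : normedModType R) (X : Omega -> R -> E) : separable E ->
  (forall w, continuous (X w)) -> (forall s, Borel_map (X ^~ s)) ->
  forall c, measurable_fun setT (fun z : Omega * RT => `|X z.1 z.2 - c|).
Proof.
move=> sE cX bX c; apply: (@Caratheodory_process (fun w s => `|X w s - c|)).
  by move=> w s; apply: cvg_norm; apply: cvgB; [exact: cX|exact: cvg_cst].
by move=> s; exact: Borel_map_dist.
Qed.

End Borel_maps.

Section progressive_measurability.
Context d (Omega : measurableType d) (R : realType) (T : R) (F : R -> set (set Omega)).
Hypothesis T0 : 0 < T.
Hypothesis Fsig : forall t : R, 0 <= t <= T -> sigma_algebra setT (F t) /\ F t `<=` measurable.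
Local Notation RT := (measurableTypeR R).
Local Notation TD := (time_domain T).

Let TT : 0 <= T <= T. Proof. by rewrite (ltW T0) lexx. Qed.

Lemma measurable_time_domain (t : R) : measurable (time_domain t : set (Omega * RT)).
Proof. by apply: measurableX => //; exact: measurable_itv. Qed.

Lemma progressive_sets_measurable A : progressive_sets T F A ->
  measurable (A : set (Omega * RT)).
Proof.
move=> [AT /(_ T TT)]; rewrite setIidl//.
apply: smallest_sub; first exact: sigma_algebra_measurable.
move=> _ [B FB [C mC <-]]; apply: measurableX => //.
exact: (Fsig TT).2.
Qed.

(** The sets whose section at time t belongs to F t form a sigma-algebra containing the generating
    rectangles. *)
Lemma progressive_section (E : topologicalType) (phi : Omega -> R -> E) (t : R) :
  0 <= t <= T -> progressive T F phi ->
  forall B, borel B -> F t ((phi ^~ t) @^-1` B).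
Proof.
move=> tT phiP B bB; have [_ /(_ t tT)] := phiP B bB.
have [sF _] := Fsig tT.
set A := (X in <<s _ >> X); move=> mA.
have -> : (phi ^~ t) @^-1` B = [set w | A (w, t)].
  apply/seteqP; split => w /=; rewrite /A /time_domain /= ?in_itv/=.
    by move=> Bw; do !split => //; case/andP : tT => ? ?; apply/andP; split.
  by move=> [[_ ?] _].
move: A mA; apply: smallest_sub.
  split.
  - by case: sF.
  - move=> A mA /=; rewrite (_ : [set w | _] = setT `\` [set w | A (w, t)]).
      by case: sF => _ + _; exact.
    by apply/seteqP; split => w /= [].
  - move=> A mA /=; rewrite (_ : [set w | _] = \bigcup_k [set w | A k (w, t)]).
      by case: sF => _ _; exact.
    by apply/seteqP; split => w.
move=> _ [B' FB [C mC <-]] /=.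
case: (pselect (C t)) => Ct.
  by rewrite (_ : [set w | _] = B')//; apply/seteqP; split => w //= [].
rewrite (_ : [set w | _] = set0); first by case: sF.
by apply/seteqP; split => w //= [].
Qed.

(** Progressive measurability concerns times in [0, T] only; extending by 0 gives Borel maps on the
    whole product, to which Fubini and the calculus above apply. *)
Definition time_ext (E : zmodType) (phi : Omega -> R -> E) (z : Omega * RT) : E :=
  if z \in TD then phi z.1 z.2 else 0.

Definition Borel_on (D : set (Omega * RT)) (E : topologicalType) (f : Omega * RT -> E) :=
  forall B, open B -> measurable (D `&` f @^-1` B).

Lemma Borel_on_ext (E : normedModType R) (f : Omega -> R -> E) :
  Borel_on TD (fun z => f z.1 z.2) -> Borel_map (time_ext f).
Proof.
move=> bf B oB; rewrite (_ : _ @^-1` B = (TD `&` (fun z => f z.1 z.2) @^-1` B) `|`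
    (~` TD `&` (cst (0 : E)) @^-1` B)).
  apply: measurableU; first exact: bf.
  apply: measurableI; first by apply: measurableC; exact: measurable_time_domain.
  by rewrite preimage_cst; case: ifPn.
apply/seteqP; split => z /=; rewrite /time_ext.
  by case: (boolP (z \in TD)) => [/set_mem Sw|/negP wS] ?; [left|right; split => // /mem_set].
by move=> [[Sw]|[Sw]]; [rewrite mem_set|rewrite memNset].
Qed.

Lemma progressive_Borel (E : normedModType R) (phi : Omega -> R -> E) :
  progressive T F phi -> Borel_map (time_ext phi).
Proof.
move=> phiP; apply: Borel_on_ext => B oB.
by apply: progressive_sets_measurable; apply: phiP; exact: sub_sigma_algebra.
Qed.

Lemma Borel_borel d' (Y : measurableType d') (E : topologicalType) (f : Y -> E) (D : set Y) :
  measurable D -> (forall B, open B -> measurable (D `&` f @^-1` B)) ->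
  forall B, borel B -> measurable (D `&` f @^-1` B).
Proof.
move=> mD bf B; move: B; apply: smallest_sub => //; split.
- by rewrite preimage_set0 setI0.
- move=> A mA; rewrite setTD preimage_setC -setDE.
  rewrite (_ : D `\` _ = D `\` (D `&` f @^-1` A)); first exact: measurableD.
  by rewrite setDIr setDv set0U.
- move=> A mA; rewrite preimage_bigcup setI_bigcupr.
  exact: bigcupT_measurable.
Qed.

(** Pull back along z -> (z, u z): generating rectangles have measurable preimages within the time
    domain, and the property passes to the generated sigma-algebra. *)
Lemma progressive_operator_comp (E E' : normedModType R) (B : Omega -> R -> E -> E')
    (u : Omega -> R -> E) :
  progressive_operator T F B -> Borel_map (time_ext u) ->
  Borel_map (time_ext (fun w t => B w t (u w t))).
Proof.
move=> BP bu; apply: Borel_on_ext => C oC.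
have := BP C (sub_sigma_algebra oC); set S := (X in <<s _, _ >> X) => mS.
rewrite (_ : _ `&` _ = TD `&` [set z | S (z, u z.1 z.2)]); last first.
  apply/seteqP; split => z [Tz Cz]; split => //; by case: Cz.
move: S mS; apply: smallest_sub.
  split.
  - by rewrite (_ : _ `&` _ = set0)//; apply/seteqP; split => z //= -[].
  - move=> A mA /=; rewrite (_ : _ `&` _ = TD `\` (TD `&` [set z | A (z, u z.1 z.2)])).
      by apply: measurableD => //; exact: measurable_time_domain.
    apply/seteqP; split => z /=; first by move=> [Tz [_ nA]]; split => // -[].
    by move=> [Tz nA]; split => //; split; [split|move=> ?; apply: nA].
  - move=> A mA; rewrite (_ : _ `&` _ = \bigcup_k (TD `&` [set z | A k (z, u z.1 z.2)])).
      exact: bigcupT_measurable.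
    apply/seteqP; split => z /=; first by move=> [Tz [k _ Ak]]; exists k.
    by move=> [k _ [Tz Ak]]; split => //; exists k.
move=> _ [A pA [C' bC' <-]] /=.
rewrite (_ : _ `&` _ = A `&` (TD `&` (time_ext u) @^-1` C')).
  apply: measurableI; first exact: progressive_sets_measurable.
  apply: (Borel_borel (f := time_ext u)) => //; first exact: measurable_time_domain.
  by move=> O oO; apply: measurableI; [exact: measurable_time_domain|exact: bu].
have [AT _] := pA.
apply/seteqP; split => z /=.
  by move=> [Tz [Az Cz]]; split => //; split => //; rewrite /time_ext mem_set.
by move=> [Az [Tz]]; rewrite /time_ext mem_set.
Qed.

Lemma time_ext_xsection (E : normedModType R) (phi : Omega -> R -> E) w :
  Borel_map (time_ext phi) -> Borel_map (fun r : RT => time_ext phi (w, r)).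
Proof.
move=> bphi B oB; have := measurable_xsection w (bphi B oB).
congr measurable; apply/seteqP; split => r /=.
  by rewrite /xsection /= => /set_mem.
by move=> Br; rewrite /xsection /=; apply/mem_set.
Qed.

End progressive_measurability.

Import HBNNSimple.

(** * Brownian increments *)

Section integral_from_sets.
Context d (X : measurableType d) (R : realType) (mu : {measure set X -> \bar R}).
Context d' (Y : measurableType d') (pi : X -> Y) (g : X -> R).
Hypotheses (mpi : measurable_fun setT pi) (mg : measurable_fun setT g) (g0 : forall x, 0 <= g x).

Lemma integral_nnsfun_comp (h : {nnsfun Y >-> R}) :
  (\int[mu]_x (h (pi x) * g x)%:E =
   \sum_(y \in range h) (y%:E * \int[mu]_x (\1_(h @^-1` [set y]) (pi x) * g x)%:E))%E.
Proof.
transitivity (\int[mu]_x (\sum_(y \in range h)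
   (fun y x => (y * (\1_(h @^-1` [set y]) (pi x) * g x))%:E) y x))%E.
  apply: eq_integral => x _; rewrite fsumEFin//.
  rewrite [in LHS](fimfunE h) !fsbig_finite//= mulr_suml.
  by congr (_%:E); apply: eq_bigr => y _; rewrite mulrA.
have mi y : measurable_fun setT (fun x => \1_(h @^-1` [set y]) (pi x) * g x).
  apply: measurable_funM => //; apply: measurableT_comp => //.
have i0 y x : 0 <= \1_(h @^-1` [set y]) (pi x) * g x by rewrite mulr_ge0.
rewrite ge0_integral_fsum//.
- apply: eq_fsbigr => y /set_mem [z _ <-]; exact: ge0_integral_scale.
- by move=> y; apply/measurable_EFinP; apply: measurable_funM.
- move=> y x _; have [[z _ <-]|yh] := pselect (range h y).
    by rewrite lee_fin mulr_ge0.
  rewrite (_ : \1_(h @^-1` [set y]) (pi x) = 0) ?mul0r ?mulr0//.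
  rewrite indicE memNset// => hx; apply: yh; exists (pi x) => //.
Qed.

End integral_from_sets.

Section integral_machine.
Context d1 (X1 : measurableType d1) d2 (X2 : measurableType d2) (R : realType).
Variables (mu1 : {measure set X1 -> \bar R}) (mu2 : {measure set X2 -> \bar R}).
Context d' (Y : measurableType d') (pi1 : X1 -> Y) (pi2 : X2 -> Y) (g1 : X1 -> R) (g2 : X2 -> R).
Hypotheses (mpi1 : measurable_fun setT pi1) (mg1 : measurable_fun setT g1) (g10 : forall x, 0 <= g1 x).
Hypotheses (mpi2 : measurable_fun setT pi2) (mg2 : measurable_fun setT g2) (g20 : forall x, 0 <= g2 x).
Hypothesis le_sets : forall B : set Y, measurable B ->
  (\int[mu1]_x (\1_B (pi1 x) * g1 x)%:E <= \int[mu2]_x (\1_B (pi2 x) * g2 x)%:E)%E.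

(** Monotone convergence along simple functions. The common space Y allows the two integrals to live
    on different spaces; the lemma serves for the law of Brownian increments, for their independence
    of the past and for (G2) with weights. *)
Lemma le_integral_sets (f : Y -> R) : measurable_fun setT f -> (forall y, 0 <= f y) ->
  (\int[mu1]_x (f (pi1 x) * g1 x)%:E <= \int[mu2]_x (f (pi2 x) * g2 x)%:E)%E.
Proof.
move=> mf f0; have mF : measurable_fun setT (EFin \o f) by exact/measurable_EFinP.
have F0 y : setT y -> (0 <= (EFin \o f) y)%E by move=> _; rewrite lee_fin.
pose h := nnsfun_approx measurableT mF.
have h_cvg y : h n y @[n --> \oo] --> f y.
  have := cvg_nnsfun_approx measurableT mF F0 (x := y) I.
  by move=> /fine_cvgP[_].
have h_nd y : {homo (fun n => h n y) : m n / (m <= n)%N >-> m <= n}.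
  move=> m n mn; have := nd_nnsfun_approx measurableT mF mn.
  by move/lefP; exact.
have cv d (X : measurableType d) (mu : {measure set X -> \bar R}) (pi : X -> Y) (g : X -> R) :
   measurable_fun setT pi -> measurable_fun setT g -> (forall x, 0 <= g x) ->
   (\int[mu]_x (h n (pi x) * g x)%:E @[n --> \oo] --> \int[mu]_x (f (pi x) * g x)%:E)%E.
  move=> mpi mg g0.
  have := @cvg_monotone_convergence _ _ _ mu setT measurableT
    (fun n x => (h n (pi x) * g x)%:E) _ _ _.
  have -> : (fun x => limn ((fun n x => (h n (pi x) * g x)%:E)^~ x)) =
     (fun x => (f (pi x) * g x)%:E).
    apply/funext => x; apply/cvg_lim => //; apply: cvg_EFin; first exact: nearW.
    rewrite /=.
    by apply: (@cvgMl R _ \oo _ (fun n => h n (pi x))); exact: h_cvg.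
  apply.
  - move=> n; apply/measurable_EFinP/measurable_funM => //.
    by apply: measurableT_comp.
  - by move=> n x _; rewrite lee_fin mulr_ge0.
  - by move=> x _ m n mn; rewrite lee_fin ler_wpM2r// h_nd.
have c1 := cv _ _ mu1 pi1 g1 mpi1 mg1 g10; have c2 := cv _ _ mu2 pi2 g2 mpi2 mg2 g20.
rewrite -(cvg_lim _ c1)// -(cvg_lim _ c2)//.
apply: lee_lim; [exact: cvgP c1|exact: cvgP c2|].
apply: nearW => n; rewrite !integral_nnsfun_comp//.
apply: lee_fsum => //.
move=> _ [y _ <-]; apply: lee_wpmul2l; first by rewrite lee_fin.
apply: le_sets; exact: measurable_funPTI.
Qed.


End integral_machine.

(** * Moments of the normal law *)

Section normal_moments.
Context (R : realType).
Local Notation leb := (@lebesgue_measure R).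

Lemma integral_normal_prob (m s : R) (f : R -> R) :
  measurable_fun setT f -> (forall x, 0 <= f x) ->
  (\int[normal_prob m s]_x (f x)%:E = \int[leb]_x (f x * normal_pdf m s x)%:E)%E.
Proof.
move=> mf f0.
have e (B : set R) : measurable B -> (\int[normal_prob m s]_x (\1_B x * cst 1 x)%:E =
    \int[leb]_x (\1_B x * normal_pdf m s x)%:E)%E.
  move=> mB; under eq_integral do rewrite mulr1.
  rewrite integral_indic// setIT /normal_prob [LHS]integral_mkcond.
  apply: eq_integral => x _; rewrite patchE indicE.
  by case: ifPn => _; rewrite ?mul1r ?mul0r.
have p0 := @normal_pdf_ge0 R m s; have mp := @measurable_normal_pdf R m s.
have n1 : forall x : R, 0 <= cst (1 : R) x by move=> x; exact: ler01.
transitivity (\int[normal_prob m s]_x (f x * cst 1 x)%:E)%E.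
  by apply: eq_integral => x _; rewrite mulr1.
apply/le_anti/andP; split.
- apply: (@le_integral_sets _ _ _ _ _ (normal_prob m s) leb _ _ id id) => // B mB.
  by rewrite e.
- apply: (@le_integral_sets _ _ _ _ _ leb (normal_prob m s) _ _ id id) => // B mB.
  by rewrite e.
Qed.

(** Comparison with the normal density of variance 2: for y = x^2 / 4 one has x^4 = 64 (y / 2)^2 <=
    64 exp(y), because y / 2 <= exp(y / 2). *)
Lemma normal_moment4_lty : (\int[normal_prob (0 : R) 1]_x (x ^+ 4)%:E < +oo)%E.
Proof.
rewrite integral_normal_prob//; last first.
  by move=> x; rewrite (_ : x ^+ 4 = (x ^+ 2) ^+ 2) ?sqr_ge0//; ring.
pose c : R := 64 * normal_peak 1 / normal_peak (Num.sqrt 2).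
apply: (@le_lt_trans _ _ (\int[leb]_x (c * normal_pdf 0 (Num.sqrt 2) x)%:E)%E).
  have s2 : (Num.sqrt 2 : R) != 0 by rewrite gt_eqF// sqrtr_gt0.
  apply: ge0_le_integral => //.
  - move=> x _; rewrite lee_fin mulr_ge0 ?normal_pdf_ge0//.
    by rewrite (_ : x ^+ 4 = (x ^+ 2) ^+ 2) ?sqr_ge0//; ring.
  - apply/measurable_EFinP/measurable_funM; last exact: measurable_normal_pdf.
    exact: exprn_measurable.
  - apply/measurable_EFinP/measurable_funM => //; exact: measurable_normal_pdf.
  - move=> x _; rewrite lee_fin !normal_pdfE ?oner_neq0// /c /normal_fun !subr0.
    rewrite sqr_sqrtr//.
    have -> : 64 * normal_peak 1 / normal_peak (Num.sqrt 2) *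
      (normal_peak (Num.sqrt 2) * expR (- x ^+ 2 / (2 *+ 2))) =
      64 * expR (- x ^+ 2 / 4) * normal_peak (1 : R).
      rewrite (_ : (2 : R) *+ 2 = 4); last by rewrite -mulr_natr; ring.
      by field; rewrite gt_eqF// normal_peak_gt0.
    rewrite [normal_peak 1 * _]mulrC mulrA ler_wpM2r ?normal_peak_ge0//.
    have -> : - x ^+ 2 / (1 ^+ 2 *+ 2) = (- x ^+ 2 / 4) + (- x ^+ 2 / 4).
      by rewrite (_ : (1 : R) ^+ 2 *+ 2 = 2); [field|rewrite expr1n].
    rewrite expRD mulrA ler_wpM2r ?expR_ge0//.
    have -> : x ^+ 4 = 16 * (x ^+ 2 / 4) ^+ 2 by field.
    have -> : expR (- x ^+ 2 / 4) = (expR (x ^+ 2 / 4 / 2) ^+ 2)^-1.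
      by rewrite -expRM_natl -expRN; congr expR; field.
    set y := x ^+ 2 / 4; have y0 : 0 <= y by rewrite divr_ge0// sqr_ge0.
    rewrite ler_pdivrMr ?exprn_gt0 ?expR_gt0//.
    rewrite (_ : 16 * y ^+ 2 = 64 * (y / 2) ^+ 2); last by field.
    rewrite ler_pM2l// lerXn2r ?nnegrE ?expR_ge0 ?divr_ge0 ?sqr_ge0//.
    by apply: le_trans (expR_ge1Dx _); rewrite lerDr.
rewrite (_ : (\int[leb]_x _)%E = c%:E) ?ltry//; rewrite -[RHS]mule1 -(integral_normal_pdf (0 : R) (Num.sqrt 2)) -ge0_integralZl_EFin//.
- by move=> x _; rewrite lee_fin normal_pdf_ge0.
- by apply/measurable_EFinP; exact: measurable_normal_pdf.
- by rewrite /c divr_ge0 ?mulr_ge0 ?normal_peak_ge0.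
Qed.

End normal_moments.

Section square_integrable.
Context d (Omega : measurableType d) (R : realType) (P : probability Omega R).

Definition sq_integrable (f : Omega -> R) :=
  measurable_fun setT f /\ P.-integrable setT (EFin \o (fun w => f w ^+ 2)).

Lemma sq_integrable_mul f g : sq_integrable f -> sq_integrable g ->
  P.-integrable setT (EFin \o (fun w => f w * g w)).
Proof.
move=> [mf iff] [mg ig].
apply: (rintegrable_le measurableT _ (rintegrableD measurableT iff ig)) => [|w _ /=].
  exact: measurable_funM.
rewrite normrM -(real_normK (num_real (f w))) -(real_normK (num_real (g w))).
have := sqr_ge0 (`|f w| - `|g w|); nra.
Qed.

Lemma sq_integrable_bounded_mul (c : R) (f g : Omega -> R) : measurable_fun setT f -> (forall w, `|f w| <= c) ->
  sq_integrable g -> sq_integrable (fun w => f w * g w).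
Proof.
move=> mf fc [mg ig]; split; first exact: measurable_funM.
apply: (rintegrable_le measurableT _ (rintegrableZ measurableT (c ^+ 2) ig)) => [|w _ /=].
  by apply: measurable_funX; exact: measurable_funM.
rewrite ger0_norm ?sqr_ge0// exprMn ler_wpM2r ?sqr_ge0//.
by rewrite -(real_normK (num_real (f w))) lerXn2r ?nnegrE// (le_trans _ (fc w)).
Qed.

Lemma sq_integrableD f g : sq_integrable f -> sq_integrable g ->
  sq_integrable (fun w => f w + g w).
Proof.
move=> [mf iff] [mg ig]; split; first exact: measurable_funD.
apply: (rintegrable_le measurableT _ (rintegrableD measurableT
  (rintegrableZ measurableT 2 iff) (rintegrableZ measurableT 2 ig))) => [|w _ /=].
  by apply: measurable_funX; exact: measurable_funD.
rewrite ger0_norm ?sqr_ge0//; have := sqr_ge0 (f w - g w); nra.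
Qed.

Lemma sq_integrableZ c f : sq_integrable f -> sq_integrable (fun w => c * f w).
Proof.
move=> h; apply: (sq_integrable_bounded_mul (c := `|c|)) => //.
Qed.

Lemma sq_integrable_cst c : sq_integrable (cst c).
Proof.
split => //; apply: (rintegrable_cst measurableT (c ^+ 2)).
apply: le_lt_trans (probability_le1 P measurableT) _; exact: ltry.
Qed.

Lemma sq_integrable_integrable f : sq_integrable f -> P.-integrable setT (EFin \o f).
Proof.
move=> sf; have := sq_integrable_mul sf (sq_integrable_cst 1).
by under eq_fun do rewrite mulr1.
Qed.

Lemma sq_integrable_bounded (c : R) (f : Omega -> R) : measurable_fun setT f -> (forall w, `|f w| <= c) ->
  sq_integrable f.
Proof.
move=> mf fc; have := sq_integrable_bounded_mul mf fc (sq_integrable_cst 1).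
by under eq_fun do rewrite mulr1.
Qed.

Lemma sq_integrable_lty (f : Omega -> R) : measurable_fun setT f -> (\int[P]_w (f w ^+ 2)%:E < +oo)%E ->
  sq_integrable f.
Proof.
move=> mf foo; split => //; apply/integrableP; split.
  by apply/measurable_EFinP; exact: measurable_funX.
by under eq_integral do rewrite /= ger0_norm ?sqr_ge0//.
Qed.

End square_integrable.

(** * Law, independence and covariance of the increments *)

Section Brownian_increments.
Context d (Omega : measurableType d) (R : realType) (P : probability Omega R).
Context (T : R) (Ft : R -> set (set Omega)) (Ft_filtration : complete_filtration P T Ft).
Context (U : hilbertType R) (W : R -> U -> Omega -> R) (W_Wiener : cylindrical_Wiener P T Ft W).
Local Notation B := (increment W).

(** Reading F_s as the sigma-algebra of a measurable type makes every fact on [Borel_map] available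
    for adapted maps. *)
Definition adapted_at (s : R) (E : topologicalType) (f : Omega -> E) :=
  @Borel_map _ (g_sigma_algebraType (Ft s)) E f.

Lemma filtration_sigma s (A : set Omega) : 0 <= s <= T ->
  measurable (A : set (g_sigma_algebraType (Ft s))) <-> Ft s A.
Proof.
case: Ft_filtration => _ sF _ _ /sF[sA _]; split; last exact: sub_sigma_algebra.
by apply: smallest_sub.
Qed.

Lemma filtration_measurable s (A : set Omega) : 0 <= s <= T -> Ft s A -> measurable A.
Proof. by case: Ft_filtration => _ sF _ _ /sF[_]; apply. Qed.

Lemma adapted_at_Borel s (E : topologicalType) (f : Omega -> E) : 0 <= s <= T ->
  adapted_at s f -> Borel_map f.
Proof.
move=> sT bf A oA; apply: (filtration_measurable sT).
by apply/(filtration_sigma _ sT); exact: bf.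
Qed.

Lemma adapted_at_le s t (E : topologicalType) (f : Omega -> E) : 0 <= s -> s <= t -> t <= T ->
  adapted_at s f -> adapted_at t f.
Proof.
move=> s0 st tT bf A oA; have tT' : 0 <= t <= T by rewrite tT (le_trans s0).
have sT' : 0 <= s <= T by rewrite s0 (le_trans st).
apply/(filtration_sigma _ tT'); case: Ft_filtration => _ _ /(_ s t s0 st tT) Fst _.
by apply: Fst; apply/(filtration_sigma _ sT'); exact: bf.
Qed.

Lemma adapted_measurable s (f : Omega -> R) : adapted_at s f ->
  @measurable_fun _ _ (g_sigma_algebraType (Ft s)) R setT f.
Proof. exact: Borel_map_measurable. Qed.

Lemma measurable_adapted s (f : Omega -> R) :
  @measurable_fun _ _ (g_sigma_algebraType (Ft s)) R setT f -> adapted_at s f.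
Proof. exact: measurable_Borel_map. Qed.

Lemma adapted_indic s (A : set Omega) : 0 <= s <= T -> Ft s A -> adapted_at s (\1_A : Omega -> R).
Proof.
move=> sT FA; apply: measurable_adapted.
by apply: (@measurable_indic _ (g_sigma_algebraType (Ft s))); apply/(filtration_sigma _ sT).
Qed.

Lemma adaptedM s (f g : Omega -> R) : adapted_at s f -> adapted_at s g ->
  adapted_at s (fun w => f w * g w).
Proof.
move=> /adapted_measurable mf /adapted_measurable mg; apply: measurable_adapted.
exact: measurable_funM.
Qed.

Lemma Wiener_adapted_at t g : 0 <= t <= T -> adapted_at t (W t g).
Proof.
move=> tT A oA; apply/(filtration_sigma _ tT); apply: (Wiener_adapted W_Wiener) => //.
exact: open_measurable.
Qed.

Lemma increment_adapted s t g : 0 <= s -> s <= t -> t <= T -> adapted_at t (B s t g).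
Proof.
move=> s0 st tT; have tT' : 0 <= t <= T by rewrite tT (le_trans s0).
have sT' : 0 <= s <= T by rewrite s0 (le_trans st).
apply: measurable_adapted; apply: measurable_funB; apply: adapted_measurable.
  exact: Wiener_adapted_at.
by apply: adapted_at_le (Wiener_adapted_at g sT').
Qed.

Lemma increment_measurable s t g : 0 <= s -> s <= t -> t <= T -> measurable_fun setT (B s t g).
Proof.
move=> s0 st tT; apply: Borel_map_measurable.
apply: (@adapted_at_Borel t); first by rewrite tT (le_trans s0).
exact: increment_adapted.
Qed.

Lemma increment_linear s t a g h : 0 <= s -> s <= t -> t <= T ->
  {ae P, forall w, B s t (a *: g + h) w = a * B s t g w + B s t h w}.
Proof.
move=> s0 st tT; have tT' : 0 <= t <= T by rewrite tT (le_trans s0).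
have sT' : 0 <= s <= T by rewrite s0 (le_trans st).
have lt := Wiener_linear W_Wiener a g h tT'; have ls := Wiener_linear W_Wiener a g h sT'.
by apply: filterS2 lt ls => w; rewrite /increment => -> ->; ring.
Qed.

Lemma increment0 s t : 0 <= s -> s <= t -> t <= T -> {ae P, forall w, B s t 0 w = 0}.
Proof.
move=> s0 st tT; have := increment_linear 1 0 0 s0 st tT.
apply: filterS => w; rewrite scaler0 addr0 mul1r => /eqP.
by rewrite -subr_eq0 opprD addrA subrr sub0r oppr_eq0 => /eqP.
Qed.

Lemma incrementZ s t a g : 0 <= s -> s <= t -> t <= T ->
  {ae P, forall w, B s t (a *: g) w = a * B s t g w}.
Proof.
move=> s0 st tT; have l := increment_linear a g 0 s0 st tT; have z := increment0 s0 st tT.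
by apply: filterS2 l z => w; rewrite addr0 => -> ->; rewrite addr0.
Qed.

Lemma increment_law s t g (f : R -> R) : 0 <= s -> s < t -> t <= T -> g != 0 ->
  measurable_fun setT f -> (forall x, 0 <= f x) ->
  (\int[P]_w (f (B s t g w))%:E =
   \int[normal_prob 0 (Num.sqrt (t - s) * `|g|)]_x (f x)%:E)%E.
Proof.
move=> s0 st tT g0 mf f0; have mB := increment_measurable g s0 (ltW st) tT.
set N := normal_prob _ _.
have e (C : set R) : measurable C -> (\int[P]_w (\1_C (B s t g w) * cst 1 w)%:E =
    \int[N]_x (\1_C x * cst 1 x)%:E)%E.
  move=> mC; under eq_integral do rewrite mulr1.
  under [RHS]eq_integral do rewrite mulr1.
  rewrite [RHS]integral_indic// setIT.
  rewrite -[RHS](Wiener_normal W_Wiener s0 st tT g0 mC).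
  rewrite -[in RHS](setIT (B s t g @^-1` C)) -integral_indic//.
  by rewrite -[X in measurable X]setTI; exact: mB.
transitivity (\int[P]_w (f (B s t g w) * cst 1 w)%:E)%E.
  by apply: eq_integral => x _; rewrite mulr1.
transitivity (\int[N]_x (f x * cst 1 x)%:E)%E; last first.
  by apply: eq_integral => x _; rewrite mulr1.
have n1 X : forall x : X, 0 <= cst (1 : R) x by move=> x; exact: ler01.
apply/le_anti/andP; split.
- by apply: (@le_integral_sets _ _ _ _ _ P N _ _ _ id) => // C mC; rewrite e.
- by apply: (@le_integral_sets _ _ _ _ _ N P _ _ id) => // C mC; rewrite e.
Qed.

Lemma increment_independent_event s t g A (f : R -> R) : 0 <= s -> s < t -> t <= T ->
  Ft s A -> measurable_fun setT f -> (forall x, 0 <= f x) ->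
  (\int[P]_w (f (B s t g w) * \1_A w)%:E = \int[P]_w (f (B s t g w) * fine (P A))%:E)%E.
Proof.
move=> s0 st tT FA mf f0; have mB := increment_measurable g s0 (ltW st) tT.
have mA : measurable A.
  by apply: filtration_measurable FA; rewrite s0 (le_trans (ltW st)).
have mBC C : measurable C -> measurable (B s t g @^-1` C).
  by move=> mC; rewrite -[X in measurable X]setTI; exact: mB.
have e (C : set R) : measurable C -> (\int[P]_w (\1_C (B s t g w) * \1_A w)%:E =
    \int[P]_w (\1_C (B s t g w) * cst (fine (P A)) w)%:E)%E.
  move=> mC; transitivity (\int[P]_w (\1_(A `&` B s t g @^-1` C) w)%:E)%E.
    apply: eq_integral => w _; rewrite setIC indicI//.
  rewrite integral_indic ?setIT//; last by apply: measurableI => //; exact: mBC.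
  transitivity (P A * P (B s t g @^-1` C))%E.
    exact: (Wiener_independent W_Wiener g s0 st tT FA mC).
  under eq_integral do rewrite mulrC.
  rewrite ge0_integral_scale ?fine_ge0//; last first.
    by apply: measurableT_comp mB; exact: measurable_indic.
  rewrite fineK ?fin_num_measure//; congr (_ * _)%E.
  by rewrite -[in LHS](setIT (_ @^-1` _)) -integral_indic//; exact: mBC.
have m1 : measurable_fun setT (\1_A : Omega -> R) by exact: measurable_indic.
have mf1 : forall x : Omega, 0 <= cst (fine (P A)) x.
  by move=> x; apply: fine_ge0.
apply/le_anti/andP; split.
- apply: (@le_integral_sets _ _ _ _ _ P P _ _ _ _ (\1_A) (cst (fine (P A)))) => // C mC.
  by rewrite e.
- apply: (@le_integral_sets _ _ _ _ _ P P _ _ _ _ (cst (fine (P A))) (\1_A)) => // C mC.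
  by rewrite e.
Qed.

Lemma increment_independent s t g (zeta : Omega -> R) (f : R -> R) :
  0 <= s -> s < t -> t <= T -> adapted_at s zeta -> (forall w, 0 <= zeta w) ->
  measurable_fun setT f -> (forall x, 0 <= f x) -> (\int[P]_w (f (B s t g w))%:E < +oo)%E ->
  (\int[P]_w (zeta w * f (B s t g w))%:E =
   \int[P]_w (zeta w)%:E * \int[P]_w (f (B s t g w))%:E)%E.
Proof.
move=> s0 st tT az z0 mf f0 foo; have mB := increment_measurable g s0 (ltW st) tT.
have sT' : 0 <= s <= T by rewrite s0 (le_trans (ltW st)).
have mfB : measurable_fun setT (fun w => f (B s t g w)) by exact: measurableT_comp.
set I := (\int[P]_w (f (B s t g w))%:E)%E.
have I0 : (0 <= I)%E by apply: integral_ge0 => w _; rewrite lee_fin.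
have [c c0 If] : exists2 c, 0 <= c & I = c%:E.
  by exists (fine I); [exact: fine_ge0|rewrite fineK// ge0_fin_numE].
(* The identity seen as a map into the coarser space: the sets to be tested in [le_integral_sets]
   are then exactly the events of F_s. *)
have mid : measurable_fun setT (id : Omega -> g_sigma_algebraType (Ft s)).
  move=> _ C mC; rewrite setTI preimage_id; apply: (filtration_measurable sT').
  by apply/(filtration_sigma _ sT').
have e (A : set (g_sigma_algebraType (Ft s))) : measurable A ->
    (\int[P]_w (\1_A w * f (B s t g w))%:E = \int[P]_w (\1_A w * cst c w)%:E)%E.
  move=> /(filtration_sigma _ sT') FA.
  have mA := filtration_measurable sT' FA.
  under eq_integral do rewrite mulrC.
  rewrite (increment_independent_event g s0 st tT FA)//.
  under eq_integral do rewrite mulrC.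
  rewrite ge0_integral_scale ?fine_ge0// -/I If.
  under eq_integral do rewrite mulrC.
  rewrite ge0_integral_scale//.
  rewrite integral_indic// setIT fineK ?fin_num_measure// muleC//.
have mz : measurable_fun setT zeta by apply: Borel_map_measurable; exact: adapted_at_Borel az.
transitivity (\int[P]_w (zeta w * cst c w)%:E)%E; last first.
  under eq_integral do rewrite mulrC.
  by rewrite ge0_integral_scale// muleC -If.
apply/le_anti/andP; split.
- apply: (@le_integral_sets _ _ _ _ _ P P _ (g_sigma_algebraType (Ft s)) id id
    (fun w => f (B s t g w)) (cst c)) => //; last exact: adapted_measurable.
  by move=> A mA; rewrite e.
- apply: (@le_integral_sets _ _ _ _ _ P P _ (g_sigma_algebraType (Ft s)) id id
    (cst c) (fun w => f (B s t g w))) => //; last exact: adapted_measurable.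
  by move=> A mA; rewrite e.
Qed.


(** The moments remain symbolic constants; finiteness and sign are what the estimates use. *)
Definition normal_moment (m : nat) : R := fine (\int[normal_prob (0 : R) 1]_x (x ^+ m)%:E).

Lemma normal_moment4E : (\int[normal_prob (0 : R) 1]_x (x ^+ 4)%:E = (normal_moment 4)%:E)%E.
Proof.
rewrite /normal_moment fineK// ge0_fin_numE ?normal_moment4_lty//.
by apply: integral_ge0 => x _; rewrite lee_fin (_ : x ^+ 4 = (x ^+ 2) ^+ 2) ?sqr_ge0//; ring.
Qed.

Lemma normal_moment2E : (\int[normal_prob (0 : R) 1]_x (x ^+ 2)%:E = (normal_moment 2)%:E)%E.
Proof.
rewrite /normal_moment fineK// ge0_fin_numE; last first.
  by apply: integral_ge0 => x _; rewrite lee_fin sqr_ge0.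
apply: (@le_lt_trans _ _ (\int[normal_prob (0 : R) 1]_x (1 + x ^+ 4)%:E)%E).
  apply: ge0_le_integral => //.
  - by move=> x _; rewrite lee_fin sqr_ge0.
  - apply/measurable_EFinP; exact: exprn_measurable.
  - apply/measurable_EFinP/measurable_funD => //; exact: exprn_measurable.
  - by move=> x _; rewrite lee_fin; have := sqr_ge0 (x ^+ 2 - 1); nra.
under eq_integral do rewrite EFinD.
rewrite ge0_integralD//; last 2 first.
- by move=> x _; rewrite lee_fin (_ : x ^+ 4 = (x ^+ 2) ^+ 2) ?sqr_ge0//; ring.
- apply/measurable_EFinP; exact: exprn_measurable.
rewrite integral_cst// mul1e lte_add_pinfty ?normal_moment4_lty//.
by apply: le_lt_trans (probability_le1 _ measurableT) _; exact: ltry.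
Qed.

Lemma normal_moment_ge0 m : 0 <= normal_moment m.*2.
Proof.
apply/fine_ge0/integral_ge0 => x _.
by rewrite lee_fin -muln2 mulnC exprM exprn_ge0// sqr_ge0.
Qed.

(** By linearity of W in g, dividing g by l = sqrt(t - s) |g| reduces to the standard normal law.
    For g = 0 or s = t, where no law is prescribed, the increment vanishes almost surely. *)
Lemma increment_moment s t g (m : nat) (c : R) : 0 <= s -> s <= t -> t <= T -> (0 < m)%N ->
  (\int[normal_prob (0 : R) 1]_x (x ^+ m.*2)%:E = c%:E)%E ->
  (\int[P]_w (B s t g w ^+ m.*2)%:E = (((t - s) * `|g| ^+ 2) ^+ m * c)%:E)%E.
Proof.
move=> s0 st tT m0 cE; have mB h := increment_measurable h s0 st tT.
have e0 (x : R) : 0 <= x ^+ m.*2 by rewrite -muln2 mulnC exprM exprn_ge0// sqr_ge0.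
have zero : {ae P, forall w, B s t g w = 0} -> (t - s) * `|g| ^+ 2 = 0 ->
   (\int[P]_w (B s t g w ^+ m.*2)%:E = (((t - s) * `|g| ^+ 2) ^+ m * c)%:E)%E.
  move=> B0 ->; rewrite expr0n gtn_eqF// mul0r.
  transitivity (\int[P]_w (cst 0%E w))%E; last by rewrite integral0.
  apply: ae_eq_integral => //.
    by apply/measurable_EFinP/measurable_funX.
  by apply: filterS B0 => w /= -> _; rewrite expr0n double_eq0 gtn_eqF.
have [g0|g0] := eqVneq g 0.
  apply: zero; first by rewrite g0; exact: increment0.
  by rewrite g0 normr0 expr0n mulr0.
move: st; rewrite le_eqVlt => /predU1P[st|st].
  by apply: zero; [apply: nearW => w; rewrite st /increment subrr|rewrite st subrr mul0r].
pose l := Num.sqrt (t - s) * `|g|.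
have l0 : 0 < l by rewrite mulr_gt0 ?normr_gt0// sqrtr_gt0 subr_gt0.
have l2 : l ^+ 2 = (t - s) * `|g| ^+ 2 by rewrite exprMn sqr_sqrtr// subr_ge0 ltW.
pose g' := l^-1 *: g.
have g'0 : g' != 0 by rewrite scaler_eq0 invr_eq0 (gt_eqF l0).
have ng' : Num.sqrt (t - s) * `|g'| = 1.
  rewrite normrZ ger0_norm ?invr_ge0 ?ltW// mulrCA -/l mulVf// gt_eqF//.
transitivity (\int[P]_w (l ^+ m.*2 * B s t g' w ^+ m.*2)%:E)%E.
  apply: ae_eq_integral => //.
  - by apply/measurable_EFinP/measurable_funX.
  - by apply/measurable_EFinP/measurable_funM => //; apply: measurable_funX.
  - have := incrementZ l g' s0 (ltW st) tT; apply: filterS => w /= + _.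
    by rewrite scalerA mulfV ?gt_eqF// scale1r => ->; rewrite exprMn.
rewrite ge0_integral_scale//; last by apply: measurable_funX.
rewrite (increment_law s0 st tT g'0 (f := fun x => x ^+ m.*2))// ng' cE -EFinM.
by rewrite -l2 -exprM mul2n.
Qed.

Lemma increment_moment2 s t g : 0 <= s -> s <= t -> t <= T ->
  (\int[P]_w (B s t g w ^+ 2)%:E = ((t - s) * `|g| ^+ 2 * normal_moment 2)%:E)%E.
Proof.
move=> s0 st tT.
by rewrite (@increment_moment s t g 1 (normal_moment 2))// normal_moment2E.
Qed.

Lemma increment_moment4 s t g : 0 <= s -> s <= t -> t <= T ->
  (\int[P]_w (B s t g w ^+ 4)%:E = (((t - s) * `|g| ^+ 2) ^+ 2 * normal_moment 4)%:E)%E.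
Proof.
move=> s0 st tT.
by rewrite (@increment_moment s t g 2 (normal_moment 4))// normal_moment4E.
Qed.

Lemma increment_sq_integrable s t g : 0 <= s -> s <= t -> t <= T -> sq_integrable P (B s t g).
Proof.
move=> s0 st tT; apply: sq_integrable_lty; first exact: increment_measurable.
by rewrite increment_moment2// ltry.
Qed.

(** By symmetry: the increments along g and -g have the same law. Independence is available for
    nonnegative functions, so [zeta] and the increment are both split into positive and negative
    parts. *)
Lemma increment_centered s t g zeta : 0 <= s -> s <= t -> t <= T ->
  adapted_at s zeta -> sq_integrable P zeta -> \int[P]_w (zeta w * B s t g w) = 0.
Proof.
move=> s0 + tT az sz; rewrite le_eqVlt => /predU1P[->|st].
  by under eq_Rintegral do rewrite /increment subrr mulr0; rewrite Rintegral_cst// mul0r.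
have [->|g0] := eqVneq g 0.
  have [mz _] := sz; transitivity (\int[P]_w (cst 0 w : R)); last first.
    by rewrite Rintegral_cst// mul0r.
  apply: eq_ae_Rintegral => //.
  - by apply: measurable_funM => //; exact: increment_measurable (ltW st) tT.
  - by have := increment0 s0 (ltW st) tT; apply: filterS => w ->; rewrite mulr0.
have sB h := increment_sq_integrable h s0 (ltW st) tT.
pose pos (x : R) := Num.max x 0.
have pos0 x : 0 <= pos x by rewrite le_max lexx orbT.
have mpos : measurable_fun setT pos by apply: measurable_maxr.
have posE x : x = pos x - pos (- x).
  by rewrite /pos; case: (lerP x 0) => x0; case: (lerP (- x) 0) => y0; lra.
have pos_le x : `|pos x| <= `|x|.
  rewrite ger0_norm// /pos; case: (lerP x 0) => x0; first exact: normr_ge0.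
  by rewrite ger0_norm// ltW.
have spos f : sq_integrable P f -> sq_integrable P (fun w => pos (f w)).
  move=> [mf iff]; split; first exact: measurableT_comp.
  apply: (rintegrable_le measurableT _ iff) => [|w _ /=].
    by apply: measurable_funX; exact: measurableT_comp.
  by rewrite ger0_norm ?sqr_ge0// -[leLHS]real_normK ?num_real// -[leRHS]real_normK ?num_real//
     lerXn2r ?nnegrE.
have sposB h : sq_integrable P (fun w => pos (B s t h w)) by exact: spos.
have posoo h : (\int[P]_w (pos (B s t h w))%:E < +oo)%E.
  have := sq_integrable_integrable (sposB h) => /(integrable_fin_num measurableT).
  by rewrite ge0_fin_numE//; apply: integral_ge0 => w _; rewrite lee_fin.
have sym : (\int[P]_w (pos (B s t g w))%:E = \int[P]_w (pos (- B s t g w))%:E)%E.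
  transitivity (\int[P]_w (pos (B s t (-1 *: g) w))%:E)%E.
    have g1 : -1 *: g != 0 by rewrite scaler_eq0 oppr_eq0 oner_eq0.
    rewrite (increment_law s0 st tT g0 mpos pos0) (increment_law s0 st tT g1 mpos pos0).
    by rewrite normrZ normrN1 mul1r.
  apply: ae_eq_integral => //.
  - by apply/measurable_EFinP; have [] := sposB (-1 *: g).
  - apply/measurable_EFinP; apply: measurableT_comp => //; apply: measurable_funN.
    exact: increment_measurable (ltW st) tT.
  - have := incrementZ (-1) g s0 (ltW st) tT.
    by apply: filterS => w /= -> _; rewrite mulN1r.
have spN : sq_integrable P (fun w => pos (- B s t g w)).
  by apply: spos; under eq_fun do rewrite -mulN1r; exact: sq_integrableZ.
have key z : adapted_at s z -> sq_integrable P z -> (forall w, 0 <= z w) ->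
    \int[P]_w (z w * B s t g w) = 0.
  move=> az' sz' z0.
  under eq_Rintegral do rewrite (posE (B s t g _)) mulrBr.
  rewrite RintegralB//; [|exact: sq_integrable_mul..].
  apply/eqP; rewrite subr_eq0; apply/eqP; congr fine.
  rewrite (increment_independent s0 st tT az' z0 mpos)// sym.
  have neg_ok : measurable_fun setT (fun x : R => pos (- x)).
    by apply: measurableT_comp => //; exact: measurable_funN.
  rewrite (increment_independent (f := fun x => pos (- x)) s0 st tT az' z0)// -sym.
  exact: posoo.
have apos f : adapted_at s f -> adapted_at s (fun w => pos (f w)).
  move=> /adapted_measurable mf; apply: measurable_adapted; exact: measurableT_comp.
have aN : adapted_at s (fun w => - zeta w).
  by apply: measurable_adapted; apply: measurable_funN; exact: adapted_measurable.
have sN : sq_integrable P (fun w => - zeta w).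
  by under eq_fun do rewrite -mulN1r; exact: sq_integrableZ.
under eq_Rintegral do rewrite (posE (zeta _)) mulrBl.
rewrite RintegralB//; [|by apply: sq_integrable_mul => //; apply: spos..].
rewrite !key ?subrr//; [exact: apos|exact: spos|exact: apos|exact: spos].
Qed.

Lemma increment_quadratic s t g (zeta : Omega -> R) (c : R) : 0 <= s -> s <= t -> t <= T ->
  adapted_at s zeta -> (forall w, `|zeta w| <= c) ->
  \int[P]_w (zeta w * B s t g w ^+ 2) =
  (t - s) * `|g| ^+ 2 * normal_moment 2 * \int[P]_w zeta w.
Proof.
move=> s0 + tT az zc; rewrite le_eqVlt => /predU1P[->|st].
  under eq_Rintegral do rewrite /increment subrr expr0n mulr0.
  by rewrite Rintegral_cst// subrr !mul0r.
have sT' : 0 <= s <= T by rewrite s0 (le_trans (ltW st)).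
have mz : measurable_fun setT zeta by apply: Borel_map_measurable; exact: adapted_at_Borel az.
have [mB iB2] := increment_sq_integrable g s0 (ltW st) tT.
have iz : P.-integrable setT (EFin \o zeta).
  exact: sq_integrable_integrable (sq_integrable_bounded P mz zc).
have izB : P.-integrable setT (EFin \o (fun w => zeta w * B s t g w ^+ 2)).
  apply: (rintegrable_le measurableT _ (rintegrableZ measurableT c iB2)) => [|w _ /=].
    by apply: measurable_funM => //; exact: measurable_funX.
  by rewrite normrM [X in _ * X]ger0_norm ?sqr_ge0// ler_wpM2r ?sqr_ge0.
have icB := rintegrableZ measurableT c iB2.
have EB : \int[P]_w (B s t g w ^+ 2) = (t - s) * `|g| ^+ 2 * normal_moment 2.
  by rewrite /Rintegral increment_moment2// ltW.
(* Adding the bound c makes the weight nonnegative, as independence requires. *)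
have : \int[P]_w ((zeta w + c) * B s t g w ^+ 2) =
    (\int[P]_w (zeta w + c)) * \int[P]_w (B s t g w ^+ 2).
  rewrite /Rintegral -fineM; first last.
  - by apply: integrable_fin_num.
  - apply: integrable_fin_num => //; apply: rintegrableD => //.
    by have [_ /= h] := sq_integrable_cst P c; exact: sq_integrable_integrable (sq_integrable_cst P c).
  congr fine; rewrite -(increment_independent (f := fun x => x ^+ 2) s0 st tT)//.
  - apply: measurable_adapted; apply: measurable_funD => //; exact: adapted_measurable.
  - by move=> w; have := zc w; rewrite ler_norml => /andP[+ _]; rewrite -lerBlDr sub0r.
  - by move=> x; exact: sqr_ge0.
  - by rewrite increment_moment2 ?ltry// ltW.
under eq_Rintegral do rewrite mulrDl.
have ic := sq_integrable_integrable (sq_integrable_cst P c).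
have -> : \int[P]_w (zeta w * B s t g w ^+ 2 + c * B s t g w ^+ 2) =
    \int[P]_w (zeta w * B s t g w ^+ 2) + c * \int[P]_w (B s t g w ^+ 2).
  by rewrite RintegralD// RintegralZl.
have -> : \int[P]_w (zeta w + c) = \int[P]_w zeta w + c.
  rewrite RintegralD// Rintegral_cst//; congr (_ + _); rewrite -[RHS]mulr1.
  by congr (_ * _); rewrite -[RHS]/(fine 1%E); congr fine; exact: probability_setT.
rewrite EB => h.
apply: (addIr (c * ((t - s) * `|g| ^+ 2 * normal_moment 2))).
by rewrite h; ring.
Qed.


(** Polarization: four times the product is the difference of the squared increments along g + h and
    g - h. *)
Lemma increment_product s t g h (zeta : Omega -> R) (c : R) : 0 <= s -> s <= t -> t <= T ->
  adapted_at s zeta -> (forall w, `|zeta w| <= c) ->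
  \int[P]_w (zeta w * (B s t g w * B s t h w)) =
  hdot g h * (t - s) * normal_moment 2 * \int[P]_w zeta w.
Proof.
move=> s0 st tT az zc; have sT' : 0 <= s <= T by rewrite s0 (le_trans st).
have mz : measurable_fun setT zeta by apply: Borel_map_measurable; exact: adapted_at_Borel az.
have sB x := increment_sq_integrable x s0 st tT.
have szB x := sq_integrable_bounded_mul mz zc (sB x).
have i2 x : P.-integrable setT (EFin \o (fun w => zeta w * B s t x w ^+ 2)).
  have := sq_integrable_mul (szB x) (sB x); apply: eq_integrable => // w _ /=.
  by rewrite expr2 mulrA.
transitivity (\int[P]_w (4^-1 * (zeta w * B s t (g + h) w ^+ 2) -
     4^-1 * (zeta w * B s t (g - h) w ^+ 2))).
  apply: eq_ae_Rintegral => //.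
  - apply: measurable_funM => //.
    by apply: measurable_funM; [have [] := sB g|have [] := sB h].
  - apply: rintegrable_measurable; apply: (rintegrableB (mu := P)) => //.
      by apply: rintegrableZ.
    by apply: rintegrableZ.
  - have lp := increment_linear 1 g h s0 st tT; have lm := increment_linear (-1) h g s0 st tT.
    apply: filterS2 lp lm => w; rewrite scale1r scaleN1r (addrC (- h)) => -> ->.
    by rewrite mul1r mulN1r; field.
rewrite RintegralB//; [|exact: rintegrableZ..].
rewrite !RintegralZl// !(increment_quadratic _ _ _ _ az zc)//.
have e1 : `|g + h| ^+ 2 = `|g| ^+ 2 + 2 * hdot g h + `|h| ^+ 2.
  rewrite -!hdotxx hdotDl (hdotC g (g + h)) (hdotC h (g + h)) !hdotDl (hdotC h g); ring.
have e2 : `|g - h| ^+ 2 = `|g| ^+ 2 - 2 * hdot g h + `|h| ^+ 2.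
  have hN (k k' : U) : hdot (- k) k' = - hdot k k' by rewrite -scaleN1r hdotZl mulN1r.
  rewrite -!hdotxx hdotDl (hdotC g (g - h)) (hdotC (- h) (g - h)) !hdotDl.
  by rewrite (hdotC g (- h)) !hN (hdotC h (- h)) hN (hdotC h g); ring.
by rewrite e1 e2; field.
Qed.

Lemma increment_split s r t g w : B s t g w = B s r g w + B r t g w.
Proof. by rewrite /increment; ring. Qed.

(** The length of the intersection of [a, b] and [a', b']. *)
Definition overlap (a b a' b' : R) : R := Num.max 0 (Num.min b b' - Num.max a a').

Lemma overlapC a b a' b' : overlap a b a' b' = overlap a' b' a b.
Proof. by rewrite /overlap minC [Num.max a _]maxC. Qed.

(** Covariance of two weighted increments. Both intervals are cut at a' (the later start) and at the
    earlier end; outside the intersection one factor is an increment over a later interval than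
    everything else in the product, hence contributes 0. *)
Lemma increment_pair a b a' b' g h (x x' : Omega -> R) (c c' : R) :
  0 <= a -> a <= b -> b <= T -> 0 <= a' -> a' <= b' -> b' <= T ->
  adapted_at a x -> (forall w, `|x w| <= c) -> adapted_at a' x' -> (forall w, `|x' w| <= c') ->
  \int[P]_w ((x w * B a b g w) * (x' w * B a' b' h w)) =
  hdot g h * overlap a b a' b' * normal_moment 2 * \int[P]_w (x w * x' w).
Proof.
wlog aa : a b a' b' g h x x' c c' / a <= a'.
  move=> H a0 ab bT a'0 ab' bT' ax xc ax' xc'.
  case: (leP a a') => aa; first exact: H ax xc ax' xc'.
  rewrite hdotC overlapC; under eq_Rintegral do rewrite mulrC.
  by under [in RHS]eq_Rintegral do rewrite mulrC; exact: (H _ _ _ _ _ _ _ _ _ _ (ltW aa)) ax' xc' ax xc.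
move=> a0 ab bT a'0 ab' bT' ax xc ax' xc'.
have aT : 0 <= a <= T by rewrite a0 (le_trans ab).
have aT' : 0 <= a' <= T by rewrite a'0 (le_trans ab').
have mx : measurable_fun setT x by apply: Borel_map_measurable; exact: adapted_at_Borel ax.
have mx' : measurable_fun setT x' by apply: Borel_map_measurable; exact: adapted_at_Borel ax'.
have right r s t k (eta : Omega -> R) : 0 <= r -> r <= s -> s <= t -> t <= T ->
    adapted_at r eta -> sq_integrable P eta -> \int[P]_w (eta w * B s t k w) = 0.
  move=> r0 rs st tT ae se; apply: increment_centered => //; first exact: le_trans rs.
  by apply: adapted_at_le ae => //; exact: le_trans tT.
have cc w : `|x w * x' w| <= c * c' by rewrite normrM ler_pM.
have [ba|ba] := leP b a'.
  have -> : overlap a b a' b' = 0.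
    rewrite /overlap; apply/max_idPl; rewrite subr_le0 ge_min le_max ba.
    by rewrite orbT.
  rewrite mulr0 !mul0r.
  under eq_Rintegral do rewrite mulrA (mulrAC _ _ (x' _)).
  have ab0 : 0 <= b by exact: le_trans ab.
  apply: (right a') => //.
    apply: adaptedM; last by apply: (adapted_at_le (s := b)) => //; [exact: le_trans bT'|exact: increment_adapted].
    by apply: adaptedM => //; apply: adapted_at_le ax => //; exact: le_trans bT'.
  apply: sq_integrable_bounded_mul (cc) _; first exact: measurable_funM.
  exact: increment_sq_integrable.
have xa' : adapted_at a' x by apply: adapted_at_le ax => //; exact: le_trans bT'.
pose m := Num.min b b'.
have a'm : a' <= m by rewrite le_min ab' ltW.
have mb : m <= b by rewrite ge_min lexx.
have mb' : m <= b' by rewrite ge_min lexx orbT.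
have mT : m <= T by exact: le_trans bT.
have -> : overlap a b a' b' = m - a'.
  by rewrite /overlap (max_idPr aa) -/m; apply/max_idPr; rewrite subr_ge0.
have axx : adapted_at a' (fun w => x w * x' w) by exact: adaptedM.
have mxx : measurable_fun setT (fun w => x w * x' w) by exact: measurable_funM.
have m0 : 0 <= m by exact: le_trans a'm.
have sB s t k : 0 <= s -> s <= t -> t <= T -> sq_integrable P (B s t k).
  by move=> *; exact: increment_sq_integrable.
have sxB s t k : 0 <= s -> s <= t -> t <= T -> sq_integrable P (fun w => (x w * x' w) * B s t k w).
  by move=> s0 st tT; apply: sq_integrable_bounded_mul (cc) _ => //; exact: sB.
have aB t k : a' <= t -> t <= T -> adapted_at t (fun w => (x w * x' w) * B a' t k w).
  move=> at' tT; apply: adaptedM; last exact: increment_adapted.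
  exact: adapted_at_le axx.
have e1 : \int[P]_w ((x w * B a b g w) * (x' w * B a' b' h w)) =
    \int[P]_w ((x w * x' w) * (B a a' g w * B a' b' h w)) +
    \int[P]_w ((x w * x' w) * (B a' b g w * B a' b' h w)).
  rewrite -RintegralD//.
  - by apply: eq_Rintegral => w _; rewrite (increment_split a a'); ring.
  - have := sq_integrable_mul (sxB a a' g a0 aa (le_trans ab' bT')) (sB a' b' h a'0 ab' bT').
    by apply: eq_integrable => // w _ /=; rewrite mulrA.
  - have := sq_integrable_mul (sxB a' b g a'0 (ltW ba) bT) (sB a' b' h a'0 ab' bT').
    by apply: eq_integrable => // w _ /=; rewrite mulrA.
rewrite {}e1.
have -> : \int[P]_w ((x w * x' w) * (B a a' g w * B a' b' h w)) = 0.
  under eq_Rintegral do rewrite mulrA.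
  apply: (right a') => //; last exact: sxB _ (le_trans ab' bT').
  apply: adaptedM => //; apply: increment_adapted => //; exact: le_trans bT'.
rewrite add0r.
have -> : \int[P]_w ((x w * x' w) * (B a' b g w * B a' b' h w)) =
    \int[P]_w ((x w * x' w) * (B a' m g w * B a' m h w)).
  rewrite /m; case: (leP b b') => bb.
    have sa := sxB a' b g a'0 (ltW ba) bT.
    transitivity (\int[P]_w ((x w * x' w) * B a' b g w * B a' b h w) +
      \int[P]_w ((x w * x' w) * B a' b g w * B b b' h w)).
      rewrite -RintegralD//.
      + by apply: eq_Rintegral => w _; rewrite (increment_split a' b b'); ring.
      + by apply: sq_integrable_mul => //; apply: sB => //; exact: ltW.
      + by apply: sq_integrable_mul => //; apply: sB => //; exact: le_trans (ltW ba).
    rewrite [X in _ + X](right b)//; [|exact: le_trans (ltW ba)|exact: aB (ltW ba) bT].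
    by rewrite addr0; apply: eq_Rintegral => w _; rewrite mulrA.
  have sa := sxB a' b' h a'0 ab' bT'.
  transitivity (\int[P]_w ((x w * x' w) * B a' b' h w * B a' b' g w) +
      \int[P]_w ((x w * x' w) * B a' b' h w * B b' b g w)).
    rewrite -RintegralD//.
    + by apply: eq_Rintegral => w _; rewrite (increment_split a' b' b); ring.
    + by apply: sq_integrable_mul => //; apply: sB.
    + by apply: sq_integrable_mul => //; apply: sB => //; [exact: le_trans ab'|exact: ltW].
  rewrite [X in _ + X](right b')//; [|exact: le_trans ab'|exact: ltW|exact: aB ab' bT'].
  by rewrite addr0; apply: eq_Rintegral => w _; ring.
by rewrite (increment_product _ _ _ _ _ axx cc).
Qed.

End Brownian_increments.

(** * Elementary stochastic integrals *)

Section Rintegral_sums.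
Context d (X : measurableType d) (R : realType) (mu : {measure set X -> \bar R}).
Variables (D : set X) (mD : measurable D).

Lemma rintegrable_sum (I : Type) (r : seq I) (f : I -> X -> R) :
  (forall i, mu.-integrable D (EFin \o f i)) ->
  mu.-integrable D (EFin \o (fun x => \sum_(i <- r) f i x)).
Proof.
move=> iF; have := integrable_sum mD r (P := xpredT) (fun i _ => iF i).
by apply: eq_integrable => // x _ /=; rewrite sumEFin.
Qed.

Lemma Rintegral_sum (I : Type) (r : seq I) (f : I -> X -> R) :
  (forall i, mu.-integrable D (EFin \o f i)) ->
  \int[mu]_(x in D) (\sum_(i <- r) f i x) = \sum_(i <- r) \int[mu]_(x in D) f i x.
Proof.
move=> iF; elim: r => [|i r IH].
  by under eq_Rintegral do rewrite big_nil; rewrite big_nil Rintegral_cst// mul0r.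
under eq_Rintegral do rewrite big_cons.
by rewrite RintegralD ?IH ?big_cons//; exact: rintegrable_sum.
Qed.

End Rintegral_sums.

Section elementary_increments.
Context d (Omega : measurableType d) (R : realType) (P : probability Omega R).
Context (T : R) (Ft : R -> set (set Omega)) (Ft_filtration : complete_filtration P T Ft).
Context (U : hilbertType R) (e : onbasis U).
Context (W : R -> U -> Omega -> R) (W_Wiener : cylindrical_Wiener P T Ft W).
Context (E : normedModType R).
Local Notation B := (increment W).
Local Notation RT := (measurableTypeR R).
Local Notation leb := (@lebesgue_measure R).

Section difference.
Variables s1 s2 : elementary T Ft E.

Let c1 j := (j < el_size s1)%N.

Let diff_time j : let s (a b : nat -> R) := if c1 j then a j else b (j - el_size s1)%N in
  0 <= s (el_start s1) (el_start s2) /\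
  s (el_start s1) (el_start s2) <= s (el_end s1) (el_end s2) /\ s (el_end s1) (el_end s2) <= T.
Proof. by rewrite /=; case: ifP => _; exact: el_time. Qed.

Let diff_adapted j : Ft (if c1 j then el_start s1 j else el_start s2 (j - el_size s1)%N)
  (if c1 j then el_event s1 j else el_event s2 (j - el_size s1)%N).
Proof. by case: ifP => _; exact: el_adapted. Qed.

Definition el_sub : elementary T Ft E := @Elementary _ _ _ _ _ _ (el_size s1 + el_size s2)
  (fun j => if c1 j then el_event s1 j else el_event s2 (j - el_size s1)%N)
  (fun j => if c1 j then el_start s1 j else el_start s2 (j - el_size s1)%N)
  (fun j => if c1 j then el_end s1 j else el_end s2 (j - el_size s1)%N)
  (fun j => if c1 j then el_index s1 j else el_index s2 (j - el_size s1)%N)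
  (fun j => if c1 j then el_val s1 j else - el_val s2 (j - el_size s1)%N)
  diff_time diff_adapted.

Lemma el_sub_fun w r g : el_fun e el_sub w r g = el_fun e s1 w r g - el_fun e s2 w r g.
Proof.
rewrite /el_fun /= big_split_ord /= /c1 -sumrN; congr (_ + _); apply: eq_bigr => j _.
  by rewrite ltn_ord.
by rewrite ltnNge leq_addr/= addKn scalerN.
Qed.

Lemma el_sub_integral w r :
  el_integral e W el_sub w r = el_integral e W s1 w r - el_integral e W s2 w r.
Proof.
rewrite /el_integral /= big_split_ord /= /c1 -sumrN; congr (_ + _); apply: eq_bigr => j _.
  by rewrite ltn_ord.
by rewrite ltnNge leq_addr/= addKn scalerN.
Qed.

End difference.

Section increments.
Variables (s : elementary T Ft E) (s' t : R).
Hypotheses (s'0 : 0 <= s') (s't : s' <= t) (tT : t <= T).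

(** Clipping the jump times to [s', t] writes the increment of an elementary integral over [s', t]
    as a sum of weighted Brownian increments. *)
Definition el_lo j := Num.max s' (Num.min t (el_start s j)).
Definition el_hi j := Num.max s' (Num.min t (el_end s j)).
(** Terms starting at t or later are dropped: their clipped interval is empty, and their event may
    be unknown at the clipped start t. *)
Definition el_coef j : Omega -> R :=
  if el_start s j < t then \1_(el_event s j) else cst 0.

Lemma el_lo_ge j : s' <= el_lo j. Proof. by rewrite le_max lexx. Qed.
Lemma el_lo_hi j : el_lo j <= el_hi j.
Proof.
have [_ [h _]] := el_time s j.
rewrite /el_lo /el_hi ge_max !le_max lexx /=; apply/orP; right.
by rewrite le_min !ge_min lexx h orbT.
Qed.
Lemma el_hi_le j : el_hi j <= t. Proof. by rewrite ge_max s't ge_min lexx. Qed.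
Lemma el_lo_ge0 j : 0 <= el_lo j. Proof. exact: le_trans (el_lo_ge j). Qed.
Lemma el_hi_leT j : el_hi j <= T. Proof. exact: le_trans (el_hi_le j) _. Qed.

Lemma el_increment_term j g w :
  \1_(el_event s j) w *
   ((W (Num.min t (el_end s j)) g w - W (Num.min t (el_start s j)) g w) -
    (W (Num.min s' (el_end s j)) g w - W (Num.min s' (el_start s j)) g w))
  = el_coef j w * B (el_lo j) (el_hi j) g w.
Proof.
have [_ [h _]] := el_time s j; rewrite /el_coef /el_lo /el_hi /increment.
have clamp x : W (Num.max s' (Num.min t x)) g w = W (Num.min t x) g w - W (Num.min s' x) g w + W s' g w.
  case: (leP t x) => tx.
    by rewrite (max_idPr s't) (min_idPl (le_trans s't tx)); ring.
  by case: (leP s' x) => sx; ring.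
rewrite !clamp; case: ifPn => [_|]; first by ring.
rewrite -leNgt => tst; rewrite (min_idPl tst) (min_idPl (le_trans tst h)).
rewrite (min_idPl (le_trans s't tst)) (min_idPl (le_trans s't (le_trans tst h))) /cst; ring.
Qed.

Lemma el_increment w : el_integral e W s w t - el_integral e W s w s' =
  \sum_(j < el_size s) (el_coef j w * B (el_lo j) (el_hi j) (e (el_index s j)) w) *: el_val s j.
Proof.
rewrite /el_integral -sumrB; apply: eq_bigr => j _; rewrite -scalerBl -mulrBr.
by rewrite el_increment_term.
Qed.

Lemma el_coef_le1 j w : `|el_coef j w| <= 1.
Proof.
rewrite /el_coef; case: ifP => _; last by rewrite /cst normr0.
by rewrite indicE; case: (_ \in _); rewrite ?normr1 ?normr0.
Qed.

Lemma el_coef_adapted j : adapted_at Ft (el_lo j) (el_coef j).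
Proof.
have lT : 0 <= el_lo j <= T by rewrite el_lo_ge0 (le_trans (el_lo_hi j))// el_hi_leT.
rewrite /el_coef; case: ifPn => [h|_]; last exact: Borel_map_cst.
apply: (adapted_indic Ft_filtration lT).
have [s0 [_ _]] := el_time s j; have /andP[_ lT'] := lT.
case: Ft_filtration => _ _ /(_ (el_start s j) (el_lo j) s0 _ lT') + _; apply.
  by rewrite /el_lo (min_idPr (ltW h)) le_max lexx orbT.
exact: el_adapted.
Qed.

Section quadratic.
Variable K : Omega -> E -> E -> R.
Hypotheses (KZDl : forall w a x y z, K w (a *: x + y) z = a * K w x z + K w y z)
  (KC : forall w x y, K w x y = K w y x)
  (K_bounded : forall x y, exists c, forall w, `|K w x y| <= c)
  (K_adapted : forall i j, adapted_at Ft s' (fun w => K w (el_val s i) (el_val s j))).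

Let K_0l w z : K w 0 z = 0.
Proof. by have := KZDl w 1 0 0 z; rewrite scaler0 addr0 mul1r; lra. Qed.

Let K_suml w z (I : Type) (r : seq I) (a : I -> R) (v : I -> E) :
  K w (\sum_(i <- r) a i *: v i) z = \sum_(i <- r) a i * K w (v i) z.
Proof.
elim: r => [|i r IH]; first by rewrite !big_nil K_0l.
by rewrite !big_cons KZDl IH.
Qed.

Let K_sum w (I : Type) (r : seq I) (a : I -> R) (v : I -> E) :
  K w (\sum_(i <- r) a i *: v i) (\sum_(i <- r) a i *: v i) =
  \sum_(i <- r) \sum_(j <- r) a i * a j * K w (v i) (v j).
Proof.
rewrite K_suml; apply: eq_bigr => i _; rewrite KC K_suml mulr_sumr.
by apply: eq_bigr => j _; rewrite KC mulrA.
Qed.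

Let x_ i j w := K w (el_val s i) (el_val s j) * el_coef i w.

Let mono i (f : Omega -> R) : adapted_at Ft s' f -> adapted_at Ft (el_lo i) f.
Proof.
apply: (adapted_at_le Ft_filtration) => //; first exact: el_lo_ge.
exact: le_trans (el_lo_hi i) (el_hi_leT i).
Qed.

Let x_adapted i j : adapted_at Ft (el_lo i) (x_ i j).
Proof. by apply: adaptedM; [exact: mono|exact: el_coef_adapted]. Qed.

Let x_bounded i j : exists c, forall w, `|x_ i j w| <= c.
Proof.
have [c Kc] := K_bounded (el_val s i) (el_val s j); exists c => w.
by rewrite normrM (le_trans (ler_wpM2l (normr_ge0 _) (el_coef_le1 i w)))// mulr1.
Qed.

Let loT i : 0 <= el_lo i <= T.
Proof. by rewrite el_lo_ge0 (le_trans (el_lo_hi i))// el_hi_leT. Qed.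

Let m_adapted i (f : Omega -> R) : adapted_at Ft (el_lo i) f -> measurable_fun setT f.
Proof. by move=> af; apply: Borel_map_measurable; exact: (adapted_at_Borel Ft_filtration (loT i)). Qed.

Let E_ i j := \int[P]_w (x_ i j w * el_coef j w).

Let i_xc i j : P.-integrable setT (EFin \o (fun w => x_ i j w * el_coef j w)).
Proof.
have [c xc] := x_bounded i j; apply: sq_integrable_mul.
  by apply: sq_integrable_bounded xc; exact: m_adapted.
by apply: sq_integrable_bounded (el_coef_le1 j); apply: m_adapted; exact: el_coef_adapted.
Qed.

Let i_xB i j g h : P.-integrable setT (EFin \o (fun w =>
   x_ i j w * B (el_lo i) (el_hi i) g w * (el_coef j w * B (el_lo j) (el_hi j) h w))).
Proof.
have [c xc] := x_bounded i j.
have sB k g' : sq_integrable P (B (el_lo k) (el_hi k) g').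
  by apply: (increment_sq_integrable Ft_filtration W_Wiener);
    [exact: el_lo_ge0|exact: el_lo_hi|exact: el_hi_leT].
apply: sq_integrable_mul.
  by apply: sq_integrable_bounded_mul xc _ => //; exact: m_adapted.
apply: sq_integrable_bounded_mul (el_coef_le1 j) _ => //.
by apply: m_adapted; exact: el_coef_adapted.
Qed.

Definition el_Delta w := el_integral e W s w t - el_integral e W s w s'.

Lemma el_Delta_quadratic :
  \int[P]_w K w (el_Delta w) (el_Delta w) =
  \sum_(i < el_size s) \sum_(j < el_size s)
    (el_index s i == el_index s j)%:R * overlap (el_lo i) (el_hi i) (el_lo j) (el_hi j)
     * normal_moment R 2 * E_ i j.
Proof.
transitivity (\int[P]_w (\sum_(i < el_size s) \sum_(j < el_size s)
   x_ i j w * B (el_lo i) (el_hi i) (e (el_index s i)) w *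
   (el_coef j w * B (el_lo j) (el_hi j) (e (el_index s j)) w))).
  apply: eq_Rintegral => w _; rewrite /el_Delta el_increment K_sum.
  by apply: eq_bigr => i _; apply: eq_bigr => j _; rewrite /x_; ring.
rewrite Rintegral_sum// => [|i]; last by apply: rintegrable_sum => // j; exact: i_xB.
apply: eq_bigr => i _; rewrite Rintegral_sum//.
apply: eq_bigr => j _; have [c xc] := x_bounded i j.
rewrite (increment_pair Ft_filtration W_Wiener _ _ (el_lo_ge0 i) (el_lo_hi i) (el_hi_leT i)
  (el_lo_ge0 j) (el_lo_hi j) (el_hi_leT j) (@x_adapted i j) xc (@el_coef_adapted j) (el_coef_le1 j)).
by rewrite onvec_orthonormal.
Qed.

Let N := (\max_(i < el_size s) el_index s i).+1.

Let Iprod i j r : R := (\1_(`]el_start s i, el_end s i]) r : R) * \1_(`]el_start s j, el_end s j]) r.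

Let el_fun_quadratic w r : s' < r -> r <= t ->
  \sum_(k < N) K w (el_fun e s w r (e k)) (el_fun e s w r (e k)) =
  \sum_(i < el_size s) \sum_(j < el_size s)
   (el_index s i == el_index s j)%:R * Iprod i j r * (x_ i j w * el_coef j w).
Proof.
move=> s'r rt.
have ind i : (\1_(el_event s i) w : R) * \1_(`]el_start s i, el_end s i]) r =
    el_coef i w * \1_(`]el_start s i, el_end s i]) r.
  rewrite /el_coef; case: ifPn => //; rewrite -leNgt => ts.
  have -> : \1_(`]el_start s i, el_end s i]) r = 0 :> R.
    by rewrite indicE memNset//= in_itv/= ltNge (le_trans rt ts).
  by rewrite !mulr0.
under eq_bigr => k _.
  rewrite /el_fun K_sum; under eq_bigr => i _ do under eq_bigr => j _ do
    rewrite !ind !onvec_orthonormal.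
  over.
rewrite exchange_big/=; apply: eq_bigr => i _; rewrite exchange_big/=; apply: eq_bigr => j _.
have iN : (el_index s i < N)%N.
  by rewrite ltnS; exact: (@leq_bigmax _ (fun k : 'I_(el_size s) => el_index s k) i).
rewrite (bigD1 (Ordinal iN))//= big1 ?addr0 => [|k ki].
  rewrite /= eqxx (eq_sym (el_index s j)) /Iprod /x_ mulr1.
  by case: (el_index s i == _); rewrite ?mulr1n ?mulr0n; ring.
rewrite (_ : el_index s i == k = false) ?mulr0 ?mul0r//.
by apply/negbTE; apply: contra ki => /eqP ik; apply/eqP/val_inj.
Qed.

Let Iprod_integral i j : leb.-integrable `]s', t] (EFin \o Iprod i j) /\
  \int[leb]_(r in `]s', t]) Iprod i j r = overlap (el_lo i) (el_hi i) (el_lo j) (el_hi j).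
Proof.
have -> : Iprod i j = \1_(`]el_start s i, el_end s i] `&` `]el_start s j, el_end s j]).
  by rewrite indicI.
have mI : measurable (`]el_start s i, el_end s i] `&` `]el_start s j, el_end s j] : set RT).
  by apply: measurableI; exact: measurable_itv.
split.
  apply: (rintegrable_le _ _ (rintegrable_cst (mu := leb) _ 1 _)) => //.
  - by rewrite [X in (X < _)%E]lebesgue_measure_itv /=; case: ifP => _; rewrite -?EFinB ltry.
  - by move=> r _; rewrite indicE; case: (_ \in _); rewrite ?normr1 ?normr0.
rewrite /Rintegral integral_indic// .
have -> : `]el_start s i, el_end s i] `&` `]el_start s j, el_end s j] `&` `]s', t] =
   [set` `](Num.max (el_lo i) (el_lo j)), (Num.min (el_hi i) (el_hi j))]]; last first.
  rewrite [X in fine X]lebesgue_measure_itv /= lte_fin /overlap; case: ltP => h.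
    by rewrite -EFinB/=; apply/esym/max_idPr; rewrite subr_ge0 ltW.
  by apply/esym/max_idPl; rewrite subr_le0.
apply/seteqP; split => r /=; rewrite !in_itv/= /el_lo /el_hi !gt_max !gt_min !le_min !le_max !le_min.
  by move=> [[/andP[a b] /andP[a' b']] /andP[c f]]; rewrite a b a' b' c f !orbT.
move=> /andP[/andP[/andP[c a] /andP[_ a']] /andP[b b']]; move: a a' b b'.
rewrite (leNgt r s') c /= => a a' /andP[rt b] /andP[_ b']; move: a a'.
by rewrite (ltNge t r) rt/= => -> ->; rewrite b b'.
Qed.

Let quad_integrable r : s' < r -> r <= t -> P.-integrable setT
  (EFin \o (fun w => \sum_(k < N) K w (el_fun e s w r (e k)) (el_fun e s w r (e k)))).
Proof.
move=> sr rt; under eq_fun do rewrite el_fun_quadratic//.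
apply: rintegrable_sum => // i; apply: rintegrable_sum => // j; exact: rintegrableZ.
Qed.

(** The Ito isometry with the squared norm replaced by a random quadratic form known at time s'. It
    is applied to the scalar product and to the scalar product weighted by k(a)^2, with a known at
    s'. The number n exceeds every basis index occurring in s, so the sum is complete. *)
Lemma el_isometry : exists n, (\int[P]_w (K w (el_Delta w) (el_Delta w))%:E =
  (normal_moment R 2)%:E * \int[leb]_(r in `]s', t])
    \int[P]_w (\sum_(k < n) K w (el_fun e s w r (e k)) (el_fun e s w r (e k)))%:E)%E.
Proof.
exists N.
have i_quad : P.-integrable setT (EFin \o (fun w => K w (el_Delta w) (el_Delta w))).
  have -> : (fun w => K w (el_Delta w) (el_Delta w)) = (fun w =>
    \sum_(i < el_size s) \sum_(j < el_size s)
      x_ i j w * B (el_lo i) (el_hi i) (e (el_index s i)) w *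
      (el_coef j w * B (el_lo j) (el_hi j) (e (el_index s j)) w)).
    apply/funext => w; rewrite /el_Delta el_increment K_sum.
    by apply: eq_bigr => i _; apply: eq_bigr => j _; rewrite /x_; ring.
  by apply: rintegrable_sum => // i; apply: rintegrable_sum => // j.
transitivity ((normal_moment R 2)%:E * (\int[leb]_(r in `]s', t])
    \sum_(i < el_size s) \sum_(j < el_size s)
      (el_index s i == el_index s j)%:R * E_ i j * Iprod i j r)%:E)%E; last first.
  have iI i j : leb.-integrable `]s', t] (EFin \o (fun r =>
      (el_index s i == el_index s j)%:R * E_ i j * Iprod i j r)).
    by apply: rintegrableZ => //; have [] := Iprod_integral i j.
  congr (_ * _)%E; rewrite /Rintegral fineK; last first.
    apply: integrable_fin_num => //; apply: rintegrable_sum => // i.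
    exact: rintegrable_sum.
  apply: eq_integral => r; rewrite inE /= in_itv/= => /andP[sr rt].
  have -> : (\int[P]_w (\sum_(k < N) K w (el_fun e s w r (e k)) (el_fun e s w r (e k)))%:E)%E
     = (\int[P]_w (\sum_(k < N) K w (el_fun e s w r (e k)) (el_fun e s w r (e k))))%:E.
    by rewrite /Rintegral fineK// integrable_fin_num//; exact: quad_integrable.
  congr EFin; under [RHS]eq_Rintegral do rewrite el_fun_quadratic//.
  rewrite Rintegral_sum// => [|i]; last first.
    by apply: rintegrable_sum => // j; exact: rintegrableZ.
  apply: eq_bigr => i _; rewrite Rintegral_sum// => [|j]; last exact: rintegrableZ.
  by apply: eq_bigr => j _; rewrite RintegralZl// /E_; ring.
have -> : (\int[P]_w (K w (el_Delta w) (el_Delta w))%:E =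
    (\int[P]_w K w (el_Delta w) (el_Delta w))%:E)%E.
  by rewrite /Rintegral fineK// integrable_fin_num.
rewrite el_Delta_quadratic -EFinM; congr EFin.
have iI i j : leb.-integrable `]s', t] (EFin \o (fun r =>
      (el_index s i == el_index s j)%:R * E_ i j * Iprod i j r)).
  by apply: rintegrableZ => //; have [] := Iprod_integral i j.
rewrite Rintegral_sum// => [|i]; last exact: rintegrable_sum.
rewrite mulr_sumr; apply: eq_bigr => i _; rewrite Rintegral_sum// mulr_sumr.
apply: eq_bigr => j _; have [iIp <-] := Iprod_integral i j.
by rewrite RintegralZl//; ring.
Qed.

End quadratic.
End increments.
End elementary_increments.

Section square_sums.
Context (R : realType) (E : normedModType R).

(** The squared Hilbert-Schmidt norm when g k is the image of the k-th basis vector; integrands are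
    handled below through these images. *)
Definition sqsum (g : nat -> E) : \bar R := (\sum_(0 <= k <oo) (`|g k| ^+ 2)%:E)%E.

Lemma sqsum_ge0 g : (0 <= sqsum g)%E.
Proof. by apply: nneseries_ge0 => k _ _; rewrite lee_fin sqr_ge0. Qed.

Lemma norm_sqr_le2 (x y : E) : `|x + y| ^+ 2 <= 2 * `|x| ^+ 2 + 2 * `|y| ^+ 2.
Proof.
have : `|x + y| ^+ 2 <= (`|x| + `|y|) ^+ 2.
  by rewrite lerXn2r ?nnegrE ?addr_ge0// ler_normD.
have := sqr_ge0 (`|x| - `|y|); nra.
Qed.

Lemma sqsum_triangle (a b c : nat -> E) : (sqsum (fun k => (a k - b k)%R) <=
  2%:E * sqsum (fun k => (a k - c k)%R) + 2%:E * sqsum (fun k => (b k - c k)%R))%E.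
Proof.
rewrite /sqsum -!nneseriesZl; try by move=> k _; rewrite lee_fin sqr_ge0.
rewrite -nneseriesD; try by move=> k _ _; rewrite -EFinM lee_fin mulr_ge0 ?sqr_ge0.
apply: lee_nneseries => k _; first by rewrite lee_fin sqr_ge0.
rewrite -!EFinM -EFinD lee_fin (_ : a k - b k = (a k - c k) + (c k - b k)); last first.
  by rewrite addrA subrK.
by rewrite (distrC (b k)) norm_sqr_le2.
Qed.

Lemma sqsum_sum_le n (g : nat -> E) : (\sum_(k < n) (`|g k| ^+ 2)%:E <= sqsum g)%E.
Proof.
rewrite -(big_mkord xpredT (fun k => (`|g k| ^+ 2)%:E)).
by apply: nneseries_lim_ge => k _ _; rewrite lee_fin sqr_ge0.
Qed.

Lemma sqsum_finite n g : (forall k, (n <= k)%N -> g k = 0) ->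
  sqsum g = (\sum_(k < n) (`|g k| ^+ 2)%:E)%E.
Proof.
move=> g0; rewrite /sqsum (nneseries_split _ n) => [|k _]; last by rewrite lee_fin sqr_ge0.
rewrite eseries0 ?adde0 ?add0n ?big_mkord// => k + _.
by move=> nk; rewrite g0// normr0 expr0n.
Qed.

Lemma measurable_sqsum d (X : measurableType d) (g : X -> nat -> E) :
  (forall k, Borel_map (g ^~ k)) -> measurable_fun setT (fun x => sqsum (g x)).
Proof.
move=> bg; apply: (@ge0_emeasurable_sum _ _ _ _ (fun k x => (`|g x k| ^+ 2)%:E)) => [k x _ _|k _].
  by rewrite lee_fin sqr_ge0.
by apply/measurable_EFinP/measurable_funX; exact: Borel_map_norm.
Qed.

End square_sums.

Section elementary_measurability.
Context d (Omega : measurableType d) (R : realType) (P : probability Omega R).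
Context (T : R) (Ft : R -> set (set Omega)) (Ft_filtration : complete_filtration P T Ft).
Context (U : hilbertType R) (e : onbasis U).
Context (W : R -> U -> Omega -> R) (W_Wiener : cylindrical_Wiener P T Ft W).
Context (E : normedModType R) (E_separable : separable E).
Local Notation RT := (measurableTypeR R).

Lemma Borel_map_sum d' (X : measurableType d') (I : Type) (r : seq I) (f : I -> X -> E) :
  (forall i, Borel_map (f i)) -> Borel_map (fun x => \sum_(i <- r) f i x).
Proof.
move=> bf; elim: r => [|i r IH].
  by under eq_fun do rewrite big_nil; exact: Borel_map_cst.
by under eq_fun do rewrite big_cons; exact: Borel_mapD.
Qed.

Lemma Borel_map_scale d' (X : measurableType d') (a : X -> R) (v : E) :
  measurable_fun setT a -> Borel_map (fun x => a x *: v).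
Proof.
move=> ma; apply: (@Borel_map_comp _ _ R E a (fun c => c *: v)).
  by move=> c; exact: scalel_continuous.
exact: measurable_Borel_map.
Qed.

Lemma el_event_measurable (s : elementary T Ft E) j : measurable (el_event s j).
Proof.
have [a [b c]] := el_time s j; apply: (filtration_measurable Ft_filtration _ (el_adapted s j)).
by rewrite a (le_trans b).
Qed.

Lemma el_fun_Borel (s : elementary T Ft E) g :
  Borel_map (fun z : Omega * RT => el_fun e s z.1 z.2 g).
Proof.
apply: Borel_map_sum => j; apply: Borel_map_scale; apply: measurable_funM => //.
apply: measurable_funM.
  apply: (@measurableT_comp _ _ _ _ _ _ (\1_(el_event s j) : Omega -> R)) => //.
  by apply: measurable_indic; exact: el_event_measurable.
apply: (@measurableT_comp _ _ _ _ _ _ (\1_(`]el_start s j, el_end s j]) : RT -> R)) => //.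
Qed.

Lemma Wiener_measurable t g : 0 <= t <= T -> measurable_fun setT (W t g).
Proof.
move=> tT; apply: Borel_map_measurable.
by apply: (adapted_at_Borel Ft_filtration tT); exact: (Wiener_adapted_at Ft_filtration W_Wiener).
Qed.

Lemma el_integral_Borel (s : elementary T Ft E) t : 0 <= t <= T ->
  Borel_map (fun w => el_integral e W s w t).
Proof.
move=> /andP[t0 tT]; apply: Borel_map_sum => j; apply: Borel_map_scale.
have [a [b c]] := el_time s j; apply: measurable_funM.
  by apply: measurable_indic; exact: el_event_measurable.
apply: measurable_funB; apply: Wiener_measurable.
  by rewrite le_min t0 (le_trans a b) ge_min tT.
by rewrite le_min t0 a ge_min tT.
Qed.

End elementary_measurability.

Section iterated_integrals.
Context d (Omega : measurableType d) (R : realType) (P : probability Omega R).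
Local Notation RT := (measurableTypeR R).
Local Notation leb := (@lebesgue_measure R).
Variables (D : set RT) (mD : measurable D).
Implicit Types f g : Omega * RT -> \bar R.

(** Expectation inside and time outside, the order produced by the isometry and needed to regard the
    approximation error as a density in time. *)
Definition iterated f : \bar R := (\int[leb]_(r in D) \int[P]_w f (w, r))%E.

Lemma measurable_inner f : measurable_fun setT f -> (forall z, (0 <= f z)%E) ->
  measurable_fun setT (fun r : RT => \int[P]_w f (w, r))%E.
Proof. by move=> mf f0; exact: (measurable_fun_fubini_tonelli_G (m1 := P) f mf f0). Qed.

Lemma iterated_ge0 f : (forall z, (0 <= f z)%E) -> (0 <= iterated f)%E.
Proof. by move=> f0; apply: integral_ge0 => r _; apply: integral_ge0 => w _. Qed.

Lemma le_iterated f g : measurable_fun setT f -> measurable_fun setT g ->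
  (forall z, (0 <= f z)%E) -> (forall w r, D r -> (f (w, r) <= g (w, r))%E) ->
  (forall z, (0 <= g z)%E) -> (iterated f <= iterated g)%E.
Proof.
move=> mf mg f0 fg g0; apply: ge0_le_integral => //.
- by move=> r _; apply: integral_ge0.
- by apply: measurable_funTS; exact: measurable_inner.
- by apply: measurable_funTS; exact: measurable_inner.
- move=> r Dr; apply: ge0_le_integral => //.
  + exact: measurableT_comp.
  + exact: measurableT_comp.
  + by move=> w _; exact: fg.
Qed.

Lemma iteratedD f g : measurable_fun setT f -> measurable_fun setT g ->
  (forall z, (0 <= f z)%E) -> (forall z, (0 <= g z)%E) ->
  iterated (fun z => (f z + g z)%E) = (iterated f + iterated g)%E.
Proof.
move=> mf mg f0 g0; rewrite /iterated -ge0_integralD//.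
- apply: eq_integral => r _; rewrite ge0_integralD//; exact: measurableT_comp.
- by move=> r _; apply: integral_ge0.
- by apply: measurable_funTS; exact: measurable_inner.
- by move=> r _; apply: integral_ge0.
- by apply: measurable_funTS; exact: measurable_inner.
Qed.

Lemma iteratedZ (c : R) f : 0 <= c -> measurable_fun setT f -> (forall z, (0 <= f z)%E) ->
  iterated (fun z => (c%:E * f z)%E) = (c%:E * iterated f)%E.
Proof.
move=> c0 mf f0; rewrite /iterated -ge0_integralZl_EFin//.
- apply: eq_integral => r _; rewrite ge0_integralZl_EFin//; exact: measurableT_comp.
- by move=> r _; apply: integral_ge0.
- by apply: measurable_funTS; exact: measurable_inner.
Qed.

Lemma iterated_swap f : measurable_fun setT f -> (forall z, (0 <= f z)%E) ->
  iterated f = (\int[P]_w \int[leb]_(r in D) f (w, r))%E.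
Proof.
move=> mf f0; pose g (z : Omega * RT) := (if z.2 \in D then f z else 0)%E.
have mg : measurable_fun setT g.
  apply: measurable_fun_ifT => //.
  apply: (@measurableT_comp _ _ _ _ _ _ (fun r : RT => r \in D)) => //.
  by apply: (measurable_fun_bool true); rewrite setTI (_ : _ @^-1` _ = D)//;
    apply/seteqP; split => r /=; [exact: set_mem|exact: mem_set].
have g0 z : (0 <= g z)%E by rewrite /g; case: ifP.
have := fubini_tonelli (m1 := P) (m2 := leb) g mg g0.
rewrite /fubini_F /fubini_G /iterated => h.
transitivity (\int[leb]_y \int[P]_x g (x, y))%E.
  rewrite [LHS]integral_mkcond.
  apply: eq_integral => r _; rewrite patchE /g/=; case: ifPn => // _.
  by rewrite integral0.
rewrite -h; apply: eq_integral => w _; rewrite [RHS]integral_mkcond.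
by apply: eq_integral => r _; rewrite patchE.
Qed.

End iterated_integrals.

(** * Approximation of stochastic integrals by elementary ones *)

Section stochastic_approximation.
Context d (Omega : measurableType d) (R : realType) (P : probability Omega R).
Context (T : R) (Ft : R -> set (set Omega)) (Ft_filtration : complete_filtration P T Ft).
Context (U : hilbertType R) (e : onbasis U).
Context (W : R -> U -> Omega -> R) (W_Wiener : cylindrical_Wiener P T Ft W).
Context d' (X : measurableType d') (mu : {measure set X -> \bar R}).
Local Notation H := (L2 mu).
Hypothesis H_separable : separable H.
Local Notation RT := (measurableTypeR R).
Local Notation leb := (@lebesgue_measure R).
Local Notation c2 := (normal_moment R 2).
Implicit Types s : elementary T Ft H.

Variables s' t : R.
Hypotheses (s'0 : 0 <= s') (s't : s' <= t) (tT : t <= T).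
Local Notation Delta s := (el_Delta e W s s' t).

Let mI : measurable (`]s', t] : set RT). Proof. exact: measurable_itv. Qed.

Let s'T : 0 <= s' <= T. Proof. by rewrite s'0 (le_trans s't). Qed.
Let tT' : 0 <= t <= T. Proof. by rewrite tT (le_trans s'0). Qed.

Lemma el_Delta_Borel s : Borel_map (Delta s).
Proof.
by apply: Borel_mapB => //; apply: (el_integral_Borel Ft_filtration).
Qed.


Let mdiff s1 s2 : measurable_fun setT (fun z : Omega * RT =>
  sqsum (fun k => el_fun e s1 z.1 z.2 (e k) - el_fun e s2 z.1 z.2 (e k))).
Proof.
apply: measurable_sqsum => k; by apply: Borel_mapB => //; exact: (el_fun_Borel Ft_filtration).
Qed.

Lemma el_sub_Delta s1 s2 w : Delta (el_sub s1 s2) w = Delta s1 w - Delta s2 w.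
Proof.
rewrite /el_Delta !el_sub_integral !opprD !opprK !addrA; congr (_ + _).
by rewrite -!addrA; congr (_ + _); rewrite addrC.
Qed.

Lemma el_Delta_dist s1 s2 : (\int[P]_w (`|Delta s1 w - Delta s2 w| ^+ 2)%:E <=
  c2%:E * iterated P `]s', t] (fun z =>
     sqsum (fun k => (el_fun e s1 z.1 z.2 (e k) - el_fun e s2 z.1 z.2 (e k))%R)))%E.
Proof.
have [||||n] := @el_isometry _ _ _ P _ _ Ft_filtration _ e _ W_Wiener _ (el_sub s1 s2) s' t
  s'0 s't tT (fun _ x y => L2_dot x y).
- by move=> _ a x y z; rewrite L2_dotDl L2_dotZl.
- by move=> _ x y; exact: L2_dotC.
- by move=> x y; exists `|L2_dot x y|.
- by move=> i j; exact: Borel_map_cst.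
under eq_integral do rewrite el_sub_Delta -L2_normE.
move=> ->; apply: lee_wpmul2l; first by rewrite lee_fin; exact: (normal_moment_ge0 R 1).
apply: (@le_iterated _ _ _ P _ mI (fun z => (\sum_(k < n)
   L2_dot (el_fun e (el_sub s1 s2) z.1 z.2 (e k)) (el_fun e (el_sub s1 s2) z.1 z.2 (e k)))%:E)).
- apply/measurable_EFinP; under eq_fun do under eq_bigr do rewrite -L2_normE.
  apply: measurable_sum => k; apply: measurable_funX; apply: Borel_map_norm.
  exact: (el_fun_Borel Ft_filtration).
- exact: mdiff.
- by move=> z; rewrite lee_fin; apply: sumr_ge0 => k _; rewrite -L2_normE sqr_ge0.
- move=> w r _ /=; apply: le_trans (sqsum_sum_le n _); rewrite -sumEFin.
  by apply: lee_sum => k _; rewrite -L2_normE el_sub_fun.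
- by move=> z; exact: sqsum_ge0.
Qed.


Lemma sqr_dist_integral (f g h : Omega -> H) : Borel_map f -> Borel_map g -> Borel_map h ->
  (\int[P]_w (`|f w - h w| ^+ 2)%:E <= 2%:E * \int[P]_w (`|f w - g w| ^+ 2)%:E
     + 2%:E * \int[P]_w (`|g w - h w| ^+ 2)%:E)%E.
Proof.
move=> bf bg bh.
have m (a b : Omega -> H) : Borel_map a -> Borel_map b ->
    measurable_fun setT (fun w => `|a w - b w| ^+ 2).
  by move=> ba bb; apply: measurable_funX; apply: Borel_map_norm; exact: Borel_mapB.
have m1 := m _ _ bf bg; have m2 := m _ _ bg bh.
rewrite -(ge0_integral_scale P (c := 2) _ m1)// -?(ge0_integral_scale P (c := 2) _ m2)//;
  try by move=> w; exact: sqr_ge0.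
rewrite -ge0_integralD//.
- apply: ge0_le_integral => //.
  + by apply/measurable_EFinP; exact: m.
  + by apply/measurable_EFinP/measurable_funD; apply: measurable_funM.
  + move=> w _; rewrite -EFinD lee_fin.
    by rewrite (_ : f w - h w = (f w - g w) + (g w - h w)) ?norm_sqr_le2// addrA subrK.
- by apply/measurable_EFinP; apply: measurable_funM.
- by apply/measurable_EFinP; apply: measurable_funM.
Qed.

Definition el_dist s (Phi : Omega -> R -> nat -> H) (z : Omega * RT) : \bar R :=
  sqsum (fun k => el_fun e s z.1 z.2 (e k) - Phi z.1 z.2 k).

(** What the energy estimate retains of a stochastic integral M with integrand Phi, given by its
    images of the basis. Phrased this way it applies directly to the difference of two integrals. *)
Definition stochastic_approx (s_ : nat -> elementary T Ft H) (Phi : Omega -> R -> nat -> H)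
    (M : Omega -> R -> H) :=
  [/\ forall k, Borel_map (fun z : Omega * RT => Phi z.1 z.2 k),
      forall r, 0 <= r <= T -> Borel_map (M ^~ r),
      iterated P `[0, T] (el_dist (s_ n) Phi) @[n --> \oo] --> 0%E &
      forall r, 0 <= r <= T ->
        (\int[P]_w (`|el_integral e W (s_ n) w r - M w r| ^+ 2)%:E)%E @[n --> \oo] --> 0%E].

Section approximation.
Variables (s_ : nat -> elementary T Ft H) (Phi : Omega -> R -> nat -> H) (M : Omega -> R -> H).
Hypothesis approx : stochastic_approx s_ Phi M.

Let mdist s : measurable_fun setT (el_dist s Phi).
Proof.
have [bP _ _ _] := approx.
by apply: measurable_sqsum => k; apply: Borel_mapB => //; exact: (el_fun_Borel Ft_filtration).
Qed.

Let dist0 s z : (0 <= el_dist s Phi z)%E. Proof. exact: sqsum_ge0. Qed.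

Let c20 : 0 <= c2. Proof. exact: (normal_moment_ge0 R 1). Qed.

Let sub_iterated s : (iterated P `]s', t] (el_dist s Phi) <= iterated P `[0%R, T] (el_dist s Phi))%E.
Proof.
rewrite /iterated; apply: ge0_subset_integral => //.
- by apply: measurable_funTS; exact: measurable_inner.
- by move=> r _; apply: integral_ge0.
- move=> r /=; rewrite !in_itv/= => /andP[sr rt].
  by rewrite (le_trans s'0 (ltW sr)) (le_trans rt).
Qed.

Lemma Delta_approx n : (\int[P]_w (`|Delta (s_ n) w - (M w t - M w s')| ^+ 2)%:E <=
  2%:E * \int[P]_w (`|el_integral e W (s_ n) w t - M w t| ^+ 2)%:E +
  2%:E * \int[P]_w (`|el_integral e W (s_ n) w s' - M w s'| ^+ 2)%:E)%E.
Proof.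
have [_ bM _ _] := approx.
have bI r : 0 <= r <= T -> Borel_map (fun w => el_integral e W (s_ n) w r).
  by move=> rT; apply: (el_integral_Borel Ft_filtration).
have h := @sqr_dist_integral (fun w => el_integral e W (s_ n) w t - M w t) (cst 0)
  (fun w => el_integral e W (s_ n) w s' - M w s')
  (Borel_mapB H_separable (bI _ tT') (bM _ tT')) (@Borel_map_cst _ _ _ _)
  (Borel_mapB H_separable (bI _ s'T) (bM _ s'T)).
have -> : (\int[P]_w (`|Delta (s_ n) w - (M w t - M w s')| ^+ 2)%:E =
    \int[P]_w (`|(el_integral e W (s_ n) w t - M w t) -
       (el_integral e W (s_ n) w s' - M w s')| ^+ 2)%:E)%E.
  apply: eq_integral => w _; congr (`|_| ^+ 2)%:E.
  rewrite /el_Delta !opprD !opprK !addrA; congr (_ + _); rewrite -!addrA; congr (_ + _).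
  by rewrite addrC.
apply: le_trans h _; apply: leeD; apply: lee_wpmul2l => //; rewrite le_eqVlt; apply/orP; left;
  apply/eqP/eq_integral => w _; by rewrite /cst ?subr0 ?sub0r ?normrN.
Qed.

Lemma approx_Delta_cvg :
  (\int[P]_w (`|Delta (s_ n) w - (M w t - M w s')| ^+ 2)%:E)%E @[n --> \oo] --> 0%E.
Proof.
have [_ _ _ cM] := approx.
apply: (@squeeze_cvge _ _ _ _ (cst 0%E) _ (fun n =>
  2%:E * (\int[P]_w (`|el_integral e W (s_ n) w t - M w t| ^+ 2)%:E) +
  2%:E * \int[P]_w (`|el_integral e W (s_ n) w s' - M w s'| ^+ 2)%:E)%E).
- apply: nearW => n; rewrite Delta_approx andbT.
  by apply: integral_ge0 => w _; rewrite lee_fin sqr_ge0.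
- exact: cvg_cst.
- have -> : (0 = 2%:E * 0 + 2%:E * 0 :> \bar R)%E by rewrite mule0 adde0.
  apply: cvgeD; first by rewrite mule0.
    by apply: cvgeZl => //; exact: cM.
  by apply: cvgeZl => //; exact: cM.
Qed.

(** Insert the approximating integral of [s_ n], apply the isometry to the difference of the two
    elementary processes and let n grow. Two squared triangle inequalities produce the factor 4. *)
Lemma Delta_M_dist s : (\int[P]_w (`|Delta s w - (M w t - M w s')| ^+ 2)%:E <=
  (4 * c2)%:E * iterated P `]s', t] (el_dist s Phi))%E.
Proof.
have [bP bM cP _] := approx.
have bMd : Borel_map (fun w => M w t - M w s') by apply: Borel_mapB => //; exact: bM.
set I := iterated _ _ _; have I0 : (0 <= I)%E by exact: iterated_ge0.
apply/lee_addgt0Pr => eps eps0.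
have d0 : 0 < eps / (4 * c2 + 2).
  by rewrite divr_gt0// ltr_wpDl// mulr_ge0.
have [N1 hN1] := cvge0_lt approx_Delta_cvg d0; have [N2 hN2] := cvge0_lt cP d0.
pose n := maxn N1 N2.
have h := sqr_dist_integral (el_Delta_Borel s) (el_Delta_Borel (s_ n)) bMd.
apply: le_trans h _.
have h1 : (\int[P]_w (`|Delta s w - Delta (s_ n) w| ^+ 2)%:E <=
    c2%:E * (2%:E * I + 2%:E * iterated P `]s', t] (el_dist (s_ n) Phi)))%E.
  apply: le_trans (el_Delta_dist s (s_ n)) _; apply: lee_wpmul2l; first by rewrite lee_fin.
  have m2 s0 : measurable_fun setT (fun z => (2%:E * el_dist s0 Phi z)%E).
    exact: measurable_funeM.
  have p2 s0 z : (0 <= 2%:E * el_dist s0 Phi z)%E by rewrite mule_ge0.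
  have -> : (2%:E * I + 2%:E * iterated P `]s', t] (el_dist (s_ n) Phi) =
    iterated P `]s', t] (fun z => 2%:E * el_dist s Phi z + 2%:E * el_dist (s_ n) Phi z))%E.
    rewrite (iteratedD P mI (m2 s) (m2 (s_ n)) (p2 s) (p2 (s_ n))).
    by congr (_ + _)%E; rewrite iteratedZ.
  apply: le_iterated => //.
  - exact: emeasurable_funD.
  - by move=> z; exact: sqsum_ge0.
  - by move=> w r _; exact: sqsum_triangle.
  - by move=> z; rewrite adde_ge0// mule_ge0.
have h2 : (\int[P]_w (`|Delta (s_ n) w - (M w t - M w s')| ^+ 2)%:E <= (eps / (4 * c2 + 2))%:E)%E.
  by apply/ltW/hN1; exact: leq_maxl.
have h3 : (iterated P `]s', t] (el_dist (s_ n) Phi) <= (eps / (4 * c2 + 2))%:E)%E.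
  by apply: le_trans (sub_iterated _) _; apply/ltW/hN2; exact: leq_maxr.
apply: (@le_trans _ _ (2%:E * (c2%:E * (2%:E * I + 2%:E * (eps / (4 * c2 + 2))%:E)) +
   2%:E * (eps / (4 * c2 + 2))%:E)%E).
  apply: leeD; apply: lee_wpmul2l => //; apply: le_trans h1 _.
  by apply: lee_wpmul2l; rewrite ?lee_fin// leeD2l// lee_wpmul2l.
(* For infinite I the bound is trivial unless c2 = 0, when the product is 0 by convention and only
   the error term remains. *)
case: (I) I0 => [x| |]// _; last first.
  have [->|c2n] := eqVneq c2 0.
    rewrite !mulr0 !mul0e !mule0 !add0e -EFinM lee_fin add0r; lra.
  have -> : ((4 * c2)%:E * +oo = +oo :> \bar R)%E.
    by rewrite gt0_muley// lte_fin mulr_gt0// lt_neqAle eq_sym c2n.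
  by rewrite addye// leey.
rewrite -!EFinM -!EFinD lee_fin; set q := eps / _.
have -> : eps = (4 * c2 + 2) * q by rewrite /q; field; rewrite gt_eqF// ltr_wpDl// mulr_ge0.
by rewrite le_eqVlt; apply/orP; left; apply/eqP; ring.
Qed.

Lemma el_revalue s (D : set H) eps : (forall x r, 0 < r -> exists2 y, D y & `|x - y| < r) ->
  0 < eps -> exists2 s0 : elementary T Ft H, (forall j, D (el_val s0 j)) &
  forall w r, (sqsum (fun k => (el_fun e s w r (e k) - el_fun e s0 w r (e k))%R) <= eps%:E)%E.
Proof.
move=> D_dense eps0; set m := el_size s; set N := (\max_(i < m) el_index s i).+1.
(* Changing each of the m values by less than dl moves each of the N relevant coordinates by at most
   m dl; as dl <= 1, the squared error is at most m^2 N dl <= eps. *)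
pose q : R := m%:R ^+ 2 * N%:R + 1.
have q1 : 1 <= q by rewrite lerDr mulr_ge0// sqr_ge0.
have q0 : 0 < q by exact: lt_le_trans q1.
pose dl := Num.min 1 (eps / q).
have dl0 : 0 < dl by rewrite lt_min ltr01 divr_gt0.
have [v vP] : {v : nat -> H | forall j, D (v j) /\ `|el_val s j - v j| < dl}.
  have ch j : {y | D y /\ `|el_val s j - y| < dl}.
    by apply: cid; have [y Dy xy] := D_dense (el_val s j) _ dl0; exists y.
  by exists (fun j => sval (ch j)) => j; exact: (svalP (ch j)).
pose s0 := Elementary (el_size s) (el_index s) v (el_time s) (el_adapted s).
exists s0 => [j|w r]; first by have [] := vP j.
have diffE k : el_fun e s w r (e k) - el_fun e s0 w r (e k) = \sum_(j < m)
    (\1_(el_event s j) w * \1_(`]el_start s j, el_end s j]) r *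
     (el_index s j == k)%:R) *: (el_val s j - v j).
  rewrite /el_fun -sumrB; apply: eq_bigr => j _; rewrite /s0 /= -scalerBr.
  by rewrite onvec_orthonormal.
have term k : `|el_fun e s w r (e k) - el_fun e s0 w r (e k)| <= m%:R * dl.
  rewrite diffE (le_trans (ler_norm_sum _ _ _))//.
  apply: (@le_trans _ _ (\sum_(j < m) dl)); last by rewrite sumr_const card_ord mulr_natl.
  apply: ler_sum => j _; rewrite normrZ -[leRHS]mul1r ler_pM//; last by have [_ /ltW] := vP j.
  rewrite !indicE; case: (_ \in _); case: (_ \in _); case: (_ == _);
    by rewrite ?mul1r ?mul0r ?mulr0 ?normr1 ?normr0.
rewrite (@sqsum_finite _ _ N) => [|k Nk]; last first.
  rewrite diffE big1// => j _; rewrite (_ : el_index s j == k = false) ?mulr0 ?scale0r//.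
  apply/negbTE; rewrite neq_ltn; apply/orP; left; apply: leq_trans Nk.
  by rewrite ltnS; exact: (@leq_bigmax _ (fun k : 'I_m => el_index s k) j).
apply: (@le_trans _ _ (\sum_(k < N) ((m%:R * dl) ^+ 2)%:E)%E).
  apply: lee_sum => k _; rewrite lee_fin lerXn2r ?nnegrE ?mulr_ge0// ?term//.
  exact: ltW.
rewrite sumEFin lee_fin sumr_const card_ord -[_ *+ N]mulr_natr exprMn.
have dl1 : dl <= 1 by rewrite ge_min lexx.
have dle : dl <= eps / q by rewrite ge_min lexx orbT.
have d2 : dl ^+ 2 <= eps / q by apply: le_trans dle; rewrite expr2 ler_piMl// ltW.
apply: (@le_trans _ _ (m%:R ^+ 2 * N%:R * (eps / q))).
  by rewrite mulrAC; rewrite ler_wpM2l// mulr_ge0// sqr_ge0.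
rewrite mulrA ler_pdivrMr// mulrC ler_pM2l// /q; lra.
Qed.

(** With D the image of V, this provides approximations whose values have finite quartic integrals.
    The second error is uniform in time and omega, so it is chosen of order eps / T. *)
Lemma approx_revalue (D : set H) eps : 0 < T ->
  (forall x r, 0 < r -> exists2 y, D y & `|x - y| < r) -> 0 < eps ->
  exists2 s0 : elementary T Ft H, (forall j, D (el_val s0 j)) &
    (iterated P `[0%R, T] (el_dist s0 Phi) <= eps%:E)%E.
Proof.
move=> T0 D_dense eps0; have [bP bM cP _] := approx.
have e4 : 0 < eps / 4 by rewrite divr_gt0.
have e8 : 0 < eps / (4 * T) by rewrite divr_gt0// mulr_gt0.
have [n hn] := cvge0_lt cP e4.
have [s0 s0D s0s] := el_revalue (s_ n) D_dense e8; exists s0 => //.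
have mJ : measurable (`[0, T] : set RT) by exact: measurable_itv.
have mc : measurable_fun setT (fun z : Omega * RT => 2%:E * (eps / (4 * T))%:E)%E.
  exact: measurable_cst.
have m2 : measurable_fun setT (fun z => (2%:E * el_dist (s_ n) Phi z)%E).
  exact: measurable_funeM.
have p2 z : (0 <= 2%:E * el_dist (s_ n) Phi z)%E by rewrite mule_ge0.
apply: (@le_trans _ _ (iterated P `[0%R, T] (fun z => 2%:E * el_dist (s_ n) Phi z +
    2%:E * (eps / (4 * T))%:E))%E).
  apply: le_iterated => //.
  - exact: emeasurable_funD.
  - move=> w r _; rewrite /el_dist.
    pose zero : nat -> H := fun k => Phi w r k - el_fun e (s_ n) w r (e k).
    have := @sqsum_triangle _ _ (fun k => el_fun e s0 w r (e k)) (fun k => Phi w r k)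
      (fun k => el_fun e (s_ n) w r (e k)).
    move=> /le_trans; apply; rewrite addeC; apply: leeD; apply: lee_wpmul2l => //.
      rewrite /sqsum; apply: lee_nneseries => k _; first by rewrite lee_fin sqr_ge0.
      by rewrite distrC.
    apply: le_trans (s0s w r); rewrite /sqsum.
    apply: lee_nneseries => k _; first by rewrite lee_fin sqr_ge0.
    by rewrite distrC.
  - by move=> z; rewrite adde_ge0// mule_ge0// lee_fin ltW.
rewrite iteratedD// => [|z]; last by rewrite mule_ge0// lee_fin ltW.
rewrite iteratedZ//.
apply: (@le_trans _ _ (2%:E * (eps / 4)%:E + (eps / 2)%:E)%E); last first.
  by rewrite -EFinM -EFinD lee_fin; lra.
apply: leeD; first by apply: lee_wpmul2l => //; apply/ltW/hn.
rewrite (_ : iterated _ _ _ = \int[leb]_(r in `[0%R, T]) (2 * (eps / (4 * T)))%:E)%E; last first.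
  apply: eq_integral => r _; rewrite -EFinM integral_cst//.
  by rewrite [X in (_ * X)%E]probability_setT mule1.
rewrite integral_cst//=.
rewrite [X in (_ * X)%E]lebesgue_measure_itv/= lte_fin T0 -EFinD -EFinM lee_fin subr0.
by rewrite le_eqVlt; apply/orP; left; apply/eqP; field; rewrite gt_eqF.
Qed.


End approximation.

End stochastic_approximation.

(** * One step of a stochastic integral *)

Lemma holder_continuous (R : realType) (E E' : normedModType R) (f : E -> E') C : 0 <= C ->
  (forall x y, `|f x - f y| ^+ 2 <= C * `|x - y|) -> continuous f.
Proof.
move=> C0 Ch a; apply/cvgrPdist_le => eps eps0.
have e1 : 0 < eps ^+ 2 / (C + 1) by rewrite divr_gt0 ?exprn_gt0// ltr_wpDl.
near=> b; rewrite -ler_sqr ?nnegrE ?normr_ge0 ?(ltW eps0)//; apply: le_trans (Ch _ _) _.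
apply: (@le_trans _ _ ((C + 1) * `|a - b|)); first by rewrite ler_wpM2r// lerDl.
rewrite -ler_pdivlMl ?ltr_wpDl// mulrC; near: b.
exact: cvgr_dist_le.
Unshelve. all: by end_near. Qed.

(** * The weight k(a) and integrated Taylor expansion *)

Section weights.
Context d (X : measurableType d) (R : realType) (mu : {measure set X -> \bar R}).
Local Notation H := (L2 mu).
Implicit Types a b x y : H.

Lemma measurable_tf_k : measurable_fun setT (@tf_k R).
Proof.
by apply: (@lip_measurable _ _ 1) => u v; rewrite mul1r; exact: tf_k_lip.
Qed.

Let mk a : measurable_fun setT (fun z => tf_k (Lp_fun a z)).
Proof. by apply: measurableT_comp; [exact: measurable_tf_k|exact: Lp_fun_measurable]. Qed.

Let k_le1 (u : R) : `|tf_k u| <= 1.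
Proof. by have /andP[k0 k1] := tf_k_bounds u; rewrite ger0_norm. Qed.

Let k_dist (u v : R) : `|tf_k u - tf_k v| <= 1.
Proof.
have /andP[? ?] := tf_k_bounds u; have /andP[? ?] := tf_k_bounds v.
by rewrite ler_norml; lra.
Qed.

(** A contraction of H: its square is multiplication by the weight that controls phi''. *)
Definition kmul a x : H := ofun mu (fun z => tf_k (Lp_fun a z) * Lp_fun x z).

Lemma kmulE a x : {ae mu, forall z, Lp_fun (kmul a x) z = tf_k (Lp_fun a z) * Lp_fun x z}.
Proof.
apply: ofunE; apply: (@Lfun2_le _ _ _ _ _ 1 x).
  by apply: measurable_funM; [exact: mk|exact: Lp_fun_measurable].
by apply: nearW => z; rewrite normrM ler_wpM2r.
Qed.

Lemma kmulZD a r x y : kmul a (r *: x + y) = r *: kmul a x + kmul a y.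
Proof.
apply: Lp_eqP.
apply: filterS3 (filterI (kmulE a (r *: x + y)) (kmulE a x))
  (filterI (kmulE a y) (Lp_funD (r *: x) y))
  (filterI (filterI (Lp_funD (r *: kmul a x) (kmul a y)) (Lp_funZ r x)) (Lp_funZ r (kmul a x))).
by move=> z [-> e1] [e2 ->] [[-> ->] ->]; rewrite e1 e2; ring.
Qed.

Lemma kmul_norm a x : `|kmul a x| <= `|x|.
Proof.
rewrite -[leRHS]mul1r; apply: L2_norm_le => //; apply: filterS (kmulE a x) => z ->.
by rewrite normrM ler_wpM2r.
Qed.

Lemma kmulD a x y : kmul a (x + y) = kmul a x + kmul a y.
Proof. by rewrite -[x]scale1r kmulZD !scale1r. Qed.

(** This is how the weighted bound on the noise returns the energy. *)
Lemma kmul_self a : kmul a a = nemytskii (@tf_g R) a.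
Proof.
apply: Lp_eqP; have g0 : @tf_g R 0 = 0 by rewrite /tf_g mul0r.
by apply: filterS2 (kmulE a a) (nemytskiiE g0 (@tf_g_lip R) a) => z -> ->; rewrite /tf_g mulrC.
Qed.

Definition quartic x : \bar R := (\int[mu]_z (Lp_fun x z ^+ 4)%:E)%E.

Lemma quartic_ge0 x : (0 <= quartic x)%E.
Proof.
apply: integral_ge0 => z _; rewrite lee_fin (_ : _ ^+ 4 = (Lp_fun x z ^+ 2) ^+ 2) ?sqr_ge0//; ring.
Qed.

(** Since k is 1-Lipschitz with values in [0, 1], |k(a) - k(b)|^2 <= |a - b|; when x^2 lies in L^2,
    Cauchy-Schwarz concludes. Continuity in a is needed for measurability along a random a. *)
Lemma kmul_holder x : (quartic x < +oo)%E -> exists2 C, 0 <= C &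
  forall a b, `|kmul a x - kmul b x| ^+ 2 <= C * `|a - b|.
Proof.
move=> x4; pose q : H := ofun mu (fun z => Lp_fun x z ^+ 2).
have mx := @Lp_fun_measurable _ _ _ mu x.
have qE : {ae mu, forall z, Lp_fun q z = Lp_fun x z ^+ 2}.
  apply: ofunE; apply: Lfun2P; first exact: measurable_funX.
  by under eq_integral do rewrite -exprM.
pose nrm (u : R) := `|u|; have n0 : nrm 0 = 0 by exact: normr0.
have nl (u v : R) : `|nrm u - nrm v| <= 1 * `|u - v| by rewrite mul1r ler_dist_dist.
exists `|q| => // a b; set ab := nemytskii nrm (a - b).
apply: (@le_trans _ _ (L2_dot q ab)); last first.
  apply: le_trans (ler_norm _) _; apply: le_trans (L2_dot_le _ _) _.
  by rewrite ler_wpM2l// -[leRHS]mul1r; apply: nemytskii_norm.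
rewrite L2_normE -subr_ge0 /L2_dot -RintegralB//; [|exact: integrable_dot..].
have i1 := @integrable_dot _ _ _ mu q ab.
have i2 := @integrable_dot _ _ _ mu (kmul a x - kmul b x) (kmul a x - kmul b x).
have m3 := rintegrable_measurable (rintegrableB measurableT i1 i2).
apply: fine_ge0.
rewrite (ae_eq_integral (fun z => (Num.max 0 (Lp_fun q z * Lp_fun ab z -
  Lp_fun (kmul a x - kmul b x) z * Lp_fun (kmul a x - kmul b x) z))%:E))//.
- by apply: integral_ge0 => z _; rewrite lee_fin le_max lexx.
- exact/measurable_EFinP.
- by apply/measurable_EFinP; apply: measurable_maxr.
apply: filterS3 (filterI qE (nemytskiiE n0 nl (a - b)))
  (filterI (kmulE a x) (kmulE b x))
  (filterI (Lp_funB (kmul a x) (kmul b x)) (Lp_funB a b)).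
move=> z [qz abz] [az bz] [kz dz] _; congr EFin; apply/esym/max_idPr.
rewrite /ab qz abz kz az bz dz -mulrBl -expr2 exprMn (mulrC (_ ^+ 2)) -mulrBl.
apply: mulr_ge0; last exact: sqr_ge0.
set u := Lp_fun a z; set v := Lp_fun b z; rewrite subr_ge0.
apply: le_trans (tf_k_lip u v); rewrite -real_normK ?num_real// expr2 ler_piMl//.
Qed.

Lemma kmul_continuous x : (quartic x < +oo)%E -> continuous (fun a : H => kmul a x).
Proof. by move=> /kmul_holder[C C0 Ch]; exact: holder_continuous Ch. Qed.

Let taylor_ae (a m m' : H) : {ae mu, forall z : X,
  Lp_fun (nemytskii (@tf_g R) (a + m)) z ^+ 2 <= Lp_fun (nemytskii (@tf_g R) a) z ^+ 2 +
   Lp_fun (nemytskii (@tf_sigma R) a) z * Lp_fun m z +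
   400 * (Lp_fun (kmul a m') z ^+ 2 + Lp_fun m' z ^+ 4 + Lp_fun (m - m') z ^+ 2)}.
Proof.
have g0 : @tf_g R 0 = 0 by rewrite /tf_g mul0r.
have s0 : @tf_sigma R 0 = 0 by exact: tf_sigma_le0.
apply: filterS3 (filterI (nemytskiiE g0 (@tf_g_lip R) (a + m)) (nemytskiiE g0 (@tf_g_lip R) a))
  (filterI (nemytskiiE s0 (@tf_sigma_lip R) a) (kmulE a m'))
  (filterI (Lp_funD a m) (Lp_funB m m')).
move=> z [-> ->] [-> ->] [-> ->]; rewrite -!tf_phi_gE exprMn.
have := tf_phi_taylor (Lp_fun a z) (Lp_fun m z) (Lp_fun m' z).
rewrite ler_norml => /andP[_]; lra.
Qed.

(** Here m will be the true stochastic increment and m' an elementary one: the quartic term falls on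
    m' alone. *)
Lemma taylor_integral (a m m' : H) : (quartic m' < +oo)%E ->
  `|nemytskii (@tf_g R) (a + m)| ^+ 2 <= `|nemytskii (@tf_g R) a| ^+ 2
    + L2_dot (nemytskii (@tf_sigma R) a) m
    + 400 * (`|kmul a m'| ^+ 2 + fine (quartic m') + `|m - m'| ^+ 2).
Proof.
move=> q4; have g0 : @tf_g R 0 = 0 by rewrite /tf_g mul0r.
have s0 : @tf_sigma R 0 = 0 by exact: tf_sigma_le0.
have mL y := @Lp_fun_measurable _ _ _ mu y.
have i4 : mu.-integrable setT (EFin \o (fun z => Lp_fun m' z ^+ 4)).
  apply/integrableP; split; first by apply/measurable_EFinP/measurable_funX.
  rewrite (_ : (\int[mu]_z _)%E = quartic m')//; apply: eq_integral => z _ /=.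
  by rewrite ger0_norm// exprn_even_ge0.
have i2 (y : H) : mu.-integrable setT (EFin \o (fun z => Lp_fun y z ^+ 2)).
  by have := @integrable_dot _ _ _ mu y y; apply: eq_integrable => // z _ /=; rewrite expr2.
have n2 (y : H) : `|y| ^+ 2 = \int[mu]_z (Lp_fun y z ^+ 2).
  by rewrite L2_normE; apply: eq_Rintegral => z _; rewrite expr2.
rewrite [fine _](_ : _ = \int[mu]_z (Lp_fun m' z ^+ 4))// !n2.
have iD := @integrable_dot _ _ _ mu (nemytskii (@tf_sigma R) a) m.
rewrite /L2_dot -!RintegralD//; [|by repeat apply: rintegrableD..].
rewrite -RintegralZl//; last by repeat apply: rintegrableD.
rewrite -RintegralD//; [|exact: rintegrableD|by apply: rintegrableZ => //; repeat apply: rintegrableD].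
apply: ae_le_Rintegral => //.
- apply: rintegrableD => //; first exact: rintegrableD.
  by apply: rintegrableZ => //; repeat apply: rintegrableD.
by apply: filterS (taylor_ae a m m') => z + _.
Qed.

End weights.

Section sq_integrable_more.
Context d (Omega : measurableType d) (R : realType) (P : probability Omega R).

Lemma sq_integrable_le (f g : Omega -> R) : measurable_fun setT f ->
  (forall w, `|f w| <= g w) -> sq_integrable P g -> sq_integrable P f.
Proof.
move=> mf fg [mg ig]; split => //.
apply: (rintegrable_le measurableT _ ig) => [|w _ /=]; first exact: measurable_funX.
by rewrite ger0_norm ?sqr_ge0// -real_normK ?num_real// lerXn2r ?nnegrE// (le_trans _ (fg w)).
Qed.

Lemma sq_integrable_sum (I : Type) (r : seq I) (f : I -> Omega -> R) :
  (forall i, sq_integrable P (f i)) -> sq_integrable P (fun w => \sum_(i <- r) f i w).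
Proof.
move=> sf; elim: r => [|i r IH].
  by under eq_fun do rewrite big_nil; exact: sq_integrable_cst.
by under eq_fun do rewrite big_cons; exact: sq_integrableD.
Qed.

Lemma sq_integrableE (f : Omega -> R) : sq_integrable P f ->
  (\int[P]_w (f w ^+ 2)%:E = (\int[P]_w (f w ^+ 2))%:E)%E.
Proof. by move=> [_ ig]; rewrite /Rintegral fineK// integrable_fin_num. Qed.

End sq_integrable_more.

Section quartic_sums.
Context d (X : measurableType d) (R : realType) (mu : {measure set X -> \bar R}).
Local Notation H := (L2 mu).

Lemma expr4_ge0 (x : R) : 0 <= x ^+ 4. Proof. exact: exprn_even_ge0. Qed.

(** Iterates (a + b)^4 <= 8 a^4 + 8 b^4. The crude constant is acceptable, because the number of
    terms is fixed before the step tends to 0. *)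
Lemma sum_expr4 n (y : 'I_n -> R) : (\sum_(j < n) y j) ^+ 4 <= 8 ^+ n * \sum_(j < n) y j ^+ 4.
Proof.
elim: n y => [|n IH] y; first by rewrite !big_ord0 mulr0 expr0n.
rewrite !big_ord_recr /=; set a := \sum_(j < n) _; set b := y ord_max.
have h : (a + b) ^+ 4 <= 8 * a ^+ 4 + 8 * b ^+ 4.
  have h1 : (a + b) ^+ 2 <= 2 * a ^+ 2 + 2 * b ^+ 2 by have := sqr_ge0 (a - b); nra.
  have h2 : ((a + b) ^+ 2) ^+ 2 <= (2 * a ^+ 2 + 2 * b ^+ 2) ^+ 2.
    by rewrite lerXn2r ?nnegrE ?sqr_ge0// addr_ge0// mulr_ge0// sqr_ge0.
  rewrite (exprM _ 2 2) (le_trans h2)//.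
  have := sqr_ge0 (a ^+ 2 - b ^+ 2); nra.
apply: (le_trans h); rewrite mulrDr (exprS 8 n) lerD//.
  by rewrite -mulrA ler_wpM2l//; exact: IH.
by rewrite ler_wpM2r ?expr4_ge0// ler_peMr// exprn_ege1// ler1n.
Qed.

Lemma quartic_sum n (y : 'I_n -> R) (v : 'I_n -> H) :
  (quartic (\sum_(j < n) y j *: v j)%R <=
   \sum_(j < n) (8 ^+ n * y j ^+ 4)%:E * quartic (v j))%E.
Proof.
have mL (x : H) := @Lp_fun_measurable _ _ _ mu x.
have E1 : {ae mu, forall z, Lp_fun (\sum_(j < n) y j *: v j) z = \sum_(j < n) y j * Lp_fun (v j) z}.
  elim: n y v => [|n IH] y v.
    by rewrite big_ord0; apply: filterS (@Lp_fun0 _ _ _ mu) => z ->; rewrite big_ord0.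
  rewrite big_ord_recr /=.
  apply: filterS3 (IH (fun j => y (widen_ord (leqnSn n) j)) (fun j => v (widen_ord (leqnSn n) j)))
    (Lp_funZ (y ord_max) (v ord_max))
    (Lp_funD (\sum_(j < n) y (widen_ord (leqnSn n) j) *: v (widen_ord (leqnSn n) j)) (y ord_max *: v ord_max)).
  by move=> z e1 e2 ->; rewrite e1 e2 big_ord_recr.
rewrite /quartic (ae_eq_integral (fun z => ((\sum_(j < n) y j * Lp_fun (v j) z) ^+ 4)%:E))//; first last.
- by apply: filterS E1 => z -> _.
- apply/measurable_EFinP/measurable_funX/measurable_sum => j.
  exact: measurable_funM.
- by apply/measurable_EFinP/measurable_funX.
apply: (@le_trans _ _ (\int[mu]_z (\sum_(j < n) (8 ^+ n * y j ^+ 4 * Lp_fun (v j) z ^+ 4)%:E)%E)%E).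
  apply: ge0_le_integral => //.
  - by move=> z _; rewrite lee_fin expr4_ge0.
  - apply/measurable_EFinP/measurable_funX/measurable_sum => j.
    exact: measurable_funM.
  - under eq_fun do rewrite sumEFin; apply/measurable_EFinP/measurable_sum => j.
    by apply: measurable_funM => //; exact: measurable_funX.
  - move=> z _; rewrite sumEFin lee_fin (le_trans (sum_expr4 _))// mulr_sumr.
    by rewrite ler_sum// => j _; rewrite exprMn mulrA.
rewrite ge0_integral_sum//.
- apply: lee_sum => j _; rewrite ge0_integral_scale//.
  + by rewrite mulr_ge0 ?expr4_ge0// exprn_ge0.
  + exact: measurable_funX.
  + by move=> z; exact: expr4_ge0.
- move=> j; apply/measurable_EFinP; apply: measurable_funM => //; exact: measurable_funX.
- by move=> j z _; rewrite lee_fin mulr_ge0 ?expr4_ge0// mulr_ge0 ?expr4_ge0// exprn_ge0.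
Qed.

End quartic_sums.

Lemma combine_bounds (R : realType) (A a b q k1 k2 k3 : R) (I J : \bar R) :
  0 <= A -> 0 <= a -> 0 <= b -> (0 <= I)%E -> (0 <= J)%E ->
  (k1%:E <= a%:E * (I + J))%E -> (k2%:E <= q%:E)%E -> (k3%:E <= b%:E * J)%E ->
  ((A * (k1 + k2 + k3))%:E <= (A * (a + b))%:E * (I + J) + (A * q)%:E)%E.
Proof.
move=> A0 a0 b0 I0 J0 h1 h2 h3; have IJ0 : (0 <= I + J)%E by exact: adde_ge0.
have h3' : (k3%:E <= b%:E * (I + J))%E.
  by apply: le_trans h3 _; apply: lee_wpmul2l; rewrite ?lee_fin// leeDr.
have -> : (A * (a + b))%:E = (A%:E * (a + b)%:E)%E by [].
have -> : (A * q)%:E = (A%:E * q%:E)%E by [].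
have -> : (A * (k1 + k2 + k3))%:E = (A%:E * (k1%:E + k2%:E + k3%:E))%E by [].
have q_def : ((a + b)%:E * (I + J) +? q%:E)%E by exact: fin_num_adde_defl.
rewrite -muleA -muleDr//; apply: lee_wpmul2l => //.
rewrite EFinD ge0_muleDl ?lee_fin// addeAC.
by apply: leeD => //; exact: leeD.
Qed.

Section stochastic_step.
Context d (Omega : measurableType d) (R : realType) (P : probability Omega R).
Context (T : R) (Ft : R -> set (set Omega)) (Ft_filtration : complete_filtration P T Ft).
Context (U : hilbertType R) (e : onbasis U).
Context (W : R -> U -> Omega -> R) (W_Wiener : cylindrical_Wiener P T Ft W).
Context d' (X : measurableType d') (mu : {measure set X -> \bar R}).
Local Notation H := (L2 mu).
Hypothesis H_separable : separable H.
Local Notation RT := (measurableTypeR R).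
Local Notation c2 := (normal_moment R 2).
Local Notation c4 := (normal_moment R 4).
Implicit Types s : elementary T Ft H.

Section one_step.
Variables s' t : R.
Hypotheses (s'0 : 0 <= s') (s't : s' <= t) (tT : t <= T).
Local Notation Delta s := (el_Delta e W s s' t).

Let Bj s j w := el_coef s t j w *
  increment W (el_lo s s' t j) (el_hi s s' t j) (e (el_index s j)) w.

Let DeltaE s w : Delta s w = \sum_(j < el_size s) Bj s j w *: el_val s j.
Proof. by rewrite /el_Delta el_increment. Qed.

Let sT : 0 <= s' <= T. Proof. by rewrite s'0 (le_trans s't). Qed.

Let loT s j : 0 <= el_lo s s' t j <= T.
Proof.
rewrite el_lo_ge0//=; apply: le_trans (el_hi_leT s s't tT j); exact: el_lo_hi.
Qed.

Let sB s j : sq_integrable P (Bj s j).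
Proof.
apply: (@sq_integrable_bounded_mul _ _ _ _ 1).
- apply: Borel_map_measurable; apply: (adapted_at_Borel Ft_filtration (loT s j)).
  exact: (el_coef_adapted Ft_filtration).
- exact: el_coef_le1.
- by apply: (increment_sq_integrable Ft_filtration W_Wiener);
    [exact: el_lo_ge0|exact: el_lo_hi|exact: el_hi_leT].
Qed.

Lemma el_Delta_sq_integrable s : sq_integrable P (fun w => `|Delta s w|).
Proof.
apply: (@sq_integrable_le _ _ _ _ _ (fun w => \sum_(j < el_size s) `|el_val s j| * `|Bj s j w|)).
- by apply: Borel_map_norm; exact: (el_Delta_Borel Ft_filtration).
- move=> w; rewrite normr_id DeltaE (le_trans (ler_norm_sum _ _ _))// ler_sum// => j _.
  by rewrite normrZ mulrC.
- apply: sq_integrable_sum => j; apply: sq_integrableZ.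
  apply: (@sq_integrable_le _ _ _ _ _ (fun w => `|Bj s j w|)) => [|w|].
  + by apply: measurableT_comp => //; have [] := sB s j.
  + by rewrite normr_id.
  + have [mB iB] := sB s j; split; first exact: measurableT_comp.
    by move: iB; apply: eq_integrable => // w _ /=; rewrite real_normK ?num_real.
Qed.

(** The fourth moment of a Brownian increment is of order (t - s')^2, which makes this term
    negligible after division by the step. The measurable majorant b stands in for the quartic
    integral of the random increment. *)
Lemma el_quartic_bound s : (forall j, (quartic (el_val s j) < +oo)%E) ->
  exists b : Omega -> R, [/\ measurable_fun setT b, forall w, 0 <= b w,
    forall w, (quartic (Delta s w) <= (b w)%:E)%E &
    (\int[P]_w (b w)%:E <= (8 ^+ el_size s * c4 *
       (\sum_(j < el_size s) fine (quartic (el_val s j))) * (t - s') ^+ 2)%:E)%E].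
Proof.
move=> q4; set m := el_size s; pose q j := fine (quartic (el_val s j)).
have qE j : quartic (el_val s j) = (q j)%:E by rewrite /q fineK// ge0_fin_numE// quartic_ge0.
have q0 j : 0 <= q j by exact/fine_ge0/quartic_ge0.
have mB j : measurable_fun setT (Bj s j) by have [] := sB s j.
have c0 : 0 <= 8 ^+ m :> R by exact: exprn_ge0.
have t0 j w : 0 <= 8 ^+ m * q j * Bj s j w ^+ 4 by rewrite mulr_ge0 ?expr4_ge0// mulr_ge0.
have mt j : measurable_fun setT (fun w => 8 ^+ m * q j * Bj s j w ^+ 4).
  by apply: measurable_funM => //; exact: measurable_funX.
exists (fun w => \sum_(j < m) 8 ^+ m * q j * Bj s j w ^+ 4); split.
- exact: measurable_sum.
- by move=> w; exact: sumr_ge0.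
- move=> w; rewrite DeltaE (le_trans (quartic_sum _ _))// -sumEFin.
  by apply: lee_sum => j _; rewrite qE -EFinM lee_fin mulrAC.
under eq_integral do rewrite -sumEFin.
rewrite ge0_integral_sum//; last 2 first.
- by move=> j; exact/measurable_EFinP.
- by move=> j w _; rewrite lee_fin.
rewrite mulr_sumr mulr_suml -sumEFin; apply: lee_sum => j _.
rewrite ge0_integral_scale ?mulr_ge0//; [|exact: measurable_funX|by move=> w; exact: expr4_ge0].
rewrite -/(q j) (_ : 8 ^+ m * c4 * q j * (t - s') ^+ 2 =
  (8 ^+ m * q j) * (c4 * (t - s') ^+ 2)); last by ring.
rewrite [leRHS]EFinM; apply: lee_wpmul2l.
  by rewrite lee_fin mulr_ge0.
have h1 : 0 <= el_lo s s' t j by exact: el_lo_ge0.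
have h2 : el_lo s s' t j <= el_hi s s' t j by exact: el_lo_hi.
have h3 : el_hi s s' t j <= T by exact: el_hi_leT.
have incr4 := increment_moment4 Ft_filtration W_Wiener (e (el_index s j)) h1 h2 h3.
apply: (@le_trans _ _ (\int[P]_w (increment W (el_lo s s' t j) (el_hi s s' t j)
   (e (el_index s j)) w ^+ 4)%:E)%E).
  apply: ge0_le_integral => //.
  - by move=> w _; rewrite lee_fin expr4_ge0.
  - by apply/measurable_EFinP; exact: measurable_funX.
  - apply/measurable_EFinP; apply: measurable_funX.
    by apply: (increment_measurable Ft_filtration W_Wiener);
      [exact: el_lo_ge0|exact: el_lo_hi|exact: el_hi_leT].
  - move=> w _; rewrite lee_fin exprMn ler_piMl ?expr4_ge0// -[leLHS]ger0_norm ?expr4_ge0//.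
    by rewrite normrX exprn_ile1// el_coef_le1.
rewrite incr4 lee_fin -hdotxx onvec_orthonormal eqxx mulr1 mulrC.
rewrite ler_wpM2l ?(normal_moment_ge0 R 2)// lerXn2r ?nnegrE ?subr_ge0//.
by apply: lerB; [exact: el_hi_le|exact: el_lo_ge].
Qed.

Lemma el_Delta_centered s (D : Omega -> H) : adapted_at Ft s' D -> sq_integrable P (fun w => `|D w|) ->
  \int[P]_w L2_dot (D w) (Delta s w) = 0.
Proof.
move=> aD sD; pose L j w := L2_dot (D w) (el_val s j).
have aL j : adapted_at Ft s' (L j).
  apply: (@Borel_map_comp _ (g_sigma_algebraType (Ft s')) H R D (fun h : H => L2_dot h (el_val s j))) => //.
  apply: (@lip_continuous _ H R^o _ `|el_val s j|) => x y.
  by rewrite -L2_dotBl mulrC; exact: L2_dot_le.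
have sL j : sq_integrable P (L j).
  apply: (@sq_integrable_le _ _ _ _ _ (fun w => `|el_val s j| * `|D w|)).
  - by apply: Borel_map_measurable; exact: (adapted_at_Borel Ft_filtration sT).
  - by move=> w; rewrite mulrC; exact: L2_dot_le.
  - exact: sq_integrableZ.
transitivity (\int[P]_w (\sum_(j < el_size s) (L j w * Bj s j w))).
  apply: eq_Rintegral => w _; rewrite DeltaE L2_dot_sumr; apply: eq_bigr => j _.
  by rewrite L2_dotZr mulrC.
rewrite Rintegral_sum// => [|j]; last exact: sq_integrable_mul.
apply: big1 => j _; under eq_Rintegral do rewrite mulrA.
have lT := loT s j.
have aLlo : adapted_at Ft (el_lo s s' t j) (L j).
  by apply: (adapted_at_le Ft_filtration s'0 _ _ (aL j)); [exact: el_lo_ge|case/andP: lT].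
apply: (increment_centered Ft_filtration W_Wiener).
- exact: el_lo_ge0.
- exact: el_lo_hi.
- exact: el_hi_leT.
- by apply: adaptedM => //; exact: (el_coef_adapted Ft_filtration).
- under eq_fun do rewrite mulrC.
  apply: (@sq_integrable_bounded_mul _ _ _ _ 1) => //.
    apply: Borel_map_measurable; apply: (adapted_at_Borel Ft_filtration lT).
    exact: (el_coef_adapted Ft_filtration).
  exact: el_coef_le1.
Qed.


Variables (s_ : nat -> elementary T Ft H) (Phi : Omega -> R -> nat -> H) (M : Omega -> R -> H).
Hypothesis approx : stochastic_approx P e W s_ Phi M.
Local Notation DM w := (M w t - M w s').

Let bDM : Borel_map (fun w => DM w).
Proof.
have [_ bM _ _] := approx.
by apply: Borel_mapB => //; apply: bM; rewrite ?tT ?(le_trans s'0)//; case/andP: sT.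
Qed.

Let sq_dist s : (\int[P]_w (`|Delta s w - DM w| ^+ 2)%:E < +oo)%E ->
  sq_integrable P (fun w => `|Delta s w - DM w|).
Proof.
move=> h; apply: sq_integrable_lty => //; apply: Borel_map_norm; apply: Borel_mapB => //.
exact: (el_Delta_Borel Ft_filtration).
Qed.

Let cvg_dist := approx_Delta_cvg Ft_filtration W_Wiener H_separable s'0 s't tT approx.

Lemma stochastic_sq_integrable : sq_integrable P (fun w => `|DM w|).
Proof.
have [n hn] := cvge0_lt cvg_dist ltr01.
have sd := sq_dist (lt_trans (hn n (leqnn n)) (ltry 1)).
apply: (@sq_integrable_le _ _ _ _ _ (fun w => `|Delta (s_ n) w| + `|Delta (s_ n) w - DM w|)).
- exact: Borel_map_norm.
- move=> w; rewrite normr_id; apply: le_trans (ler_normB _ _).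
  by rewrite subKr.
- by apply: sq_integrableD => //; exact: el_Delta_sq_integrable.
Qed.

(** Elementary increments are centred; the error of the approximation is absorbed by Young's
    inequality with a small parameter. *)
Lemma stochastic_centered (D : Omega -> H) : adapted_at Ft s' D ->
  sq_integrable P (fun w => `|D w|) ->
  P.-integrable setT (EFin \o (fun w => L2_dot (D w) (DM w))) /\
  \int[P]_w L2_dot (D w) (DM w) = 0.
Proof.
move=> aD sD; have bD : Borel_map D by exact: (adapted_at_Borel Ft_filtration sT).
have mdot (f g : Omega -> H) : Borel_map f -> Borel_map g ->
    measurable_fun setT (fun w => L2_dot (f w) (g w)).
  move=> bf bg; apply: Borel_map_measurable.
  by apply: (Borel_map_comp2 (h := fun z => L2_dot z.1 z.2) H_separable H_separable bf bg);
    exact: L2_dot_continuous.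
have idot (f g : Omega -> H) : Borel_map f -> Borel_map g ->
    sq_integrable P (fun w => `|f w|) -> sq_integrable P (fun w => `|g w|) ->
    P.-integrable setT (EFin \o (fun w => L2_dot (f w) (g w))).
  move=> bf bg sf sg; apply: (rintegrable_le measurableT (mdot _ _ bf bg)
    (sq_integrable_mul sf sg)) => w _; exact: L2_dot_le.
have iM := idot _ _ bD bDM sD stochastic_sq_integrable.
split => //; apply/eqP; rewrite -normr_le0; apply/ler_addgt0Pr => eps eps0; rewrite add0r.
pose A := \int[P]_w (`|D w| ^+ 2).
have A0 : 0 <= A by apply: Rintegral_ge0 => w _; exact: sqr_ge0.
(* Each of the two terms of Young's inequality then contributes at most eps / 2. *)
pose eta := eps / (A + 1).
have eta0 : 0 < eta by rewrite divr_gt0// ltr_wpDl.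
have ee : 0 < eps * eta by rewrite mulr_gt0.
have [n hn] := cvge0_lt cvg_dist ee; have {}hn := hn n (leqnn n).
have sd := sq_dist (lt_trans hn (ltry _)).
have bDs : Borel_map (Delta (s_ n)) by exact: (el_Delta_Borel Ft_filtration).
have bdiff : Borel_map (fun w => Delta (s_ n) w - DM w) by exact: Borel_mapB.
have i1 := idot _ _ bD bDs sD (el_Delta_sq_integrable (s_ n)).
have i2 := idot _ _ bD bdiff sD sd.
have -> : \int[P]_w L2_dot (D w) (DM w) =
    \int[P]_w (L2_dot (D w) (Delta (s_ n) w) - L2_dot (D w) (Delta (s_ n) w - DM w)).
  by apply: eq_Rintegral => w _; rewrite -L2_dotBr subKr.
rewrite RintegralB// el_Delta_centered// sub0r normrN.
apply: le_trans (le_normr_Rintegral _ _) _ => //.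
have [mD iD] := sD; have [mdf idf] := sd.
apply: (@le_trans _ _ (\int[P]_w (eta / 2 * `|D w| ^+ 2 +
   (2 * eta)^-1 * `|Delta (s_ n) w - DM w| ^+ 2))).
  apply: le_Rintegral => //.
  - by have := integrable_norm i2; apply: eq_integrable.
  - by apply: rintegrableD => //; exact: rintegrableZ.
  move=> w _; apply: le_trans (L2_dot_le _ _) _; rewrite -subr_ge0.
  set x := `|D w|; set y := `|_ - _|.
  have -> : eta / 2 * x ^+ 2 + (2 * eta)^-1 * y ^+ 2 - x * y = (2 * eta)^-1 * (eta * x - y) ^+ 2.
    by field; rewrite gt_eqF.
  by rewrite mulr_ge0 ?sqr_ge0// invr_ge0 mulr_ge0// ltW.
rewrite RintegralD//; [|exact: rintegrableZ..].
rewrite !RintegralZl// -/A.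
have h2 : \int[P]_w (`|Delta (s_ n) w - DM w| ^+ 2) <= eps * eta.
  by rewrite -lee_fin -sq_integrableE// ltW.
apply: (@le_trans _ _ (eps / 2 + (2 * eta)^-1 * (eps * eta))).
  apply: lerD; last by rewrite ler_wpM2l// invr_ge0 mulr_ge0// ltW.
  rewrite /eta mulrAC ler_wpM2r// mulrAC ler_pdivrMr ?ltr_wpDl// ler_pM2l// lerDl//.
by rewrite le_eqVlt; apply/orP; left; apply/eqP; field; rewrite gt_eqF.
Qed.

Local Notation Phi_ a := (`|nemytskii (@tf_g R) a| ^+ 2).

Let L2_dot_sum2 (I : Type) (r : seq I) (c : I -> R) (u : I -> H) :
  L2_dot (\sum_(i <- r) c i *: u i) (\sum_(i <- r) c i *: u i) =
  \sum_(i <- r) \sum_(j <- r) c i * c j * L2_dot (u i) (u j).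
Proof.
rewrite L2_dot_sumr exchange_big; apply: eq_bigr => j _ /=.
rewrite L2_dotZr L2_dotC L2_dot_sumr mulr_sumr; apply: eq_bigr => i _.
by rewrite L2_dotZr (L2_dotC (u j)); ring.
Qed.

Let kmul_sum a (I : Type) (r : seq I) (c : I -> R) (u : I -> H) :
  kmul a (\sum_(i <- r) c i *: u i) = \sum_(i <- r) c i *: kmul a (u i).
Proof.
elim: r => [|i r IH]; last by rewrite !big_cons kmulZD IH.
rewrite !big_nil; have := kmulZD a (-1) 0 0.
by rewrite scaler0 addr0 scaleN1r addNr.
Qed.

(** The isometry for the form weighted by k(a). Replacing the elementary integrand by Phi costs the
    factor 2 and, as [kmul] is a contraction, the unweighted distance. *)
Lemma kmul_Delta_bound s (a : Omega -> H) (b : Omega * RT -> \bar R) :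
  (forall j, (quartic (el_val s j) < +oo)%E) -> adapted_at Ft s' a ->
  measurable_fun setT b -> (forall z, (0 <= b z)%E) ->
  (forall n w r, s' < r -> r <= t ->
    ((\sum_(k < n) `|kmul (a w) (Phi w r k)| ^+ 2)%:E <= b (w, r))%E) ->
  (\int[P]_w (`|kmul (a w) (Delta s w)| ^+ 2)%:E <=
    (2 * c2)%:E * (iterated P `]s', t] b + iterated P `]s', t] (el_dist e s Phi)))%E.
Proof.
move=> q4 aa mb b0 Pb; have [bP _ _ _] := approx.
have ak (Om := g_sigma_algebraType (Ft s')) j : @Borel_map _ Om H (fun w => kmul (a w) (el_val s j)).
  apply: (@Borel_map_comp _ Om H H a (fun h : H => kmul h (el_val s j))) => //.
  exact: kmul_continuous.
have aK i j : adapted_at Ft s' (fun w => L2_dot (kmul (a w) (el_val s i)) (kmul (a w) (el_val s j))).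
  by apply: (Borel_map_comp2 (h := fun z => L2_dot z.1 z.2) H_separable H_separable (ak i) (ak j));
    exact: L2_dot_continuous.
have [||||n isoE] := @el_isometry _ _ _ P _ _ Ft_filtration _ e _ W_Wiener _ s s' t
  s'0 s't tT (fun w x y => L2_dot (kmul (a w) x) (kmul (a w) y)).
- by move=> w c x y z; rewrite kmulZD L2_dotDl L2_dotZl.
- by move=> w x y; exact: L2_dotC.
- move=> x y; exists (`|x| * `|y|) => w; apply: le_trans (L2_dot_le _ _) _.
  by rewrite ler_pM// kmul_norm.
- exact: aK.
under eq_integral do rewrite L2_normE.
rewrite isoE (_ : (2 * c2)%:E = (c2%:E * 2%:E)%E); last by rewrite -EFinM mulrC.
rewrite -muleA; apply: lee_wpmul2l; first by rewrite lee_fin (normal_moment_ge0 R 1).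
have mI : measurable (`]s', t] : set RT) by exact: measurable_itv.
have md : measurable_fun setT (el_dist e s Phi).
  by apply: measurable_sqsum => k; apply: Borel_mapB => //; exact: (el_fun_Borel Ft_filtration).
have d0 z : (0 <= el_dist e s Phi z)%E by exact: sqsum_ge0.
rewrite -iteratedD// -iteratedZ//; last 2 first.
- exact: emeasurable_funD.
- by move=> z; exact: adde_ge0.
apply: (@le_iterated _ _ _ P _ mI (fun z => (\sum_(k < n)
   L2_dot (kmul (a z.1) (el_fun e s z.1 z.2 (e k))) (kmul (a z.1) (el_fun e s z.1 z.2 (e k))))%:E)).
- apply/measurable_EFinP/measurable_sum => k.
  under eq_fun do rewrite /el_fun kmul_sum L2_dot_sum2.
  apply: measurable_sum => i; apply: measurable_sum => j.
  have mc l : measurable_fun setT (fun z : Omega * RT => (\1_(el_event s l) z.1 *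
     \1_(`]el_start s l, el_end s l]) z.2 * hdot (e (el_index s l)) (e k) : R)).
    apply: measurable_funM => //; apply: measurable_funM.
      apply: (@measurableT_comp _ _ _ _ _ _ (\1_(el_event s l) : Omega -> R)) => //.
      by apply: measurable_indic; exact: (el_event_measurable Ft_filtration).
    by apply: (@measurableT_comp _ _ _ _ _ _ (\1_(`]el_start s l, el_end s l]) : RT -> R)).
  apply: measurable_funM; first exact: measurable_funM.
  apply: (@measurableT_comp _ _ _ _ _ _ (fun w => L2_dot (kmul (a w) (el_val s i))
     (kmul (a w) (el_val s j)))) => //.
  by apply: Borel_map_measurable; exact: (adapted_at_Borel Ft_filtration sT (@aK i j)).
- by apply: measurable_funeM; exact: emeasurable_funD.
- by move=> z; rewrite lee_fin; apply: sumr_ge0 => k _; rewrite -L2_normE sqr_ge0.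
- move=> w r; rewrite /= in_itv/= => /andP[s'r rt].
  apply: (@le_trans _ _ (2%:E * ((\sum_(k < n) `|kmul (a w) (Phi w r k)| ^+ 2)%:E +
     (\sum_(k < n) `|el_fun e s w r (e k) - Phi w r k| ^+ 2)%:E))%E).
    rewrite -EFinD -EFinM lee_fin mulrDr !mulr_sumr -big_split/=; apply: ler_sum => k _.
    rewrite -L2_normE; set x := el_fun _ _ _ _ _; set y := Phi w r k.
    rewrite (_ : kmul (a w) x = kmul (a w) y + kmul (a w) (x - y)); last first.
      by rewrite -kmulD addrC subrK.
    apply: le_trans (norm_sqr_le2 _ _) _; rewrite lerD2l ler_wpM2l//.
    by rewrite lerXn2r ?nnegrE// kmul_norm.
  apply: lee_wpmul2l => //; apply: leeD; first exact: Pb.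
  by rewrite -sumEFin; exact: sqsum_sum_le.
- by move=> z; rewrite mule_ge0// adde_ge0.
Qed.

(** The linear Taylor term has mean zero. The weighted, quartic and distance terms are bounded by
    [kmul_Delta_bound], [el_quartic_bound] and [Delta_M_dist]; the first and the last give 2400 =
    400 (2 + 4). *)
Lemma stochastic_step s (a : Omega -> H) (b : Omega * RT -> \bar R) :
  (forall j, (quartic (el_val s j) < +oo)%E) ->
  adapted_at Ft s' a -> sq_integrable P (fun w => `|a w|) ->
  measurable_fun setT b -> (forall z, (0 <= b z)%E) ->
  (forall n w r, s' < r -> r <= t ->
    ((\sum_(k < n) `|kmul (a w) (Phi w r k)| ^+ 2)%:E <= b (w, r))%E) ->
  (\int[P]_w (Phi_ (a w + DM w))%:E <= \int[P]_w (Phi_ (a w))%:E +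
    (2400 * c2)%:E * (iterated P `]s', t] b + iterated P `]s', t] (el_dist e s Phi)) +
    (400 * (8 ^+ el_size s * c4 * (\sum_(j < el_size s) fine (quartic (el_val s j)))
       * (t - s') ^+ 2))%:E)%E.
Proof.
move=> q4 aa sa mb b0 Pb; have [bq [mbq bq0 bqD Ebq]] := el_quartic_bound q4.
have sM := stochastic_sq_integrable; have sN := el_Delta_sq_integrable s.
have ba : Borel_map a by exact: (adapted_at_Borel Ft_filtration sT).
have bN : Borel_map (Delta s) by exact: (el_Delta_Borel Ft_filtration).
have g0 : @tf_g R 0 = 0 by rewrite /tf_g mul0r.
have s0 : @tf_sigma R 0 = 0 by exact: tf_sigma_le0.
have cg : continuous (nemytskii (mu := mu) (@tf_g R)).
  by apply: (nemytskii_continuous g0 ler01); exact: tf_g_lip.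
have cs : continuous (nemytskii (mu := mu) (@tf_sigma R)).
  by apply: (nemytskii_continuous s0 (ler0n R 12)); exact: tf_sigma_lip.
have sqPhi (f : Omega -> H) : Borel_map f -> sq_integrable P (fun w => `|f w|) ->
    sq_integrable P (fun w => `|nemytskii (@tf_g R) (f w)|).
  move=> bf sf; apply: (sq_integrable_le _ _ sf) => [|w].
    apply: Borel_map_norm; exact: (Borel_map_comp cg bf).
  by rewrite normr_id -[leRHS]mul1r; apply: nemytskii_norm => //; exact: tf_g_lip.
have baM : Borel_map (fun w => a w + DM w) by exact: Borel_mapD.
have saM : sq_integrable P (fun w => `|a w + DM w|).
  apply: (sq_integrable_le _ _ (sq_integrableD sa sM)) => [|w].
    exact: Borel_map_norm.
  by rewrite normr_id ler_normD.
have s1 := sqPhi _ baM saM; have s2 := sqPhi _ ba sa.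
have aS : adapted_at Ft s' (fun w => nemytskii (@tf_sigma R) (a w)).
  exact: (@Borel_map_comp _ (g_sigma_algebraType (Ft s')) H H a (nemytskii (@tf_sigma R))).
have sS : sq_integrable P (fun w => `|nemytskii (@tf_sigma R) (a w)|).
  apply: (sq_integrable_le _ _ (sq_integrableZ 12 sa)) => [|w].
    by apply: Borel_map_norm; exact: (adapted_at_Borel Ft_filtration sT).
  by rewrite normr_id; apply: nemytskii_norm => //; exact: tf_sigma_lip.
have [iS ES] := stochastic_centered aS sS.
have sdist : sq_integrable P (fun w => `|DM w - Delta s w|).
  apply: (sq_integrable_le _ _ (sq_integrableD sM sN)) => [|w].
    by apply: Borel_map_norm; exact: Borel_mapB.
  by rewrite normr_id ler_normB.
have ibq : P.-integrable setT (EFin \o bq).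
  apply/integrableP; split; first exact/measurable_EFinP.
  under eq_integral do rewrite /= ger0_norm//.
  by apply: le_lt_trans Ebq _; exact: ltry.
have skm : sq_integrable P (fun w => `|kmul (a w) (Delta s w)|).
  apply: (sq_integrable_le _ _ sN) => [|w]; last by rewrite normr_id kmul_norm.
  (* Measurability of [kmul] in its first argument is known against vectors of finite quartic
     integral, so the norm is expanded over the finitely many values of s. *)
  have -> : (fun w => `|kmul (a w) (Delta s w)|) = (fun w => Num.sqrt
     (\sum_(i < el_size s) \sum_(j < el_size s) Bj s i w * Bj s j w *
        L2_dot (kmul (a w) (el_val s i)) (kmul (a w) (el_val s j)))).
    apply/funext => w; rewrite DeltaE kmul_sum -L2_dot_sum2 -L2_normE sqrtr_sqr.
    by rewrite normr_id.
  apply: (@measurableT_comp _ _ _ _ _ _ (@Num.sqrt R)).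
    by apply: continuous_measurable_fun; exact: sqrt_continuous.
  have bk j : Borel_map (fun w => kmul (a w) (el_val s j)).
    exact: (@Borel_map_comp _ _ _ _ a (fun h : H => kmul h (el_val s j)) (kmul_continuous (q4 j)) ba).
  have mB j : measurable_fun setT (Bj s j) by have [] := sB s j.
  apply: measurable_sum => i; apply: measurable_sum => j.
  apply: measurable_funM; first exact: measurable_funM.
  apply: Borel_map_measurable.
  by apply: (Borel_map_comp2 (h := fun z => L2_dot z.1 z.2) H_separable H_separable (bk i) (bk j));
    exact: L2_dot_continuous.
rewrite (sq_integrableE s1) (sq_integrableE s2).
apply: (@le_trans _ _ (\int[P]_w Phi_ (a w) + 0 + 400 * (\int[P]_w (`|kmul (a w) (Delta s w)| ^+ 2) +
   \int[P]_w bq w + \int[P]_w (`|DM w - Delta s w| ^+ 2)))%:E).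
  rewrite -ES lee_fin; have [_ i1] := s1; have [_ i2] := s2; have [_ i3] := skm.
  have [_ i4] := sdist.
  have i5 := rintegrableD measurableT (rintegrableD measurableT i3 ibq) i4.
  rewrite -!RintegralD//; [|exact: rintegrableD..].
  rewrite -RintegralZl// -RintegralD//; [|exact: rintegrableD|exact: rintegrableZ].
  apply: le_Rintegral => //.
    by apply: rintegrableD => //; [exact: rintegrableD|exact: rintegrableZ].
  move=> w _; apply: le_trans (taylor_integral (a w) (DM w) (le_lt_trans (bqD w) (ltry _))) _.
  have hq : fine (quartic (Delta s w)) <= bq w.
    have qf : quartic (Delta s w) \is a fin_num.
      by rewrite ge0_fin_numE ?quartic_ge0//; apply: le_lt_trans (bqD w) (ltry _).
    by rewrite -lee_fin fineK.
  exact: (lerD (lexx _) (ler_wpM2l (ler0n R 400) (lerD (lerD (lexx _) hq) (lexx _)))).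
rewrite addr0 EFinD -addeA; apply: leeD => //.
rewrite (_ : 2400 * c2 = 400 * (2 * c2 + 4 * c2)); last by ring.
have c20 : 0 <= c2 := normal_moment_ge0 R 1.
have iE : (\int[P]_w bq w)%:E = (\int[P]_w (bq w)%:E)%E.
  by rewrite /Rintegral fineK// integrable_fin_num.
have k3 : ((\int[P]_w (`|DM w - Delta s w| ^+ 2))%:E <=
    (4 * c2)%:E * iterated P `]s', t] (el_dist e s Phi))%E.
  rewrite -(sq_integrableE sdist); under eq_integral do rewrite distrC.
  exact: (Delta_M_dist Ft_filtration W_Wiener H_separable s'0 s't tT approx s).
have k1 := kmul_Delta_bound q4 aa mb b0 Pb; rewrite (sq_integrableE skm) in k1.
rewrite -iE in Ebq.
apply: (combine_bounds (ler0n R 400) (mulr_ge0 (ler0n R 2) c20) (mulr_ge0 (ler0n R 4) c20)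
  (iterated_ge0 P _ b0) (iterated_ge0 P _ _) k1 Ebq k3) => z.
exact: sqsum_ge0.
Qed.



End one_step.
End stochastic_step.

(** * Continuous paths and Gronwall *)

Section clamp.
Context (R : realType).

(** Composing with it freezes a path outside [a, b], which gives continuity on the whole line and
    spares boundary cases. *)
Definition clamp (a b s : R) : R := Num.max a (Num.min s b).

Lemma clamp_itv a b s : a <= b -> a <= clamp a b s <= b.
Proof. by move=> ab; rewrite /clamp le_max lexx ge_max ab ge_min lexx orbT. Qed.

Lemma clamp_id a b s : a <= s <= b -> clamp a b s = s.
Proof. by move=> /andP[as_ sb]; rewrite /clamp (min_idPl sb); exact/max_idPr. Qed.

Lemma clamp_lip a b r s : `|clamp a b r - clamp a b s| <= `|r - s|.
Proof.
wlog rs : r s / s <= r.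
  move=> H; have /orP[rs|sr] := le_total s r; first exact: H.
  by rewrite distrC (distrC r); exact: H.
have m : clamp a b s <= clamp a b r.
  rewrite /clamp ge_max le_max lexx/= le_max; apply/orP; right.
  by rewrite le_min !ge_min rs lexx orbT.
rewrite !ger0_norm ?subr_ge0// /clamp lerBlDr ge_max; apply/andP; split.
  by rewrite -[leLHS]add0r lerD ?subr_ge0// le_max lexx.
have [sb|bs] := leP s b.
  apply: (@le_trans _ _ r); first by rewrite ge_min lexx.
  have : s <= Num.max a s by rewrite le_max lexx orbT.
  by set m2 := Num.max a s; lra.
rewrite (min_idPr (le_trans (ltW bs) rs)) -[leLHS]add0r lerD ?subr_ge0//.
by rewrite le_max lexx orbT.
Qed.

Lemma clamp_continuous a b : continuous (clamp a b).
Proof.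
by apply: (@lip_continuous _ R^o R^o _ 1) => r s; rewrite mul1r; exact: clamp_lip.
Qed.

Lemma within_clamp (E : topologicalType) (f : R -> E) a b : a <= b ->
  {within `[a, b], continuous f} -> continuous (fun s => f (clamp a b s)).
Proof.
move=> ab /subspace_continuousP cf s B fB.
have ms := clamp_itv s ab.
have := cf (clamp a b s); rewrite /= in_itv/= => /(_ ms _ fB).
rewrite /within/= => near_c.
have hc : \forall r \near s, `[a, b]%classic (clamp a b r) -> B (f (clamp a b r)).
  exact: (@clamp_continuous a b s _ near_c).
apply: filterS hc => r /=; apply; rewrite in_itv/=; exact: clamp_itv.
Qed.

End clamp.

(** * Measurable suprema and moduli of continuity of paths *)

Section rational_suprema.
Context (R : realType).

Definition nth_rational (i : nat) : R := if unpickle i is Some q then ratr q else 0.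

Lemma le_rational (g : R -> R) c : continuous g -> (forall i, g (nth_rational i) <= c) ->
  forall x, g x <= c.
Proof.
move=> cg gc x; rewrite leNgt; apply/negP => cx.
have op : open [set y | c < g y].
  apply: (@open_comp _ _ g [set y | c < y]); first by move=> y _; exact: cg.
  exact: open_gt.
have [y [cy [q _ qy]]] := @dense_rat R _ (ex_intro _ x cx) op.
have := gc (pickle q); rewrite /nth_rational pickleK qy leNgt; move: cy => /= ->.
by [].
Qed.

Lemma le_sups (u : nat -> R) (c : R) : (forall i, u i <= c) -> forall i, u i <= sups u 0.
Proof.
move=> uc i; apply: ub_le_sup; last by exists i.
by exists c => _ [j _ <-].
Qed.

Lemma sups_le (u : nat -> R) (c : R) : (forall i, u i <= c) -> sups u 0 <= c.
Proof. by move=> uc; apply: ge_sup => [|_ [j _ <-]//]; exists (u 0%N); exists 0%N. Qed.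

End rational_suprema.

Lemma norm_comp_continuous (R : realType) (E : normedModType R) (f : R -> E) :
  continuous f -> continuous (fun s => `|f s|).
Proof. by move=> cf s; apply: cvg_norm; exact: cf. Qed.

Section paths.
Context d (Omega : measurableType d) (R : realType) (E : normedModType R).
Variables (T : R) (X : Omega -> R -> E).
Hypotheses (T0 : 0 <= T) (cX : forall w, continuous (X w))
  (X_clamp : forall w s, X w s = X w (clamp 0 T s))
  (bX : forall s, Borel_map (X ^~ s)) (sE : separable E).
Local Notation h n := (n.+1%:R^-1 : R).

Lemma path_bounded w : exists B, forall s, `|X w s| <= B.
Proof.
have cn : {within `[0, T], continuous (fun s => `|X w s|)}.
  by apply: continuous_subspaceT; apply: norm_comp_continuous; exact: cX.
have [c _ cmax] := EVT_max T0 cn.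
by exists `|X w c| => s; rewrite X_clamp; apply: cmax; rewrite in_itv/=; exact: clamp_itv.
Qed.

(** A countable supremum, hence measurable; by continuity it bounds the path at all times. *)
Definition path_sup w : R := sups (fun i => `|X w (nth_rational R i)|) 0.

Lemma le_path_sup w s : `|X w s| <= path_sup w.
Proof.
have [B XB] := path_bounded w.
apply: (@le_rational R (fun s => `|X w s|)).
  by apply: norm_comp_continuous; exact: cX.
by move=> i; apply: (@le_sups _ _ B).
Qed.

Lemma path_sup_le w c : (forall s, `|X w s| <= c) -> path_sup w <= c.
Proof. by move=> Xc; exact: sups_le. Qed.

Lemma measurable_path_sup : measurable_fun setT path_sup.
Proof.
apply: measurable_fun_sups => [w _|i].
  by have [B XB] := path_bounded w; exists B => _ [i _ <-].
exact: Borel_map_norm.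
Qed.

Let step n (i : nat) (r : R) := r - h n * clamp 0 1 (nth_rational R i).

(** The modulus of continuity at scale h. The second time is r - h theta with theta in [0, 1], and
    both r and theta run through rationals, so the supremum is countable. *)
Definition path_osc n w : R := sups (fun i =>
  sups (fun j => `|X w (nth_rational R i) - X w (step n j (nth_rational R i))|) 0) 0.

Let osc_bounded w : exists B, forall r s, `|X w r - X w s| <= B.
Proof.
have [B XB] := path_bounded w; exists (B + B) => r s.
by rewrite (le_trans (ler_normB _ _))// lerD.
Qed.

Lemma le_path_osc n w r s : `|r - s| <= h n -> `|X w r - X w s| <= path_osc n w.
Proof.
wlog sr : r s / s <= r.
  move=> H; have /orP[rs|sr] := le_total s r; first exact: H.
  by rewrite distrC (distrC (X w r)); exact: H.
rewrite ger0_norm ?subr_ge0// => rsh.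
have [B XB] := osc_bounded w.
have cXX (a b : R -> R) : continuous a -> continuous b -> continuous (fun x => `|X w (a x) - X w (b x)|).
  move=> ca cb; apply: norm_comp_continuous => x.
  by apply: cvgB; [apply: (cvg_comp _ _ (ca x)); exact: cX|apply: (cvg_comp _ _ (cb x)); exact: cX].
have h0 : 0 < h n by rewrite invr_gt0.
have key i theta : `|X w (nth_rational R i) - X w (nth_rational R i - h n * clamp 0 1 theta)| <= path_osc n w.
  apply: (@le_rational R (fun th => `|X w (nth_rational R i) - X w (nth_rational R i - h n * clamp 0 1 th)|)).
    apply: (cXX (cst (nth_rational R i))); first exact: cst_continuous.
    move=> x; apply: (@cvgB _ R^o); first exact: cvg_cst.
    by apply: (@cvgMr R); exact: clamp_continuous.
  move=> j; apply: le_trans (@le_sups _ (fun j => `|X w (nth_rational R i) - X w (step n j (nth_rational R i))|) B _ j) _ => //.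
  by apply: (@le_sups R (fun i' => sups (fun j0 => `|X w (nth_rational R i') -
    X w (step n j0 (nth_rational R i'))|) 0) B _ i) => i'; exact: sups_le.
have : `|X w r - X w (r - h n * clamp 0 1 ((r - s) / h n))| <= path_osc n w.
  apply: (@le_rational R (fun r' => `|X w r' - X w (r' - h n * clamp 0 1 ((r - s) / h n))|) (path_osc n w)).
    apply: (cXX id) => x; first exact: cvg_id.
    by apply: (@cvgB _ R^o); [exact: cvg_id|exact: cvg_cst].
  by move=> i; exact: key.
rewrite clamp_id; first by rewrite mulrC divfK ?gt_eqF// subKr.
by rewrite divr_ge0 ?subr_ge0 ?(ltW h0)//= ler_pdivrMr// mul1r.
Qed.

Lemma path_osc_le n w c : (forall r s, `|X w r - X w s| <= c) -> path_osc n w <= c.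
Proof. by move=> Xc; apply: sups_le => i; exact: sups_le. Qed.

Lemma measurable_path_osc n : measurable_fun setT (path_osc n).
Proof.
apply: measurable_fun_sups => [w _|i].
  by have [B XB] := osc_bounded w; exists B => _ [i _ <-]; exact: sups_le.
apply: measurable_fun_sups => [w _|j].
  by have [B XB] := osc_bounded w; exists B => _ [j _ <-].
by apply: Borel_map_norm; exact: Borel_mapB.
Qed.

Lemma path_osc_cvg0 w : path_osc n w @[n --> \oo] --> 0.
Proof.
apply/cvgrPdist_le => eps eps0.
have osc0 n : 0 <= path_osc n w.
  by apply: le_trans (@le_path_osc n w 0 0 _); rewrite ?subrr ?normr0 ?invr_ge0.
(* Uniform continuity from compactness; arbitrary times are first clamped into [0, T]. *)
have := @segment_compact R (-1) (T + 1).
rewrite compact_near_coveringP => /(_ nat \oo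
  (fun n r => forall s, `|r - s| <= h n -> `|X w r - X w s| <= eps) _) [|N _ HN].
  move=> x _; have /cvgrPdist_lt/(_ (eps / 2)) := @cX w x.
  rewrite divr_gt0// => /(_ isT) /nbhs_ballP[dl /= dl0 xdl].
  have d2 : 0 < dl / 2 by rewrite divr_gt0.
  near=> y n => s ys.
  have xy : `|x - y| < dl / 2 by near: y; exact: cvgr_dist_lt.
  have hn : h n < dl / 2 by near: n; exact: near_infty_natSinv_lt (PosNum d2).
  have h1 : `|X w x - X w y| < eps / 2.
    by apply: xdl; rewrite -ball_normE /= (lt_trans xy)// ltr_pdivrMr// ltr_pMr// ltr1n.
  have h2 : `|X w x - X w s| < eps / 2.
    apply: xdl; rewrite -ball_normE /= (_ : x - s = (x - y) + (y - s)); last by ring.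
    rewrite (le_lt_trans (ler_normD _ _))// (_ : dl = dl / 2 + dl / 2); last by field.
    by rewrite ltrD// (le_lt_trans ys).
  rewrite (_ : X w y - X w s = (X w x - X w s) - (X w x - X w y)); last first.
    by rewrite opprB [RHS]addrC addrA subrK.
  rewrite (le_trans (ler_normB _ _))// (_ : eps = eps / 2 + eps / 2); last by field.
  by rewrite lerD// ltW.
near=> n; rewrite sub0r normrN ger0_norm//.
have hN : forall r, `[-1, T + 1]%classic r -> forall s, `|r - s| <= h n -> `|X w r - X w s| <= eps.
  by move=> r; apply: HN; near: n; exact: nbhs_infty_ge.
apply: sups_le => i; apply: sups_le => j; set r := nth_rational R i; set s := step _ _ _.
rewrite X_clamp (X_clamp w s); apply: hN.
  by have /andP[a b] := clamp_itv r T0; rewrite /= in_itv/=; apply/andP; split; lra.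
rewrite (le_trans (clamp_lip _ _ _ _))// /s /step subKr normrM !ger0_norm ?invr_ge0//.
  by rewrite ler_piMr ?invr_ge0//; have /andP[] := clamp_itv (nth_rational R j) (@ler01 R).
by have /andP[] := clamp_itv (nth_rational R j) (@ler01 R).
Unshelve. all: by end_near. Qed.

End paths.

(** * Null sets of a product and their sections *)

Section almost_everywhere_sections.
Context d1 d2 (X1 : measurableType d1) (X2 : measurableType d2) (R : realType).
Variables (m1 : {sigma_finite_measure set X1 -> \bar R}) (m2 : {sigma_finite_measure set X2 -> \bar R}).

Lemma ae_xsection (Q : X1 * X2 -> Prop) : {ae (m1 \x m2)%E, forall z, Q z} ->
  {ae m1, forall x, {ae m2, forall y, Q (x, y)}}.
Proof.
move=> [N [mN N0 QN]].
have m0 : measurable_fun setT (fun x => m2 (xsection N x)) by exact: measurable_fun_xsection.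
have : (\int[m1]_x `|m2 (xsection N x)| = 0)%E.
  by rewrite -[RHS]N0; apply: eq_integral => x _; rewrite gee0_abs.
move/(ae_eq_integral_abs m1 measurableT m0); apply: filterS => x /(_ I) /= Nx0.
exists (xsection N x); split => //; first exact: measurable_xsection.
by move=> y /= Qxy; rewrite /xsection/= inE; apply: QN.
Qed.

Lemma ae_ysection (Q : X1 * X2 -> Prop) : {ae (m1 \x m2)%E, forall z, Q z} ->
  {ae m2, forall y, {ae m1, forall x, Q (x, y)}}.
Proof.
move=> [N [mN N0 QN]].
have m0 : measurable_fun setT (fun y => m1 (ysection N y)) by exact: measurable_fun_ysection.
have : (\int[m2]_y `|m1 (ysection N y)| = 0)%E.
  rewrite -[RHS]N0 (product_measure_unique (m1 := m1) (m2 := m2) (m' := (m1 \x^ m2)%E))//.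
    by apply: eq_integral => y _; rewrite gee0_abs.
  by move=> A1 A2 mA1 mA2; exact: product_measure2E.
move/(ae_eq_integral_abs m2 measurableT m0); apply: filterS => y /(_ I) /= Ny0.
exists (ysection N y); split => //; first exact: measurable_ysection.
by move=> x /= Qxy; rewrite /ysection/= inE; apply: QN.
Qed.

End almost_everywhere_sections.

(** * Gronwall's inequality and averaged increments in time *)

Section Gronwall.
Context (R : realType).
Local Notation leb := (@lebesgue_measure R).
Variables (y : R -> R) (C T B : R).
Hypotheses (C0 : 0 <= C) (y0 : forall t, 0 <= t <= T -> 0 <= y t)
  (yB : forall t, 0 <= t <= T -> y t <= B)
  (iy : forall t, 0 <= t <= T -> leb.-integrable `[0, t] (EFin \o y))
  (yC : forall t, 0 <= t <= T -> y t <= C * \int[leb]_(r in `[0, t]) y r).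

(* On an interval of length at most 1/(2C+1) to the right of a zero interval, the supremum
   of y is at most half of itself. *)
Lemma Gronwall t : 0 <= t <= T -> y t = 0.
Proof.
pose tau := (2 * C + 1)^-1; have C1 : 0 < 2 * C + 1 by rewrite ltr_wpDl// mulr_ge0.
have tau0 : 0 < tau by rewrite invr_gt0.
have Ctau : C * tau <= 2^-1 by rewrite ler_pdivrMr// mulrC ler_pdivlMr//; lra.
suff key k r : 0 <= r <= T -> r <= k%:R * tau -> y r = 0.
  move=> tT; apply: (key (Num.truncn (t / tau)).+1) => //; case/andP: tT => t0 _.
  rewrite -ler_pdivrMr// ltW//.
  by have /andP[] := truncn_itv (divr_ge0 t0 (ltW tau0)).
elim: k r => [|k IH] r rT.
  rewrite mul0r => r0; have r_0 : r = 0 by apply/le_anti; rewrite r0; case/andP: rT.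
  apply/le_anti; rewrite (y0 rT) andbT (le_trans (yC rT))// r_0 set_itv1.
  by rewrite Rintegral_set1 ?mulr0.
pose S := [set y s | s in [set s | 0 <= s <= T /\ s <= k.+1%:R * tau]].
move=> rk; have Sr : S (y r) by exists r.
have Sub : has_ubound S by exists B => _ [s [sT _] <-]; exact: yB.
have hS : has_sup S by split => //; exists (y r).
have le_S s : 0 <= s <= T -> s <= k.+1%:R * tau -> y s <= sup S.
  by move=> sT sk; apply: ub_le_sup => //; exists s.
have S0 : 0 <= sup S by apply: le_trans (y0 rT) (le_S _ rT rk).
have half s : 0 <= s <= T -> s <= k.+1%:R * tau -> y s <= sup S / 2.
  move=> sT sk; have [skt|ks] := leP s (k%:R * tau).
    by rewrite (IH s sT skt) divr_ge0.
  have /andP[s0 sT'] := sT.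
  have kt0 : 0 <= k%:R * tau by rewrite mulr_ge0// ltW.
  apply: le_trans (yC sT) _.
  have ig : leb.-integrable `[0, s] (EFin \o (fun r => sup S * \1_(`](k%:R * tau), s]) r)).
    apply: rintegrableZ => //; apply: (rintegrable_le _ _ (rintegrable_cst (mu := leb) _ 1 _)) => //.
    - by rewrite [X in (X < _)%E]lebesgue_measure_itv /=; case: ifP => _; rewrite -?EFinB ltry.
    - by move=> q _; rewrite indicE; case: (_ \in _); rewrite ?normr1 ?normr0.
  apply: (@le_trans _ _ (C * (sup S * (s - k%:R * tau)))).
    rewrite ler_wpM2l//.
    apply: (@le_trans _ _ (\int[leb]_(r in `[0, s]) (sup S * \1_(`](k%:R * tau), s]) r))).
      apply: le_Rintegral => //; first exact: iy.
      move=> q; rewrite /= in_itv/= => /andP[q0 qs].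
      have qT : 0 <= q <= T by rewrite q0 (le_trans qs).
      rewrite indicE; have [qk|kq] := leP q (k%:R * tau).
        rewrite (IH q qT qk) memNset ?mulr0//= in_itv/= ltNge qk//.
      rewrite mem_set ?mulr1/= ?in_itv/= ?kq//; apply: le_S => //.
      exact: le_trans sk.
    rewrite RintegralZl//; last first.
      apply: (rintegrable_le _ _ (rintegrable_cst (mu := leb) _ 1 _)) => //.
      - by rewrite [X in (X < _)%E]lebesgue_measure_itv /=; case: ifP => _; rewrite -?EFinB ltry.
      - by move=> q _; rewrite indicE; case: (_ \in _); rewrite ?normr1 ?normr0.
    rewrite ler_wpM2l// /Rintegral integral_indic// setIidl; last first.
      move=> q; rewrite /= !in_itv/= => /andP[kq ->]; rewrite andbT.
      by rewrite (le_trans kt0)// ltW.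
    by rewrite [X in fine X]lebesgue_measure_itv/= lte_fin ks -EFinB.
  apply: (@le_trans _ _ (C * (sup S * tau))).
    rewrite ler_wpM2l// ler_wpM2l// lerBlDl (le_trans sk)//.
    by rewrite -natr1 mulrDl mul1r.
  by rewrite mulrCA ler_wpM2l.
have : sup S <= sup S / 2 by apply: ge_sup => [|_ [s [sT sk] <-]]; [exists (y r)|exact: half].
move=> h; apply/le_anti; rewrite (y0 rT) andbT (le_trans (le_S r rT rk))//; lra.
Qed.

End Gronwall.

Section time_increments.
Context (R : realType).
Local Notation leb := (@lebesgue_measure R).
Local Notation h n := (n.+1%:R^-1 : R).
Variable y : R -> R.
Hypothesis cy : continuous y.

Lemma continuous_integrable (f : R -> R) a b : continuous f -> leb.-integrable `[a, b] (EFin \o f).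
Proof.
move=> cf; apply: continuous_compact_integrable; first exact: segment_compact.
exact: continuous_subspaceT.
Qed.

Lemma Rintegral_translate (c a b : R) : a <= b ->
  \int[leb]_(s in `[a, b]) y (s - c) = \int[leb]_(s in `[a - c, b - c]) y s.
Proof.
move=> ab; pose F (x : R) := x - c.
have dF (x : R) : is_derive x (1 : R) F (1 : R).
  have := is_deriveB (is_derive_id x 1) (is_derive_cst c x 1).
  by rewrite subr0.
have F'E : derive1 F = cst 1.
  by apply/funext => x; rewrite derive1E; apply: derive_val.
rewrite /Rintegral.
have := @integration_by_substitution_increasing _ F y a b ab; rewrite F'E.
move=> ->.
- by congr fine; apply: eq_integral => x _; rewrite !fctE mulr1.
- by move=> x z _ _ xz; rewrite /F ltrD2r.
- by move=> x _; exact: cst_continuous.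
- exact: is_cvg_cst.
- exact: is_cvg_cst.
- have cF : continuous F by move=> x; apply: (@cvgB _ R^o); [exact: cvg_id|exact: cvg_cst].
  split.
  + by move=> x _; have := dF x.
  + by apply: cvg_at_right_filter; exact: cF.
  + by apply: cvg_at_left_filter; exact: cF.
- exact: continuous_subspaceT.
Qed.

Lemma Rintegral_split (a b c : R) : a <= b -> b <= c ->
  \int[leb]_(s in `[a, c]) y s = \int[leb]_(s in `[a, b]) y s + \int[leb]_(s in `[b, c]) y s.
Proof.
move=> ab bc; have i (u v : R) := @continuous_integrable y u v cy.
apply/eqP; rewrite addrC -subr_eq; apply/eqP; rewrite Rintegral_itvB//.
by rewrite Rintegral_itv_obnd_cbnd//; apply: integrableS (i b c) => //; exact: subset_itv_oc_cc.
Qed.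

Lemma Rintegral_itv_cst (u v c : R) : u <= v -> \int[leb]_(s in `[u, v]) cst c s = c * (v - u).
Proof.
move=> uv; rewrite Rintegral_cst// [X in _ * fine X]lebesgue_measure_itv/= lte_fin.
case: ltP => [//|vu].
by rewrite (@le_anti _ _ u v) ?uv// subrr.
Qed.

(* The averages of increments of y over [h, t] telescope to averages near t and near 0. *)
Lemma average_increments t eps : 0 < t -> 0 < eps -> exists N, forall n, (N <= n)%N ->
  h n <= t /\ y t - y 0 - eps <= n.+1%:R * \int[leb]_(s in `[h n, t]) (y s - y (s - h n)).
Proof.
move=> t0 eps0; have e2 : 0 < eps / 2 by rewrite divr_gt0.
have i (f : R -> R) (u v : R) := @continuous_integrable f u v.
have near_y r : exists2 dl, 0 < dl & forall s, `|r - s| < dl -> `|y r - y s| <= eps / 2.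
  have /cvgrPdist_le/(_ _ e2)/nbhs_ballP[dl /= dl0 H] := cy (x := r).
  by exists dl => // s rs; apply: H; rewrite -ball_normE.
have [d1 d10 D1] := near_y t; have [d2 d20 D2] := near_y 0.
pose dl := Num.min t (Num.min d1 d2).
have dl0 : 0 < dl by rewrite !lt_min t0 d10.
have [N _ HN] := near_infty_natSinv_lt (PosNum dl0); exists N => n Nn.
have := HN n Nn; rewrite /= !lt_min => /andP[ht /andP[h1 h2]].
split; first exact: ltW.
have h0 : 0 < h n by rewrite invr_gt0.
have -> : \int[leb]_(s in `[h n, t]) (y s - y (s - h n)) =
    \int[leb]_(s in `[t - h n, t]) y s - \int[leb]_(s in `[0, h n]) y s.
  rewrite RintegralB//; [|exact: i|by apply: i => x; apply: continuous_comp;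
    [apply: (@cvgB _ R^o); [exact: cvg_id|exact: cvg_cst]|exact: cy]].
  rewrite Rintegral_translate ?subrr ?(ltW ht)//.
  have e1 : \int[leb]_(s in `[0, t]) y s = \int[leb]_(s in `[0, h n]) y s + \int[leb]_(s in `[h n, t]) y s.
    by apply: Rintegral_split; exact: ltW.
  have e3 : \int[leb]_(s in `[0, t]) y s = \int[leb]_(s in `[0, t - h n]) y s + \int[leb]_(s in `[t - h n, t]) y s.
    by apply: Rintegral_split; rewrite ?subr_ge0 ?gerBl ltW.
  by move: e3; rewrite e1; lra.
have l1 : (y t - eps / 2) * h n <= \int[leb]_(s in `[t - h n, t]) y s.
  have <- : \int[leb]_(s in `[t - h n, t]) cst (y t - eps / 2) s = (y t - eps / 2) * h n.
    by rewrite Rintegral_itv_cst ?gerBl ?(ltW h0)// subKr.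
  apply: le_Rintegral => //; [by apply: i; exact: cst_continuous|exact: i|].
  move=> s; rewrite /= in_itv/= => /andP[s1 s2].
  have : `|t - s| < d1 by rewrite ger0_norm ?subr_ge0// (le_lt_trans _ h1)// lerBlDr addrC -lerBlDr.
  by move=> /D1; rewrite ler_norml => /andP[_]; rewrite lerBlDr addrC -lerBlDr.
have l2 : \int[leb]_(s in `[0, h n]) y s <= (y 0 + eps / 2) * h n.
  have <- : \int[leb]_(s in `[0, h n]) cst (y 0 + eps / 2) s = (y 0 + eps / 2) * h n.
    by rewrite Rintegral_itv_cst ?(ltW h0)// subr0.
  apply: le_Rintegral => //; [exact: i|by apply: i; exact: cst_continuous|].
  move=> s; rewrite /= in_itv/= => /andP[s1 s2].
  have : `|0 - s| < d2 by rewrite sub0r normrN ger0_norm// (le_lt_trans s2 h2).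
  by move=> /D2; rewrite ler_norml => /andP[+ _]; rewrite lerBrDr addrC lerBlDr.
apply: (@le_trans _ _ (n.+1%:R * ((y t - eps / 2) * h n - (y 0 + eps / 2) * h n))).
  rewrite -mulrBl mulrCA divff// mulr1; lra.
by rewrite ler_wpM2l// lerB.
Qed.

End time_increments.

(** * Pathwise drift estimate *)

Section power_inequalities.
Context (R : realType).

Lemma powRD_le (x y r : R) : 0 <= x -> 0 <= y -> 0 <= r ->
  (x + y) `^ r <= 2 `^ r * (x `^ r + y `^ r).
Proof.
move=> x0 y0 r0; wlog yx : x y x0 y0 / y <= x.
  by have [|/ltW] := leP y x; [|rewrite addrC [X in _ * X]addrC] => h; exact.
apply: (@le_trans _ _ ((2 * x) `^ r)).
  by apply: ge0_ler_powR; rewrite ?nnegrE ?addr_ge0 ?mulr_ge0//; lra.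
by rewrite powRM// ler_wpM2l ?powR_ge0// lerDl powR_ge0.
Qed.

Lemma Young_powR (p x y : R) : 2 <= p -> 0 <= x -> 0 <= y ->
  x * y <= x `^ (p / (p - 1)) + y `^ p.
Proof.
move=> p2 x0 y0; have p0 : 0 < p by lra.
have p1 : 0 < p - 1 by lra.
have q0 : 0 < p / (p - 1) by rewrite divr_gt0.
have E : (p / (p - 1))^-1 + p^-1 = 1 by rewrite invf_div; field; rewrite !gt_eqF.
apply: le_trans (conjugate_powR x0 y0 q0 p0 E) _; rewrite lerD//.
  rewrite ler_piMr ?powR_ge0// invf_div ler_pdivrMr//; lra.
rewrite ler_piMr ?powR_ge0// invf_le1//; lra.
Qed.

End power_inequalities.

(** * The energy and its derivative on H *)

Section test_functional.
Context d (X : measurableType d) (R : realType) (mu : {measure set X -> \bar R}).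
Local Notation H := (L2 mu).

(** The integral of phi(a), since phi is the square of [tf_g]. *)
Definition pos_energy (a : H) : R := `|nemytskii (@tf_g R) a| ^+ 2.

Definition pos_force (a : H) : H := nemytskii (@tf_sigma R) a.

Let gE (a : H) : {ae mu, forall x, Lp_fun (nemytskii (@tf_g R) a) x = tf_g (Lp_fun a x)}.
Proof. by apply: (@nemytskiiE _ _ _ _ _ 1) => //; [rewrite /tf_g mul0r|exact: tf_g_lip]. Qed.

Lemma pos_forceE (a : H) : {ae mu, forall x, Lp_fun (pos_force a) x = tf_sigma (Lp_fun a x)}.
Proof. by apply: (@nemytskiiE _ _ _ _ _ 12) => //; [exact: tf_sigma_le0|exact: tf_sigma_lip]. Qed.

Lemma pos_force_norm (a : H) : `|pos_force a| <= 12 * `|a|.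
Proof. by apply: nemytskii_norm => //; [exact: tf_sigma_le0|exact: tf_sigma_lip]. Qed.

Lemma pos_energy_ge0 (a : H) : 0 <= pos_energy a.
Proof. exact: sqr_ge0. Qed.

Lemma pos_energy_le (a : H) : pos_energy a <= `|a| ^+ 2.
Proof.
rewrite /pos_energy lerXn2r ?nnegrE// -[leRHS]mul1r.
by apply: nemytskii_norm => //; [rewrite /tf_g mul0r|exact: tf_g_lip].
Qed.

Lemma pos_energy_continuous : continuous pos_energy.
Proof.
have g0 : tf_g (0 : R) = 0 by rewrite /tf_g mul0r.
have cN := @nemytskii_continuous _ X R mu _ 1 g0 ler01 (@tf_g_lip R).
move=> a; apply: (@continuous_comp _ _ _ (fun b => `|nemytskii (@tf_g R) b|) (fun x : R => x ^+ 2)).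
  exact: cvg_norm (cN a).
exact: exprn_continuous.
Qed.

Lemma pos_energy_eq0 (a : H) : pos_energy a = 0 -> {ae mu, forall x, Lp_fun a x <= 0}.
Proof.
move=> /eqP; rewrite sqrf_eq0 normr_eq0 => /eqP a0.
have := gE a; rewrite a0; apply: filterS2 (Lp_fun0 mu) => x -> /esym ga0.
by apply: tf_phi_eq0; rewrite tf_phi_gE ga0 expr0n.
Qed.

Lemma pos_energy_le0 (a : H) : {ae mu, forall x, Lp_fun a x <= 0} -> pos_energy a = 0.
Proof.
move=> a0; rewrite /pos_energy (_ : nemytskii _ a = 0) ?normr0 ?expr0n//.
apply: Lp_eqP; apply: filterS3 (Lp_fun0 mu) (gE a) a0 => x -> -> /tf_phi_le0.
by rewrite tf_phi_gE => /eqP; rewrite sqrf_eq0 => /eqP.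
Qed.

Lemma pos_energy_convex (b D : H) :
  pos_energy b - pos_energy (b - D) <= L2_dot D (pos_force b).
Proof.
rewrite /pos_energy !L2_normE /L2_dot -RintegralB//; [|exact: integrable_dot|exact: integrable_dot].
apply: ae_le_Rintegral => //; [|exact: integrable_dot|].
  by apply: rintegrableB; rewrite ?measurableT//; exact: integrable_dot.
apply: filterS3 (filterI (gE b) (gE (b - D))) (pos_forceE b) (Lp_funB b D) => x [-> ->] -> -> _.
by rewrite -!expr2 -!tf_phi_gE mulrC; exact: tf_phi_convex.
Qed.

(** The difference of the F-terms at time r is controlled by b = w(r) but tested with phi'(a) for a
    = w(s). Splitting b = a + (b - a), the first part gives the energy through r phi'(r) <= 4
    phi(r), the second an oscillation term. *)
Lemma pos_force_le (c b a : H) C : 0 <= C ->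
  {ae mu, forall x, `|Lp_fun c x| <= C * `|Lp_fun b x|} ->
  L2_dot c (pos_force a) <= C * (4 * pos_energy a + 12 * `|b - a| * `|a|).
Proof.
move=> C0 cb.
have n0 : forall x y : R, `| `|x| - `|y| | <= 1 * `|x - y|.
  by move=> x y; rewrite mul1r; exact: ler_dist_dist.
pose N : H := nemytskii (@Num.norm R R) (b - a).
have NE : {ae mu, forall x, Lp_fun N x = `|Lp_fun (b - a) x|}.
  by apply: (@nemytskiiE _ _ _ _ _ 1) => //; rewrite normr0.
have key : L2_dot c (pos_force a) <=
    4 * C * L2_dot (nemytskii (@tf_g R) a) (nemytskii (@tf_g R) a) + C * L2_dot N (pos_force a).
  rewrite /L2_dot -!RintegralZl//; [|exact: integrable_dot|exact: integrable_dot].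
  rewrite -RintegralD//; try (apply: rintegrableZ => //; exact: integrable_dot).
  apply: ae_le_Rintegral => //; first exact: integrable_dot.
    by apply: rintegrableD => //; apply: rintegrableZ => //; exact: integrable_dot.
  apply: filterS3 (filterI (gE a) (pos_forceE a)) (filterI NE (Lp_funB b a)) cb.
  move=> x [-> ->] [-> ->] cx _; have s0 := tf_sigma_ge0 (Lp_fun a x).
  rewrite -expr2 -tf_phi_gE.
  apply: (@le_trans _ _ (C * `|Lp_fun b x| * tf_sigma (Lp_fun a x))).
    by rewrite ler_wpM2r// (le_trans _ cx)// ler_norm.
  have bx : `|Lp_fun b x| <= `|Lp_fun b x - Lp_fun a x| + `|Lp_fun a x|.
    by rewrite -{1}(subrK (Lp_fun a x) (Lp_fun b x)) ler_normD.
  apply: (@le_trans _ _ (C * (`|Lp_fun b x - Lp_fun a x| + `|Lp_fun a x|) * tf_sigma (Lp_fun a x))).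
    by rewrite ler_wpM2r// ler_wpM2l.
  have := tf_sigma_phi (Lp_fun a x); rewrite normrM (ger0_norm s0) => h.
  rewrite [leLHS](_ : _ = C * (`|Lp_fun a x| * tf_sigma (Lp_fun a x)) +
    C * (`|Lp_fun b x - Lp_fun a x| * tf_sigma (Lp_fun a x))); last by ring.
  by rewrite lerD2r// (mulrC 4) -mulrA ler_wpM2l.
rewrite -L2_normE in key; apply: le_trans key _.
rewrite [leRHS](_ : _ = 4 * C * pos_energy a + C * (12 * `|b - a| * `|a|)); last by ring.
rewrite lerD2l ler_wpM2l//.
rewrite (le_trans (ler_norm _))// (le_trans (L2_dot_le _ _))//.
rewrite -mulrA mulrCA ler_pM//.
  rewrite -[leRHS]mul1r; apply: nemytskii_norm => //; exact: normr0.
exact: pos_force_norm.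
Qed.

End test_functional.

Lemma eq_Bochner_integral d (X : measurableType d) (R : realType) (E : normedModType R)
    (mu : {measure set X -> \bar R}) (D : set X) (f g : X -> E) I :
  (forall x, D x -> f x = g x) -> is_Bochner_integral mu D f I -> is_Bochner_integral mu D g I.
Proof.
move=> fg [s [s1 s2 s3 s4]]; exists s; split => //.
- by apply: filterS (s2) => x s2x Dx; rewrite -fg//; exact: s2x.
- move: s3; apply: cvg_trans; apply: near_eq_cvg; apply: nearW => n.
  by apply: eq_integral => x /set_mem Dx; rewrite fg.
Qed.

Section Bochner_increments.
Context (R : realType) (E : normedModType R).
Local Notation leb := (@lebesgue_measure R).
Local Notation RT := (measurableTypeR R).
Variables (f : RT -> E) (l : E -> R) (C : R).
Hypotheses (bf : Borel_map f)
  (l_lin : forall a x y, l (a *: x + y) = a * l x + l y)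
  (l_le : forall x, `|l x| <= C * `|x|) (C0 : 0 <= C).

Let l_continuous : continuous (l : E -> R^o).
Proof.
apply: (@lip_continuous _ _ _ _ C) => x y; rewrite (le_trans _ (l_le _))//.
by rewrite (_ : x - y = (-1) *: y + x) ?l_lin ?mulN1r 1?addrC// scaleN1r addrC.
Qed.

Lemma Borel_map_functional : measurable_fun setT (l \o f).
Proof. by apply: Borel_map_measurable; exact: (Borel_map_comp (f := f) l_continuous). Qed.

Lemma Bochner_functional (s : R) I : is_Bochner_integral leb `[0, s] f I ->
  [/\ leb.-integrable `[0, s] (fun r => `|f r|%:E), leb.-integrable `[0, s] (EFin \o (l \o f)) &
    l I = \int[leb]_(r in `[0, s]) l (f r)].
Proof.
have mi : measurable (`[0, s]%classic : set RT) by exact: measurable_itv.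
have mf (c : E) : measurable_fun (`[0, s]%classic : set RT) (fun x : RT => `|f x - c|).
  by apply: measurable_funTS; exact: Borel_map_dist.
have ml : measurable_fun (`[0, s]%classic : set RT) (l \o f).
  by apply: measurable_funTS; exact: Borel_map_functional.
by move=> BI; exact: (is_Bochner_integral_functional mi mf l_lin l_le C0 ml BI).
Qed.

Lemma Bochner_increment (s s' : R) I I' : 0 <= s' -> s' <= s ->
  is_Bochner_integral leb `[0, s] f I -> is_Bochner_integral leb `[0, s'] f I' ->
  leb.-integrable `[0, s] (EFin \o (l \o f)) /\
  l I - l I' = \int[leb]_(r in `]s', s]) l (f r).
Proof.
move=> s'0 s's /Bochner_functional[_ i1 ->] /Bochner_functional[_ i2 ->].
by split => //; rewrite Rintegral_itvB.
Qed.

Lemma Bochner_point I : is_Bochner_integral leb `[0, 0] f I -> l I = 0.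
Proof.
move=> /Bochner_functional[_ _ ->]; rewrite /Rintegral set_itv1 integral_set1//.
Qed.

End Bochner_increments.

Section solution_increments.
Context d (X : measurableType d) (R : realType) (mu : {measure set X -> \bar R}).
Local Notation H := (L2 mu).
Local Notation leb := (@lebesgue_measure R).
Local Notation RT := (measurableTypeR R).
Context (V : completeNormedModType R) (iota : blin V H).

(** The equation for one fixed omega, where the stochastic integral has become a given path m. *)
Definition drift_equation (T : R) (u m : R -> H) (a : R -> dual V) (g f : R -> H) (u0 : H) :=
  forall s : R, 0 <= s <= T -> exists (IA : dual V) (Ih IF : H),
  [/\ is_Bochner_integral leb `[0, s] a IA, is_Bochner_integral leb `[0, s] g Ih,
      is_Bochner_integral leb `[0, s] f IF &
      forall z : V, L2_dot (u s) (iota z) + IA z = L2_dot (u0 + Ih + IF + m s) (iota z)].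

Lemma dot_functional (y : H) :
  (forall a (x x' : H), L2_dot (a *: x + x') y = a * L2_dot x y + L2_dot x' y) /\
  (forall x : H, `|L2_dot x y| <= `|y| * `|x|).
Proof.
by split=> [a x x'|x]; [rewrite L2_dotDl L2_dotZl|rewrite mulrC L2_dot_le].
Qed.

Lemma pairing_functional (z : V) :
  (forall c (x x' : dual V), (c *: x + x') z = c * x z + x' z) /\
  (forall x : dual V, `|x z| <= `|z| * `|x|).
Proof. by split=> [c x x'//|x]; rewrite mulrC le_opnorm. Qed.

Variables (T : R) (u m : R -> H) (a : RT -> dual V) (g f : RT -> H) (u0 : H).
Hypotheses (ba : Borel_map a) (bg : Borel_map g) (bf : Borel_map f)
  (sol : drift_equation T u m a g f u0).

Lemma solution_increment (s s' : R) z : 0 <= s' -> s' <= s -> s <= T ->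
  [/\ leb.-integrable `[0, s] (EFin \o (fun r => a r z)),
      leb.-integrable `[0, s] (EFin \o (fun r => L2_dot (g r) (iota z))),
      leb.-integrable `[0, s] (EFin \o (fun r => L2_dot (f r) (iota z))) &
      L2_dot (u s - u s' - (m s - m s')) (iota z) =
        \int[leb]_(r in `]s', s]) L2_dot (g r) (iota z)
        + \int[leb]_(r in `]s', s]) L2_dot (f r) (iota z)
        - \int[leb]_(r in `]s', s]) a r z].
Proof.
move=> s'0 s's sT.
have [|IA [Ih [IF [BA Bh BF E]]]] := sol (s := s); first by rewrite sT (le_trans s'0).
have [|IA' [Ih' [IF' [BA' Bh' BF' E']]]] := sol (s := s'); first by rewrite s'0 (le_trans s's).
have [dl dC] := dot_functional (iota z); have [al aC] := pairing_functional z.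
have [ia Ea] := Bochner_increment ba (l := fun phi : dual V => phi z) al aC (normr_ge0 _) s'0 s's BA BA'.
have [ig Eg] := Bochner_increment bg dl dC (normr_ge0 _) s'0 s's Bh Bh'.
have [if_ Ef] := Bochner_increment bf dl dC (normr_ge0 _) s'0 s's BF BF'.
split => //; rewrite -Eg -Ef -Ea.
have {}E := E z; have {}E' := E' z.
rewrite !L2_dotBl; rewrite !L2_dotDl in E E'.
have -> : L2_dot (u s) (iota z) = L2_dot u0 (iota z) + L2_dot Ih (iota z) + L2_dot IF (iota z)
  + L2_dot (m s) (iota z) - IA z by rewrite -E addrK.
have -> : L2_dot (u s') (iota z) = L2_dot u0 (iota z) + L2_dot Ih' (iota z) + L2_dot IF' (iota z)
  + L2_dot (m s') (iota z) - IA' z by rewrite -E' addrK.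
by ring.
Qed.

Lemma drift_norm_integrable : 0 <= T -> leb.-integrable `[0, T] (fun r => `|a r|%:E).
Proof.
move=> T0; have [|IA [Ih [IF [BA _ _ _]]]] := sol (s := T); first by rewrite T0 lexx.
have [al aC] := pairing_functional 0.
by have [] := Bochner_functional ba (l := fun phi : dual V => phi 0) al aC (normr_ge0 _) BA.
Qed.

(** The integrals over [0, 0] vanish, and testing against the dense image of V identifies the
    initial value in H. *)
Lemma drift_equation_start : 0 <= T -> dense (range iota) -> u 0 = u0 + m 0.
Proof.
move=> T0 dV; have [|IA [Ih [IF [BA Bh BF E]]]] := sol (s := 0); first by rewrite lexx T0.
have Ez z : L2_dot (u 0 - (u0 + m 0)) (iota z) = 0.
  have [dl dC] := dot_functional (iota z); have [al aC] := pairing_functional z.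
  have Eh := Bochner_point bg dl dC (normr_ge0 _) Bh.
  have Ef := Bochner_point bf dl dC (normr_ge0 _) BF.
  have Ea := Bochner_point ba (l := fun phi : dual V => phi z) al aC (normr_ge0 _) BA.
  have := E z; rewrite L2_dotBl !L2_dotDl Eh Ef Ea !addr0 => ->.
  by rewrite subrr.
apply/eqP; rewrite -subr_eq0 -normr_le0; set y := _ - _ in Ez *.
apply/ler_addgt0Pr => eps eps0; rewrite add0r.
have [x [yx [z _ zx]]] : ball y eps `&` range iota !=set0.
  by apply: dV; [exists y; exact: ballxx|exact: ball_open].
have [->|y0] := eqVneq y 0; first by rewrite normr0 ltW.
have yp : 0 < `|y| by rewrite normr_gt0.
rewrite -(ler_pM2l yp) -expr2 L2_normE -(subr0 (L2_dot y y)) -(Ez z) -L2_dotBr.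
apply: le_trans (ler_norm _) _; apply: le_trans (L2_dot_le _ _) _.
by rewrite ler_wpM2l// zx; move: yx; rewrite -ball_normE => /ltW.
Qed.

End solution_increments.

Lemma subrACA (E : zmodType) (a b c e : E) : a - b - (c - e) = a - c - (b - e).
Proof. by rewrite opprD addrACA -opprD. Qed.

(** The constants of |a|^q and |z|^p in terms of [path_growth], added after Young's inequality; 24
    is the factor in front of [sigV] in z. *)
Definition drift_const (R : realType) (p C : R) : R :=
  2 `^ (p / (p - 1)) * 2 + 24 `^ p * C * 2 `^ p.

Section pathwise_drift.
Context d (X : measurableType d) (R : realType) (mu : {measure set X -> \bar R}).
Local Notation H := (L2 mu).
Local Notation leb := (@lebesgue_measure R).
Local Notation RT := (measurableTypeR R).
Local Notation h n := (n.+1%:R^-1 : R).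
Context (V : completeNormedModType R) (iota : blin V H).
Hypothesis V_separable : separable V.
Variables (T t p : R).
Hypotheses (t0 : 0 <= t) (tT : t <= T) (p_ge2 : 2 <= p).
Let q := p / (p - 1).

Variables (A : R -> V -> dual V) (sigV : V -> V) (C CA : R) (hA : R -> R).
Hypotheses (C0 : 0 <= C) (CA0 : 0 <= CA)
  (sigVE : forall phi, {ae mu, forall x,
     Lp_fun (iota (sigV phi)) x = tf_sig (Lp_fun (iota phi) x)})
  (sigV_ge0 : forall (r : R) phi psi, 0 <= r <= T ->
     0 <= (A r phi - A r psi) (sigV (phi - psi)))
  (sigV_le : forall (r : R) phi, 0 <= r <= T -> `|sigV phi| `^ p <= C * `|A r phi| `^ q)
  (A_le : forall (r : R) phi, 0 <= r <= T -> `|A r phi| `^ q <= CA * `|phi| `^ p + hA r).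

Variables (u1 u2 m1 m2 : R -> H) (a1 a2 : RT -> dual V) (g1 g2 f1 f2 : RT -> H) (u01 u02 : H).
Variables (v1 v2 : R -> V).
Hypotheses (ba1 : Borel_map a1) (bg1 : Borel_map g1) (bf1 : Borel_map f1)
  (ba2 : Borel_map a2) (bg2 : Borel_map g2) (bf2 : Borel_map f2)
  (sol1 : drift_equation iota T u1 m1 a1 g1 f1 u01)
  (sol2 : drift_equation iota T u2 m2 a2 g2 f2 u02)
  (a1E : forall r : R, 0 <= r <= T -> a1 r = A r (v1 r))
  (a2E : forall r : R, 0 <= r <= T -> a2 r = A r (v2 r))
  (vE : {ae leb, forall r : R, 0 <= r <= T -> iota (v1 r) = u1 r /\ iota (v2 r) = u2 r})
  (g_le : {ae leb, forall r : R, 0 <= r <= T -> le_ae (g1 r) (g2 r)}).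

Definition path_growth (r : R) : R := CA * `|v1 r| `^ p + CA * `|v2 r| `^ p + hA r.

Hypothesis ikappa : leb.-integrable `[0, T] (EFin \o path_growth).

Variables (w M : R -> H) (CF D1 : R) (Osc : nat -> R).
Hypotheses (wE : forall r, 0 <= r <= T -> w r = u1 r - u2 r)
  (ME : forall r, 0 <= r <= T -> M r = m1 r - m2 r)
  (cw : continuous w) (cM : continuous M) (CF0 : 0 <= CF)
  (f_le : {ae leb, forall r : R, 0 <= r <= T ->
     {ae mu, forall x, `|Lp_fun (f1 r - f2 r) x| <= CF * `|Lp_fun (w r) x|}})
  (w_osc : forall n r s, `|r - s| <= h n -> `|w r - w s| <= Osc n)
  (w_le : forall r, `|w r| <= D1).

(** The difference quotient of the energy without the noise, minus the allowance for F: what is left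
    has to be absorbed by the monotone term. *)
Definition drift_bound n (s : R) : R :=
  n.+1%:R * (pos_energy (w s) - pos_energy (w (s - h n) + M s - M (s - h n)))
  - CF * (4 * pos_energy (w s) + 12 * Osc n * D1).

Let on_itv (E : zmodType) (y : R -> E) (r : R) : E := if 0 <= r <= t then y r else 0.

(** The factor 24 undoes the normalization of [tf_sig], so that z s represents phi'(w(s)) in V for
    almost every s. *)
Let z : R -> V := on_itv (fun s => 24 *: sigV (v1 s - v2 s)).
Let a : R -> dual V := on_itv (fun s => a1 s - a2 s).

Let onT r : 0 <= r <= t -> 0 <= r <= T.
Proof. by move=> /andP[-> /le_trans]; exact. Qed.

Let hA0 r : 0 <= r <= T -> 0 <= hA r.
Proof.
move=> rT; have := A_le 0 rT; rewrite normr0 powR0 ?mulr0 ?add0r.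
  by apply: le_trans; exact: powR_ge0.
by move: p_ge2 => ?; rewrite gt_eqF//; lra.
Qed.

Let kappa0 r : 0 <= r <= T -> 0 <= path_growth r.
Proof. by move=> rT; rewrite !addr_ge0 ?mulr_ge0 ?powR_ge0 ?hA0. Qed.

Let iotaz s : 0 <= s <= t -> iota (v1 s) = u1 s -> iota (v2 s) = u2 s ->
  iota (z s) = pos_force (w s).
Proof.
move=> st i1 i2; rewrite /z /on_itv st linearZ/= wE ?onT// -i1 -i2 -linearB.
apply: Lp_eqP; apply: filterS3 (sigVE (v1 s - v2 s))
  (Lp_funZ 24 (iota (sigV (v1 s - v2 s)))) (pos_forceE (iota (v1 s - v2 s))) => x E -> ->.
by rewrite E /tf_sig mulrA divff ?mul1r.
Qed.

(* Only the A-term survives with its sign: the h-term is nonpositive and the F-term is a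
   multiple of the energy up to the oscillation of the path. *)
Let drift_bound_le n : {ae leb, forall s, h n <= s -> s <= t ->
    drift_bound n s <= - lavg (fun r => a r (z s)) n s}.
Proof.
apply: filterS vE => s /[swap] hs /[swap] st.
have h0 : 0 < h n by rewrite invr_gt0.
have s0t : 0 <= s <= t by rewrite st (le_trans _ hs)// ltW.
move=> /(_ (onT s0t))[i1 i2].
pose s' := s - h n; have s'0 : 0 <= s' by rewrite subr_ge0.
have s's : s' <= s by rewrite gerBl ltW.
have sT : s <= T := le_trans st tT.
have [ia1 ig1 if1 E1] := solution_increment ba1 bg1 bf1 sol1 (z s) s'0 s's sT.
have [ia2 ig2 if2 E2] := solution_increment ba2 bg2 bf2 sol2 (z s) s'0 s's sT.
have sub : `]s', s] `<=` `[0, s]%classic by apply: subset_itvr; rewrite bnd_simp.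
have iS (y : R -> R) : leb.-integrable `[0, s] (EFin \o y) -> leb.-integrable `]s', s] (EFin \o y).
  by apply: integrableS.
set D := w s - w s' - (M s - M s').
have s't : 0 <= s' <= t by rewrite s'0 (le_trans s's).
have DE : L2_dot D (pos_force (w s)) =
    \int[leb]_(r in `]s', s]) L2_dot (g1 r - g2 r) (pos_force (w s))
    + \int[leb]_(r in `]s', s]) L2_dot (f1 r - f2 r) (pos_force (w s))
    - \int[leb]_(r in `]s', s]) a r (z s).
  have -> : \int[leb]_(r in `]s', s]) a r (z s) = \int[leb]_(r in `]s', s]) (a1 r (z s) - a2 r (z s)).
    apply: eq_Rintegral => r; rewrite inE/= in_itv/= => /andP[r1 r2].
    by rewrite /a /on_itv (le_trans s'0 (ltW r1)) (le_trans r2 st).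
  rewrite RintegralB//; [|exact: iS|exact: iS].
  rewrite -(iotaz s0t i1 i2).
  under eq_Rintegral do rewrite L2_dotBl; rewrite RintegralB//; [|exact: iS|exact: iS].
  under [X in _ = _ - _ + X - _]eq_Rintegral do rewrite L2_dotBl.
  rewrite RintegralB//; [|exact: iS|exact: iS].
  have -> : D = (u1 s - u1 s' - (m1 s - m1 s')) - (u2 s - u2 s' - (m2 s - m2 s')).
    rewrite /D !wE ?ME ?onT//.
    by rewrite (subrACA (u1 s)) (subrACA (m1 s)) (subrACA (u1 s - _)).
  by rewrite L2_dotBl E1 E2 subrACA opprD addrACA.
have mi : measurable (`]s', s]%classic : set RT) by exact: measurable_itv.
have iD (y y' : RT -> H) : leb.-integrable `[0, s] (EFin \o (fun r => L2_dot (y r) (iota (z s)))) ->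
    leb.-integrable `[0, s] (EFin \o (fun r => L2_dot (y' r) (iota (z s)))) ->
    leb.-integrable `]s', s] (EFin \o (fun r => L2_dot (y r - y' r) (pos_force (w s)))).
  move=> iy iy'; under [X in _.-integrable _ (_ \o X)]funext do rewrite L2_dotBl.
  by rewrite -(iotaz s0t i1 i2); apply: rintegrableB => //; exact: iS.
have fin_s : (leb `]s', s]%classic < +oo)%E.
  by rewrite lebesgue_measure_itv; case: ifP => _; rewrite ltry.
have inT (r : R) : `]s', s]%classic r -> 0 <= r <= T.
  by rewrite /= in_itv/= => /andP[r1 r2]; rewrite (le_trans s'0 (ltW r1)) (le_trans r2).
have g_term : \int[leb]_(r in `]s', s]) L2_dot (g1 r - g2 r) (pos_force (w s)) <= 0.
  apply: (@le_trans _ _ (\int[leb]_(r in `]s', s]) cst 0 r)); last by rewrite Rintegral_cst// mul0r.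
  apply: ae_le_Rintegral => //; [exact: iD|exact: rintegrable_cst|].
  apply: filterS g_le => r gr /inT rT; rewrite -oppr_ge0 -L2_dotNl opprB.
  apply: L2_dot_ge0; apply: filterS3 (gr rT) (Lp_funB (g2 r) (g1 r)) (pos_forceE (w s)).
  by move=> x gx -> ->; rewrite mulr_ge0 ?subr_ge0// tf_sigma_ge0.
pose c := CF * (4 * pos_energy (w s) + 12 * Osc n * D1).
have s'lt : s' < s by rewrite gtrBl.
have ss' : s - s' = h n by rewrite /s' opprB addrC subrK.
have f_term : \int[leb]_(r in `]s', s]) L2_dot (f1 r - f2 r) (pos_force (w s)) <= c * h n.
  apply: (@le_trans _ _ (\int[leb]_(r in `]s', s]) cst c r)); last first.
    by rewrite Rintegral_cst// [X in fine X]lebesgue_measure_itv/= lte_fin s'lt/= ss'.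
  apply: ae_le_Rintegral => //; [exact: iD|exact: rintegrable_cst|].
  apply: filterS f_le => r fr /[dup] /inT rT; rewrite /= in_itv/= => /andP[r1 r2].
  apply: le_trans (pos_force_le (w s) CF0 (fr rT)) _.
  rewrite ler_wpM2l// lerD2l -!mulrA ler_wpM2l// ler_pM//.
  apply: w_osc; rewrite ler0_norm ?subr_le0// opprB lerBlDr addrC -lerBlDr.
  exact: ltW.
have conv := pos_energy_convex (w s) D.
have DwE : w s - D = w s' + M s - M s'.
  by rewrite /D opprB addrCA subKr addrC addrA.
rewrite DwE in conv.
have n1 : 0 < n.+1%:R :> R by [].
apply: (@le_trans _ _ (n.+1%:R * (0 + c * h n - \int[leb]_(r in `]s', s]) a r (z s)) - c)).
  rewrite /drift_bound lerD2r ler_wpM2l//; apply: le_trans conv _.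
  by rewrite DE; apply: lerD => //; exact: lerD.
rewrite /lavg le_eqVlt; apply/orP; left; apply/eqP; rewrite -/s'.
have scale (N x y : R) : N != 0 -> N * (0 + x / N - y) - x = - (N * y) by move=> N0; field.
by rewrite scale// pnatr_eq0.
Qed.

Let Kk := 2 `^ q * 2.
Let KJ := 24 `^ p * C * 2 `^ p.

Let Kk0 : 0 <= Kk. Proof. by rewrite mulr_ge0// powR_ge0. Qed.

Let KJ0 : 0 <= KJ. Proof. by rewrite !mulr_ge0// powR_ge0. Qed.

Let q0 : 0 <= q.
Proof. by move: p_ge2 => ?; rewrite divr_ge0//; lra. Qed.

Let p0 : 0 <= p. Proof. by move: p_ge2 => ?; lra. Qed.

Let k : R -> R := on_itv (fun r => Kk * path_growth r).
Let J : R -> R := on_itv (fun r => KJ * path_growth r).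

Let a_norm r : 0 <= r <= t -> `|a r| `^ q <= k r.
Proof.
move=> rt; have rT := onT rt; rewrite /a /k /on_itv rt.
apply: (@le_trans _ _ ((`|a1 r| + `|a2 r|) `^ q)).
  by apply: ge0_ler_powR; rewrite ?nnegrE ?addr_ge0// ler_normB.
apply: le_trans (powRD_le (normr_ge0 _) (normr_ge0 _) q0) _.
rewrite /Kk -mulrA ler_wpM2l ?powR_ge0//.
rewrite a1E// a2E//.
apply: le_trans (lerD (A_le (v1 r) rT) (A_le (v2 r) rT)) _.
have ? := hA0 rT; have ? := powR_ge0 `|v1 r| p; have ? := powR_ge0 `|v2 r| p.
rewrite /path_growth; have ? : 0 <= CA * `|v1 r| `^ p by rewrite mulr_ge0.
have ? : 0 <= CA * `|v2 r| `^ p by rewrite mulr_ge0.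
lra.
Qed.

Let z_norm s : 0 <= s <= t -> `|z s| `^ p <= J s.
Proof.
move=> st; have sT := onT st; rewrite /z /J /on_itv st normrZ ger0_norm// powRM//.
rewrite /KJ -!mulrA ler_wpM2l ?powR_ge0//.
apply: le_trans (sigV_le _ sT) _; rewrite ler_wpM2l//.
apply: le_trans (A_le _ sT) _.
have two : 1 <= 2 `^ p by rewrite -[leLHS](powRr0 (2 : R)) ler_powR// ler1n.
have ? := hA0 sT.
have v12 : `|v1 s - v2 s| `^ p <= 2 `^ p * (`|v1 s| `^ p + `|v2 s| `^ p).
  apply: le_trans (powRD_le (normr_ge0 _) (normr_ge0 _) p0).
  by apply: ge0_ler_powR; rewrite ?nnegrE ?addr_ge0// ler_normB.
rewrite [leRHS](_ : _ = CA * (2 `^ p * (`|v1 s| `^ p + `|v2 s| `^ p)) + 2 `^ p * hA s).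
  by apply: lerD; [rewrite ler_wpM2l|rewrite ler_peMl].
by rewrite /path_growth; ring.
Qed.

Let k0 r : 0 <= k r.
Proof. by rewrite /k /on_itv; case: ifP => // /onT rT; rewrite mulr_ge0// kappa0. Qed.

Let J0 r : 0 <= J r.
Proof. by rewrite /J /on_itv; case: ifP => // /onT rT; rewrite mulr_ge0// kappa0. Qed.

(** Young's inequality separates the time r of the operator from the time s of the test vector; this
    is where the growth of [sigV] is indispensable. *)
Let a_lower r s : - (k r + J s) <= a r (z s).
Proof.
have [rt|rt] := boolP (0 <= r <= t); last first.
  by rewrite /a /on_itv (negbTE rt) oppr_le0 addr_ge0.
have [st|st] := boolP (0 <= s <= t); last first.
  by rewrite /z /on_itv (negbTE st) linear0 oppr_le0 addr_ge0.
rewrite lerNl (le_trans (ler_norm _))// normrN (le_trans (le_opnorm _ _))//.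
change (`|a r| * `|z s| <= k r + J s).
apply: le_trans (Young_powR p_ge2 (normr_ge0 _) (normr_ge0 _)) _.
by rewrite lerD// ?a_norm// z_norm.
Qed.

Let a_sign : {ae leb, forall s, 0 <= s <= t -> 0 <= a s (z s)}.
Proof.
apply: nearW => s st; have sT := onT st; rewrite /a /z /on_itv st a1E// a2E//.
by rewrite linearZ; apply: mulr_ge0 => //; exact: sigV_ge0.
Qed.

Let on_itv_integrable (y : R -> R) : leb.-integrable `[0, T] (EFin \o y) ->
  leb.-integrable setT (EFin \o on_itv y) /\
  \int[leb]_r on_itv y r = \int[leb]_(r in `[0, t]) y r.
Proof.
move=> iy; have mi : measurable (`[0, t]%classic : set RT) by exact: measurable_itv.
have i0t : leb.-integrable `[0, t] (EFin \o y).
  by apply: integrableS iy => //; apply: subset_itvl; rewrite bnd_simp.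
have E : on_itv y = y \_ `[0, t].
  by apply/funext => r; rewrite /on_itv /patch mem_setE in_itv.
rewrite E; split; first by rewrite -restrict_EFin -integrable_mkcond.
by rewrite -Rintegral_mkcond.
Qed.

Lemma drift_bound_continuous n : continuous (drift_bound n).
Proof.
have cE (y : R -> H) : continuous y -> continuous (fun s => pos_energy (y s)).
  by move=> cy s; apply: continuous_comp; [exact: cy|exact: pos_energy_continuous].
have cS (y : R -> H) : continuous y -> continuous (fun s => y (s - h n)).
  move=> cy s; apply: continuous_comp; last exact: cy.
  by apply: (@cvgB _ R^o); [exact: cvg_id|exact: cvg_cst].
have c1 := cE _ cw.
have c2 : continuous (fun s => pos_energy (w (s - h n) + M s - M (s - h n))).
  apply: cE => s; apply: cvgB; last exact: cS.
  by apply: cvgD; [exact: cS|exact: cM].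
move=> s; apply: (@cvgB _ R^o); first by apply: (@cvgZr _ R^o); apply: (@cvgB _ R^o); [exact: c1|exact: c2].
apply: (@cvgZr _ R^o); apply: (@cvgD _ R^o); last exact: cvg_cst.
by apply: (@cvgZr _ R^o); exact: c1.
Qed.

Lemma drift_bound_integrable n : leb.-integrable `[0, t]
  (EFin \o (fun s => (if h n <= s then 1 else 0) * drift_bound n s)).
Proof.
have mi : measurable (`[0, t]%classic : set RT) by exact: measurable_itv.
have iP := continuous_integrable 0 t (@drift_bound_continuous n).
apply: (rintegrable_le mi _ (integrable_norm iP)).
  apply: measurable_funM; last exact: rintegrable_measurable iP.
  by apply: measurable_funTS; apply: measurable_fun_ifT => //; exact: measurable_fun_ler.
by move=> s _ /=; case: ifP => _; rewrite ?mul1r// mul0r normr0.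
Qed.

(** The first bound is uniform in n and provides, later on, the majorant for reverse Fatou in omega;
    the second is the pathwise sign in the limit. *)
Lemma pathwise_drift :
  (forall n, \int[leb]_(s in `[0, t]) ((if h n <= s then 1 else 0) * drift_bound n s) <=
     drift_const p C * \int[leb]_(s in `[0, t]) path_growth s) /\
  forall eps, 0 < eps -> exists N, forall n, (N <= n)%N ->
    \int[leb]_(s in `[0, t]) ((if h n <= s then 1 else 0) * drift_bound n s) <= eps.
Proof.
have T0 : 0 <= T := le_trans t0 tT.
have ma (v : V) : measurable_fun setT (fun r => a r v).
  have [al aC] := pairing_functional v.
  have ma1 := Borel_map_functional ba1 (l := fun phi : dual V => phi v) al aC.
  have ma2 := Borel_map_functional ba2 (l := fun phi : dual V => phi v) al aC.
  apply: (eq_measurable_fun (fun r : RT => if 0 <= r <= t then a1 r v - a2 r v else 0)).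
    by move=> r _; rewrite /a /on_itv; case: ifP.
  apply: measurable_fun_ifT => //; last exact: measurable_funB.
  by apply: measurable_and; exact: measurable_fun_ler.
have mi : measurable (`[0, T]%classic : set RT) by exact: measurable_itv.
have iN0 := rintegrableD mi (drift_norm_integrable ba1 sol1 T0)
  (drift_norm_integrable ba2 sol2 T0).
have [iN _] := on_itv_integrable iN0.
have ik' : leb.-integrable `[0, T] (EFin \o (fun r => Kk * path_growth r)) by exact: rintegrableZ.
have iJ' : leb.-integrable `[0, T] (EFin \o (fun r => KJ * path_growth r)) by exact: rintegrableZ.
have [ik Ek] := on_itv_integrable ik'; have [iJ EJ] := on_itv_integrable iJ'.
have aN r : `|a r| <= on_itv (fun r => `|a1 r| + `|a2 r|) r.
  by rewrite /a /on_itv; case: ifP => _; rewrite ?normr0// ler_normB.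
have k_out r : ~~ (0 <= r <= t) -> k r = 0 by rewrite /k /on_itv => /negbTE ->.
have iJt : leb.-integrable `[0, t] (EFin \o J) by apply: integrableS iJ.
have [H1 H2] := lavg_pairing_limsup V_separable ma iN aN ik k0 k_out iJt J0 a_lower a_sign
  drift_bound_integrable drift_bound_le.
split => // n; apply: le_trans (H1 n) _.
have ig : leb.-integrable `[0, t] (EFin \o path_growth).
  by apply: integrableS ikappa => //; apply: subset_itvl; rewrite bnd_simp.
rewrite Ek [drift_const p C]/(Kk + KJ) mulrDl -!RintegralZl// lerD2l.
by rewrite le_eqVlt; apply/orP; left; apply/eqP; apply: eq_Rintegral => r;
  rewrite inE/= in_itv/= /J /on_itv => ->.
Qed.

End pathwise_drift.

(** * Consequences of the structural assumptions *)

Section finite_domain.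
Context (R : realType).
Local Notation RT := (measurableTypeR R).

Let cube n (B : R) := [set u : n.-tuple RT | forall i, `|tnth u i| <= B].

Let measurable_cube n B : measurable (@cube n B).
Proof.
rewrite (_ : @cube n B = \bigcap_(i in [set: 'I_n]) [set u | `|tnth u i| <= B]); last first.
  by apply/seteqP; split=> [u uB i _|u uB i]; exact: uB.
apply: fin_bigcap_measurable => // i _.
rewrite (_ : [set u | _] = (fun u : n.-tuple RT => tnth u i) @^-1` `[- B, B]%classic).
  by rewrite -[X in measurable X]setTI; apply: measurable_tnth.
by apply/seteqP; split=> u /=; rewrite in_itv/= ler_norml.
Qed.

Let lebesgue_tuple_cube n B : (lebesgue_tuple R n (@cube n B) < +oo)%E.
Proof.
elim: n => [|n IH].
  rewrite /= diracE; by case: (_ \in _); rewrite ltry.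
apply: (@le_lt_trans _ _ (((@lebesgue_measure R) \x lebesgue_tuple R n)%E
   (`[- B, B]%classic `*` @cube n B))).
  set m := ((@lebesgue_measure R) \x lebesgue_tuple R n)%E.
  have -> : lebesgue_tuple R n.+1 (@cube n.+1 B) = m (@tuple_cons R n @^-1` @cube n.+1 B) by [].
  apply: le_measure; rewrite ?inE.
  - rewrite -[X in measurable X]setTI.
    by apply: measurable_tuple_cons => //; exact: measurable_cube.
  - by apply: measurableX => //; exact: measurable_cube.
  - move=> [x u] /= xu; split.
      by have := xu ord0; rewrite /= in_itv/= ler_norml.
    by move=> i; have := xu (lift ord0 i); rewrite tnthS.
rewrite product_measure1E//; last exact: measurable_cube.
rewrite lte_mul_pinfty ?ge0_fin_numE// [X in (X < _)%E]lebesgue_measure_itv/=.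
by case: ifP => _; rewrite ltry.
Qed.

(** Finite measure puts the constants in L^2, on which the Lipschitz constant of f is read off from
    that of F. *)
Lemma lebesgue_on_finite n (O : set 'rV[R]_n) (oO : open O) : bounded_set O ->
  (lebesgue_on oO setT < +oo)%E.
Proof.
move=> /pinfty_ex_gt0[B B0 OB].
apply: le_lt_trans (lebesgue_tuple_cube n B).
change (lebesgue_tuple R n (@row_of_tuple R n @^-1` (setT `&` O)) <= lebesgue_tuple R n (@cube n B))%E.
rewrite setTI.
apply: le_measure; rewrite ?inE; last 2 first.
- exact: measurable_cube.
- move=> u /= /OB uB i; apply: le_trans uB.
  rewrite -[`|row_of_tuple u|]/(mx_norm (row_of_tuple u : 'rV[R]_n)) mx_normrE.
  have := le_bigmax (0 : R) (fun ij => `|(row_of_tuple u : 'rV[R]_n) ij.1 ij.2|) (ord0, i).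
  by rewrite /= mxE.
rewrite -[X in measurable X]setTI; apply: measurable_row_of_tuple => //; exact: open_borel.
Qed.

End finite_domain.

Section superposition_operator.
Context d (Omega : measurableType d) (R : realType) (P : probability Omega R).
Context d' (X : measurableType d') (mu : {measure set X -> \bar R}).
Local Notation H := (L2 mu).
Local Notation leb := (@lebesgue_measure R).
Variables (T CF : R) (f : Omega -> R -> R -> R) (F : Omega -> R -> H -> H).
Hypotheses (mu_fin : (mu setT < +oo)%E) (mu_pos : mu setT != 0%E) (CF0 : 0 <= CF)
  (cf : forall w (t : R), 0 <= t <= T -> continuous (f w t))
  (fF : superposition P T f F)
  (F_lip : forall u1 u2 : H, {ae (P \x leb)%E, forall z : Omega * R, 0 <= z.2 <= T ->
    `|F z.1 z.2 u1 - F z.1 z.2 u2| <= CF * `|u1 - u2|}).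

Let const (y : R) : H := ofun mu (cst y).

Let constE y : {ae mu, forall x, Lp_fun (const y) x = y}.
Proof.
apply: ofunE; apply: Lfun2P => //.
rewrite (_ : (fun x => _) = cst (y ^+ 2)%:E)// integral_cst//.
by rewrite lte_mul_pinfty// lee_fin sqr_ge0.
Qed.

Let norm_const (u : H) c : {ae mu, forall x, Lp_fun u x = c} ->
  (`|u| ^+ 2)%:E = ((c ^+ 2)%:E * mu setT)%E.
Proof.
move=> uc; rewrite L2_normE_int -integral_cst//; apply: ae_eq_integral => //.
  by apply/measurable_EFinP; apply: measurable_funX; exact: Lp_fun_measurable.
by apply: filterS uc => x -> _.
Qed.

(* On constants the Lipschitz bound of F is a pointwise bound for f, since the domain has
   positive finite measure. *)
Lemma superposition_lip : {ae (P \x leb)%E, forall z : Omega * R, 0 <= z.2 <= T ->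
  forall y y', `|f z.1 z.2 y - f z.1 z.2 y'| <= CF * `|y - y'|}.
Proof.
(* The exceptional set in (F2) depends on the two arguments, so only countably many constants are
   tested at first; continuity of f reaches the others. *)
have h1 : {ae (P \x leb)%E, forall z : Omega * R, forall i j : nat, 0 <= z.2 <= T ->
    `|F z.1 z.2 (const (nth_rational R i)) - F z.1 z.2 (const (nth_rational R j))| <=
    CF * `|const (nth_rational R i) - const (nth_rational R j)|}.
  by apply: ae_foralln => i; apply: ae_foralln => j; exact: F_lip.
move: fF; rewrite /superposition => fF'.
have flt : Filter (almost_everywhere (P \x leb)%E) by exact: ae_filter_ringOfSetsType.
apply: filterS2 fF' h1 => z fz Fz zT.
have key i j : `|f z.1 z.2 (nth_rational R i) - f z.1 z.2 (nth_rational R j)| <=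
    CF * `|nth_rational R i - nth_rational R j|.
  have := Fz i j zT; set y := nth_rational R i; set y' := nth_rational R j.
  have e1 : {ae mu, forall x, Lp_fun (const y - const y') x = y - y'}.
    by apply: filterS3 (Lp_funB (const y) (const y')) (constE y) (constE y') => x -> -> ->.
  have e2 : {ae mu, forall x, Lp_fun (F z.1 z.2 (const y) - F z.1 z.2 (const y')) x =
      f z.1 z.2 y - f z.1 z.2 y'}.
    apply: filterS3 (Lp_funB (F z.1 z.2 (const y)) (F z.1 z.2 (const y')))
      (filterI (fz zT (const y)) (fz zT (const y'))) (filterI (constE y) (constE y')).
    by move=> x -> [-> ->] [-> ->].
  rewrite -(@ler_sqr _ `|F _ _ _ - _|) ?nnegrE ?mulr_ge0// exprMn -lee_fin.
  rewrite [X in (_ <= X)%E]EFinM (norm_const e1) (norm_const e2) muleA -EFinM.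
  have mf : mu setT = (fine (mu setT))%:E by rewrite fineK// ge0_fin_numE.
  have m0 : 0 < fine (mu setT) by rewrite fine_gt0// mu_fin lt0e mu_pos measure_ge0.
  rewrite mf -!EFinM lee_fin ler_pM2r// => le2.
  by rewrite -ler_sqr ?nnegrE ?mulr_ge0// exprMn !real_normK ?num_real.
move=> y y'.
have cz := cf (w := z.1) zT.
have cd (y0 : R) : continuous (fun y => `|f z.1 z.2 y - f z.1 z.2 y0| - CF * `|y - y0|).
  move=> x; apply: (@cvgB _ R^o).
    by apply: cvg_norm; apply: (@cvgB _ R^o); [exact: cz|exact: cvg_cst].
  by apply: (@cvgZr _ R^o); apply: cvg_norm; apply: (@cvgB _ R^o); [exact: cvg_id|exact: cvg_cst].
have k1 j x : `|f z.1 z.2 x - f z.1 z.2 (nth_rational R j)| - CF * `|x - nth_rational R j| <= 0.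
  by apply: (le_rational (cd _)) => i; rewrite subr_le0.
rewrite -subr_le0; apply: (le_rational (cd y')) => i.
by have := k1 i y'; rewrite distrC (distrC y').
Qed.

(** Compared with (F2), the bound is pointwise in x and its exceptional set of times no longer
    depends on the arguments, so it holds along random paths. *)
Lemma superposition_operator_lip : {ae (P \x leb)%E, forall z : Omega * R, 0 <= z.2 <= T ->
  forall u u' : H, {ae mu, forall x,
    `|Lp_fun (F z.1 z.2 u - F z.1 z.2 u') x| <= CF * `|Lp_fun (u - u') x|}}.
Proof.
move: fF; rewrite /superposition => fF'.
have flt : Filter (almost_everywhere (P \x leb)%E) by exact: ae_filter_ringOfSetsType.
apply: filterS2 fF' superposition_lip => z fz lz zT u u'.
apply: filterS3 (Lp_funB (F z.1 z.2 u) (F z.1 z.2 u')) (Lp_funB u u')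
  (filterI (fz zT u) (fz zT u')) => x -> -> [-> ->].
exact: lz.
Qed.

End superposition_operator.

Section weighted_noise.
Context d' (X : measurableType d') (R : realType) (mu : {measure set X -> \bar R}).
Local Notation H := (L2 mu).

Let kmul_int (a x : H) : ((`|kmul a x| ^+ 2)%:E =
  \int[mu]_z (tf_k (Lp_fun a z) ^+ 2 * Lp_fun x z ^+ 2)%:E)%E.
Proof.
rewrite L2_normE_int; apply: ae_eq_integral => //.
- by apply/measurable_EFinP; apply: measurable_funX; exact: Lp_fun_measurable.
- apply/measurable_EFinP; apply: measurable_funM; apply: measurable_funX.
    apply: measurableT_comp; last exact: Lp_fun_measurable.
    by apply: (@lip_measurable _ _ 1) => // r s; rewrite mul1r; exact: tf_k_lip.
  exact: Lp_fun_measurable.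
- by apply: filterS (kmulE a x) => z -> _; rewrite exprMn.
Qed.

(** Passes from sets to the weight k(a)^2 by approximating the weight with simple functions. *)
Lemma kmul_sum_le (y : nat -> H) (x : H) (C : R) n (a : H) :
  (forall B, measurable B ->
    (\sum_(0 <= k <oo) \int[mu]_(z in B) (Lp_fun (y k) z ^+ 2)%:E <=
     C%:E * \int[mu]_(z in B) (Lp_fun x z ^+ 2)%:E)%E) -> 0 <= C ->
  \sum_(k < n) `|kmul a (y k)| ^+ 2 <= C * `|kmul a x| ^+ 2.
Proof.
move=> yx C0; rewrite -lee_fin EFinM kmul_int -sumEFin.
under eq_bigr do rewrite kmul_int.
have mL (b : H) : measurable_fun setT (fun z => Lp_fun b z ^+ 2).
  by apply: measurable_funX; exact: Lp_fun_measurable.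
have mka : measurable_fun setT (fun z => tf_k (Lp_fun a z) ^+ 2).
  apply: measurable_funX; apply: measurableT_comp; last exact: Lp_fun_measurable.
  by apply: (@lip_measurable _ _ 1) => // r s; rewrite mul1r; exact: tf_k_lip.
rewrite -ge0_integralZl_EFin//; last 2 first.
- by move=> z _; rewrite lee_fin mulr_ge0 ?sqr_ge0.
- by apply/measurable_EFinP; exact: measurable_funM.
rewrite -ge0_integral_sum//; last 2 first.
- by move=> k; apply/measurable_EFinP; exact: measurable_funM.
- by move=> k z _; rewrite lee_fin mulr_ge0 ?sqr_ge0.
pose g1 z := \sum_(k < n) Lp_fun (y k) z ^+ 2; pose g2 z := C * Lp_fun x z ^+ 2.
have mg1 : measurable_fun setT g1 by apply: measurable_sum => k.
have mg2 : measurable_fun setT g2 by apply: measurable_funM.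
rewrite (eq_integral (fun z => (tf_k (Lp_fun a z) ^+ 2 * g1 z)%:E)); last first.
  by move=> z _; rewrite sumEFin mulr_sumr.
rewrite [leRHS](eq_integral (fun z => (tf_k (Lp_fun a z) ^+ 2 * g2 z)%:E)); last first.
  by move=> z _; rewrite -EFinM mulrCA.
apply: (@le_integral_sets _ _ _ _ _ mu mu _ _ id id g1 g2 _ _ _ _ _ _ _ (fun z => tf_k (Lp_fun a z) ^+ 2)) => //.
- by move=> z; apply: sumr_ge0 => k _; exact: sqr_ge0.
- by move=> z; rewrite mulr_ge0// sqr_ge0.
- move=> B mB; have ind (g : X -> R) : (\int[mu]_z (\1_B z * g z)%:E = \int[mu]_(z in B) (g z)%:E)%E.
    rewrite [RHS]integral_mkcond; apply: eq_integral => z _; rewrite /patch indicE.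
    by case: (z \in B); rewrite ?mul1r ?mul0r.
  rewrite !ind; apply: (@le_trans _ _ (C%:E * \int[mu]_(z in B) (Lp_fun x z ^+ 2)%:E)%E); last first.
    rewrite -ge0_integralZl_EFin//.
    - by move=> z _; rewrite lee_fin sqr_ge0.
    - by apply/measurable_EFinP; apply: measurable_funTS.
  apply: le_trans (yx B mB); rewrite (eq_integral (fun z => \sum_(k < n) (Lp_fun (y k) z ^+ 2)%:E)%E).
    rewrite ge0_integral_sum//; last 2 first.
    - by move=> k; apply/measurable_EFinP; apply: measurable_funTS.
    - by move=> k z _; rewrite lee_fin sqr_ge0.
    rewrite -(big_mkord xpredT (fun k => \int[mu]_(z in B) (Lp_fun (y k) z ^+ 2)%:E)%E).
    by apply: nneseries_lim_ge => k _ _; apply: integral_ge0 => z _; rewrite lee_fin sqr_ge0.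
  by move=> z _; rewrite sumEFin.
- by move=> z; exact: sqr_ge0.
Qed.

End weighted_noise.

Lemma Lnorm4_quartic d' (X : measurableType d') (R : realType) (mu : {measure set X -> \bar R})
    (x : L2 mu) (C : R) : ('N[mu]_4%:E[EFin \o Lp_fun x] <= C%:E)%E -> (quartic x < +oo)%E.
Proof.
rewrite unlock /= => xC; rewrite /quartic.
have : ((\int[mu]_z (`|Lp_fun x z| `^ 4)%:E) `^ 4^-1 < +oo)%E by apply: le_lt_trans xC _; exact: ltry.
move=> /lty_poweRy; rewrite invr_eq0 pnatr_eq0 => /(_ isT).
apply: le_lt_trans; rewrite le_eqVlt; apply/orP; left; apply/eqP.
apply: eq_integral => z _; rewrite powR_mulrn//; congr (_%:E).
by rewrite -[4%N]/(2 * 2)%N !exprM real_normK ?num_real.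
Qed.

(** * Energy inequality *)

Section Fubini_real.
Context d (Omega : measurableType d) (R : realType) (P : probability Omega R).
Local Notation RT := (measurableTypeR R).
Local Notation leb := (@lebesgue_measure R).

Lemma Fubini_real (D : set RT) (f : Omega * RT -> R) : measurable D -> measurable_fun setT f ->
  (iterated P D (fun z => `|f z|%:E) < +oo)%E ->
  (forall w, leb.-integrable D (EFin \o (fun r => f (w, r)))) ->
  (forall r, D r -> P.-integrable setT (EFin \o (fun w => f (w, r)))) ->
  [/\ P.-integrable setT (EFin \o (fun w => \int[leb]_(r in D) f (w, r))),
      leb.-integrable D (EFin \o (fun r => \int[P]_w f (w, r))) &
      \int[P]_w \int[leb]_(r in D) f (w, r) = \int[leb]_(r in D) \int[P]_w f (w, r)].
Proof.
move=> mD mf fi if1 if2.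
pose g (z : Omega * RT) := (if z.2 \in D then f z else 0)%:E.
have mg : measurable_fun setT g.
  apply/measurable_EFinP/measurable_fun_ifT => //.
  apply: (measurable_fun_bool true).
  rewrite setTI (_ : _ @^-1` _ = snd @^-1` D).
    by rewrite -[X in measurable X]setTI; apply: measurable_snd.
  by apply/seteqP; split => z /=; [exact: set_mem|exact: mem_set].
have E1 w : (\int[leb]_r g (w, r) = (\int[leb]_(r in D) f (w, r))%:E)%E.
  rewrite /Rintegral fineK; last exact: integrable_fin_num (if1 w).
  by rewrite [RHS]integral_mkcond; apply: eq_integral => r _; rewrite /g /patch/=; case: ifP.
have E2 r : (\int[P]_w g (w, r) = (if r \in D then \int[P]_w f (w, r) else 0)%:E)%E.
  rewrite /g/=; case: ifPn => [/set_mem Dr|_]; last by rewrite integral0.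
  by rewrite /Rintegral fineK//; exact: integrable_fin_num (if2 r Dr).
have gfin : (\int[leb]_r \int[P]_w `|g (w, r)| < +oo)%E.
  apply: le_lt_trans fi; rewrite /iterated [X in (_ <= X)%E]integral_mkcond.
  rewrite le_eqVlt; apply/orP; left; apply/eqP; apply: eq_integral => r _.
  rewrite /patch /g/=; case: ifP => // _.
  by apply: integral0_eq => w _; rewrite /= normr0.
have ig : (P \x leb)%E.-integrable setT g by exact: (integrable21ltyP _ _ mg).2 gfin.
have iF := integrable_fubini_F ig.
have iG : leb.-integrable setT (fubini_G P g).
  apply/integrableP; split; first exact: measurable_fubini_G ig.
  apply: le_lt_trans gfin; apply: ge0_le_integral => //.
  - by apply: measurableT_comp => //; exact: measurable_fubini_G ig.
  - apply: (measurable_fun_fubini_tonelli_G (m1 := P) (fun z => `|g z|%E)) => //.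
    exact: measurableT_comp.
  - by move=> r _; apply: le_abse_integral => //; exact: measurableT_comp.
have FE : fubini_F leb g = EFin \o (fun w => \int[leb]_(r in D) f (w, r)).
  by apply/funext => w; rewrite /fubini_F E1.
have GE : fubini_G P g = EFin \o ((fun r => \int[P]_w f (w, r)) \_ D).
  by apply/funext => r; rewrite /fubini_G E2 /patch.
rewrite FE in iF; rewrite GE -restrict_EFin -integrable_mkcond// in iG.
split => //; have := Fubini ig; under eq_integral do rewrite E1.
under [in RHS]eq_integral do rewrite E2.
move=> /(congr1 fine); rewrite -/(Rintegral P setT _) => ->.
by rewrite -/(Rintegral leb setT _) [RHS]Rintegral_mkcond.
Qed.

(** Turns the extended-real error density in time into a real integrable function, whose left
    averages can then be formed. *)
Lemma real_density (T eps : R) (g : RT -> \bar R) : 0 <= T -> measurable_fun setT g ->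
  (forall r, (0 <= g r)%E) -> (\int[leb]_(r in `[0%R, T]) g r <= eps%:E)%E ->
  exists k : R -> R, [/\ leb.-integrable setT (EFin \o k), forall r, 0 <= k r,
    \int[leb]_r k r <= eps &
    forall s' s : R, 0 <= s' -> s' <= s -> s <= T ->
      (\int[leb]_(r in `]s', s]) g r <= (\int[leb]_(r in `]s', s]) k r)%:E)%E].
Proof.
move=> T0 mg g0 ge; have mi : measurable (`[0, T]%classic : set RT) by exact: measurable_itv.
have ig : leb.-integrable (`[0, T]%classic : set RT) g.
  apply/integrableP; split; first exact: measurable_funTS.
  by apply: le_lt_trans (ltry eps); under eq_integral do rewrite gee0_abs//.
have gfin := integrable_ae mi ig.
have igf : leb.-integrable (`[0, T]%classic : set RT) (EFin \o (fine \o g)).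
  apply/integrableP; split.
    by apply/measurable_EFinP; apply: measurable_funTS; exact: measurableT_comp.
  apply: le_lt_trans (ltry eps); apply: le_trans ge.
  rewrite le_eqVlt; apply/orP; left; apply/eqP; apply: ae_eq_integral => //.
  - apply: measurable_funTS; apply/measurableT_comp => //; apply/measurable_EFinP.
    exact: measurableT_comp.
  - exact: measurable_funTS.
  by apply: filterS gfin => r gr Dr /=; rewrite ger0_norm ?fine_ge0// fineK// gr.
exists ((fine \o g) \_ `[0, T]); split.
- by rewrite -restrict_EFin -integrable_mkcond.
- by move=> r; rewrite /patch; case: ifP => // _; exact: fine_ge0.
- rewrite -Rintegral_mkcond -lee_fin /Rintegral fineK; last exact: integrable_fin_num igf.
  apply: le_trans ge; rewrite le_eqVlt; apply/orP; left; apply/eqP; apply: ae_eq_integral => //.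
  + by apply: measurable_funTS; apply/measurable_EFinP; exact: measurableT_comp.
  + exact: measurable_funTS.
  by apply: filterS gfin => r gr Dr /=; rewrite fineK// gr.
- move=> s' s s'0 s's sT.
  have sub : `]s', s]%classic `<=` (`[0, T]%classic : set RT).
    by apply: subset_itvScc => //; rewrite bnd_simp.
  have mi' : measurable (`]s', s]%classic : set RT) by exact: measurable_itv.
  have ifs : leb.-integrable (`]s', s]%classic : set RT) (EFin \o (fine \o g) \_ `[0, T]).
    have : leb.-integrable setT (EFin \o (fine \o g) \_ `[0, T]).
      by rewrite -restrict_EFin -integrable_mkcond.
    by apply: integrableS.
  rewrite /Rintegral fineK; last exact: integrable_fin_num ifs.
  rewrite le_eqVlt; apply/orP; left; apply/eqP; apply: ae_eq_integral => //.
  + exact: measurable_funTS.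
  + by case/integrableP : ifs.
  apply: filterS gfin => r gr /[dup] rs /sub rT /=.
  by rewrite /patch mem_set// fineK// gr.
Qed.

End Fubini_real.

Lemma le_Rintegral_subset d (Y : measurableType d) (R : realType)
    (nu : {measure set Y -> \bar R}) (D E : set Y) (f : Y -> R) :
  measurable D -> measurable E -> D `<=` E -> nu.-integrable E (EFin \o f) ->
  (forall x, E x -> 0 <= f x) -> \int[nu]_(x in D) f x <= \int[nu]_(x in E) f x.
Proof.
move=> mD mE DE iE f0; have iD := integrableS mE mD DE iE.
rewrite -lee_fin /Rintegral !fineK; [|exact: integrable_fin_num iE|exact: integrable_fin_num iD].
apply: ge0_subset_integral => //; first by case/integrableP : iE.
Qed.

Lemma integral_le_cst d (Y : measurableType d) (R : realType)
    (nu : {measure set Y -> \bar R}) (D : set Y) (g : Y -> \bar R) (C : R) :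
  measurable D -> measurable_fun D g -> (forall x, D x -> (0 <= g x <= C%:E)%E) -> (nu D < +oo)%E ->
  (\int[nu]_(x in D) g x < +oo)%E.
Proof.
move=> mD mg gC Doo; apply: (@le_lt_trans _ _ (\int[nu]_(x in D) (Num.max 0 C)%:E)%E).
  apply: ge0_le_integral => //.
  - by move=> x /gC /andP[].
  - by move=> x /gC /andP[_] /le_trans; apply; rewrite lee_fin le_max lexx orbT.
by rewrite integral_cst// lte_mul_pinfty// lee_fin le_max lexx.
Qed.

Lemma le_sum_halves (R : realFieldType) (a1 a2 a3 s x b c e : R) :
  s * (2 * x) <= e -> c * (2 * b) <= e -> a1 + a2 <= s * x -> a3 <= c * b -> a1 + a3 + a2 <= e.
Proof. by rewrite mulrCA [c * (2 * _)]mulrCA; lra. Qed.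

Lemma le_increment_combine (R : realFieldType) (e a b c t A B I J K r y0 y1 : R) :
  A - (a * B + b * J) - (c * K + r) <= e -> y1 - y0 - e <= A -> r <= e * t ->
  c * K <= c * e -> b * J <= b * I -> a * B <= a * I ->
  y1 <= y0 + (a + b) * I + (2 * e + c * e + e * t).
Proof. by rewrite mulrDl; lra. Qed.

Section energy.
Context d (Omega : measurableType d) (R : realType) (P : probability Omega R).
Context (T : R) (Ft : R -> set (set Omega)) (Ft_filtration : complete_filtration P T Ft).
Context (U : hilbertType R) (e : onbasis U).
Context (W : R -> U -> Omega -> R) (W_Wiener : cylindrical_Wiener P T Ft W).
Context d' (X : measurableType d') (mu : {measure set X -> \bar R}).
Local Notation H := (L2 mu).
Local Notation RT := (measurableTypeR R).
Local Notation leb := (@lebesgue_measure R).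
Local Notation h n := (n.+1%:R^-1 : R).
Hypotheses (T0 : 0 < T) (H_separable : separable H).
Variables (w M : Omega -> R -> H) (Phi : Omega -> R -> nat -> H).
Variables (s_ : nat -> elementary T Ft H) (CG2 CF : R) (D : set H).
Hypotheses (cw : forall om, continuous (w om)) (cM : forall om, continuous (M om))
  (w_clamp : forall om s, w om s = w om (clamp 0 T s))
  (bw : forall s, Borel_map (w ^~ s)) (bM : forall s, Borel_map (M ^~ s))
  (w_sq : sq_integrable P (path_sup w))
  (w_adapted : forall s, 0 < s -> s <= T -> adapted_at Ft s (w ^~ s))
  (approx : stochastic_approx P e W s_ Phi M)
  (CG0 : 0 <= CG2) (CF0 : 0 <= CF)
  (Phi_le : forall n om (r : R) a, 0 <= r <= T ->
    \sum_(k < n) `|kmul a (Phi om r k)| ^+ 2 <= CG2 * `|kmul a (w om r)| ^+ 2)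
  (D_dense : forall x r, 0 < r -> exists2 y, D y & `|x - y| < r)
  (D_quartic : forall x, D x -> (quartic x < +oo)%E).

Let TT : 0 <= T. Proof. exact: ltW. Qed.

Let sup_le om s : `|w om s| <= path_sup w om.
Proof. exact: le_path_sup TT cw w_clamp om s. Qed.

Let sup_ge0 om : 0 <= path_sup w om.
Proof. by apply: le_trans (sup_le om 0). Qed.

Let osc_le n om r s : `|r - s| <= h n -> `|w om r - w om s| <= path_osc w n om.
Proof. exact: le_path_osc TT cw w_clamp n om r s. Qed.

Let osc_ge0 n om : 0 <= path_osc w n om.
Proof. by apply: le_trans (osc_le (r := 0) (s := 0) om _); rewrite ?subrr ?normr0// ltW. Qed.

Let osc_sup n om : path_osc w n om <= 2 * path_sup w om.
Proof.
apply: path_osc_le => r s; rewrite (le_trans (ler_normB _ _))// mulr2n mulrDl mul1r.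
by rewrite lerD.
Qed.

Let msup : measurable_fun setT (path_sup w).
Proof. exact: measurable_path_sup TT cw w_clamp bw. Qed.

Let mosc n : measurable_fun setT (path_osc w n).
Proof. exact: (measurable_path_osc TT cw w_clamp bw H_separable). Qed.

Let men (x : Omega -> H) : Borel_map x -> measurable_fun setT (fun om => pos_energy (x om)).
Proof.
by move=> bx; apply: Borel_map_measurable; apply: (Borel_map_comp (f := x)); [exact: pos_energy_continuous|].
Qed.

Let isup2 : P.-integrable setT (EFin \o (fun om => path_sup w om ^+ 2)).
Proof. by case: w_sq. Qed.

Let en_le om s : pos_energy (w om s) <= path_sup w om ^+ 2.
Proof.
apply: le_trans (pos_energy_le _) _.
by rewrite lerXn2r ?nnegrE//.
Qed.

Let ien s : P.-integrable setT (EFin \o (fun om => pos_energy (w om s))).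
Proof.
apply: (rintegrable_le measurableT _ isup2); first exact: men.
by move=> om _; rewrite ger0_norm ?pos_energy_ge0.
Qed.

Definition mean_energy (s : R) : R := \int[P]_om pos_energy (w om s).

Let y := mean_energy.

Let y_ge0 s : 0 <= y s.
Proof. by apply: Rintegral_ge0 => om _; exact: pos_energy_ge0. Qed.

Let B0 := \int[P]_om (path_sup w om ^+ 2).

Let y_le s : y s <= B0.
Proof. by apply: le_Rintegral => // om _; exact: en_le. Qed.

Let y_continuous : continuous y.
Proof.
move=> s; have sI : s \in (`]s - 1, s + 1[%classic : set R).
  by rewrite inE/= in_itv/= gtrBl ltrDl ltr01.
have := @continuity_under_integral R _ Omega P (fun s om => pos_energy (w om s)) setT measurableT
  (s - 1) (s + 1) _ _ (fun om => path_sup w om ^+ 2).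
apply => //.
- apply: nearW => om _ r _; apply: continuous_comp; [exact: cw|exact: pos_energy_continuous].
- by move=> r _; apply: nearW => om _; rewrite ger0_norm ?pos_energy_ge0.
Qed.

Let osc_cvg : (\int[P]_om ((path_osc w n om ^+ 2 + path_osc w n om * path_sup w om)%:E))%E
  @[n --> \oo] --> 0%E.
Proof.
have := @dominated_convergence _ _ _ P setT measurableT
  (fun n om => (path_osc w n om ^+ 2 + path_osc w n om * path_sup w om)%:E) (cst 0%E)
  (EFin \o (fun om => 6 * path_sup w om ^+ 2)).
case=> //.
- move=> n; apply/measurable_EFinP; apply: measurable_funD.
    exact: measurable_funX.
  exact: measurable_funM.
- apply: nearW => om _; apply: cvg_EFin; first exact: nearW.
  have c0 := path_osc_cvg0 TT cw w_clamp om.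
  rewrite [X in _ --> X](_ : _ = 0 ^+ 2 + 0 * path_sup w om); last by rewrite mul0r addr0 expr0n.
  apply: (@cvgD _ R^o).
    by under eq_fun do rewrite expr2; rewrite expr2; apply: (@cvgM R); exact: c0.
  by apply: (@cvgMr_tmp R); exact: c0.
- exact: rintegrableZ.
(* The oscillation is at most twice the supremum, whence 6 = 4 + 2. *)
- apply: nearW => om n _; rewrite /= lee_fin ger0_norm.
    have ? := osc_sup n om; have ? := osc_ge0 n om; have ? := sup_ge0 om.
    apply: (@le_trans _ _ ((2 * path_sup w om) ^+ 2 + 2 * path_sup w om * path_sup w om)).
      by rewrite lerD ?ler_wpM2r// lerXn2r ?nnegrE// mulr_ge0.
    by rewrite le_eqVlt; apply/orP; left; apply/eqP; ring.
  by rewrite addr_ge0 ?sqr_ge0// mulr_ge0.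
- move=> _ _; by rewrite integral0.
Qed.

(* One time step: the stochastic increment costs the energy itself, up to the oscillation of
   the path and the distance to the approximating elementary process. *)
Let en_step n (s0 : elementary T Ft H) (s : R) : (forall j, D (el_val s0 j)) ->
  h n < s -> s <= T ->
  P.-integrable setT (EFin \o (fun om => pos_energy (w om (s - h n) + M om s - M om (s - h n)))) /\
  ((\int[P]_om pos_energy (w om (s - h n) + M om s - M om (s - h n)))%:E <=
   (y (s - h n))%:E + (2400 * normal_moment R 2)%:E *
     ((h n * (2 * CG2 * (y (s - h n) + \int[P]_om (path_osc w n om ^+ 2))))%:E +
      iterated P `](s - h n)%R, s] (el_dist e s0 Phi)) +
   (400 * (8 ^+ el_size s0 * normal_moment R 4 *
      (\sum_(j < el_size s0) fine (quartic (el_val s0 j))) * (h n) ^+ 2))%:E)%E.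
Proof.
move=> s0D hs sT; pose s' := s - h n; rewrite -/s'.
have h0 : 0 < h n by rewrite invr_gt0.
have s'0 : 0 < s' by rewrite subr_gt0.
have s's : s' <= s by rewrite gerBl ltW.
have ss' : s - s' = h n by rewrite /s' opprB addrC subrK.
have sDM := stochastic_sq_integrable Ft_filtration W_Wiener H_separable (ltW s'0) s's sT approx.
have sws' : sq_integrable P (fun om => `|w om s'|).
  apply: sq_integrable_le w_sq; first by apply: Borel_map_norm.
  by move=> om; rewrite normr_id.
have aE om : w om s' + M om s - M om s' = w om s' + (M om s - M om s') by rewrite addrA.
have bq : Borel_map (fun om => w om s' + M om s - M om s').
  by apply: Borel_mapB => //; exact: Borel_mapD.
have iq : P.-integrable setT (EFin \o (fun om => pos_energy (w om s' + M om s - M om s'))).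
  have [_ i2] := sq_integrableD sws' sDM.
  apply: (rintegrable_le measurableT _ i2); first exact: men.
  move=> om _; rewrite ger0_norm ?pos_energy_ge0// (le_trans (pos_energy_le _))//.
  by rewrite lerXn2r ?nnegrE ?addr_ge0// aE ler_normD.
split=> //.
(* The noise at time r is weighted by k(w(s')). Writing w(r) = w(s') + (w(r) - w(s')), the first
   part yields the energy at s', the second at most the oscillation. *)
pose b (z : Omega * RT) := (2 * CG2 * (pos_energy (w z.1 s') + path_osc w n z.1 ^+ 2))%:E.
have mb : measurable_fun setT b.
  apply/measurable_EFinP; apply: measurable_funM => //.
  apply: (@measurableT_comp _ _ _ _ _ _ (fun om => pos_energy (w om s') + path_osc w n om ^+ 2)) => //.
  by apply: measurable_funD; [exact: men|exact: measurable_funX].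
have b0 z : (0 <= b z)%E.
  by rewrite lee_fin !mulr_ge0// addr_ge0 ?pos_energy_ge0 ?sqr_ge0.
have bP m om (r : R) : s' < r -> r <= s ->
    ((\sum_(k < m) `|kmul (w om s') (Phi om r k)| ^+ 2)%:E <= b (om, r))%E.
  move=> s'r rs; rewrite lee_fin.
  have rT : 0 <= r <= T by rewrite (le_trans (ltW s'0) (ltW s'r)) (le_trans rs).
  apply: le_trans (Phi_le _ _ _ rT) _; rewrite [2 * _]mulrC -mulrA ler_wpM2l//.
  have -> : kmul (w om s') (w om r) = kmul (w om s') (w om s') + kmul (w om s') (w om r - w om s').
    by rewrite -kmulD addrC subrK.
  apply: le_trans (norm_sqr_le2 _ _) _; rewrite kmul_self mulrDr lerD2l ler_wpM2l//.
  rewrite lerXn2r ?nnegrE//.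
  apply: le_trans (kmul_norm _ _) _; apply: osc_le.
  by rewrite ger0_norm ?subr_ge0 ?(ltW s'r)// -ss' lerD2r.
have step := stochastic_step Ft_filtration W_Wiener H_separable (ltW s'0) s's sT approx
  (fun j => D_quartic (s0D j)) (w_adapted s'0 (le_trans s's sT)) sws' mb b0 bP.
have EQ : ((\int[P]_om pos_energy (w om s' + M om s - M om s'))%:E =
    \int[P]_om (`|nemytskii (@tf_g R) (w om s' + (M om s - M om s'))| ^+ 2)%:E)%E.
  rewrite /Rintegral fineK; last exact: integrable_fin_num iq.
  by apply: eq_integral => om _; rewrite aE.
have Ey : ((y s')%:E = \int[P]_om (`|nemytskii (@tf_g R) (w om s')| ^+ 2)%:E)%E.
  by rewrite /y /mean_energy /Rintegral fineK//; exact: integrable_fin_num (ien s').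
have iosc : P.-integrable setT (EFin \o (fun om => path_osc w n om ^+ 2)).
  apply: (rintegrable_le measurableT _ (rintegrableZ measurableT 4 isup2)).
    exact: measurable_funX.
  move=> om _; rewrite ger0_norm ?sqr_ge0// (_ : 4 = 2 ^+ 2) -?exprMn ?lerXn2r ?nnegrE//.
  - by rewrite mulr_ge0.
  - by rewrite -natrX.
have Eb : iterated P `]s', s] b =
    (h n * (2 * CG2 * (y s' + \int[P]_om (path_osc w n om ^+ 2))))%:E.
  have ib : P.-integrable setT (EFin \o (fun om => 2 * CG2 * (pos_energy (w om s') + path_osc w n om ^+ 2))).
    by apply: rintegrableZ => //; exact: rintegrableD.
  have E1 r : (\int[P]_om b (om, r))%E = (2 * CG2 * (y s' + \int[P]_om (path_osc w n om ^+ 2)))%:E.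
    transitivity (\int[P]_om (2 * CG2 * (pos_energy (w om s') + path_osc w n om ^+ 2)))%:E.
      by rewrite /Rintegral fineK//; exact: integrable_fin_num ib.
    rewrite RintegralZl//; last exact: rintegrableD.
    by rewrite RintegralD.
  rewrite /iterated; under eq_integral do rewrite E1.
  rewrite integral_cst//= [X in (_ * X)%E]lebesgue_measure_itv/= lte_fin ltrBlDr ltrDl h0.
  by rewrite -EFinB ss' -EFinM mulrC.
rewrite EQ Ey -Eb -ss'; exact: step.
Qed.

Let Q n om (s : R) := pos_energy (w om (s - h n) + M om s - M om (s - h n)).

Let o n := \int[P]_om (path_osc w n om ^+ 2).

(** The order of the quantifiers matters: c precedes eps, whereas Cs depends on the approximation
    and hence on eps, but is multiplied by h^2. *)
Let en_step_real : exists2 c, 0 <= c & forall eps, 0 < eps -> exists (k : R -> R) (Cs : R),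
  [/\ leb.-integrable setT (EFin \o k), forall r, 0 <= k r, \int[leb]_r k r <= eps, 0 <= Cs &
  forall n s, h n < s -> s <= T -> P.-integrable setT (EFin \o (fun om => Q n om s)) /\
    \int[P]_om Q n om s <= y (s - h n) + c * (h n * (2 * CG2 * (y (s - h n) + o n)) +
      \int[leb]_(r in `](s - h n), s]) k r) + Cs * (h n) ^+ 2].
Proof.
have c0 : 0 <= 2400 * normal_moment R 2 :> R.
  exact: (mulr_ge0 (ler0n R 2400) (normal_moment_ge0 R 1)).
exists (2400 * normal_moment R 2); first exact: c0.
move=> eps eps0.
have [s0 s0D s0eps] := approx_revalue Ft_filtration H_separable approx T0 D_dense eps0.
have md : measurable_fun setT (el_dist e s0 Phi).
  have [bP _ _ _] := approx.
  by apply: measurable_sqsum => j; apply: Borel_mapB => //; exact: (el_fun_Borel Ft_filtration).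
have d0 z : (0 <= el_dist e s0 Phi z)%E by exact: sqsum_ge0.
have mg := measurable_inner P md d0.
have g0 (r : RT) : (0 <= \int[P]_om el_dist e s0 Phi (om, r))%E by exact: integral_ge0.
have [k [ik k0 keps kle]] := real_density TT mg g0 s0eps.
pose Cs := 400 * (8 ^+ el_size s0 * normal_moment R 4 *
      (\sum_(j < el_size s0) fine (quartic (el_val s0 j)))).
have Cs0 : 0 <= Cs.
  apply: (mulr_ge0 (ler0n R 400)); apply: mulr_ge0.
    exact: (mulr_ge0 (exprn_ge0 _ (ler0n R 8)) (normal_moment_ge0 R 2)).
  by apply: sumr_ge0 => j _; exact/fine_ge0/quartic_ge0.
exists k, Cs; split => // n s hs sT.
have [iq step] := en_step s0D hs sT; split => //.
have s's : s - h n <= s by rewrite gerBl.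
have s'0 : 0 <= s - h n by rewrite subr_ge0 ltW.
rewrite -lee_fin; apply: le_trans step _.
rewrite EFinD [(_ + _ * _)%:E]EFinD; apply: leeD; last first.
  by rewrite lee_fin /Cs mulrA.
apply: leeD => //; rewrite [X in (_ <= X)%E](EFinM (2400 * normal_moment R 2)).
apply: lee_wpmul2l.
  by rewrite lee_fin; exact: c0.
rewrite EFinD; apply: leeD => //; exact: kle.
Qed.

Let o' n := \int[P]_om (path_osc w n om * path_sup w om).

Let iosc n : P.-integrable setT (EFin \o (fun om => path_osc w n om ^+ 2)) /\
  P.-integrable setT (EFin \o (fun om => path_osc w n om * path_sup w om)).
Proof.
have sosc : sq_integrable P (path_osc w n).
  apply: (sq_integrable_le (g := fun om => 2 * path_sup w om)) => //.
  - by move=> om; rewrite ger0_norm ?osc_ge0.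
  - exact: sq_integrableZ.
by split; [case: sosc|exact: sq_integrable_mul].
Qed.

Let o_cvg eps : 0 < eps -> exists N, forall n, (N <= n)%N -> o n + o' n <= eps.
Proof.
move=> eps0; have [N HN] := cvge0_lt osc_cvg eps0.
exists N => n /HN h1; rewrite /o /o' -RintegralD//; try by case: (iosc n).
rewrite -lee_fin /Rintegral fineK; first exact: ltW.
by apply: integrable_fin_num => //; apply: rintegrableD => //; case: (iosc n).
Qed.

Let o_ge0 n : 0 <= o n. Proof. by apply: Rintegral_ge0 => om _; exact: sqr_ge0. Qed.

Let o'_ge0 n : 0 <= o' n.
Proof. by apply: Rintegral_ge0 => om _; rewrite mulr_ge0. Qed.

Let drift n om (s : R) : R :=
  drift_bound (w om) (M om) CF (path_sup w om) (fun n => path_osc w n om) n s.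

Let drift_continuous n om : continuous (drift n om).
Proof. exact: drift_bound_continuous. Qed.

Let drift_measurable_at n s : measurable_fun setT (drift n ^~ s).
Proof.
apply: measurable_funB; last first.
  apply: measurable_funM => //; apply: measurable_funD; first by apply: measurable_funM => //; exact: men.
  by apply: measurable_funM => //; exact: measurable_funM.
apply: measurable_funM => //; apply: measurable_funB; apply: men => //.
by apply: Borel_mapB => //; exact: Borel_mapD.
Qed.

Let drift_measurable n : measurable_fun setT (fun z : Omega * RT => drift n z.1 z.2).
Proof.
apply: Caratheodory_process => [om|s]; first exact: drift_continuous.
exact: drift_measurable_at.
Qed.

Let drift_le n om s : `|drift n om s| <=
  n.+1%:R * (path_sup w om ^+ 2 + Q n om s) + 28 * CF * path_sup w om ^+ 2.
Proof.
rewrite /drift /drift_bound -/(Q n om s); have := en_le om s; have := osc_sup n om.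
have := sup_ge0 om; have := osc_ge0 n om; have := pos_energy_ge0 (w om s).
have : 0 <= Q n om s by exact: pos_energy_ge0.
move: (Q n om s) (pos_energy _) (path_sup w om) (path_osc w n om) => q E S O q0 E0 O0 S0 OS ES.
have OS2 : O * S <= 2 * S ^+ 2 by rewrite expr2 mulrA ler_wpM2r.
rewrite (le_trans (ler_normB _ _))// lerD//.
  rewrite normrM ger0_norm// ler_wpM2l// (le_trans (ler_normB _ _))//.
  by rewrite !ger0_norm// lerD2r.
rewrite normrM ger0_norm// ger0_norm; last first.
  by rewrite addr_ge0 ?mulr_ge0.
rewrite [leRHS](_ : _ = CF * (28 * S ^+ 2)); last by ring.
rewrite ler_wpM2l// -mulrA.
apply: (@le_trans _ _ (4 * S ^+ 2 + 12 * (2 * S ^+ 2))).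
  by apply: lerD; rewrite ler_wpM2l.
by rewrite le_eqVlt; apply/orP; left; apply/eqP; ring.
Qed.

(** Open at h, so that s - h > 0: adaptedness of w is available at positive times. *)
Let D_ n (t : R) : set RT := `]h n, t]%classic.

Let mD_ n t : measurable (D_ n t). Proof. exact: measurable_itv. Qed.

Let D_fin n t : (leb (D_ n t) < +oo)%E.
Proof. by rewrite /D_ lebesgue_measure_itv; case: ifP => _; rewrite ltry. Qed.

Let drift_Fubini n t : t <= T ->
  [/\ P.-integrable setT (EFin \o (fun om => \int[leb]_(s in D_ n t) drift n om s)),
      leb.-integrable (D_ n t) (EFin \o (fun s => \int[P]_om drift n om s)) &
      \int[P]_om \int[leb]_(s in D_ n t) drift n om s =
      \int[leb]_(s in D_ n t) \int[P]_om drift n om s].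
Proof.
move=> tT; have [c c0 step] := en_step_real.
(* At fixed n any error level will do; the bounds serve only for integrability. *)
have [k [Cs [ik k0 keps Cs0 st]]] := step 1 ltr01.
have iD s : D_ n t s -> P.-integrable setT (EFin \o (fun om => n.+1%:R *
    (path_sup w om ^+ 2 + Q n om s) + 28 * CF * path_sup w om ^+ 2)).
  rewrite /D_/= in_itv/= => /andP[hs s_t]; have [iq _] := st n s hs (le_trans s_t tT).
  by apply: rintegrableD => //; apply: rintegrableZ => //; exact: rintegrableD.
have id s : D_ n t s -> P.-integrable setT (EFin \o (fun om => drift n om s)).
  move=> Ds; apply: (rintegrable_le measurableT _ (iD s Ds)) => [|om _]; last exact: drift_le.
  exact: drift_measurable_at.
apply: (@Fubini_real _ _ _ P (D_ n t) (fun z => drift n z.1 z.2)) => //.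
- pose Bq := B0 + c * (h n * (2 * CG2 * (B0 + o n)) + 1) + Cs * (h n) ^+ 2.
  have BqE s : D_ n t s -> \int[P]_om Q n om s <= Bq.
    rewrite /D_/= in_itv/= => /andP[hs s_t]; have [_] := st n s hs (le_trans s_t tT).
    move=> /le_trans; apply; rewrite /Bq lerD2r; apply: lerD => //; rewrite ler_wpM2l//.
    apply: lerD.
      rewrite ler_wpM2l ?invr_ge0// ler_wpM2l ?mulr_ge0// lerD2r; exact: y_le.
    apply: le_trans keps; apply: le_Rintegral_subset => //; exact: measurable_itv.
  apply: (integral_le_cst (C := n.+1%:R * (B0 + Bq) + 28 * CF * B0)) => //.
  + apply: measurable_funTS.
    apply: (measurable_inner P (f := fun z : Omega * RT => `|drift n z.1 z.2|%:E)) => //.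
    by apply/measurable_EFinP; apply: measurableT_comp.
  + move=> s Ds;  rewrite integral_ge0//=.
  have i1 := iD s Ds.
  apply: (@le_trans _ _ (\int[P]_om (n.+1%:R * (path_sup w om ^+ 2 + Q n om s)
      + 28 * CF * path_sup w om ^+ 2)%:E)%E).
    apply: ge0_le_integral => //.
    + apply/measurable_EFinP; apply: measurableT_comp => //; exact: drift_measurable_at.
    + by case/integrableP : i1.
    + by move=> om _; rewrite lee_fin; exact: drift_le.
  move: (Ds); rewrite /D_/= in_itv/= => /andP[hs s_t]; have [iq _] := st n s hs (le_trans s_t tT).
  rewrite -[X in (X <= _)%E]fineK; last exact: integrable_fin_num i1.
  rewrite lee_fin -/(Rintegral P setT _) RintegralD//; last 2 first.
  + by apply: rintegrableZ => //; exact: rintegrableD.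
  + exact: rintegrableZ.
  rewrite !RintegralZl//; last exact: rintegrableD.
  rewrite RintegralD// lerD2r ler_wpM2l// lerD2l; exact: BqE.
  + exact: D_fin.
- move=> om; apply: integrableS (continuous_integrable 0 t (drift_continuous (n := n) (om := om))) => //.
  by apply: subset_itvScc => //; rewrite bnd_simp.
Qed.

Let window_integral n t (f : R -> R) : continuous f ->
  \int[leb]_(s in `[0, t]) ((if h n <= s then 1 else 0) * f s) = \int[leb]_(s in D_ n t) f s.
Proof.
move=> cf; rewrite /D_ Rintegral_itv_obnd_cbnd; last first.
  apply: integrableS (continuous_integrable (h n) t cf) => //.
  by apply: subset_itvScc => //; rewrite bnd_simp.
rewrite Rintegral_mkcond [RHS]Rintegral_mkcond; apply: eq_Rintegral => s _.
rewrite /patch !mem_setE !in_itv/=; case: ifPn; case: ifPn => //; last 1 first.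
- by move=> /andP[hs ->]; rewrite andbT (le_trans _ hs).
- by move=> hs /andP[_ ->]; rewrite mul1r.
- by rewrite mul0r.
Qed.

(* The one-step bounds are averaged over [h, t]; as h tends to 0, reverse Fatou in om discards
   the drift, which is only known to be nonpositive in the limit. *)
Lemma energy_inequality : exists2 C, 0 <= C & forall t (K : Omega -> R), 0 < t -> t <= T ->
  P.-integrable setT (EFin \o K) -> (forall om, 0 <= K om) ->
  {ae P, forall om,
    (forall n, \int[leb]_(s in `[0, t]) ((if h n <= s then 1 else 0) *
      drift_bound (w om) (M om) CF (path_sup w om) (fun n => path_osc w n om) n s) <= K om) /\
    (forall eps, 0 < eps -> exists N, forall n, (N <= n)%N ->
      \int[leb]_(s in `[0, t]) ((if h n <= s then 1 else 0) *
      drift_bound (w om) (M om) CF (path_sup w om) (fun n => path_osc w n om) n s) <= eps)} ->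
  mean_energy t <= mean_energy 0 + C * \int[leb]_(s in `[0, t]) mean_energy s.
Proof.
have [c c0 step] := en_step_real; exists (c * (2 * CG2) + 4 * CF).
  by rewrite addr_ge0 ?mulr_ge0.
move=> t K t0 tT iK K0 driftK; rewrite -/y; apply/ler_addgt0Pr => eta eta0.
(* The final error is 2 eps + c eps + eps t, made equal to eta. *)
pose den := 2 + c + t; have den0 : 0 < den by rewrite addr_gt0// ltr_wpDr.
pose eps := eta / den; have eps0 : 0 < eps by rewrite divr_gt0.
have [k [Cs [ik k0 keps Cs0 st]]] := step eps eps0.
(* What remains of a step after division by h: oscillation in the noise, the quartic term,
   oscillation in F. *)
pose r n := c * (2 * CG2) * o n + Cs * h n + 12 * CF * o' n.
have [N1 rN] : exists N, forall n, (N <= n)%N -> r n <= eps.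
  pose G := c * (2 * CG2) + 12 * CF + 1.
  have G0 : 0 < G by rewrite ltr_wpDl// addr_ge0 ?mulr_ge0.
  have [N oN] := o_cvg (divr_gt0 eps0 (mulr_gt0 (ltr0n R 2) G0)).
  have [N' _ hN] := near_infty_natSinv_lt (PosNum (divr_gt0 eps0 (mulr_gt0 (ltr0n R 2) (ltr_wpDl Cs0 ltr01)))).
  exists (maxn N N') => n; rewrite geq_max => /andP[/oN on /hN /= /ltW hn].
  have o0 := o_ge0 n; have o'0 := o'_ge0 n.
  rewrite ler_pdivlMr in on; last by rewrite mulr_gt0.
  rewrite ler_pdivlMr in hn; last by rewrite mulr_gt0// ltr_wpDl.
  have e1 : c * (2 * CG2) * o n + 12 * CF * o' n <= (o n + o' n) * G.
    have a0 : 0 <= c * (2 * CG2) by rewrite !mulr_ge0.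
    have b0 : 0 <= 12 * CF by rewrite mulr_ge0.
    rewrite -subr_ge0 [leRHS](_ : _ = o n * (12 * CF + 1) + o' n * (c * (2 * CG2) + 1)).
      by rewrite addr_ge0// mulr_ge0// addr_ge0.
    by rewrite /G; ring.
  have e2 : Cs * h n <= h n * (Cs + 1) by rewrite mulrC ler_wpM2l ?invr_ge0// lerDl.
  exact: le_sum_halves on hn e1 e2.
have [N2 aN] := average_increments y_continuous t0 eps0.
pose Y n om := \int[leb]_(s in D_ n t) drift n om s.
(* Reverse Fatou in omega, with the same majorant K for every n. *)
have [N3 YN] : exists N, forall n, (N <= n)%N -> \int[P]_om Y n om <= eps.
  apply: (@reverse_Fatou _ _ _ P setT measurableT Y (fun=> K) K) => //.
  - by move=> n; have [] := drift_Fubini n tT.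
  - move=> n; apply: filterS driftK => om [+ _] _ => /(_ n).
    by rewrite window_integral//; exact: drift_continuous.
  - by apply: nearW => om _; exact: cvg_cst.
  - apply: filterS driftK => om [_ +] _ eps' eps'0 => /(_ eps' eps'0)[N HN].
    exists N => // n /= /HN; rewrite window_integral//; exact: drift_continuous.
pose n := maxn N1 (maxn N2 N3).
have {}rN := rN n (leq_maxl _ _).
have [ht {}aN] := aN n (leq_trans (leq_maxl _ _) (leq_maxr _ _)).
have {}YN := YN n (leq_trans (leq_maxr _ _) (leq_maxr _ _)).
have [_ iE EY] := drift_Fubini n tT.
have h0 : 0 < h n by rewrite invr_gt0.
have cs : continuous (fun s => y (s - h n)).
  move=> s; apply: (@continuous_comp R R R (fun s => s - h n) y); last exact: y_continuous.
  by apply: (@cvgB _ R^o); [exact: cvg_id|exact: cvg_cst].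
have iDn (f : R -> R) : continuous f -> leb.-integrable (D_ n t) (EFin \o f).
  move=> cf; apply: integrableS (continuous_integrable (h n) t cf) => //.
  by apply: subset_itvScc => //; rewrite bnd_simp.
have iDl : leb.-integrable (D_ n t) (EFin \o lavg k n) by apply: integrableS (lavg_integral n ik k0).1.
(* A lower bound for the mean of the drift, from the one-step estimate; integrated over the window
   it gives the inequality for y. *)
pose L s := n.+1%:R * (y s - y (s - h n)) - (c * (2 * CG2) * y (s - h n) + 4 * CF * y s)
  - (c * lavg k n s + r n).
have EL s : D_ n t s -> L s <= \int[P]_om drift n om s.
  rewrite /D_/= in_itv/= => /andP[hs s_t]; have [iq qle] := st n s hs (le_trans s_t tT).
  have [_ io'] := iosc n.
  have dE om : drift n om s = n.+1%:R * (pos_energy (w om s) - Q n om s)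
      - (4 * CF * pos_energy (w om s) + 12 * CF * (path_osc w n om * path_sup w om)).
    by rewrite /drift /drift_bound -/(Q n om s); ring.
  under eq_Rintegral do rewrite dE.
  have i0 : P.-integrable setT (EFin \o (fun om => pos_energy (w om s) - Q n om s)) by exact: rintegrableB.
  have i1 : P.-integrable setT (EFin \o (fun om => 4 * CF * pos_energy (w om s))) by exact: rintegrableZ.
  have i2 : P.-integrable setT (EFin \o (fun om => 12 * CF * (path_osc w n om * path_sup w om))).
    exact: rintegrableZ.
  rewrite RintegralB//; [|exact: rintegrableZ|exact: rintegrableD].
  rewrite RintegralD// !RintegralZl// RintegralB//.
  rewrite -/(o' n) -[\int[P]_om pos_energy _]/(y s).
  apply: le_trans (lerB (ler_wpM2l (ler0n R n.+1) (lerB (lexx (y s)) qle)) (lexx _)).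
  have arith (N ys y' G o_ I o'_ : R) : N != 0 ->
      N * (ys - y') - (c * (2 * G) * y' + 4 * CF * ys) - (c * (N * I) + (c * (2 * G) * o_ + Cs * N^-1 + 12 * CF * o'_)) =
      N * (ys - (y' + c * (N^-1 * (2 * G * (y' + o_)) + I) + Cs * N^-1 ^+ 2)) - (4 * CF * ys + 12 * CF * o'_).
    by move=> N0; field.
  by rewrite /L /lavg arith// pnatr_eq0.
have iLy : leb.-integrable (D_ n t) (EFin \o (fun s => y s - y (s - h n))).
  by apply: rintegrableB => //; exact: iDn.
have iy1 : leb.-integrable (D_ n t) (EFin \o (fun s => c * (2 * CG2) * y (s - h n))).
  by apply: rintegrableZ => //; exact: iDn.
have iy2 : leb.-integrable (D_ n t) (EFin \o (fun s => 4 * CF * y s)).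
  by apply: rintegrableZ => //; exact: iDn.
have ikl : leb.-integrable (D_ n t) (EFin \o (fun s => c * lavg k n s)) by exact: rintegrableZ.
have ir : leb.-integrable (D_ n t) (EFin \o cst (r n)).
  by apply: rintegrable_cst => //; exact: D_fin.
have iL1 : leb.-integrable (D_ n t) (EFin \o (fun s => n.+1%:R * (y s - y (s - h n)))) by exact: rintegrableZ.
have iL2 : leb.-integrable (D_ n t) (EFin \o (fun s => c * (2 * CG2) * y (s - h n) + 4 * CF * y s)).
  exact: (rintegrableD (mD_ n t) iy1 iy2).
have iL3 : leb.-integrable (D_ n t) (EFin \o (fun s => c * lavg k n s + r n)).
  exact: (rintegrableD (mD_ n t) ikl ir).
have iL12 : leb.-integrable (D_ n t) (EFin \o (fun s => n.+1%:R * (y s - y (s - h n))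
    - (c * (2 * CG2) * y (s - h n) + 4 * CF * y s))).
  exact: (rintegrableB (mD_ n t) iL1 iL2).
have iL : leb.-integrable (D_ n t) (EFin \o L) by exact: (rintegrableB (mD_ n t) iL12 iL3).
have LE : \int[leb]_(s in D_ n t) L s <= eps.
  by apply: le_trans YN; rewrite [leRHS]EY; apply: le_Rintegral.
have LA : \int[leb]_(s in D_ n t) L s =
    n.+1%:R * \int[leb]_(s in D_ n t) (y s - y (s - h n))
    - (c * (2 * CG2) * \int[leb]_(s in D_ n t) y (s - h n) + 4 * CF * \int[leb]_(s in D_ n t) y s)
    - (c * \int[leb]_(s in D_ n t) lavg k n s + r n * fine (leb (D_ n t))).
  have e1 := RintegralB (mD_ n t) iL12 iL3; have e2 := RintegralB (mD_ n t) iL1 iL2.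
  have e3 := RintegralD (mD_ n t) iy1 iy2; have e4 := RintegralD (mD_ n t) ikl ir.
  have e5 := RintegralZl n.+1%:R (mD_ n t) iLy; have e6 := RintegralZl c (mD_ n t) iDl.
  have e7 := RintegralZl (c * (2 * CG2)) (mD_ n t) (iDn _ cs).
  have e8 := RintegralZl (4 * CF) (mD_ n t) (iDn _ y_continuous).
  have e9 := @Rintegral_cst _ _ _ leb _ (mD_ n t) (r n).
  by rewrite -e9 -e8 -e7 -e6 -e5 -e4 -e3 -e2; exact: e1.
have A_le : y t - y 0 - eps <= n.+1%:R * \int[leb]_(s in D_ n t) (y s - y (s - h n)).
  by apply: le_trans aN _; rewrite /D_ Rintegral_itv_obnd_cbnd.
have i0t : leb.-integrable (`[0, t]%classic : set RT) (EFin \o y) by exact: continuous_integrable.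
have m0t : measurable (`[0, t]%classic : set RT) by exact: measurable_itv.
have C_le : \int[leb]_(s in D_ n t) y s <= \int[leb]_(s in `[0, t]) y s.
  by apply: le_Rintegral_subset => //; apply: subset_itvScc => //; rewrite bnd_simp.
have B_le : \int[leb]_(s in D_ n t) y (s - h n) <= \int[leb]_(s in `[0, t]) y s.
  rewrite /D_ Rintegral_itv_obnd_cbnd; last exact: iDn.
  rewrite Rintegral_translate// subrr; apply: le_Rintegral_subset => //.
  by apply: subset_itvScc => //; rewrite bnd_simp gerBl.
have D_le : \int[leb]_(s in D_ n t) lavg k n s <= eps.
  have [il El] := lavg_integral n ik k0; apply: le_trans keps; rewrite -El.
  apply: le_Rintegral_subset => // s _; rewrite mulr_ge0// Rintegral_ge0//.
have r_le : r n * fine (leb (D_ n t)) <= eps * t.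
  have m_ge0 : 0 <= fine (leb (D_ n t)) by exact: fine_ge0.
  have m_le : fine (leb (D_ n t)) <= t.
    rewrite /D_ lebesgue_measure_itv/= lte_fin; case: ifP => _ /=; last exact: ltW.
    by rewrite gerBl.
  by apply: le_trans (ler_wpM2r m_ge0 rN) _; rewrite ler_wpM2l// ltW.
have epsE : eta = 2 * eps + c * eps + eps * t by rewrite /eps /den; field; rewrite gt_eqF.
rewrite epsE; rewrite LA in LE.
exact: (le_increment_combine LE A_le r_le (ler_wpM2l c0 D_le)
  (ler_wpM2l (mulr_ge0 (ler0n R 4) CF0) C_le)
  (ler_wpM2l (mulr_ge0 c0 (mulr_ge0 (ler0n R 2) CG0)) B_le)).
Qed.

Lemma energy_vanishes :
  (forall t, 0 < t -> t <= T -> exists K : Omega -> R,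
    [/\ P.-integrable setT (EFin \o K), (forall om, 0 <= K om) &
    {ae P, forall om,
    (forall n, \int[leb]_(s in `[0, t]) ((if h n <= s then 1 else 0) *
      drift_bound (w om) (M om) CF (path_sup w om) (fun n => path_osc w n om) n s) <= K om) /\
    (forall eps, 0 < eps -> exists N, forall n, (N <= n)%N ->
      \int[leb]_(s in `[0, t]) ((if h n <= s then 1 else 0) *
      drift_bound (w om) (M om) CF (path_sup w om) (fun n => path_osc w n om) n s) <= eps)}]) ->
  {ae P, forall om, pos_energy (w om 0) = 0} ->
  forall t, 0 <= t <= T -> {ae P, forall om, pos_energy (w om t) = 0}.
Proof.
move=> HK w0 t tT.
have y0 : y 0 = 0.
  transitivity (fine (\int[P]_om (0 : R)%:E)%E); last by rewrite integral0.
  congr fine; apply: ae_eq_integral => //; first by apply/measurable_EFinP; exact: men.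
  by apply: filterS w0 => om -> _.
have [C C0 HC] := energy_inequality.
have yt : y t = 0.
  apply: (@Gronwall R y C T B0) => // s sT; first exact: continuous_integrable.
  have [s0|s0] := leP s 0.
    by rewrite (_ : s = 0) ?y0 ?set_itv1 ?Rintegral_set1 ?mulr0//; apply/le_anti; rewrite s0; case/andP : sT.
  have [|K [iK K0 dK]] := HK s s0; first by case/andP : sT.
  have := HC s K s0 _ iK K0 dK; rewrite -/y y0 add0r; apply; by case/andP : sT.
have m : measurable_fun setT (fun om => (pos_energy (w om t))%:E).
  by apply/measurable_EFinP; exact: men.
have : (\int[P]_om `|(pos_energy (w om t))%:E| = 0)%E.
  transitivity (\int[P]_om (pos_energy (w om t))%:E)%E.
    by apply: eq_integral => om _; rewrite gee0_abs// lee_fin pos_energy_ge0.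
  by rewrite -[LHS]fineK ?yt//; [congr EFin; exact: yt|exact: integrable_fin_num (ien t)].
move/(ae_eq_integral_abs P measurableT m); apply: filterS => om /(_ I) /=.
by move=> [].
Qed.

End energy.

(** * Comparison of two solutions *)

Section clamped_processes.
Context d (Omega : measurableType d) (R : realType) (P : probability Omega R).
Context (T : R) (Ft : R -> set (set Omega)) (E : normedModType R).
Hypothesis T0 : 0 <= T.

Definition clamped (u : Omega -> R -> E) om (s : R) : E := u om (clamp 0 T s).

Lemma clampedE u om s : 0 <= s <= T -> clamped u om s = u om s.
Proof. by move=> sT; rewrite /clamped clamp_id. Qed.

Lemma clamped_clamp u om s : clamped u om s = clamped u om (clamp 0 T s).
Proof. by rewrite /clamped [clamp 0 T (clamp 0 T s)]clamp_id// clamp_itv. Qed.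

Lemma clamped_continuous u om : {within `[0, T], continuous (u om)} ->
  continuous (clamped u om).
Proof. exact: within_clamp. Qed.

(** Evaluation at a time is continuous for uniform convergence, so a random element of C([0, T]; H)
    has Borel values at each time. *)
Lemma uniform_eval_open (s : R) (B : set E) : 0 <= s <= T -> open B ->
  open ([set g | B (g s)] : set {uniform` `[0, T] -> E}).
Proof.
move=> sT oB; rewrite openE => g /= Bgs.
move: oB; rewrite openE => /(_ _ Bgs) /nbhs_ballP[r /= r0 rB].
apply/uniform_nbhs; exists [set xy | ball xy.1 r xy.2]; split.
  by rewrite -entourage_ballE; exists r.
move=> g' /= gg'; apply: rB; apply: (gg' s).
by rewrite /= in_itv/=.
Qed.

Variable u : Omega -> R -> E.
Hypothesis uC0 : L2C0 P T u.

Lemma L2C0_continuous om : continuous (clamped u om).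
Proof. by case: uC0 => cu _ _; exact: clamped_continuous. Qed.

Lemma L2C0_Borel s : Borel_map (clamped u ^~ s).
Proof.
case: uC0 => _ bu _ B oB.
have := bu _ (sub_sigma_algebra (uniform_eval_open (clamp_itv s T0) oB)).
by rewrite setTI.
Qed.

Hypothesis E_separable : separable E.

Lemma L2C0_sup om : (ereal_sup [set (`|u om t| ^+ 2)%:E | t in `[0%R, T]] =
  (path_sup (clamped u) om ^+ 2)%:E)%E.
Proof.
have cu := L2C0_continuous.
have le_sup s := @le_path_sup _ _ _ _ T (clamped u) T0 cu (clamped_clamp u) om s.
have S0 : 0 <= path_sup (clamped u) om by apply: le_trans (le_sup 0).
apply/le_anti/andP; split.
  apply: ge_ereal_sup => _ [t tT <-]; rewrite lee_fin lerXn2r ?nnegrE//.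
  by rewrite -(clampedE u om)//; move: tT; rewrite /= in_itv.
set S := ereal_sup _.
have le_S s : ((`|clamped u om s| ^+ 2)%:E <= S)%E.
  apply: ereal_sup_ubound; exists (clamp 0 T s) => //.
  by rewrite /= in_itv/=; exact: clamp_itv.
case: S le_S => [r||] le_S; [|by rewrite leey|by have := le_S 0; rewrite leeNy_eq].
have r0 : 0 <= r by rewrite -lee_fin; apply: le_trans (le_S 0); rewrite lee_fin sqr_ge0.
rewrite lee_fin -[leRHS](sqr_sqrtr r0) lerXn2r ?nnegrE ?sqrtr_ge0//.
apply: path_sup_le => s; rewrite -[leLHS]normr_id -sqrtr_sqr ler_wsqrtr// -lee_fin.
exact: le_S.
Qed.

Lemma L2C0_sq_integrable : sq_integrable P (path_sup (clamped u)).
Proof.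
have [_ _ fi] := uC0; apply: sq_integrable_lty.
  exact: (measurable_path_sup T0 L2C0_continuous (clamped_clamp u) L2C0_Borel).
by under eq_integral do rewrite -L2C0_sup.
Qed.

End clamped_processes.

Lemma ae_lebesgue_itv (R : realType) (Q : R -> Prop) (a b : R) : a < b ->
  {ae @lebesgue_measure R, forall r, Q r} -> exists2 r, a < r < b & Q r.
Proof.
move=> ab [N [mN N0 QN]]; apply: contrapT => noQ.
have sub : `]a, b[%classic `<=` N.
  move=> r /=; rewrite in_itv/= => rab; apply: QN => /= Qr.
  by apply: noQ; exists r.
have : (lebesgue_measure (`]a, b[%classic : set R) <= lebesgue_measure N)%E.
  by apply: le_measure => //; rewrite inE.
rewrite N0 lebesgue_measure_itv/= lte_fin ab -EFinB lee_fin leNgt subr_gt0 ab.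
by [].
Qed.

Section adapted_processes.
Context d (Omega : measurableType d) (R : realType) (P : probability Omega R).
Context (T : R) (Ft : R -> set (set Omega)) (Ft_filtration : complete_filtration P T Ft).
Context (E : normedModType R) (E_separable : separable E).
Local Notation leb := (@lebesgue_measure R).

Lemma Ft_sigma (t : R) : 0 <= t <= T -> sigma_algebra setT (Ft t) /\ Ft t `<=` measurable.
Proof. by case: Ft_filtration => _ + _ _; apply. Qed.

Lemma negligible_filtration (t : R) N : 0 <= t <= T -> P.-negligible N -> Ft t N.
Proof.
move=> /andP[t0 tT]; case: Ft_filtration => _ _ mono neg /neg F0N.
exact: (mono 0 t _ t0 tT).
Qed.

(* Completeness of the filtration lets adaptedness pass to a.s. modifications. *)
Lemma adapted_ae (t : R) (x x' : Omega -> E) : 0 <= t <= T ->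
  {ae P, forall om, x om = x' om} -> adapted_at Ft t x -> adapted_at Ft t x'.
Proof.
move=> tT xx' ax B oB; have sF := filtration_sigma Ft_filtration.
pose N := [set om | x om != x' om].
have N0 : P.-negligible N.
  by apply: negligibleS xx' => om /= /eqP xne xe; exact: xne.
have mS (S : set Omega) : P.-negligible S -> @measurable _ (g_sigma_algebraType (Ft t)) S.
  by move=> S0; apply/(sF _ _ tT); exact: negligible_filtration.
rewrite (_ : x' @^-1` B = (x @^-1` B `\` N) `|` (x' @^-1` B `&` N)).
  apply: measurableU; first by apply: measurableD; [exact: ax|exact: mS].
  by apply: mS; apply: negligibleS N0 => om [].
apply/seteqP; split => om /=.
  by rewrite /N/=; have [->|ne] := eqVneq (x om) (x' om); [left; split => //|right; split].
by move=> [[Bx /negP]|[]//]; rewrite /N/= negbK => /eqP <-.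
Qed.

(** Adaptedness known at almost every time extends to every s > 0: such times can be chosen
    increasing to s closer than 1 / (n + 1), and the path is continuous. *)
Lemma adapted_left (X : Omega -> R -> E) (s : R) : (forall om, continuous (X om)) ->
  {ae leb, forall r : R, 0 <= r <= T -> adapted_at Ft r (X ^~ r)} -> 0 < s -> s <= T ->
  adapted_at Ft s (X ^~ s).
Proof.
move=> cX aX s0 sT.
have /choice[rho rhoP] (n : nat) : exists r : R, [/\ s - n.+1%:R^-1 < r, 0 <= r, r < s &
    adapted_at Ft r (X ^~ r)].
  have [|r /andP[ar rs] aXr] := @ae_lebesgue_itv R _ (Num.max 0 (s - n.+1%:R^-1)) s _ aX.
    by rewrite gt_max s0 gtrBl invr_gt0/=.
  move: ar; rewrite gt_max => /andP[r0 ar]; exists r; split => //; first exact: ltW.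
  by apply: aXr; rewrite (ltW r0) (le_trans (ltW rs)).
have rho_cvg : rho n @[n --> \oo] --> s.
  apply/cvgrPdist_le => eps eps0; have [N _ hN] := near_infty_natSinv_lt (PosNum eps0).
  exists N => // n /hN /= /ltW; apply: le_trans; have [r1 _ r3 _] := rhoP n.
  by rewrite ger0_norm ?subr_ge0 ?(ltW r3)// lerBlDl -lerBlDr ltW.
apply: (@dist_Borel_map _ (g_sigma_algebraType (Ft s)) R E) => // c.
apply: (@measurable_fun_cvg _ (g_sigma_algebraType (Ft s)) R setT (fun n om => `|X om (rho n) - c|)).
  move=> n; have [_ r0 rs ar] := rhoP n.
  have := adapted_at_le Ft_filtration r0 (ltW rs) sT ar.
  by move=> /(@Borel_map_dist _ (g_sigma_algebraType (Ft s)) R E); exact.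
move=> om _; apply: cvg_norm; apply: cvgB; last exact: cvg_cst.
exact: (cvg_comp _ _ rho_cvg (cX om s)).
Qed.

Lemma progressive_adapted (x : Omega -> R -> E) (t : R) : 0 <= t <= T ->
  progressive T Ft x -> adapted_at Ft t (x ^~ t).
Proof.
move=> tT px B oB; apply/(filtration_sigma Ft_filtration _ tT).
apply: (progressive_section Ft_sigma tT px); exact: sub_sigma_algebra.
Qed.

End adapted_processes.

Lemma cvge0_combine (R : realType) (u a b : nat -> \bar R) : (forall n, (0 <= u n)%E) ->
  (forall n, (u n <= 2%:E * a n + 2%:E * b n)%E) ->
  a n @[n --> \oo] --> 0%E -> b n @[n --> \oo] --> 0%E -> u n @[n --> \oo] --> 0%E.
Proof.
move=> u0 uab a0 b0.
have ab0 : (2%:E * a n + 2%:E * b n)%E @[n --> \oo] --> 0%E.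
  rewrite [X in _ --> X](_ : _ = (2%:E * 0 + 2%:E * 0)%E :> \bar R); last by rewrite mule0 adde0.
  by apply: cvgeD; [rewrite !mule0|apply: cvgeZl|apply: cvgeZl].
by apply: (squeeze_cvge _ (cvg_cst 0%E) ab0); apply: nearW => n; rewrite u0 uab.
Qed.

Section stochastic_integrals.
Context d (Omega : measurableType d) (R : realType) (P : probability Omega R).
Context (T : R) (Ft : R -> set (set Omega)) (Ft_filtration : complete_filtration P T Ft).
Context (U : hilbertType R) (e : onbasis U).
Context (W : R -> U -> Omega -> R) (W_Wiener : cylindrical_Wiener P T Ft W).
Context d' (X : measurableType d') (mu : {measure set X -> \bar R}).
Local Notation H := (L2 mu).
Local Notation RT := (measurableTypeR R).
Local Notation leb := (@lebesgue_measure R).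
Hypotheses (T0 : 0 < T) (H_separable : separable H).
Local Notation HS := (hilbert_schmidt e H).

Let FtS := Ft_sigma Ft_filtration.

Lemma hs_eval_le (L : HS) k : `|L (e k)| <= `|L|.
Proof.
rewrite -ler_sqr ?nnegrE// -lee_fin -[X in (_ <= X)%E]hs_normE /hs_sum.
have s_ge0 j : (0 <= (`|L (e j)| ^+ 2)%:E)%E by rewrite lee_fin sqr_ge0.
apply: le_trans (nneseries_lim_ge (m := 0%N) k.+1 (fun j _ _ => s_ge0 j)).
by rewrite big_nat_recr//= leeDr// sume_ge0.
Qed.

Lemma Borel_hs_eval (Phi : Omega * RT -> HS) k : Borel_map Phi -> Borel_map (fun z => Phi z (e k)).
Proof.
move=> bPhi; apply: (Borel_map_comp (f := Phi) (g := fun L : HS => L (e k))) bPhi.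
apply: (@lip_continuous _ _ _ _ 1) => L L'; rewrite mul1r; exact: (hs_eval_le (L - L') k).
Qed.

Section one_integral.
Variables (Phi : Omega -> R -> HS) (I : Omega -> R -> H).
Hypothesis PhiI : is_stochastic_integral P T Ft W Phi I.

Lemma stochastic_integral_Borel r : 0 <= r <= T -> Borel_map (I ^~ r).
Proof.
move=> rT; have [_ bI _ _] := PhiI => B oB; have := bI r rT B (sub_sigma_algebra oB).
by rewrite setTI; exact: (filtration_measurable Ft_filtration rT).
Qed.

Lemma stochastic_integrand_Borel k : Borel_map (fun z : Omega * RT => time_ext T Phi z (e k)).
Proof.
apply: Borel_hs_eval; have [[pPhi _] _ _ _] := PhiI.
exact: (progressive_Borel T0 FtS pPhi).
Qed.

(** Elementary integrals vanish at time 0, and so does their L^2 limit. *)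
Lemma stochastic_integral_start : {ae P, forall om, I om 0 = 0}.
Proof.
have [_ _ _ [s [Phin [_ _ cI]]]] := PhiI.
have T00 : 0 <= (0 : R) <= T by rewrite lexx ltW.
have E0 n om : el_integral e W (s n) om 0 = 0.
  rewrite /el_integral big1// => j _; have [s0 [se _]] := el_time (s n) j.
  by rewrite (min_idPl s0) (min_idPl (le_trans s0 se)) subrr mulr0 scale0r.
have bI := stochastic_integral_Borel T00.
have mI : measurable_fun setT (fun om => (`|I om 0| ^+ 2)%:E).
  by apply/measurable_EFinP; apply: measurable_funX; exact: Borel_map_norm.
have : (\int[P]_om `|(`|I om 0| ^+ 2)%:E| = 0)%E.
  have := cI 0 T00; under eq_fun do under eq_integral do rewrite E0 sub0r normrN.
  move=> /cvg_lim <-//; rewrite lim_cst//.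
  by apply: eq_integral => om _; rewrite gee0_abs// lee_fin sqr_ge0.
move/(ae_eq_integral_abs P measurableT mI); apply: filterS => om /(_ Logic.I) /=.
by move=> [] /eqP; rewrite sqrf_eq0 normr_eq0 => /eqP.
Qed.

Lemma stochastic_integral_approx : exists s : nat -> elementary T Ft H,
  iterated P `[0%R, T] (el_dist e (s n) (fun om r k => time_ext T Phi (om, r) (e k)))
     @[n --> \oo] --> 0%E /\
  forall r, 0 <= r <= T ->
    (\int[P]_om (`|el_integral e W (s n) om r - I om r| ^+ 2)%:E)%E @[n --> \oo] --> 0%E.
Proof.
have [_ _ _ [s [Phin [PhinE cPhi cI]]]] := PhiI.
exists s; split => //; move: cPhi; apply: cvg_trans; apply: near_eq_cvg; apply: nearW => n.
rewrite iterated_swap; last 3 first.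
- exact: measurable_itv.
- apply: measurable_sqsum => k; apply: Borel_mapB => //.
    exact: (el_fun_Borel Ft_filtration).
  exact: stochastic_integrand_Borel.
- by move=> z; exact: sqsum_ge0.
apply: eq_integral => om _; apply: eq_integral => r; rewrite inE/= in_itv/= => rT.
rewrite -[LHS]hs_normE /el_dist /sqsum /hs_sum; apply: eq_eseriesr => k _ /=.
rewrite /time_ext mem_set; last by split => //; rewrite /= in_itv.
by rewrite -PhinE.
Qed.

End one_integral.

(** M is asked to be only a modification of the difference, which leaves the freedom to choose one
    with continuous paths everywhere. *)
Lemma stochastic_integral_sub (Phi1 Phi2 : Omega -> R -> HS) (I1 I2 M : Omega -> R -> H) :
  is_stochastic_integral P T Ft W Phi1 I1 -> is_stochastic_integral P T Ft W Phi2 I2 ->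
  (forall r, 0 <= r <= T -> Borel_map (M ^~ r)) ->
  (forall r, 0 <= r <= T -> {ae P, forall om, M om r = I1 om r - I2 om r}) ->
  exists s_ : nat -> elementary T Ft H, stochastic_approx P e W s_ (fun om r k =>
    time_ext T Phi1 (om, r) (e k) - time_ext T Phi2 (om, r) (e k)) M.
Proof.
move=> PI1 PI2 bM ME.
have [s1 [c1 d1]] := stochastic_integral_approx PI1.
have [s2 [c2 d2]] := stochastic_integral_approx PI2.
have b1 := stochastic_integrand_Borel PI1; have b2 := stochastic_integrand_Borel PI2.
have mi : measurable (`[0, T]%classic : set RT) by exact: measurable_itv.
have bel (s : elementary T Ft H) g : Borel_map (fun z : Omega * RT => el_fun e s z.1 z.2 g).
  exact: (el_fun_Borel Ft_filtration).
have md (s : elementary T Ft H) (Phi : Omega -> R -> nat -> H) :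
    (forall k, Borel_map (fun z : Omega * RT => Phi z.1 z.2 k)) -> measurable_fun setT (el_dist e s Phi).
  by move=> bPhi; apply: measurable_sqsum => k; exact: Borel_mapB.
exists (fun n => el_sub (s1 n) (s2 n)); split.
- by move=> k; apply: Borel_mapB.
- exact: bM.
- pose D1 n := el_dist e (s1 n) (fun om r k => time_ext T Phi1 (om, r) (e k)).
  pose D2 n := el_dist e (s2 n) (fun om r k => time_ext T Phi2 (om, r) (e k)).
  apply: cvge0_combine c1 c2 => n; first by apply: iterated_ge0 => z; exact: sqsum_ge0.
  have m1 : measurable_fun setT (D1 n) by exact: md.
  have m2 : measurable_fun setT (D2 n) by exact: md.
  have p1 z : (0 <= D1 n z)%E by exact: sqsum_ge0.
  have p2 z : (0 <= D2 n z)%E by exact: sqsum_ge0.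
  have q1 z : (0 <= 2%:E * D1 n z)%E by rewrite mule_ge0.
  have q2 z : (0 <= 2%:E * D2 n z)%E by rewrite mule_ge0.
  have n1 : measurable_fun setT (fun z => 2%:E * D1 n z)%E by exact: measurable_funeM.
  have n2 : measurable_fun setT (fun z => 2%:E * D2 n z)%E by exact: measurable_funeM.
  apply: (@le_trans _ _ (iterated P `[0%R, T] (fun z => 2%:E * D1 n z + 2%:E * D2 n z))%E).
    apply: le_iterated => //.
    + by apply: md => k; apply: Borel_mapB.
    + exact: emeasurable_funD.
    + by move=> z; exact: sqsum_ge0.
    + move=> om r _.
      have z0 (x : nat -> H) : sqsum (fun k => (x k - 0)%R) = sqsum x.
        by congr sqsum; apply/funext => k; rewrite subr0.
      rewrite (_ : el_dist _ _ _ _ = sqsum (fun k =>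
          (el_fun e (s1 n) om r (e k) - time_ext T Phi1 (om, r) (e k)) -
          (el_fun e (s2 n) om r (e k) - time_ext T Phi2 (om, r) (e k)))%R); last first.
        by congr sqsum; apply/funext => k; rewrite /= el_sub_fun subrACA.
      by apply: le_trans (sqsum_triangle _ _ (fun=> 0)) _; rewrite !z0.
    + by move=> z; exact: adde_ge0.
  by rewrite (iteratedD _ mi n1 n2 q1 q2) (iteratedZ _ mi _ m1 p1)// (iteratedZ _ mi _ m2 p2).
- move=> r rT; apply: cvge0_combine (d1 r rT) (d2 r rT) => n.
    by apply: integral_ge0 => om _; rewrite lee_fin sqr_ge0.
  have bi (s : elementary T Ft H) : Borel_map (fun om => el_integral e W s om r).
    exact: (el_integral_Borel Ft_filtration e W_Wiener H_separable s rT).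
  have bI1 := stochastic_integral_Borel PI1 rT; have bI2 := stochastic_integral_Borel PI2 rT.
  have mq (x x' : Omega -> H) : Borel_map x -> Borel_map x' ->
      measurable_fun setT (fun om => (`|x om - x' om| ^+ 2)%:E).
    move=> bx bx'; apply/measurable_EFinP; apply: measurable_funX.
    by apply: Borel_map_norm; exact: Borel_mapB.
  rewrite -!ge0_integralZl_EFin//; try exact: mq.
  rewrite -ge0_integralD//; try by apply: measurable_funeM; exact: mq.
  apply: ae_ge0_le_integral => //.
  + by apply: mq => //; exact: bM.
  + by move=> om _; rewrite -!EFinM -EFinD lee_fin addr_ge0// mulr_ge0// sqr_ge0.
  + by apply: emeasurable_funD; apply: measurable_funeM; exact: mq.
  + apply: filterS (ME r rT) => om -> _.
    rewrite el_sub_integral [X in `|X|]subrACA -!EFinM -EFinD lee_fin.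
    by apply: le_trans (norm_sqr_le2 _ _) _; rewrite normrN.
Qed.

End stochastic_integrals.

Lemma integrable_fine d (Y : measurableType d) (R : realType) (nu : {measure set Y -> \bar R})
    (g : Y -> \bar R) : measurable_fun setT g -> (forall x, (0 <= g x)%E) ->
  (\int[nu]_x g x < +oo)%E ->
  nu.-integrable setT (EFin \o (fine \o g)) /\ {ae nu, forall x, g x \is a fin_num}.
Proof.
move=> mg g0 gfin; have ig : nu.-integrable setT g.
  by apply/integrableP; split => //; under eq_integral do rewrite gee0_abs//.
have aefin := integrable_ae measurableT ig; split; last by apply: filterS aefin => x; exact.
apply/integrableP; split; first by apply/measurable_EFinP; exact: measurableT_comp.
apply: le_lt_trans gfin; rewrite le_eqVlt; apply/orP; left; apply/eqP; apply: ae_eq_integral => //.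
- by apply/measurableT_comp => //; apply/measurable_EFinP; exact: measurableT_comp.
- by apply: filterS aefin => x gx Dx /=; rewrite ger0_norm ?fine_ge0// fineK// gx.
Qed.

Lemma time_extE d (Omega : measurableType d) (R : realType) (T : R) (E : zmodType)
    (phi : Omega -> R -> E) om (r : R) : 0 <= r <= T -> time_ext T phi (om, r) = phi om r.
Proof. by move=> rT; rewrite /time_ext mem_set//; split => //; rewrite /= in_itv. Qed.

Section comparison.
Context d (Omega : measurableType d) (R : realType) (P : probability Omega R).
Context (T : R) (T0 : 0 < T).
Context (Ft : R -> set (set Omega)) (Ft_filtration : complete_filtration P T Ft).
Context (U : hilbertType R) (e : onbasis U).
Context (W : R -> U -> Omega -> R) (W_Wiener : cylindrical_Wiener P T Ft W).
Context d' (X : measurableType d') (mu : {measure set X -> \bar R}).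
Local Notation H := (L2 mu).
Local Notation RT := (measurableTypeR R).
Local Notation leb := (@lebesgue_measure R).
Hypotheses (mu_fin : (mu setT < +oo)%E) (mu_pos : mu setT != 0%E).
Context (V : completeNormedModType R) (iota : blin V H) (S2 : assumption_V iota).
Context (p : R) (p_ge2 : 2 <= p) (A : Omega -> R -> V -> dual V).
Hypotheses (A1 : assumption_A1 T Ft A) (A3 : assumption_A3 T p A) (A5 : assumption_A5 T iota A).
Variables (CA : R) (hA : Omega -> R -> R^o).
Hypotheses (CA0 : 0 < CA) (hA_L1 : LrLs P T Ft 1 1 hA)
  (A4 : forall w (t : R) (phi : V), 0 <= t <= T ->
     `|A w t phi| `^ (p / (p - 1)) <= CA * `|phi| `^ p + hA w t).
Variables (f : Omega -> R -> R -> R) (F : Omega -> R -> H -> H).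
Hypotheses (F0 : assumption_F0 P T f F) (F1 : assumption_F1 T Ft F) (F2 : assumption_F2 P T F).
Variable (G : Omega -> R -> H -> hilbert_schmidt e H).
Hypothesis G2 : assumption_G2 T G.

Let TT : 0 <= T. Proof. exact: ltW. Qed.
Let p0 : 0 < p. Proof. by rewrite (lt_le_trans _ p_ge2). Qed.
Let FtS := Ft_sigma Ft_filtration.

Let H_separable : separable H.
Proof.
have [[sV _] [_ dV] _ _] := S2.
exact: separable_dense_image sV (@blin_continuous _ _ _ iota) dV.
Qed.

Let time_ext_integrable (E : normedModType R) (x : Omega -> R -> E) (q : R) : q != 0 ->
  progressive T Ft x ->
  (\int[P]_om \int[leb]_(r in `[0%R, T]) (`|x om r| `^ q)%:E < +oo)%E ->
  (P \x leb)%E.-integrable setT (EFin \o (fun z : Omega * RT => `|time_ext T x z| `^ q)).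
Proof.
move=> q0 px xfin; have mx : measurable_fun setT (EFin \o (fun z : Omega * RT => `|time_ext T x z| `^ q)).
  apply/measurable_EFinP; apply: (measurableT_comp (measurable_powR q)).
  by apply: Borel_map_norm; exact: (progressive_Borel T0 FtS px).
apply: (integrable12ltyP _ _ mx).2; apply: le_lt_trans xfin.
rewrite le_eqVlt; apply/orP; left; apply/eqP; apply: eq_integral => om _.
rewrite [RHS]integral_mkcond; apply: eq_integral => r _; rewrite /patch mem_setE in_itv/=.
rewrite ger0_norm ?powR_ge0//; case: ifPn => rT; first by rewrite time_extE.
rewrite /time_ext memNset ?normr0 ?powR0//.
by move=> [_]; rewrite /= in_itv/= (negbTE rT).
Qed.

Let moment_integrable (v : Omega -> R -> V) : LrLs P T Ft p p v ->
  (P \x leb)%E.-integrable setT (EFin \o (fun z : Omega * RT => `|time_ext T v z| `^ p)).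
Proof.
move=> [pv vfin]; apply: time_ext_integrable => //; first by rewrite gt_eqF.
move: vfin; rewrite divff ?gt_eqF//; apply: le_lt_trans.
rewrite le_eqVlt; apply/orP; left; apply/eqP; apply: eq_integral => om _.
by rewrite poweRe1//; apply: integral_ge0 => r _; rewrite lee_fin powR_ge0.
Qed.

Let hA_integrable : (P \x leb)%E.-integrable setT (EFin \o (fun z : Omega * RT => `|time_ext T hA z|)).
Proof.
have [ph hfin] := hA_L1.
rewrite (_ : (fun z => _) = (fun z : Omega * RT => `|time_ext T hA z| `^ 1)); last first.
  by apply/funext => z; rewrite powRr1.
apply: time_ext_integrable; rewrite ?oner_eq0//.
move: hfin; rewrite divff ?oner_eq0//; apply: le_lt_trans.
rewrite le_eqVlt; apply/orP; left; apply/eqP; apply: eq_integral => om _.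
by rewrite poweRe1//; apply: integral_ge0 => r _; rewrite lee_fin powR_ge0.
Qed.

Section two_solutions.
Variables (u1 u2 h1 h2 : Omega -> R -> H) (u01 u02 : Omega -> H) (v1 v2 : Omega -> R -> V)
  (IG1 IG2 : Omega -> R -> H).
Hypotheses (h1_L2L1 : LrLs P T Ft 2 1 h1) (h2_L2L1 : LrLs P T Ft 2 1 h2)
  (u1C : L2C0 P T u1) (u2C : L2C0 P T u2)
  (v1L : LrLs P T Ft p p v1) (v2L : LrLs P T Ft p p v2)
  (v1E : {ae (P \x leb)%E, forall z : Omega * R, 0 <= z.2 <= T -> iota (v1 z.1 z.2) = u1 z.1 z.2})
  (v2E : {ae (P \x leb)%E, forall z : Omega * R, 0 <= z.2 <= T -> iota (v2 z.1 z.2) = u2 z.1 z.2})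
  (SI1 : is_stochastic_integral P T Ft W (fun w t => G w t (u1 w t)) IG1)
  (SI2 : is_stochastic_integral P T Ft W (fun w t => G w t (u2 w t)) IG2)
  (sol1 : {ae P, forall om, drift_equation iota T (u1 om) (IG1 om)
     (fun s => A om s (v1 om s)) (h1 om) (fun s => F om s (u1 om s)) (u01 om)})
  (sol2 : {ae P, forall om, drift_equation iota T (u2 om) (IG2 om)
     (fun s => A om s (v2 om s)) (h2 om) (fun s => F om s (u2 om s)) (u02 om)})
  (u0_le : {ae P, forall om, le_ae (u01 om) (u02 om)})
  (h_le : {ae (P \x leb)%E, forall z : Omega * R, 0 <= z.2 <= T -> le_ae (h1 z.1 z.2) (h2 z.1 z.2)}).

Let w om s := clamped T u1 om s - clamped T u2 om s.

Let cw om : continuous (w om).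
Proof.
by move=> s; apply: cvgB; [exact: (L2C0_continuous TT u1C)|exact: (L2C0_continuous TT u2C)].
Qed.

Let wE om r : 0 <= r <= T -> w om r = u1 om r - u2 om r.
Proof. by move=> rT; rewrite /w !clampedE. Qed.

Let w_clamp om s : w om s = w om (clamp 0 T s).
Proof. by rewrite /w clamped_clamp// [in X in _ - X = _]clamped_clamp. Qed.

Let bw s : Borel_map (w ^~ s).
Proof. by apply: Borel_mapB => //; [exact: (L2C0_Borel TT u1C)|exact: (L2C0_Borel TT u2C)]. Qed.

Let w_sq : sq_integrable P (path_sup w).
Proof.
have le1 om s := le_path_sup TT (L2C0_continuous TT u1C) (clamped_clamp TT u1) om s.
have le2 om s := le_path_sup TT (L2C0_continuous TT u2C) (clamped_clamp TT u2) om s.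
apply: (sq_integrable_le _ _ (sq_integrableD (L2C0_sq_integrable TT u1C) (L2C0_sq_integrable TT u2C))).
  exact: (measurable_path_sup TT cw w_clamp bw).
move=> om; rewrite ger0_norm; last by apply: le_trans (le_path_sup TT cw w_clamp om 0).
by apply: path_sup_le => s; apply: le_trans (ler_normB _ _) _; apply: lerD.
Qed.

(** Adaptedness comes from the progressive V-valued representatives, which agree with the solutions
    at almost every time only. *)
Let w_adapted s : 0 < s -> s <= T -> adapted_at Ft s (w ^~ s).
Proof.
apply: (adapted_left Ft_filtration H_separable cw).
apply: filterS2 (ae_ysection v1E) (ae_ysection v2E) => r e1 e2 rT.
have av (v : Omega -> R -> V) : LrLs P T Ft p p v -> adapted_at Ft r (fun om => iota (v om r)).
  move=> [pv _]; apply: (@Borel_map_comp _ (g_sigma_algebraType (Ft r)) V H (v ^~ r)).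
    exact: blin_continuous.
  exact: (progressive_adapted Ft_filtration rT pv).
have a12 : adapted_at Ft r (fun om => iota (v1 om r) - iota (v2 om r)).
  by apply: (@Borel_mapB _ (g_sigma_algebraType (Ft r)) R H) => //; exact: av.
apply: (adapted_ae Ft_filtration rT _ a12).
by apply: filterS2 e1 e2 => om /(_ rT) /= -> /(_ rT) /= ->; rewrite wE.
Qed.

Let Phi om r k : H := time_ext T (fun w t => G w t (u1 w t)) (om, r) (e k)
  - time_ext T (fun w t => G w t (u2 w t)) (om, r) (e k).

(** The stochastic integrals have continuous paths almost surely; M is set to 0 on a measurable null
    set containing the exceptional paths. *)
Let noise_path : exists M : Omega -> R -> H, [/\ forall om, continuous (M om),
  forall s, Borel_map (M ^~ s) &
  {ae P, forall om, forall r, 0 <= r <= T -> M om r = IG1 om r - IG2 om r}].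
Proof.
have [_ _ c1 _] := SI1; have [_ _ c2 _] := SI2.
have [N [mN N0 cN]] := filterI c1 c2.
have good om : om \notin N -> {within `[0, T], continuous (IG1 om)} /\ {within `[0, T], continuous (IG2 om)}.
  move=> /negP oN; apply: contrapT => nc; apply: oN; apply/mem_set; apply: cN => /= cc.
  exact: nc.
exists (fun om s => if om \in N then 0 else clamped T IG1 om s - clamped T IG2 om s); split.
- move=> om; have [oN|/good[g1 g2]] := boolP (om \in N); first by move=> s; exact: cvg_cst.
  by move=> s; apply: cvgB; exact: (clamped_continuous TT).
- move=> s; have sT := clamp_itv s TT.
  apply: (Borel_map_if (f := cst 0) mN); first exact: Borel_map_cst.
  apply: Borel_mapB => //.
    exact: (stochastic_integral_Borel Ft_filtration SI1 sT).
  exact: (stochastic_integral_Borel Ft_filtration SI2 sT).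
- exists N; split => // om /= nM; apply: contrapT => oN; apply: nM => r rT.
  by rewrite memNset// !clampedE.
Qed.

Let noise_le : exists2 CG, 0 <= CG & forall n om (r : R) a, 0 <= r <= T ->
  \sum_(k < n) `|kmul a (Phi om r k)| ^+ 2 <= CG * `|kmul a (w om r)| ^+ 2.
Proof.
have [CG CG0 HG] := G2; exists (CG ^+ 2); first exact: sqr_ge0.
move=> n om r a rT; apply: kmul_sum_le; last exact: sqr_ge0.
move=> B mB; have ae_sq (x x' y : H) : y = x - x' ->
    (\int[mu]_(z in B) (Lp_fun y z ^+ 2)%:E = \int[mu]_(z in B) ((Lp_fun x z - Lp_fun x' z) ^+ 2)%:E)%E.
  move=> ->; apply: ae_eq_integral => //.
  - by apply: measurable_funTS; apply/measurable_EFinP; apply: measurable_funX; exact: Lp_fun_measurable.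
  - apply: measurable_funTS; apply/measurable_EFinP; apply: measurable_funX.
    by apply: measurable_funB; exact: Lp_fun_measurable.
  - by apply: filterS (Lp_funB x x') => z -> _.
rewrite (ae_sq (u1 om r) (u2 om r)); last exact: wE.
apply: le_trans (HG B mB om r (u1 om r) (u2 om r) rT).
rewrite le_eqVlt; apply/orP; left; apply/eqP; apply: eq_eseriesr => k _.
by apply: ae_sq; rewrite /Phi !time_extE.
Qed.

Let D_dense (x : H) (r : R) : 0 < r -> exists2 y, range iota y & `|x - y| < r.
Proof.
move=> r0; have [_ [_ dV] _ _] := S2.
have [y [xy Vy]] : ball x r `&` range iota !=set0.
  by apply: dV; [exists x; exact: ballxx|exact: ball_open].
by exists y => //; move: xy; rewrite -ball_normE.
Qed.

Let D_quartic (x : H) : range iota x -> (quartic x < +oo)%E.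
Proof. by move=> [v _ <-]; have [_ _ _ [C VC]] := S2; exact: Lnorm4_quartic (VC v). Qed.

(** A nonnegative majorant of [path_growth] that is jointly measurable and integrable on the
    product. *)
Let growth_bound (z : Omega * RT) : R := CA * `|time_ext T v1 z| `^ p
  + CA * `|time_ext T v2 z| `^ p + `|time_ext T hA z|.

Let growth_bound_ge0 z : 0 <= growth_bound z.
Proof. by rewrite !addr_ge0 ?mulr_ge0 ?powR_ge0// ltW. Qed.

Let growth_integral (om : Omega) : \bar R := (\int[leb]_r (growth_bound (om, r))%:E)%E.

Let growth_bound_integrable : (P \x leb)%E.-integrable setT (EFin \o growth_bound).
Proof.
exact: (rintegrableD measurableT (rintegrableD measurableT
  (rintegrableZ measurableT CA (moment_integrable v1L))
  (rintegrableZ measurableT CA (moment_integrable v2L))) hA_integrable).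
Qed.

Let measurable_growth_bound : measurable_fun setT growth_bound.
Proof. by case/integrableP : growth_bound_integrable => /measurable_EFinP. Qed.

Let growth_finite : P.-integrable setT (EFin \o (fine \o growth_integral)) /\
  {ae P, forall om, growth_integral om \is a fin_num}.
Proof.
have mg : measurable_fun setT (EFin \o growth_bound) by case/integrableP : growth_bound_integrable.
have g0 z : (0 <= (EFin \o growth_bound) z)%E by rewrite lee_fin.
apply: integrable_fine.
- exact: (measurable_fun_fubini_tonelli_F (m2 := leb) (EFin \o growth_bound) mg g0).
- by move=> om; apply: integral_ge0 => r _; exact: g0.
- apply: le_lt_trans ((integrable12ltyP _ _ mg).1 growth_bound_integrable).
  rewrite le_eqVlt; apply/orP; left; apply/eqP; apply: eq_integral => om _.
  by apply: eq_integral => r _; rewrite gee0_abs.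
Qed.

Let a_ (v : Omega -> R -> V) om (r : RT) : dual V := time_ext T (fun w t => A w t (v w t)) (om, r).
Let g_ (hh : Omega -> R -> H) om (r : RT) : H := time_ext T hh (om, r).
Let f_ (u : Omega -> R -> H) om (r : RT) : H := time_ext T (fun w t => F w t (u w t)) (om, r).

Let ba_ v om : LrLs P T Ft p p v -> Borel_map (a_ v om).
Proof.
move=> [pv _]; apply: (time_ext_xsection (phi := fun w t => A w t (v w t))).
exact: (progressive_operator_comp T0 FtS A1 (progressive_Borel T0 FtS pv)).
Qed.

Let bg_ hh om : LrLs P T Ft 2 1 hh -> Borel_map (g_ hh om).
Proof.
by move=> [ph _]; apply: (time_ext_xsection (phi := hh)); exact: (progressive_Borel T0 FtS ph).
Qed.

Let bf_ u om : L2C0 P T u -> Borel_map (f_ u om).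
Proof.
move=> uC; apply: (time_ext_xsection (phi := fun w t => F w t (u w t))).
apply: (progressive_operator_comp T0 FtS F1).
have bu : Borel_map (fun z : Omega * RT => clamped T u z.1 z.2).
  apply: dist_Borel_map => // c.
  exact: (Borel_process H_separable (L2C0_continuous TT uC) (L2C0_Borel TT uC)).
rewrite (_ : time_ext T u = fun z => if z \in time_domain T then clamped T u z.1 z.2 else cst 0 z).
  by apply: Borel_map_if => //; [exact: measurable_time_domain|exact: Borel_map_cst].
apply/funext => z; rewrite /time_ext; case: ifPn => // /set_mem[_]; rewrite /= in_itv/= => rT.
by rewrite clampedE.
Qed.

Let drift_time_ext u v hh (IG : Omega -> R -> H) (u0 : Omega -> H) om :
  drift_equation iota T (u om) (IG om) (fun s => A om s (v om s)) (hh om)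
    (fun s => F om s (u om s)) (u0 om) ->
  drift_equation iota T (u om) (IG om) (a_ v om) (g_ hh om) (f_ u om) (u0 om).
Proof.
move=> sol s sT; have [IA [Ih [IF [BA Bh BF E]]]] := sol s sT.
have onT (r : R) : `[0, s]%classic r -> 0 <= r <= T.
  rewrite /= in_itv/= => /andP[-> rs]; case/andP : sT => _ sT; exact: le_trans sT.
exists IA, Ih, IF; split => //.
- by apply: eq_Bochner_integral BA => r /onT rT; rewrite /a_ time_extE.
- by apply: eq_Bochner_integral Bh => r /onT rT; rewrite /g_ time_extE.
- by apply: eq_Bochner_integral BF => r /onT rT; rewrite /f_ time_extE.
Qed.

Let start : {ae P, forall om, pos_energy (w om 0) = 0}.
Proof.
have [_ [_ dV] _ _] := S2.
have T00 : 0 <= (0 : R) <= T by rewrite lexx.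
have s1 : {ae P, forall om, u1 om 0 = u01 om}.
  apply: filterS2 sol1 (stochastic_integral_start Ft_filtration T0 SI1) => om sol I0.
  rewrite (drift_equation_start (ba_ om v1L) (bg_ om h1_L2L1) (bf_ om u1C)
    (drift_time_ext sol) TT dV) I0.
  exact: addr0.
have s2 : {ae P, forall om, u2 om 0 = u02 om}.
  apply: filterS2 sol2 (stochastic_integral_start Ft_filtration T0 SI2) => om sol I0.
  rewrite (drift_equation_start (ba_ om v2L) (bg_ om h2_L2L1) (bf_ om u2C)
    (drift_time_ext sol) TT dV) I0.
  exact: addr0.
apply: filterS3 s1 s2 u0_le => om e1 e2 le12; apply: pos_energy_le0.
rewrite wE// e1 e2; apply: filterS2 (Lp_funB (u01 om) (u02 om)) le12 => x -> le12x.
by rewrite subr_le0.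
Qed.

(** For almost every omega all sections of the null sets are null, so [pathwise_drift] applies to
    that path and feeds [energy_vanishes]. *)
Lemma energy_difference t : 0 <= t <= T -> {ae P, forall om, pos_energy (w om t) = 0}.
Proof.
have [M [cM bM ME]] := noise_path.
have [CG CG0 Phi_le] := noise_le.
have [CF CF0 HF] := F2.
have [s_ approx] := stochastic_integral_sub Ft_filtration W_Wiener T0 H_separable SI1 SI2
  (fun r _ => bM r) (fun r rT => filterS (fun om h => h r rT) ME).
have [[sV _] _ _ _] := S2.
have iota_inj : injective iota by have [_ []] := S2.
have [sigV [C [C0 sigVE sigV_ge0 sigV_le]]] := sigma_growth iota_inj p_ge2 A3 A5.
move: t; apply: (energy_vanishes Ft_filtration W_Wiener T0 H_separable cw cM w_clamp bw bM w_sq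
  w_adapted approx CG0 (ltW CF0) Phi_le D_dense D_quartic _ start).
move=> t t0 tT.
have dc0 : 0 <= drift_const p C by rewrite addr_ge0// !mulr_ge0// powR_ge0.
(* Integrable in omega by the growth assumption (A4) and the p-integrability of both solutions in
   V. *)
exists (fun om => drift_const p C * fine (growth_integral om)); split.
- exact: (rintegrableZ measurableT (drift_const p C) growth_finite.1).
- move=> om; apply: (mulr_ge0 dc0); apply: fine_ge0.
  by apply: integral_ge0 => r _; rewrite lee_fin.
have [[_ cf] _ fF] := F0.
have FL := superposition_operator_lip mu_fin mu_pos (ltW CF0) cf fF HF.
have x1 := ae_xsection v1E; have x2 := ae_xsection v2E.
have xh := ae_xsection h_le; have xF := ae_xsection FL.
apply: filterS3 (filterI sol1 sol2) (filterI (filterI x1 x2) (filterI xh xF))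
  (filterI ME growth_finite.2).
move=> om [S1 S2'] [[e1 e2] [eh eF]] [eM gfin].
pose v1' r := time_ext T v1 (om, r); pose v2' r := time_ext T v2 (om, r).
pose hA' r : R := time_ext T hA (om, r).
have mi : measurable (`[0, T]%classic : set RT) by exact: measurable_itv.
have mi' : measurable (`[0, t]%classic : set RT) by exact: measurable_itv.
have sub : (`[0, t]%classic : set RT) `<=` (`[0, T]%classic : set RT).
  by apply: subset_itvl; rewrite bnd_simp.
have mgb : measurable_fun setT (fun r : RT => growth_bound (om, r)).
  exact: (measurableT_comp measurable_growth_bound (measurable_pair1 om)).
have igb : leb.-integrable setT (EFin \o (fun r : RT => growth_bound (om, r))).
  apply/integrableP; split; first exact/measurable_EFinP.
  under eq_integral do rewrite /= ger0_norm//.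
  by rewrite -ge0_fin_numE//; apply: integral_ge0 => r _; rewrite lee_fin.
have mkappa : measurable_fun setT (fun r : RT => path_growth p CA hA' v1' v2' r).
  have bh : Borel_map (fun r : RT => time_ext T hA (om, r)).
    by case: hA_L1 => ph _; apply: (time_ext_xsection (phi := hA)); exact: (progressive_Borel T0 FtS ph).
  have bv (v : Omega -> R -> V) : LrLs P T Ft p p v ->
      measurable_fun setT (fun r : RT => `|time_ext T v (om, r)| `^ p).
    move=> [pv _]; apply: (measurableT_comp (measurable_powR p)); apply: Borel_map_norm.
    by apply: (time_ext_xsection (phi := v)); exact: (progressive_Borel T0 FtS pv).
  apply: measurable_funD; last exact: Borel_map_measurable.
  by apply: measurable_funD; apply: measurable_funM => //; exact: bv.
have kappa_le r : `|path_growth p CA hA' v1' v2' r| <= growth_bound (om, r).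
  rewrite /path_growth /growth_bound (le_trans (ler_normD _ _))// lerD2r.
  by rewrite ger0_norm// addr_ge0// mulr_ge0 ?powR_ge0// ltW.
have ikappa : leb.-integrable `[0, T] (EFin \o path_growth p CA hA' v1' v2').
  apply: (rintegrable_le mi (g := fun r => growth_bound (om, r))).
  - exact: measurable_funTS.
  - by apply: integrableS igb.
  - by move=> r _.
have A4' r phi : 0 <= r <= T -> `|A om r phi| `^ (p / (p - 1)) <= CA * `|phi| `^ p + hA' r.
  by move=> rT; rewrite /hA' time_extE//; exact: A4.
have a1E (r : R) : 0 <= r <= T -> a_ v1 om r = A om r (v1' r).
  by move=> rT; rewrite /a_ /v1' !time_extE.
have a2E (r : R) : 0 <= r <= T -> a_ v2 om r = A om r (v2' r).
  by move=> rT; rewrite /a_ /v2' !time_extE.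
have vE : {ae leb, forall r : R, 0 <= r <= T -> iota (v1' r) = u1 om r /\ iota (v2' r) = u2 om r}.
  apply: filterS2 e1 e2 => r e1r e2r rT; rewrite /v1' /v2' !time_extE//.
  by split; [exact: e1r|exact: e2r].
have g_le : {ae leb, forall r : R, 0 <= r <= T -> le_ae (g_ h1 om r) (g_ h2 om r)}.
  by apply: filterS eh => r ehr rT; rewrite /g_ !time_extE//; exact: ehr.
have f_le : {ae leb, forall r : R, 0 <= r <= T ->
    {ae mu, forall x, `|Lp_fun (f_ u1 om r - f_ u2 om r) x| <= CF * `|Lp_fun (w om r) x|}}.
  by apply: filterS eF => r eFr rT; rewrite /f_ !time_extE// wE//; exact: eFr.
have [Yle Yev] := pathwise_drift sV (ltW t0) tT p_ge2 C0 (ltW CA0) sigVE (sigV_ge0 om) (sigV_le om)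
  A4' (ba_ om v1L) (bg_ om h1_L2L1) (bf_ om u1C) (ba_ om v2L) (bg_ om h2_L2L1) (bf_ om u2C)
  (drift_time_ext S1) (drift_time_ext S2') a1E a2E vE g_le ikappa (@wE om) eM (@cw om) (@cM om)
  (ltW CF0) f_le (fun n r s => le_path_osc TT cw w_clamp om (n := n) (r := r) (s := s))
  (le_path_sup TT cw w_clamp om).
split; last exact: Yev.
move=> n; apply: le_trans (Yle n) _; apply: (ler_wpM2l dc0).
apply: (@le_trans _ _ (\int[leb]_(s in `[0, t]) growth_bound (om, s))).
  apply: le_Rintegral => //.
  - by apply: integrableS ikappa.
  - by apply: integrableS igb.
  - by move=> r _; apply: le_trans (kappa_le r); exact: ler_norm.
apply: (@le_trans _ _ (\int[leb]_s growth_bound (om, s))) => //.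
exact: (le_Rintegral_subset mi' measurableT (@subsetT _ _) igb (fun r _ => growth_bound_ge0 (om, r))).
Qed.

End two_solutions.

End comparison.

Theorem proposition2p2
  (R : realType)
  (n : nat) (O : set 'rV[R]_n.+1) (O_open : open O)
  (O_nonempty : O !=set0) (O_bounded : bounded_set O)
  (O_Lipschitz : Lipschitz_boundary O)
  (d : measure_display) (Omega : measurableType d) (P : probability Omega R)
  (T : R) (T_gt0 : 0 < T)
  (Ft : R -> set (set Omega)) (Ft_filtration : complete_filtration P T Ft)
  (U : hilbertType R) (e : onbasis U)
  (W : R -> U -> Omega -> R) (W_Wiener : cylindrical_Wiener P T Ft W)
  (V : completeNormedModType R) (iota : blin V (L2 (lebesgue_on O_open)))
  (S2 : assumption_V iota)
  (p : R) (p_ge2 : 2 <= p)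
  (A : Omega -> R -> V -> dual V)
  (A1 : assumption_A1 T Ft A) (A2 : assumption_A2 T A)
  (A3 : assumption_A3 T p A) (A4 : assumption_A4 P T Ft p A)
  (A5 : assumption_A5 T iota A)
  (f : Omega -> R -> R -> R)
  (F : Omega -> R -> L2 (lebesgue_on O_open) -> L2 (lebesgue_on O_open))
  (F0 : assumption_F0 P T f F) (F1 : assumption_F1 T Ft F)
  (F2 : assumption_F2 P T F) (F3 : assumption_F3 P T Ft F)
  (G : Omega -> R -> L2 (lebesgue_on O_open) ->
       hilbert_schmidt e (L2 (lebesgue_on O_open)))
  (G1 : assumption_G1 T Ft G) (G2 : assumption_G2 T G)
  (G3 : assumption_G3 P T Ft G)
  (u01 u02 : Omega -> L2 (lebesgue_on O_open))
  (u01_L2 : L2_initial P Ft u01) (u02_L2 : L2_initial P Ft u02)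
  (h1 h2 : Omega -> R -> L2 (lebesgue_on O_open))
  (h1_L2L1 : LrLs P T Ft 2 1 h1) (h2_L2L1 : LrLs P T Ft 2 1 h2)
  (u1 u2 : Omega -> R -> L2 (lebesgue_on O_open))
  (u1_solution : is_solution P T Ft W iota p A F G u01 h1 u1)
  (u2_solution : is_solution P T Ft W iota p A F G u02 h2 u2) :
  {ae P, forall w, le_ae (u01 w) (u02 w)} ->
  {ae (P \x lebesgue_measure)%E, forall z : Omega * R, 0 <= z.2 <= T ->
    le_ae (h1 z.1 z.2) (h2 z.1 z.2)} ->
  forall t : R, 0 <= t <= T -> {ae P, forall w, le_ae (u1 w t) (u2 w t)}.
Proof.
move=> u0_le h_le t tT.
have mu_fin := lebesgue_on_finite O_open O_bounded.
(* If the measure is zero, the whole space is an admissible exceptional set; otherwise its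
   positivity is available for the test on constants. *)
have [mu0|mu_pos] := eqVneq (lebesgue_on O_open setT) 0%E.
  by apply: nearW => om; exists setT; split.
have [u1C [v1 [IG1 [v1L v1E SI1 sol1]]]] := u1_solution.
have [u2C [v2 [IG2 [v2L v2E SI2 sol2]]]] := u2_solution.
have [CA [hA [CA0 hAL HA]]] := A4.
have := energy_difference T_gt0 Ft_filtration W_Wiener mu_fin mu_pos S2 p_ge2 A1 A3 A5 CA0 hAL HA
  F0 F1 F2 G2 h1_L2L1 h2_L2L1 u1C u2C v1L v2L v1E v2E SI1 SI2 sol1 sol2 u0_le h_le tT.
apply: filterS => om /pos_energy_eq0; rewrite !clampedE// /le_ae.
move=> h; apply: filterS2 h (Lp_funB (u1 om t) (u2 om t)) => x + E.
by rewrite E subr_le0.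
Qed.
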